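(* Let $\Omega_1,\Omega_2\subset\mathbb{R}^2$ be the two polygons (warped propellers) built from seven copies of a scalene triangle $T$ as described in the context. For $n\in\{1,2\}$ let $\Delta^N_{\Omega_n}$ be the Neumann Laplacian on $L_2(\Omega_n)$ and let $S^n=(S^n_t)_{t>0}$ be the semigroup generated by $\Delta^N_{\Omega_n}$. Then $S^1$ and $S^2$ are similar, i.e. there exists an invertible $U\in\mathcal{L}(L_2(\Omega_1),L_2(\Omega_2))$ such that $S^1_t=U^{-1}\,S^2_t\,U$ for all $t>0$. In particular, $\Delta^N_{\Omega_1}$ and $\Delta^N_{\Omega_2}$ are isospectral, i.e. they have the same sequence of eigenvalues (counted with multiplicity), even though $\Omega_1$ and $\Omega_2$ are not congruent.
   Context: The domains. Let $T\subset\mathbb{R}^2$ be an open scalene triangle with sides $\Gamma_1,\Gamma_2,\Gamma_3$, and let $\rho_j$ be the reflection of $\mathbb{R}^2$ in the line containing $\Gamma_j$. Consider the gluing patterns $E_1=\{(1,2;1),(4,7;1),(1,3;2),(2,5;2),(1,4;3),(3,6;3)\}$ and $E_2=\{(1,2;1),(3,6;1),(1,3;2),(4,7;2),(1,4;3),(2,5;3)\}$. For $n\in\{1,2\}$ let $\tau^{(n)}_1,\dots,\tau^{(n)}_7$ be the isometries of $\mathbb{R}^2$ determined by $\tau^{(n)}_1=\mathrm{id}$ and $\tau^{(n)}_l=\tau^{(n)}_k\circ\rho_j$ for every $(k,l;j)\in E_n$; put $T^{(n)}_k=\tau^{(n)}_k(T)$ and let $\Omega_n$ be the interior of $\bigcup_{k=1}^7\overline{T^{(n)}_k}$.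 So $(k,l;j)\in E_n$ means that the $k$-th and $l$-th triangles share their sides corresponding to $\Gamma_j$. It is assumed that $T$ is such that, for each $n$, the seven triangles $T^{(n)}_k$ are pairwise disjoint, the six shared sides (without endpoints) lie in $\Omega_n$, and $\partial\Omega_n$ is a simple closed polygonal curve consisting of the remaining nine sides; thus $\Omega_n$ is an open polygon (a Lipschitz domain). Congruent means that an isometry of $\mathbb{R}^2$ maps one set onto the other. The Neumann Laplacian $\Delta^N_\Omega$ is the self-adjoint operator on $L_2(\Omega)$ such that $-\Delta^N_\Omega$ is associated with the form $a(u,v)=\int_\Omega\nabla u\cdot\overline{\nabla v}$, $u,v\in H^1(\Omega)$; that is, $u\in D(\Delta^N_\Omega)$ and $-\Delta^N_\Omega u=f$ iff $u\in H^1(\Omega)$, $f\in L_2(\Omega)$ and $a(u,v)=(f,v)_{L_2(\Omega)}$ for all $v\in H^1(\Omega)$. For a polygon it has compact resolvent. *)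

(* Defs.v *)
From HB Require Import structures.
From mathcomp Require Import all_boot all_order all_algebra.
From mathcomp Require Import generic_quotient ring_quotient complex.
From mathcomp Require Import all_classical all_reals all_analysis.
From mathcomp Require Import measurable_realfun.

Set Implicit Arguments.
Unset Strict Implicit.
Unset Printing Implicit Defensive.

Import Order.TTheory GRing.Theory Num.Theory.
Import numFieldNormedType.Exports.

Local Open Scope classical_set_scope.
Local Open Scope complex_scope.
Local Open Scope ring_scope.

Notation plane R := (R * R)%type (only parsing).

Section Geometry.
Context {R : realType}.
Implicit Types (a b x y : plane R) (A B : set (plane R)).

(* R * R carries the sup norm, hence the explicit Euclidean structure. *)
Definition dot x y : R := x.1 * y.1 + x.2 * y.2.
Definition dist x y : R := Num.sqrt (dot (x - y) (x - y)).

Definition isometry (f : plane R -> plane R) : Prop :=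
  forall x y, dist (f x) (f y) = dist x y.

Definition congruent A B : Prop := exists2 f, isometry f & f @` A = B.

Definition segment a b : set (plane R) :=
  [set (1 - t) *: a + t *: b | t in `[0, 1]].
Definition open_segment a b : set (plane R) :=
  [set (1 - t) *: a + t *: b | t in `]0, 1[].

Definition line_reflection a b x : plane R :=
  2 *: (a + (dot (x - a) (b - a) / dot (b - a) (b - a)) *: (b - a)) - x.

Definition boundary A : set (plane R) := closure A `\` A^°.

Definition edge n (v : 'I_n.+1 -> plane R) (i : 'I_n.+1) : set (plane R) :=
  segment (v i) (v (ordS i)).

(* The closed polygon with successive vertices v 0, ..., v n, v 0 is simple:
   two different edges can only meet in a common end point. *)
Definition simple_polygon n (v : 'I_n.+1 -> plane R) : Prop :=
  injective v /\
  forall i j x, i != j -> edge v i x -> edge v j x ->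
    (j = ordS i /\ x = v j) \/ (i = ordS j /\ x = v i).

End Geometry.

(* A gluing pattern is a list of (k, l, j), where the triangles k and l share
   the side j. The labels 1, ..., 7 and 1, 2, 3 are read in the rings of
   integers modulo 7 and modulo 3, so that 7 and 3 are the zeros of 'I_7 and
   'I_3. *)
Definition pattern := seq ('I_7 * 'I_7 * 'I_3).

Definition E1 : pattern :=
  [:: (1, 2, 1); (4, 7, 1); (1, 3, 2); (2, 5, 2); (1, 4, 3); (3, 6, 3)].
Definition E2 : pattern :=
  [:: (1, 2, 1); (3, 6, 1); (1, 3, 2); (4, 7, 2); (1, 4, 3); (2, 5, 3)].

Definition unshared (E : pattern) (k : 'I_7) (j : 'I_3) : bool :=
  [forall l : 'I_7, ((k, l, j) \notin E) && ((l, k, j) \notin E)].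

Record domain (R : realType) := Domain {
  domain_set :> set (plane R);
  domain_open : open domain_set
}.
Arguments domain_open {R} d.

Section Unfolding.
Context {R : realType}.

(* The triangle is given by its vertices p 1, p 2, p 3; its side with label j
   is the one opposite to p j. *)
Variable p : 'I_3 -> plane R.

Definition nondegenerate_triangle : Prop :=
  (p 2 - p 1).1 * (p 3 - p 1).2 - (p 2 - p 1).2 * (p 3 - p 1).1 != 0.

Definition scalene_triangle : Prop :=
  injective (fun j : 'I_3 => dist (p (j + 1)) (p (j + 2))).

Definition open_triangle : set (plane R) :=
  [set \sum_j w j *: p j | w in
    [set w : 'I_3 -> R | (forall j, 0 < w j) /\ \sum_j w j = 1]].

Definition side (j : 'I_3) : set (plane R) :=
  segment (p (j + 1)) (p (j + 2)).
Definition open_side (j : 'I_3) : set (plane R) :=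
  open_segment (p (j + 1)) (p (j + 2)).

Definition rho (j : 'I_3) : plane R -> plane R :=
  line_reflection (p (j + 1)) (p (j + 2)).

Definition unfolding (E : pattern) (tau : 'I_7 -> plane R -> plane R) : Prop :=
  tau 1 = id /\ forall k l j, (k, l, j) \in E -> tau l = tau k \o rho j.

Variable tau : 'I_7 -> plane R -> plane R.

Definition tile (k : 'I_7) : set (plane R) := tau k @` open_triangle.

Definition glued : domain R :=
  Domain (@open_interior _ (\bigcup_k closure (tile k))).

(* The standing assumption on the triangle: disjoint tiles, shared sides in the
   interior, and a boundary that is a simple closed polygonal curve whose nine
   edges are the unshared sides. *)
Definition admissible (E : pattern) : Prop :=
  [/\ trivIset setT tile,
      forall k l j, (k, l, j) \in E -> tau k @` open_side j `<=` glued
    & exists v : 'I_9 -> plane R,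
      [/\ simple_polygon v,
          boundary glued = \bigcup_i edge v i
        & [set edge v i | i in setT] =
          [set tau kj.1 @` side kj.2 | kj in
            [set kj : 'I_7 * 'I_3 | unshared E kj.1 kj.2]]]].

End Unfolding.

Definition mplane (R : realType) : measurableType _ :=
  (measurableTypeR R * measurableTypeR R)%type.

Definition lebesgue2 (R : realType) : {measure set (mplane R) -> \bar R} :=
  (@lebesgue_measure R \x @lebesgue_measure R)%E.

Lemma open_measurable2 (R : realType) (A : set (plane R)) :
  open A -> measurable (A : set (mplane R)).
Proof.
move=> oA.
pose B (q : rat * rat * nat) : set (plane R) :=
  ball (ratr q.1.1 : R) q.2.+1%:R^-1 `*` ball (ratr q.1.2 : R) q.2.+1%:R^-1.
pose F q : set (plane R) := if `[< B q `<=` A >] then B q else set0.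
have -> : A = \bigcup_q F q.
  apply/seteqP; split=> [x Ax|x [q _]]; last first.
    by rewrite /F; case: asboolP => // BA /BA.
  have /nbhs_ballP[e /= e0 xeA] : nbhs x A by exact: open_nbhs_nbhs.
  have [n ne] : exists n, n.+1%:R^-1 < e / 2 :> R.
    have e20 : 0 < e / 2 by rewrite divr_gt0.
    by have [n _ /(_ n (leqnn n)) /= h] := near_infty_natSinv_lt (PosNum e20); exists n.
  have n0 : 0 < n.+1%:R^-1 :> R by rewrite invr_gt0.
  have ratP (y : R) : exists q : rat, ball (ratr q : R) n.+1%:R^-1 y.
    have [q] := @rat_in_itvoo R (y - n.+1%:R^-1) (y + n.+1%:R^-1)
      ltac:(by rewrite ltrD2l gtrN).
    rewrite inE /= => /andP[h1 h2].
    by exists q; rewrite /ball /= ltr_distlC; rewrite !(ltrBlDr, ltrBrDr) in h1 h2 *; apply/andP; split; rewrite // -ltrBlDr.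
  have [q1 xq1] := ratP x.1; have [q2 xq2] := ratP x.2.
  exists (q1, q2, n) => //; rewrite /F asboolT; first by split.
  have tri (q : rat) (y z : R) : ball (ratr q : R) n.+1%:R^-1 y ->
      ball (ratr q : R) n.+1%:R^-1 z -> ball y e z.
    move=> /ball_sym qy qz; have := ball_triangle qy qz.
    by apply: le_ball; rewrite [leRHS]splitr lerD// ltW.
  move=> z [/= z1 z2]; apply: xeA; split => /=.
    exact: tri xq1 z1.
  exact: tri xq2 z2.
apply: countable_bigcupT_measurable => [|q].
  exact: countableP.
rewrite /F; case: asboolP => _; last exact: measurable0.
by apply: measurableX; apply: open_measurable; exact: ball_open.
Qed.

Section L2.
Context {R : realType}.
Local Notation C := R[i].
Variable Omega : domain R.

Definition lebesgue_on : {measure set (mplane R) -> \bar R} :=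
  mrestr (@lebesgue2 R) (open_measurable2 (domain_open Omega)).

Definition sqint_pred : {pred plane R -> C} :=
  [pred f : plane R -> C |
    (@complex.Re R \o f \in Lfun lebesgue_on 2%:E) &&
    (@complex.Im R \o f \in Lfun lebesgue_on 2%:E)].

Lemma sqint_submod_closed : submod_closed sqint_pred.
Proof.
have [L0 LD] := @Lfun_submod_closed _ _ R lebesgue_on 2%:E (lee1n 2).
split; first by apply/andP; split; exact: L0.
move=> a f g /andP[f1 f2] /andP[g1 g2]; apply/andP; split.
- have -> : @complex.Re R \o (a *: f + g) =
      complex.Re a *: (@complex.Re R \o f) + (- complex.Im a *: (@complex.Im R \o f) + (@complex.Re R \o g)).
    apply/funext => x; rewrite !fctE /=; case: a (f x) (g x) => [a b] [c d] [e h] /=.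
    by rewrite scaleNr addrA.
  by apply: (LD) => //; exact: LD.
- have -> : @complex.Im R \o (a *: f + g) =
      complex.Re a *: (@complex.Im R \o f) + (complex.Im a *: (@complex.Re R \o f) + (@complex.Im R \o g)).
    apply/funext => x; rewrite !fctE /=; case: a (f x) (g x) => [a b] [c d] [e h] /=.
    by rewrite addrA.
  by apply: (LD) => //; exact: LD.
Qed.

HB.instance Definition _ := GRing.isSubmodClosed.Build C (plane R -> C)
  sqint_pred sqint_submod_closed.

(* Elements of L_2 are classes of complex functions on the whole plane modulo
   equality almost everywhere on Omega: the measure ignores the complement. *)
Record sqint := Sqint { sqint_fun :> plane R -> C; _ : sqint_fun \in sqint_pred }.
HB.instance Definition _ := [isSub for sqint_fun].
HB.instance Definition _ := [Choice of sqint by <:].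
HB.instance Definition _ := [SubChoice_isSubLmodule of sqint by <:].

Definition null_pred : {pred sqint} :=
  [pred f : sqint | `[< {ae lebesgue_on, forall x, f x = 0} >]].

Lemma null_submod_closed : submod_closed null_pred.
Proof.
split; first by apply/asboolP; apply: aeW.
move=> a f g /asboolP f0 /asboolP g0; apply/asboolP.
have FL := ae_filter_ringOfSetsType lebesgue_on.
apply: (filterS2 _ _ f0 g0) => x /= fx gx.
by change (a *: f x + g x = 0); rewrite fx gx scaler0 addr0.
Qed.

HB.instance Definition _ := GRing.isSubmodClosed.Build C sqint
  null_pred null_submod_closed.

Definition L2 : Type := Quotient.quot null_pred.
HB.instance Definition _ := GRing.Zmodule.on L2.
HB.instance Definition _ := EqQuotient.on L2.

Definition L2_fun (u : L2) : plane R -> C := sqint_fun (repr u).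


Definition L2_scale (a : C) (u : L2) : L2 := \pi_L2%qT (a *: repr u).

Lemma L2_scale_pi a (f : sqint) : L2_scale a (\pi_L2%qT f) = \pi_L2%qT (a *: f).
Proof.
apply/eqP; rewrite /L2_scale -Quotient.idealrBE -scalerBr rpredZ//.
by rewrite Quotient.idealrBE reprK.
Qed.

Lemma L2_scaleA a b u : L2_scale a (L2_scale b u) = L2_scale (a * b) u.
Proof. by rewrite -[u]reprK (L2_scale_pi b) !L2_scale_pi scalerA. Qed.

Lemma L2_scale1 : left_id 1 L2_scale.
Proof. by move=> u; rewrite -[u]reprK L2_scale_pi scale1r. Qed.

Lemma L2_scaleDr : right_distributive L2_scale +%R.
Proof.
move=> a u v; rewrite -[u]reprK -[v]reprK -[in LHS]pi_addr.
by rewrite !L2_scale_pi scalerDr [LHS]pi_addr.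
Qed.

Lemma L2_scaleDl u : {morph L2_scale^~ u : a b / a + b}.
Proof.
by move=> a b; rewrite -[u]reprK !L2_scale_pi scalerDl [LHS]pi_addr.
Qed.

HB.instance Definition _ := GRing.Zmodule_isLmodule.Build C L2
  L2_scaleA L2_scale1 L2_scaleDr L2_scaleDl.
End L2.
Arguments L2 {R} Omega.
Arguments L2_fun {R Omega} u x.
Coercion L2_fun : L2 >-> Funclass.

Section Hilbert.
Context {R : realType} {Omega : domain R}.
Local Notation C := R[i].

Definition cintegral (f : plane R -> C) : C :=
  (\int[lebesgue_on Omega]_x complex.Re (f x)) +i*
  (\int[lebesgue_on Omega]_x complex.Im (f x)).

Definition inner (u v : L2 Omega) : C := cintegral (fun x => u x * (v x)^*).

Definition L2norm (u : L2 Omega) : R := Num.sqrt (complex.Re (inner u u)).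

End Hilbert.
Arguments cintegral {R} Omega f.

Definition bounded_operator {R : realType} {Omega Omega' : domain R}
    (U : L2 Omega -> L2 Omega') : Prop :=
  exists M : R, forall u, L2norm (U u) <= M * L2norm u.

Section Neumann.
Context {R : realType}.
Local Notation C := R[i].

Definition unit_vector (i : 'I_2) : plane R :=
  if i == 0 then (1, 0) else (0, 1).

Definition partial (i : 'I_2) (phi : plane R -> R) : plane R -> R :=
  fun x => 'D_(unit_vector i) phi x.

Definition smooth (phi : plane R -> R) : Prop :=
  forall s : seq 'I_2, let g := foldr partial phi s in
    continuous g /\ forall i x, derivable g x (unit_vector i).

Variable Omega : domain R.

Definition test_function (phi : plane R -> R) : Prop :=
  let supp := closure [set x | phi x != 0] in
  [/\ smooth phi, compact supp & supp `<=` Omega].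

(* du is the distributional gradient of u; since du consists of elements of
   L_2, this says that u belongs to H^1. *)
Definition weak_gradient (u : L2 Omega) (du : 'I_2 -> L2 Omega) : Prop :=
  forall phi, test_function phi -> forall i : 'I_2,
    cintegral Omega (fun x => u x * (partial i phi x)%:C) =
    - cintegral Omega (fun x => du i x * (phi x)%:C).

(* Unbounded operators are represented by their graphs: this relation means that
   u is in the domain of the Neumann Laplacian, with image f. *)
Definition neumann_laplacian (u f : L2 Omega) : Prop :=
  exists2 du, weak_gradient u du &
    forall v dv, weak_gradient v dv ->
      \sum_(i < 2) inner (du i) (dv i) = inner (- f) v.

End Neumann.

Section Operators.
Context {R : realType}.
Local Notation C := R[i].

(* S is a strongly continuous semigroup (S_t)_{t > 0} of bounded operators
   whose generator has graph A; the values S t for t <= 0 are irrelevant. *)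
Definition semigroup_generated_by (Omega : domain R)
    (S : R -> {linear L2 Omega -> L2 Omega})
    (A : L2 Omega -> L2 Omega -> Prop) : Prop :=
  [/\ forall t, 0 < t -> bounded_operator (S t),
      forall s t, 0 < s -> 0 < t -> forall u, S (s + t) u = S s (S t u),
      forall u, L2norm (S t u - u) @[t --> 0^'+] --> (0 : R)
    & forall u f, A u f <->
        L2norm ((t^-1)%:C *: (S t u - u) - f) @[t --> 0^'+] --> (0 : R)].

Definition similar_semigroups (Omega1 Omega2 : domain R)
    (S1 : R -> {linear L2 Omega1 -> L2 Omega1})
    (S2 : R -> {linear L2 Omega2 -> L2 Omega2}) : Prop :=
  exists (U : {linear L2 Omega1 -> L2 Omega2})
         (V : {linear L2 Omega2 -> L2 Omega1}),
    [/\ bounded_operator U, bounded_operator V, cancel U V, cancel V U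
      & forall t, 0 < t -> forall u, S1 t u = V (S2 t (U u))].

Definition has_dimension (V : lmodType C) (E : set V) (d : nat) : Prop :=
  exists e : 'I_d -> V,
    (forall c : 'I_d -> C, \sum_i c i *: e i = 0 -> forall i, c i = 0) /\
    E = range (fun c : 'I_d -> C => \sum_i c i *: e i).

Definition eigenspace (V : lmodType C) (A : V -> V -> Prop) (mu : C) : set V :=
  [set u | A u (mu *: u)].

(* lambda lists the eigenvalues of -A in nondecreasing order, each one repeated
   according to its multiplicity. *)
Definition eigenvalue_sequence (V : lmodType C) (A : V -> V -> Prop)
    (lambda : nat -> R) : Prop :=
  nondecreasing_seq lambda /\
  forall mu : C, exists s : seq nat,
    [/\ uniq s, forall k, (k \in s) <-> (lambda k)%:C = mu
      & has_dimension (eigenspace A (- mu)) (size s)].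

(* The first clause compares multiplicities directly, so that the notion is not
   vacuous for operators that have no eigenvalue sequence. *)
Definition isospectral (V1 V2 : lmodType C) (A1 : V1 -> V1 -> Prop)
    (A2 : V2 -> V2 -> Prop) : Prop :=
  (forall mu d, has_dimension (eigenspace A1 mu) d <->
                has_dimension (eigenspace A2 mu) d) /\
  (forall lambda, eigenvalue_sequence A1 lambda <->
                  eigenvalue_sequence A2 lambda).

End Operators.

(* Main.v *)
(* Writing a function on Omega_n as a 7-tuple of functions on T, membership in H^1
   becomes equality of traces along the glued sides, and an integration by parts
   against test functions shows that a matrix B acting on such 7-tuples maps H^1 to
   H^1 and transports weak gradients as soon as it intertwines, for each j, the
   involutions s_j of the tiles (across a glued side j; fixed at a free one) of the
   two patterns. The incidence matrix of a suitable Fano plane is such a B, and so is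
   its inverse; both B and the transpose of its inverse then preserve the form domain,
   so that B intertwines the two Neumann Laplacians. Eigenspaces correspond under B, and the
   semigroups do because a semigroup is determined by its generator when that
   generator is dissipative and densely defined.

   The polygons are distinguished by the area that they cover in small discs, a local
   congruence invariant. The sharpest possible corner, a single copy of the smallest
   angle of T, occurs exactly once in each polygon, so a congruence matches these two
   corners and preserves or swaps the two sides of the tile sitting there. At the other
   two vertices of that tile 4 and 2 tiles meet in one polygon, and 2 and 4 in the
   other, which is incompatible with both possibilities. *)
From HB Require Import structures.
From mathcomp Require Import all_boot all_order all_algebra complex.
From mathcomp Require Import generic_quotient ring_quotient measurable_realfun.
From mathcomp Require Import all_classical all_reals all_analysis.
From mathcomp Require Import ring lra.
Require Import Defs.

Set Implicit Arguments.
Unset Strict Implicit.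
Unset Printing Implicit Defensive.

Import Order.TTheory GRing.Theory Num.Theory.
Import numFieldNormedType.Exports.

Local Open Scope classical_set_scope.
Local Open Scope complex_scope.
Local Open Scope ring_scope.

(** * Isometries and Lebesgue measure of the plane *)

(** Traces are never constructed. For a function [u] with weak gradient [G] on [T] and a smooth
    [psi] that reaches the boundary of [T] only inside one side, Green's formula would turn the
    integral of [u 'D_w psi + (w . G) psi] over [T] into a boundary integral of [u psi (w . n)].
    This integral, called [flux], replaces the trace: equality of traces along a glued side is
    equality of two fluxes. The condition is linear in the functions on the tiles, hence compatible
    with matrices acting on 7-tuples, and free sides carry no condition at all. The analytic core is
    that even reflection across a side respects weak differentiability ([flux_reflection]). Vertices
    could spoil the localisation near single sides. They are harmless because turning around a
    vertex always ends on a free side, so that test functions on the polygon vanish near all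
    vertices. The semigroups are known only through strong limits at [0+]. Comparing two of them by
    monotonicity of a squared norm needs continuity of orbits from the left as well; it is drawn
    from Baire's theorem on the time axis. *)

Section MeasurePreserving.
Context {R : realType}.
Local Notation mu1 := (@lebesgue_measure R).
Local Notation mu2 := (@lebesgue2 R).

Lemma lebesgue_measure_translate (c : R) (A : set (measurableTypeR R)) : measurable A ->
  mu1 ((fun x : R => x + c) @^-1` A) = mu1 A.
Proof.
move=> mA.
have mf : measurable_fun [set: measurableTypeR R] ((fun x : R => x + c) : _ -> measurableTypeR R).
  exact: measurable_funD.
have := @lebesgue_measure_unique R (pushforward mu1 ((fun x : R => x + c) : _ -> measurableTypeR R)).
move=> /(_ mf) h; apply/esym/h => //.
move=> _ [[a b]] _ <-.
transitivity (mu1 `]a - c, b - c]); last first.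
  congr (mu1 _).
  by apply/seteqP; split=> x /=; rewrite !in_itv /= ltrBlDr lerBrDr.
rewrite /=; by rewrite !lebesgue_measure_itv/= !lte_fin ltrD2r -!EFinB opprB addrA subrK.
Qed.

Definition measure_preserving (f : mplane R -> mplane R) :=
  measurable_fun setT f /\ forall A, measurable A -> mu2 (f @^-1` A) = mu2 A.

Lemma measure_preserving_id : measure_preserving id.
Proof. by split; [exact: measurable_id|]. Qed.

Lemma measure_preserving_comp f g :
  measure_preserving f -> measure_preserving g -> measure_preserving (f \o g).
Proof.
move=> [mf f2] [mg g2]; split; first exact: measurableT_comp.
move=> A mA; rewrite comp_preimage g2 ?f2//.
by rewrite -[X in measurable X]setTI; exact: mf.
Qed.

Lemma measure_preserving_swap : measure_preserving (fun x => (x.2, x.1)).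
Proof.
have mf : measurable_fun [set: mplane R] ((fun x => (x.2, x.1)) : _ -> mplane R).
  apply/measurable_fun_pair; [exact: measurable_snd|exact: measurable_fst].
split=> // A mA.
have := @product_measure_unique _ _ _ _ _ mu1 mu1 (pushforward mu2 ((fun x => (x.2, x.1)) : mplane R -> mplane R)).
move=> /(_ mf) h; apply/esym/h => // B C mB mC; rewrite /pushforward/=.
transitivity (mu2 (C `*` B)).
  by congr (mu2 _); apply/seteqP; split=> -[x y] /= [].
by rewrite /lebesgue2 /= product_measure1E// muleC.
Qed.

(** [product_measure1] integrates the measures of vertical sections, so a map that keeps the first
    coordinate and preserves length on every vertical line preserves area. *)
Lemma measure_preserving_section (h : R -> R -> R) :
  measurable_fun setT ((fun x => (x.1, h x.1 x.2)) : mplane R -> mplane R) ->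
  (forall x (A : set (measurableTypeR R)), measurable A -> mu1 (h x @^-1` A) = mu1 A) ->
  measure_preserving (fun x => (x.1, h x.1 x.2)).
Proof.
move=> mf hh; split=> // A mA; rewrite /lebesgue2/= /product_measure1.
apply: eq_integral => x _ /=.
transitivity (mu1 (h x @^-1` xsection A x)); last first.
  by apply: hh; exact: measurable_xsection.
by congr (mu1 _); apply/seteqP; split=> y /=; rewrite /xsection/= !inE.
Qed.

Lemma measure_preserving_shear (t e : R) :
  measure_preserving (fun x => (x.1, x.2 + (t * x.1 + e))).
Proof.
apply: (measure_preserving_section (h := fun x y => y + (t * x + e))).
- apply/measurable_fun_pair; first exact: measurable_fst.
  apply: measurable_funD; first exact: measurable_snd.
  apply: measurable_funD => //; apply: measurable_funM => //.
- by move=> x A mA; exact: lebesgue_measure_translate.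
Qed.

Lemma measure_preserving_shear' (t e : R) :
  measure_preserving (fun x => (x.1 + (t * x.2 + e), x.2)).
Proof.
exact: (measure_preserving_comp measure_preserving_swap
 (measure_preserving_comp (measure_preserving_shear t e) measure_preserving_swap)).
Qed.

Lemma measure_preserving_oppr : measure_preserving (fun x => (x.1, - x.2)).
Proof.
apply: (measure_preserving_section (h := fun x y => - y)).
- apply/measurable_fun_pair; first exact: measurable_fst.
  by apply: measurableT_comp => //; exact: measurable_snd.
- by move=> x A mA; exact: (lebesgue_measureN mA).
Qed.

Lemma measure_preserving_oppl : measure_preserving (fun x => (- x.1, x.2)).
Proof.
exact: (measure_preserving_comp measure_preserving_swap
 (measure_preserving_comp measure_preserving_oppr measure_preserving_swap)).
Qed.

(* A rotation is a product of three shears. *)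
Lemma measure_preserving_rotation (a c : R) : a ^+ 2 + c ^+ 2 = 1 ->
  measure_preserving (fun x => (a * x.1 - c * x.2, c * x.1 + a * x.2)).
Proof.
move=> ac; have [c0|c0] := eqVneq c 0.
  move: ac; rewrite c0 expr0n addr0 => /eqP; rewrite sqrf_eq1 => /orP[]/eqP ->.
    suff -> : (fun x : mplane R => (1 * x.1 - 0 * x.2, 0 * x.1 + 1 * x.2)) = id.
      exact: measure_preserving_id.
    by apply/funext => -[x y]/=; rewrite !mul1r !mul0r subr0 add0r.
  suff -> : (fun x : mplane R => (-1 * x.1 - 0 * x.2, 0 * x.1 + -1 * x.2)) =
     (fun x => (- x.1, x.2)) \o (fun x => (x.1, - x.2)).
    exact: measure_preserving_comp measure_preserving_oppl measure_preserving_oppr.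
  by apply/funext => -[x y]/=; rewrite !mulN1r !mul0r subr0 add0r.
(* For [a = cos x] and [c = sin x] this is [- tan (x / 2)], the coefficient of the two outer shears;
   [c] is that of the middle one. The case [c = 0], where [t] is meaningless, was the identity or
   the half-turn. *)
pose t := (a - 1) / c.
have -> : (fun x : mplane R => (a * x.1 - c * x.2, c * x.1 + a * x.2)) =
  (fun x => (x.1 + (t * x.2 + 0), x.2)) \o
  ((fun x => (x.1, x.2 + (c * x.1 + 0))) \o (fun x => (x.1 + (t * x.2 + 0), x.2))).
  have tc : t * c = a - 1 by rewrite /t divfK.
  have ta : t * (1 + a) = - c.
    rewrite /t mulrAC -mulrA; apply: (mulIf c0); rewrite mulrA divfK//.
    apply/eqP; rewrite -subr_eq0; apply/eqP.
    by rewrite -[RHS](subrr 1) -[X in _ = X - 1]ac; ring.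
  apply/funext => -[x y]/=; congr pair.
    transitivity ((1 + t * c) * x + (t * (1 + t * c) + t) * y); last by ring.
    rewrite tc (_ : t * (1 + (a - 1)) + t = t * (1 + a)); last by ring.
    by rewrite ta; ring.
  transitivity (c * x + (1 + t * c) * y); last by ring.
  by rewrite tc; ring.
apply: (measure_preserving_comp (measure_preserving_shear' _ _)).
exact: (measure_preserving_comp (measure_preserving_shear _ _) (measure_preserving_shear' _ _)).
Qed.

Lemma measure_preserving_translation (v : plane R) :
  measure_preserving (fun x => x + v).
Proof.
suff -> : (fun x : mplane R => x + v : plane R) = (fun x => (x.1, x.2 + (0 * x.1 + v.2))) \o
    (fun x => (x.1 + (0 * x.2 + v.1), x.2)).
  exact: measure_preserving_comp (measure_preserving_shear _ _) (measure_preserving_shear' _ _).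
by apply/funext => -[x y]/=; rewrite !mul0r !add0r.
Qed.

End MeasurePreserving.

Section Isometry.
Context {R : realType}.
Implicit Types (x y z : plane R) (f : plane R -> plane R).

Lemma dot_ge0 x : 0 <= dot x x.
Proof. by rewrite /dot addr_ge0// -expr2 sqr_ge0. Qed.

Lemma dot_eq0 x : dot x x = 0 -> x = 0.
Proof.
case: x => a b; rewrite /dot/= -!expr2 => /eqP.
by rewrite paddr_eq0 ?sqr_ge0// !sqrf_eq0 => /andP[/eqP-> /eqP->].
Qed.

Lemma sqr_dist x y : dist x y ^+ 2 = dot (x - y) (x - y).
Proof. by rewrite /dist sqr_sqrtr// dot_ge0. Qed.

Lemma isometryP f : isometry f <->
  forall x y, dot (f x - f y) (f x - f y) = dot (x - y) (x - y).
Proof.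
split=> h x y; first by rewrite -!sqr_dist h.
by rewrite /dist h.
Qed.

Lemma isometry_comp f g : isometry f -> isometry g -> isometry (f \o g).
Proof. by move=> hf hg x y /=; rewrite hf hg. Qed.

Lemma isometry_id : isometry (@id (plane R)).
Proof. by []. Qed.

(* Polarisation. *)
Lemma isometry_dot f x y z : isometry f ->
  dot (f x - f z) (f y - f z) = dot (x - z) (y - z).
Proof.
move=> /isometryP h; have := h x y; have := h x z; have := h y z.
rewrite /dot /=; nra.
Qed.

Definition linear_part f (x : plane R) : plane R := f x - f 0.

(** By polarisation the images of the two unit vectors are orthonormal, and the coordinates of
    [f x - f 0] are its products with them. [(a, c)] is the first image and [d] the determinant, so
    [f] is a possible flip of the second axis, then a rotation, then a translation. *)
Lemma isometryE f : isometry f -> exists a c d : R, [/\ a ^+ 2 + c ^+ 2 = 1,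
  d ^+ 2 = 1 & forall x, f x = (a * x.1 - c * (d * x.2), c * x.1 + a * (d * x.2)) + f 0].
Proof.
move=> hf; pose u := f (1, 0) - f 0; pose v := f (0, 1) - f 0.
have uu : dot u u = 1 by rewrite isometry_dot// /dot/=; ring.
have vv : dot v v = 1 by rewrite isometry_dot// /dot/=; ring.
have uv : dot u v = 0 by rewrite isometry_dot// /dot/=; ring.
pose d := u.1 * v.2 - u.2 * v.1.
have d1 : d ^+ 2 = 1.
  transitivity (dot u u * dot v v - dot u v ^+ 2); first by rewrite /d /dot; ring.
  by rewrite uu vv uv; ring.
have v1 : v.1 = - u.2 * d.
  transitivity (v.1 * dot u u - u.1 * dot u v); last by rewrite /d /dot; ring.
  by rewrite uu uv; ring.
have v2 : v.2 = u.1 * d.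
  transitivity (v.2 * dot u u - u.2 * dot u v); last by rewrite /d /dot; ring.
  by rewrite uu uv; ring.
have uu' : u.1 ^+ 2 + u.2 ^+ 2 = 1 by move: uu; rewrite /dot => <-; ring.
exists u.1, u.2, d; split=> //.
move=> x; have xu : dot (f x - f 0) u = x.1.
  by rewrite isometry_dot// /dot/=; ring.
have xv : dot (f x - f 0) v = x.2.
  by rewrite isometry_dot// /dot/=; ring.
apply/eqP; rewrite -subr_eq; apply/eqP.
move: v1 v2 uu' d1 xu xv; rewrite -/u -/v /dot => -> -> ; move: (f x - f 0) u.1 u.2 d {uu vv uv} => [w1 w2] u1 u2 e /=.
move=> uu' d1 <- <-; congr pair.
  transitivity (w1 * (u1 ^+ 2 + u2 ^+ 2 * e ^+ 2) + w2 * u1 * u2 * (1 - e ^+ 2)); last by ring.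
  by rewrite d1 mulr1 uu'; ring.
transitivity (w2 * (u2 ^+ 2 + u1 ^+ 2 * e ^+ 2) + w1 * u1 * u2 * (1 - e ^+ 2)); last by ring.
by rewrite d1 mulr1 (addrC (u2 ^+ 2)) uu'; ring.
Qed.

Lemma isometry_measure_preserving f : isometry f -> measure_preserving f.
Proof.
move=> /isometryE[a [c [d [ac d1 fE]]]].
have -> : f = (fun x => x + f 0) \o ((fun x => (a * x.1 - c * x.2, c * x.1 + a * x.2)) \o
   (fun x => (x.1, d * x.2))) by apply/funext => x; rewrite fE.
apply: (measure_preserving_comp (measure_preserving_translation _)).
apply: (measure_preserving_comp (measure_preserving_rotation ac)).
move/eqP: d1; rewrite sqrf_eq1 => /orP[]/eqP ->.
  suff -> : (fun x : mplane R => (x.1, 1 * x.2)) = id by exact: measure_preserving_id.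
  by apply/funext => -[x y]; rewrite /= mul1r.
suff -> : (fun x : mplane R => (x.1, -1 * x.2)) = (fun x => (x.1, - x.2)).
  exact: measure_preserving_oppr.
by apply/funext => -[x y]; rewrite /= mulN1r.
Qed.

(* The inverse of an isometry is given by the transposed matrix. *)
Lemma isometry_inverse f : isometry f ->
  exists g, [/\ isometry g, cancel f g & cancel g f].
Proof.
move=> hf; have [a [c [d [ac d1 fE]]]] := isometryE hf.
pose g x : plane R := let w := x - f 0 in
   (a * w.1 + c * w.2, d * (a * w.2 - c * w.1)).
have gf : cancel f g.
  move=> [x y]; rewrite /g fE addrK/=; congr pair.
    by transitivity ((a ^+ 2 + c ^+ 2) * x); [ring|rewrite ac mul1r].
  by transitivity ((a ^+ 2 + c ^+ 2) * d ^+ 2 * y); [ring|rewrite ac d1 !mul1r].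
have fg : cancel g f.
  move=> x; rewrite fE /g; apply/eqP; rewrite eq_sym -subr_eq; apply/eqP.
  case: (x - f 0) => [w1 w2] /=; congr pair.
    transitivity ((a ^+ 2 + c ^+ 2 * d ^+ 2) * w1 + a * c * w2 * (1 - d ^+ 2)); last by ring.
    by rewrite d1 mulr1 ac; ring.
  transitivity ((c ^+ 2 + a ^+ 2 * d ^+ 2) * w2 + a * c * w1 * (1 - d ^+ 2)); last by ring.
  by rewrite d1 mulr1 addrC (addrC (c ^+ 2)) ac; ring.
exists g; split=> // x y.
by rewrite -hf !fg.
Qed.

End Isometry.

Section IsometryMore.
Context {R : realType}.
Implicit Types (x y z : plane R) (f g : plane R -> plane R).

Lemma linear_partB f x y : isometry f -> f x - f y = linear_part f (x - y).
Proof.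
move=> /isometryE[a [c [d [_ _ fE]]]]; rewrite /linear_part.
move: (f 0) fE => w fE.
by rewrite !fE; move: x y w {fE} => [x1 x2] [y1 y2] [w1 w2] /=; congr pair => /=; ring.
Qed.

Lemma linear_partD f x y : isometry f ->
  linear_part f (x + y) = linear_part f x + linear_part f y.
Proof.
move=> /isometryE[a [c [d [_ _ fE]]]]; rewrite /linear_part.
move: (f 0) fE => w fE.
by rewrite !fE; move: x y w {fE} => [x1 x2] [y1 y2] [w1 w2] /=; congr pair => /=; ring.
Qed.

Lemma linear_partZ f (t : R) x : isometry f ->
  linear_part f (t *: x) = t *: linear_part f x.
Proof.
move=> /isometryE[a [c [d [_ _ fE]]]]; rewrite /linear_part.
move: (f 0) fE => w fE.
rewrite !fE; move: x w {fE} => [x1 x2] [w1 w2] /=; congr pair => /=.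
all: rewrite /GRing.scale /=; ring.
Qed.

Lemma linear_part_dot f x y : isometry f ->
  dot (linear_part f x) (linear_part f y) = dot x y.
Proof. by move=> hf; rewrite /linear_part isometry_dot// !subr0. Qed.

Lemma linear_part_comp f g x : isometry f -> isometry g ->
  linear_part (f \o g) x = linear_part f (linear_part g x).
Proof. by move=> hf hg; rewrite {1}/linear_part /= linear_partB. Qed.

Lemma isometry_cvx f (s t : R) x y : isometry f -> s + t = 1 ->
  f (s *: x + t *: y) = s *: f x + t *: f y.
Proof.
move=> hf st; apply/eqP; rewrite -subr_eq0; apply/eqP.
have -> : f (s *: x + t *: y) = f 0 + linear_part f (s *: x + t *: y).
  by rewrite /linear_part [RHS]addrC subrK.
have fE z : f z = f 0 + linear_part f z by rewrite /linear_part [RHS]addrC subrK.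
rewrite linear_partD// !linear_partZ// (fE x) (fE y) !scalerDr.
have -> : t = 1 - s by rewrite -st addrC addKr.
move: (f 0) (linear_part f x) (linear_part f y) => [w1 w2] [x1 x2] [y1 y2].
by congr pair => /=; rewrite /GRing.scale /=; ring.
Qed.

Lemma isometry_sum f (I : finType) (w : I -> R) (p : I -> plane R) : isometry f ->
  \sum_i w i = 1 -> f (\sum_i w i *: p i) = \sum_i w i *: f (p i).
Proof.
move=> hf w1.
have fE z : f z = linear_part f z + f 0 by rewrite /linear_part subrK.
rewrite fE [RHS](eq_bigr (fun i => w i *: linear_part f (p i) + w i *: f 0)); last first.
  by move=> i _; rewrite -scalerDr -fE.
rewrite big_split/= -scaler_suml w1 scale1r; congr (_ + _).
apply: (big_ind2 (fun x y => linear_part f x = y)).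
- by rewrite /linear_part subrr.
- by move=> x1 x2 y1 y2 <- <-; rewrite linear_partD.
- by move=> i _; rewrite linear_partZ.
Qed.

Lemma dist_norm x y : `|x - y| <= dist x y.
Proof.
rewrite /Num.norm/= /dist.
have h (a b : R) : `|a| <= Num.sqrt (a ^+ 2 + b ^+ 2).
  by rewrite -sqrtr_sqr ler_wsqrtr// lerDl sqr_ge0.
rewrite ge_max; apply/andP; split; first exact: h.
by rewrite /dot [X in Num.sqrt X]addrC -!expr2; exact: h.
Qed.

(** The sharp constant is the square root of 2; any constant suffices to compare Euclidean discs
    with sup-norm balls. *)
Lemma norm_dist x y : dist x y <= 2 * `|x - y|.
Proof.
rewrite /dist -[leRHS]ger0_norm ?mulr_ge0// -sqrtr_sqr ler_wsqrtr//.
rewrite /dot exprMn; set n := `|_|.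
have n1 : `|(x - y).1| <= n by rewrite /n /Num.norm/= le_max lexx.
have n2 : `|(x - y).2| <= n by rewrite /n /Num.norm/= le_max lexx orbT.
have h (a : R) : `|a| <= n -> a * a <= n ^+ 2.
  by move=> an; rewrite -expr2 -real_normK ?num_real// lerXn2r ?nnegrE// normr_ge0.
have := h _ n1; have := h _ n2; have := sqr_ge0 n.
move: (_ * _) (_ * _) (n ^+ 2) => A B C; lra.
Qed.

Lemma isometry_continuous f : isometry f -> continuous f.
Proof.
move=> hf x; apply/cvgrPdist_lt => e e0; near=> y.
rewrite (le_lt_trans (dist_norm _ _))// hf (le_lt_trans (norm_dist _ _))//.
rewrite mulrC -ltr_pdivlMr//; near: y.
by apply: cvgr_dist_lt; rewrite ?divr_gt0.
Unshelve. all: by end_near. Qed.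

Lemma isometry_inj f : isometry f -> injective f.
Proof. by move=> /isometry_inverse[g [_ /can_inj]]. Qed.

Lemma isometry_image f A : isometry f ->
  exists2 g, isometry g & [/\ cancel f g, cancel g f & f @` A = g @^-1` A].
Proof.
move=> /isometry_inverse[g [ig fg gf]]; exists g => //; split=> //.
apply/seteqP; split=> [_ [x Ax <-]|x /= Ax]; first by rewrite /= fg.
by exists (g x).
Qed.

Lemma isometry_open f A : isometry f -> open A -> open (f @` A).
Proof.
move=> /(@isometry_image _ A)[g ig [_ _ ->]] oA.
by apply: open_comp => // x _; exact: isometry_continuous.
Qed.

Lemma isometry_closure f A : isometry f -> closure (f @` A) = f @` closure A.
Proof.
have sub (h : plane R -> plane R) B : isometry h -> h @` closure B `<=` closure (h @` B).
  move=> hi _ [x cx <-] V /(isometry_continuous hi) /cx[y [By Vy]].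
  by exists (h y); split=> //; exists y.
move=> hf; apply/seteqP; split; last exact: sub.
have [g ig [fg gf _]] := isometry_image A hf.
move=> y cy; exists (g y); last exact: gf.
have -> : A = g @` (f @` A).
  apply/seteqP; split=> [x Ax|_ [_ [x Ax <-] <-]]; last by rewrite fg.
  by exists (f x) => //; exists x.
by apply: sub => //; exists y.
Qed.

End IsometryMore.

(** * Integrals under measure preserving maps and under restriction of the measure *)

Section AbstractIntegrals.
Context d (T : measurableType d) (R : realType) (mu : {measure set T -> \bar R}).
Implicit Types (f : T -> T) (F : T -> \bar R) (D : set T).

Lemma integral_preserving f F D : measurable_fun setT f ->
  (forall A, measurable A -> mu (f @^-1` A) = mu A) ->
  measurable_fun setT F -> measurable D ->
  (\int[mu]_(x in f @^-1` D) F (f x) = \int[mu]_(x in D) F x)%E.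
Proof.
move=> mf f2 mF mD.
have H (G : T -> \bar R) : measurable_fun setT G -> (forall x, 0 <= G x)%E ->
  (\int[mu]_(x in f @^-1` D) G (f x) = \int[mu]_(x in D) G x)%E.
  move=> mG G0; rewrite -(ge0_integral_pushforward mf mu mD)//; last first.
    exact: measurable_funTS.
  by apply: eq_measure_integral => // A mA _; exact: f2.
rewrite [LHS]integralE [RHS]integralE; congr (_ - _)%E.
  by rewrite -(H _ (measurable_funepos mF))//; apply: eq_integral => x _; rewrite !funeposE.
by rewrite -(H _ (measurable_funeneg mF))//; apply: eq_integral => x _; rewrite !funenegE.
Qed.

Lemma integrable_preserving f F D : measurable_fun setT f ->
  (forall A, measurable A -> mu (f @^-1` A) = mu A) ->
  measurable_fun setT F -> measurable D ->
  mu.-integrable D F <-> mu.-integrable (f @^-1` D) (F \o f).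
Proof.
move=> mf f2 mF mD.
split=> /integrableP[_ iF]; apply/integrableP; split.
- exact/measurable_funTS/measurableT_comp.
- by rewrite (integral_preserving (F := fun x => `|F x|%E))//; exact: measurableT_comp.
- exact: measurable_funTS.
- by move: iF; rewrite (integral_preserving (F := fun x => `|F x|%E))//; exact: measurableT_comp.
Qed.

Lemma integral_mrestr D (mD : measurable D) F : measurable_fun setT F ->
  (\int[mrestr mu mD]_x F x = \int[mu]_(x in D) F x)%E.
Proof.
move=> mF; have H (G : T -> \bar R) : measurable_fun setT G -> (forall x, 0 <= G x)%E ->
  (\int[mrestr mu mD]_x G x = \int[mu]_(x in D) G x)%E.
  move=> mG G0; rewrite -(setUv D) ge0_integral_setU//.
  - rewrite [X in (_ + X)%E](_ : _ = 0)%E ?adde0; last first.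
      apply: null_set_integral => //; first exact: measurableC.
        exact: measurable_funTS.
      by rewrite /= /mrestr setICl measure0.
    apply: eq_measure_integral => // A mA AO.
    by rewrite /= /mrestr setIidl.
  - exact: measurableC.
  - exact: measurable_funTS.
  - exact/disj_setPCl.
rewrite [LHS]integralE [RHS]integralE; congr (_ - _)%E.
  by rewrite -(H _ (measurable_funepos mF))//; apply: eq_integral => x _; rewrite !funeposE.
by rewrite -(H _ (measurable_funeneg mF))//; apply: eq_integral => x _; rewrite !funenegE.
Qed.

Lemma integrable_mrestr D (mD : measurable D) F : measurable_fun setT F ->
  (mrestr mu mD).-integrable setT F <-> mu.-integrable D F.
Proof.
move=> mF; split=> /integrableP[_ iF]; apply/integrableP; split=> //.
- exact: measurable_funTS.
- by rewrite -(integral_mrestr mD)//; exact: measurableT_comp.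
- by rewrite integral_mrestr//; exact: measurableT_comp.
Qed.

End AbstractIntegrals.

Section ChangeOfVariables.
Context {R : realType}.
Local Notation mu2 := (@lebesgue2 R).
Implicit Types (f : plane R -> plane R) (D : set (mplane R)).

Lemma isometry_measurable f : isometry f -> measurable_fun setT (f : mplane R -> mplane R).
Proof. by move=> /isometry_measure_preserving[]. Qed.

Lemma integral_isometry f (F : mplane R -> \bar R) D : isometry f ->
  measurable_fun setT F -> measurable D ->
  (\int[mu2]_(x in f @^-1` D) F (f x) = \int[mu2]_(x in D) F x)%E.
Proof. move=> /isometry_measure_preserving[mf f2]; exact: integral_preserving. Qed.

Lemma integrable_isometry f (F : mplane R -> \bar R) D : isometry f ->
  measurable_fun setT F -> measurable D ->
  mu2.-integrable D F <-> mu2.-integrable (f @^-1` D) (F \o f).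
Proof. move=> /isometry_measure_preserving[mf f2]; exact: integrable_preserving. Qed.

End ChangeOfVariables.

(** * Smooth functions and cut-offs *)

Section Smooth.
Context {R : realType}.
Implicit Types (x y v : plane R) (f g : plane R -> R).

Lemma mean_value (g dg : R -> R) (a b : R) : (forall t : R, is_derive t 1 g (dg t)) ->
  exists2 c, `|c - a| <= `|b - a| & g b - g a = dg c * (b - a).
Proof.
move=> gdg; have cg : continuous g.
  by move=> x; apply: differentiable_continuous; apply/derivable1_diffP; exact: ex_derive.
have [ab|ba|->] := ltgtP a b; last first.
- by exists b; rewrite !subrr ?mulr0.
- have [c] := @MVT R g dg b a ba (fun (t : R) _ => gdg t) (continuous_subspaceT cg).
  rewrite in_itv/= => /andP[bc ca] E; exists c.
    by rewrite !ltr0_norm ?subr_lt0// lerN2 lerB// ltW.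
  by rewrite -opprB E -mulrN opprB.
- have [c] := @MVT R g dg a b ab (fun (t : R) _ => gdg t) (continuous_subspaceT cg).
  rewrite in_itv/= => /andP[ac cb] E; exists c => //.
  by rewrite !gtr0_norm ?subr_gt0// lerB// ltW.
Qed.

(** Restricting to a line turns directional derivatives into derivatives on [R] with the very same
    difference quotients. *)
Lemma line_quotient f x v (t : R) :
  (fun h : R => h^-1 *: (((fun s : R => f (x + s *: v)) \o shift t) (h *: 1) - f (x + t *: v))) =
  (fun h : R => h^-1 *: ((f \o shift (x + t *: v)) (h *: v) - f (x + t *: v))).
Proof.
apply/funext => h /=; congr (_ *: (f _ - _)).
by rewrite scalerDl /GRing.scale/= mulr1 addrCA.
Qed.

Lemma derive_line f x v (t : R) :
  'D_1 (fun s : R => f (x + s *: v)) t = 'D_v f (x + t *: v).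
Proof. by rewrite /derive line_quotient. Qed.

Lemma derivable_line f x v (t : R) :
  derivable (fun s : R => f (x + s *: v)) t 1 = derivable f (x + t *: v) v.
Proof. by rewrite /derivable line_quotient. Qed.

Lemma mean_value_line f x v (t : R) : (forall y, derivable f y v) ->
  exists2 s : R, `|s| <= `|t| & f (x + t *: v) - f x = 'D_v f (x + s *: v) * t.
Proof.
move=> df; have := @mean_value (fun s : R => f (x + s *: v)) (fun s => 'D_v f (x + s *: v)) 0 t.
case=> [s|s].
  by rewrite -derive_line; apply: derivableP; rewrite derivable_line.
by rewrite !subr0 scale0r addr0; exists s.
Qed.

Lemma unit_vector_sum v : v = v.1 *: unit_vector 0 + v.2 *: unit_vector 1.
Proof. by case: v => a b; congr pair; rewrite /= /GRing.scale/= ?mulr1 ?mulr0 ?addr0 ?add0r. Qed.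

Lemma norm_planeE v : `|v| = Num.max `|v.1| `|v.2|.
Proof. by []. Qed.

Lemma norm_unit_vector i : `|unit_vector i : plane R| = 1.
Proof.
rewrite norm_planeE /unit_vector; case: ifP => _ /=; rewrite normr1 normr0.
  exact/max_idPl.
exact/max_idPr.
Qed.

Section C1.
Variable f : plane R -> R.
Hypothesis df : forall i x, derivable f x (unit_vector i).
Hypothesis cf : forall i, continuous (partial i f).
Variable x : plane R.

Definition gradient_map (h : plane R) : R := h.1 * partial 0 f x + h.2 * partial 1 f x.

Let gradient_map_linear : linear gradient_map.
Proof. by move=> a [u1 u2] [w1 w2]; rewrite /gradient_map /= /GRing.scale /=; ring. Qed.
HB.instance Definition _ := GRing.isLinear.Build R (plane R) R _ gradient_map gradient_map_linear.

Let gradient_map_continuous : continuous gradient_map.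
Proof.
move=> h; apply: cvgD; apply: cvgMl; [exact: cvg_fst|exact: cvg_snd].
Qed.

(** Going from [x] to [x + h] along the two axis directions, two mean values express the increment
    of [f] by partial derivatives at points close to [x]; these differ little from the ones at [x]
    by continuity. *)
Lemma C1_differentiable : differentiable f x /\ 'd f x = gradient_map :> (plane R -> R).
Proof.
have H e : 0 < e -> \forall h \near (0 : plane R),
    `|(f \o shift x - (cst (f x) + gradient_map)) h| <= e * `|h|.
  move=> e0.
  have e20 : 0 < e / 2 by rewrite divr_gt0.
  have /cvgrPdist_lt/(_ _ e20) /nbhs_ballP[r0 /= r00 h0] := @cf 0 x.
  have /cvgrPdist_lt/(_ _ e20) /nbhs_ballP[r1 /= r10 h1] := @cf 1 x.
  near=> h.
  have hr : `|h| < Num.min r0 r1.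
    by near: h; apply: (@nbhs0_lt R (plane R)); rewrite lt_min r00.
  move: hr; rewrite lt_min => /andP[hr0 hr1].
  have n1 : `|h.1| <= `|h| by rewrite [leRHS]/Num.norm/= le_max lexx.
  have n2 : `|h.2| <= `|h| by rewrite [leRHS]/Num.norm/= le_max lexx orbT.
  have [s s1 E1] := @mean_value_line f x (unit_vector 0) h.1 (@df 0).
  have [t t1 E2] := @mean_value_line f (x + h.1 *: unit_vector 0) (unit_vector 1) h.2 (@df 1).
  have -> : (f \o shift x - (cst (f x) + gradient_map)) h =
    ('D_(unit_vector 0) f (x + s *: unit_vector 0) - partial 0 f x) * h.1
   + ('D_(unit_vector 1) f (x + h.1 *: unit_vector 0 + t *: unit_vector 1) - partial 1 f x) * h.2.
    rewrite /= !fctE/= (_ : h + x = x + h.1 *: unit_vector 0 + h.2 *: unit_vector 1); last first.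
      by rewrite addrC -addrA -unit_vector_sum.
    rewrite !mulrBl -E1 -E2 /gradient_map.
    by move: (f _) (f _) (f _) => a b c; ring.
  have b0 : ball x r0 (x + s *: unit_vector 0).
    rewrite -ball_normE /ball_ /= opprD addNKr normrN.
    rewrite normrZ norm_unit_vector mulr1.
    exact: le_lt_trans s1 (le_lt_trans n1 hr0).
  have b1 : ball x r1 (x + h.1 *: unit_vector 0 + t *: unit_vector 1).
    rewrite -ball_normE /ball_ /= -addrA opprD addNKr normrN.
    rewrite norm_planeE /= /GRing.scale /= !mulr1 !mulr0 addr0 add0r gt_max.
    by rewrite (le_lt_trans n1 hr1) (le_lt_trans t1 (le_lt_trans n2 hr1)).
  have := h0 _ b0; have := h1 _ b1 => /= k1 k0.
  rewrite (le_trans (ler_normD _ _))// !normrM [e]splitr mulrDl lerD//.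
    by rewrite ler_pM// distrC ltW.
  by rewrite ler_pM// distrC ltW.
have dE : 'd f x = gradient_map :> (plane R -> R) by apply: diff_unique gradient_map_continuous _; apply/eqaddoP.
split=> //; apply/diff_locallyP; rewrite dE; split; [exact: gradient_map_continuous|exact/eqaddoP].
Unshelve. all: by end_near. Qed.

End C1.

(** [foldr] applies the last index of the list first, hence [rcons]. *)
Lemma smooth_partial f i : smooth f -> smooth (partial i f).
Proof. by move=> sf s; have := sf (rcons s i); rewrite foldr_rcons. Qed.

Lemma smooth_continuous f : smooth f -> continuous f.
Proof. by move=> /(_ [::])[]. Qed.

Lemma smooth_differentiable f x : smooth f -> differentiable f x.
Proof.
move=> sf; apply: (C1_differentiable _ _ x).1 => [i y|i]; first exact: (sf [::]).2.
exact: smooth_continuous (smooth_partial i sf).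
Qed.

Lemma derive_partial f x v : differentiable f x ->
  'D_v f x = v.1 * partial 0 f x + v.2 * partial 1 f x.
Proof.
move=> df; rewrite /partial !deriveE// {1}[v]unit_vector_sum linearD !linearZ.
by [].
Qed.

(* e_n(t) = exp(-1/t) / t^n for t > 0, extended by 0: a family of smooth
   functions that is stable under derivation up to linear combinations. *)
Definition flat_exp (n : nat) (t : R) : R :=
  if 0 < t then expR (- t^-1) * t^-1 ^+ n else 0.

Lemma flat_exp_ge0 n t : 0 <= flat_exp n t.
Proof.
rewrite /flat_exp; case: ifPn => // t0.
by rewrite mulr_ge0 ?expR_ge0// exprn_ge0// invr_ge0 ltW.
Qed.

Lemma flat_exp_gt0 n t : (0 < flat_exp n t) = (0 < t).
Proof.
rewrite /flat_exp; case: ifPn => t0; last by rewrite ltxx.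
by rewrite mulr_gt0 ?expR_gt0// exprn_gt0// invr_gt0.
Qed.

(** [exp (1/t) >= 1 + (1/t)^(n+1) / (n+1)!] gives linear decay at 0 whatever the power of [1/t];
    this is what makes all derivatives vanish there. *)
Lemma flat_exp_le n t : 0 <= t -> flat_exp n t <= n.+1`!%:R * t.
Proof.
rewrite /flat_exp; case: ifPn => t0 t1; last by rewrite mulr_ge0.
have ti : 0 < t^-1 by rewrite invr_gt0.
have := expR_ge1Dxn n (ltW ti) => h.
have {}h : t^-1 ^+ n.+1 <= n.+1`!%:R * expR (t^-1).
  rewrite mulrC -ler_pdivrMr ?ltr0n ?fact_gt0//.
  by apply: le_trans h; rewrite lerDr.
rewrite expRN -ler_pdivlMl ?invr_gt0 ?expR_gt0// invrK mulrCA mulrA.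
rewrite -[leLHS]mulr1 -(mulVf (lt0r_neq0 t0)) mulrA -exprSr.
by rewrite ler_wpM2r// (le_trans h)// mulVf ?gt_eqF// mulr_natl.
Qed.

Lemma is_derive_flat_exp n (t : R) :
  is_derive t 1 (flat_exp n) (flat_exp n.+2 t - n%:R * flat_exp n.+1 t).
Proof.
have [t0|t0|->] := ltgtP t 0.
- have E : \forall y \near t, cst 0 y = flat_exp n y.
    near=> y; rewrite /flat_exp ifF//; apply/negbTE; rewrite -leNgt ltW//.
    near: y; exact: lt_nbhsl.
  rewrite {2 3}/flat_exp !(ltNge 0 t) (ltW t0)/= mulr0 subr0.
  by apply: (near_eq_is_derive E); exact: is_derive_cst.
- have E : \forall y \near t, expR (- y^-1) * y^-1 ^+ n = flat_exp n y.
    by near=> y; rewrite /flat_exp ifT//; near: y; exact: lt_nbhsr.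
  rewrite {2 3}/flat_exp t0.
  apply: (near_eq_is_derive E).
  have tn0 : t != 0 by rewrite gt_eqF.
  have d1 : is_derive t 1 (fun y : R => y^-1) (- t ^- 2).
    have := @is_deriveV R id t 1 1 tn0 (is_derive_id _ _).
    by rewrite /GRing.scale/= mulr1.
  have d2 : is_derive t 1 (fun y : R => expR (- y^-1)) (t ^- 2 * expR (- t^-1)).
    have dN : is_derive t 1 (fun y : R => - y^-1) (t ^- 2).
      by rewrite -[t ^- 2]opprK; apply: is_deriveN.
    rewrite mulrC.
    exact: (@is_derive1_comp R expR (fun y : R => - y^-1) t _ _ (is_derive_expR _) dN).
  have d3 : is_derive t 1 (fun y : R => y^-1 ^+ n) (n%:R * t^-1 ^+ n.-1 * - t ^- 2).
    have := @is_deriveX R _ (fun y : R => y^-1) n t 1 _ d1.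
    by rewrite /GRing.scale/= exprfctE.
  apply: (is_derive_eq (is_deriveM d2 d3)).
  rewrite /GRing.scale/= -exprVn; case: (n) => [|m] /=; first by rewrite expr0 !mul0r mulr0 subr0; ring.
  by rewrite (exprS _ m.+2) (exprS _ m.+1) (exprS _ m); ring.
- have f0 m : flat_exp m 0 = 0 by rewrite /flat_exp ltxx.
  rewrite !f0 mulr0 subr0.
  (* At 0 the difference quotient of [flat_exp n] is [flat_exp n.+1]: dividing by [h] only raises
     the power of [1/h]. *)
  have H : (fun h : R => h^-1 *: ((flat_exp n \o shift 0) (h *: 1) - flat_exp n 0)) = flat_exp n.+1.
    apply/funext => h /=; rewrite f0 subr0 addr0 /flat_exp /GRing.scale/= mulr1.
    by case: ifP => h0; rewrite ?mulr0// exprS mulrCA.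
  have C : flat_exp n.+1 h @[h --> 0^'] --> (0 : R).
    apply/cvgrPdist_le => e e0; near=> h.
    rewrite sub0r normrN ger0_norm ?flat_exp_ge0//.
    have [h0|h0] := leP h 0; first by rewrite /flat_exp ltNge h0/= ltW.
    rewrite (le_trans (flat_exp_le _ (ltW h0)))//.
    rewrite mulrC -ler_pdivlMr ?ltr0n ?fact_gt0//.
    rewrite -(gtr0_norm h0); near: h; apply: dnbhs0_le.
    by rewrite divr_gt0// ltr0n fact_gt0.
  split; first by rewrite /derivable H; apply/cvg_ex; exists 0.
  by rewrite /derive H; exact: (cvg_lim _ C).
Unshelve. all: by end_near. Qed.

Lemma isometry_quotient f (A : plane R -> plane R) x v : isometry A ->
  (fun h : R => h^-1 *: (((f \o A) \o shift x) (h *: v) - f (A x))) =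
  (fun h : R => h^-1 *: ((f \o shift (A x)) (h *: linear_part A v) - f (A x))).
Proof.
move=> hA; apply/funext => h /=; congr (_ *: (f _ - _)).
by rewrite -linear_partZ// -[X in linear_part _ X](addrK x) -linear_partB// subrK.
Qed.

Lemma derive_isometry f (A : plane R -> plane R) x v : isometry A ->
  'D_v (f \o A) x = 'D_(linear_part A v) f (A x).
Proof. by move=> hA; rewrite /derive isometry_quotient. Qed.

Lemma derivable_isometry f (A : plane R -> plane R) x v : isometry A ->
  derivable (f \o A) x v = derivable f (A x) (linear_part A v).
Proof. by move=> hA; rewrite /derivable isometry_quotient. Qed.

Definition affine_form (a b c : R) x : R := a * x.1 + b * x.2 + c.

Lemma affine_form_continuous a b c : continuous (affine_form a b c).
Proof.
move=> x; apply: cvgD; last exact: cvg_cst.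
by apply: cvgD; apply: cvgMr; [exact: cvg_fst|exact: cvg_snd].
Qed.

Lemma affine_form_line a b c x v (s : R) :
  affine_form a b c (x + s *: v) = affine_form a b c x + s * (a * v.1 + b * v.2).
Proof. by rewrite /affine_form /= /GRing.scale /=; ring. Qed.

Lemma is_derive_comp_affine (g : R -> R) (dg : R) a b c x v :
  is_derive (affine_form a b c x) 1 g dg ->
  is_derive x v (g \o affine_form a b c) (dg * (a * v.1 + b * v.2)).
Proof.
move=> gd; set k := a * v.1 + b * v.2.
have E : (fun s : R => (g \o affine_form a b c) (x + s *: v)) =
   g \o (fun s : R => affine_form a b c x + s * k).
  by apply/funext => s /=; rewrite affine_form_line.
have d1 : is_derive (0 : R) 1 (fun s : R => affine_form a b c x + s * k) k.
  have d0 := @is_deriveM R _ id (cst k) 0 1 1 0 (is_derive_id _ _) (is_derive_cst _ _ _).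
  have := @is_deriveD R R R (cst (affine_form a b c x)) _ 0 1 0 _ (is_derive_cst _ _ _) d0.
  by rewrite /GRing.scale/= mul0r !add0r mulr1.
have d2 : is_derive (0 : R) 1 (g \o (fun s : R => affine_form a b c x + s * k)) (dg * k).
  by apply: is_derive1_comp => //; rewrite mul0r addr0.
rewrite -E in d2; have [d3 d4] := d2; split.
  by rewrite derivable_line scale0r addr0 in d3.
by rewrite derive_line scale0r addr0 in d4.
Qed.

Lemma smooth_cst (c : R) : smooth (cst c).
Proof.
move=> s /=; have : exists d : R, foldr (@partial R) (cst c) s = cst d.
  elim: s => [|i s [d /= ->]]; first by exists c.
  by exists 0; apply/funext => x; exact: derive_cst.
by move=> [d ->]; split=> [x|i x]; [exact: cvg_cst|exact: derivable_cst].
Qed.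

(* Smoothness only refers to partial derivatives; this class is stable under
   partial derivatives and its members are differentiable, so it consists of
   smooth functions. *)
Inductive smooth_expr : (plane R -> R) -> Prop :=
| smooth_expr_base f A : smooth f -> isometry A -> smooth_expr (f \o A)
| smooth_expr_flat n a b c : smooth_expr (flat_exp n \o affine_form a b c)
| smooth_expr_add f g : smooth_expr f -> smooth_expr g -> smooth_expr (f + g)
| smooth_expr_mul f g : smooth_expr f -> smooth_expr g -> smooth_expr (f * g)
| smooth_expr_inv f : smooth_expr f -> (forall x, f x != 0) ->
    smooth_expr (fun x => (f x)^-1).

Lemma smooth_expr_cst c : smooth_expr (cst c).
Proof. exact: (smooth_expr_base (smooth_cst c) (@isometry_id R)). Qed.

Lemma smooth_expr_opp f : smooth_expr f -> smooth_expr (- f).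
Proof.
move=> sf; have := smooth_expr_mul (smooth_expr_cst (-1)) sf.
by congr smooth_expr; apply/funext => x; rewrite /= !fctE /= mulN1r.
Qed.

Lemma smooth_expr_differentiable f x : smooth_expr f -> differentiable f x.
Proof.
elim=> {f} [f A sf hA|n a b c|f g _ df _ dg|f g _ df _ dg|f _ df f0].
- have sc i : smooth (partial i f) by exact: smooth_partial.
  have E i y : partial i (f \o A) y = (linear_part A (unit_vector i)).1 * partial 0 f (A y) +
     (linear_part A (unit_vector i)).2 * partial 1 f (A y).
    by rewrite {1}/partial derive_isometry// derive_partial//; exact: smooth_differentiable.
  apply: (C1_differentiable _ _ x).1 => [i y|i].
    by rewrite derivable_isometry//; apply: diff_derivable; exact: smooth_differentiable.
  have -> : partial i (f \o A) = fun y => (linear_part A (unit_vector i)).1 * partial 0 f (A y) +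
     (linear_part A (unit_vector i)).2 * partial 1 f (A y) by apply/funext.
  have cA j : continuous (fun y => partial j f (A y)).
    by move=> z; apply: continuous_comp; [exact: isometry_continuous|exact: smooth_continuous].
  by move=> y; apply: cvgD; apply: cvgMr; exact: cA.
- apply: differentiable_comp.
    rewrite /affine_form; apply: differentiableD => //.
    apply: differentiableD; apply: differentiableM => //.
      have c1 : continuous (fst : plane R -> R) by move=> ?; exact: cvg_fst.
      exact: linear_differentiable.
    have c2 : continuous (snd : plane R -> R) by move=> ?; exact: cvg_snd.
    exact: linear_differentiable.
  by apply/derivable1_diffP; apply: ex_derive; exact: is_derive_flat_exp.
- exact: differentiableD.
- exact: differentiableM.
- exact: differentiableV.
Qed.

Lemma smooth_expr_partial f i : smooth_expr f -> smooth_expr (partial i f).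
Proof.
elim=> {f} [f A sf hA|n a b c|f g ef df eg dg|f g ef df eg dg|f ef df f0].
- have -> : partial i (f \o A) = cst (linear_part A (unit_vector i)).1 * (partial 0 f \o A) +
     cst (linear_part A (unit_vector i)).2 * (partial 1 f \o A).
    apply/funext => y; rewrite {1}/partial derive_isometry// derive_partial//.
    exact: smooth_differentiable.
  apply: smooth_expr_add; apply: smooth_expr_mul; (try exact: smooth_expr_cst);
    by apply: smooth_expr_base => //; exact: smooth_partial.
- have -> : partial i (flat_exp n \o affine_form a b c) =
     (flat_exp n.+2 \o affine_form a b c + cst (- n%:R) * (flat_exp n.+1 \o affine_form a b c)) *
     cst (a * (unit_vector i).1 + b * (unit_vector i).2).
    apply/funext => y; rewrite /partial.
    have [_ ->] := @is_derive_comp_affine (flat_exp n) _ a b c y (unit_vector i) (is_derive_flat_exp _ _).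
    by rewrite !fctE /= mulNr.
  apply: smooth_expr_mul; last exact: smooth_expr_cst.
  apply: smooth_expr_add; first exact: smooth_expr_flat.
  by apply: smooth_expr_mul; [exact: smooth_expr_cst|exact: smooth_expr_flat].
- have -> : partial i (f + g) = partial i f + partial i g.
    apply/funext => y; rewrite /partial deriveD//; apply: diff_derivable;
    exact: smooth_expr_differentiable.
  exact: smooth_expr_add.
- have -> : partial i (f * g) = f * partial i g + g * partial i f.
    apply/funext => y; rewrite /partial deriveM//; apply: diff_derivable;
    exact: smooth_expr_differentiable.
  by apply: smooth_expr_add; apply: smooth_expr_mul.
- have -> : partial i (fun x => (f x)^-1) = - ((fun x => (f x)^-1) * (fun x => (f x)^-1) * partial i f).
    apply/funext => y; rewrite /partial deriveV//; last first.
      by apply: diff_derivable; exact: smooth_expr_differentiable.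
    by rewrite /GRing.scale /= !fctE /= expr2 invfM mulNr.
  apply: smooth_expr_opp; apply: smooth_expr_mul => //.
  by apply: smooth_expr_mul; exact: smooth_expr_inv.
Qed.

Lemma smooth_exprP f : smooth_expr f <-> smooth f.
Proof.
split=> [sf s|sf]; last exact: (smooth_expr_base sf (@isometry_id R)).
have : smooth_expr (foldr (@partial R) f s).
  by elim: s => //= i s; exact: smooth_expr_partial.
move=> /= sg; split=> [x|i x].
  by apply: differentiable_continuous; exact: smooth_expr_differentiable.
by apply: diff_derivable; exact: smooth_expr_differentiable.
Qed.

Lemma smoothD f g : smooth f -> smooth g -> smooth (f + g).
Proof. by move=> /smooth_exprP sf /smooth_exprP sg; apply/smooth_exprP; exact: smooth_expr_add. Qed.

Lemma smoothM f g : smooth f -> smooth g -> smooth (f * g).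
Proof. by move=> /smooth_exprP sf /smooth_exprP sg; apply/smooth_exprP; exact: smooth_expr_mul. Qed.

Lemma smoothN f : smooth f -> smooth (- f).
Proof. by move=> /smooth_exprP sf; apply/smooth_exprP; exact: smooth_expr_opp. Qed.

Lemma smoothB f g : smooth f -> smooth g -> smooth (f - g).
Proof. by move=> sf sg; exact: (smoothD sf (smoothN sg)). Qed.

Lemma smooth_isometry f A : smooth f -> isometry A -> smooth (f \o A).
Proof. by move=> sf hA; apply/smooth_exprP; exact: smooth_expr_base. Qed.

Definition smooth_step (t : R) : R :=
  flat_exp 0 t * (flat_exp 0 t + flat_exp 0 (1 - t))^-1.

Lemma smooth_step_den_gt0 (t : R) : 0 < flat_exp 0 t + flat_exp 0 (1 - t).
Proof.
have [t0|t0] := ltP 0 t.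
  by rewrite ltr_pwDl ?flat_exp_gt0// flat_exp_ge0.
by rewrite ltr_pwDr ?flat_exp_ge0// flat_exp_gt0 subr_gt0 (le_lt_trans t0).
Qed.

Lemma smooth_step0 (t : R) : t <= 0 -> smooth_step t = 0.
Proof. by move=> t0; rewrite /smooth_step {1}/flat_exp ltNge t0 mul0r. Qed.

Lemma smooth_step1 (t : R) : 1 <= t -> smooth_step t = 1.
Proof.
move=> t1; rewrite /smooth_step.
have := smooth_step_den_gt0 t.
have -> : flat_exp 0 (1 - t) = 0 by rewrite /flat_exp subr_gt0 ltNge t1.
by rewrite addr0 => t0; rewrite divff// gt_eqF.
Qed.

Lemma smooth_step_ge0 (t : R) : 0 <= smooth_step t.
Proof. by rewrite /smooth_step divr_ge0 ?flat_exp_ge0// ltW// smooth_step_den_gt0. Qed.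

Lemma smooth_step_le1 (t : R) : smooth_step t <= 1.
Proof.
by rewrite /smooth_step ler_pdivrMr ?smooth_step_den_gt0// mul1r lerDl flat_exp_ge0.
Qed.

Lemma smooth_step_gt0 (t : R) : (0 < smooth_step t) = (0 < t).
Proof. by rewrite /smooth_step pmulr_lgt0 ?invr_gt0 ?smooth_step_den_gt0// flat_exp_gt0. Qed.

Lemma smooth_step_affine a b c : smooth (smooth_step \o affine_form a b c).
Proof.
apply/smooth_exprP.
have E : (fun x => 1 - affine_form a b c x) = affine_form (- a) (- b) (1 - c).
  by apply/funext => x; rewrite /affine_form; ring.
have e1 := smooth_expr_flat 0 a b c.
have e2 : smooth_expr (fun x => flat_exp 0 (1 - affine_form a b c x)).
  by have := smooth_expr_flat 0 (- a) (- b) (1 - c); rewrite -E.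
have e3 := smooth_expr_add e1 e2.
apply: (smooth_expr_mul e1 (smooth_expr_inv e3 _)) => x.
by rewrite gt_eqF// smooth_step_den_gt0.
Qed.

End Smooth.

(** * Barycentric coordinates and side reflections *)

Section TriangleIndex.
Implicit Types i j : 'I_3.

Lemma ord3_11 j : j + 1 + 1 = j + 2.
Proof. by rewrite -addrA. Qed.
Lemma ord3_12 j : j + 1 + 2 = j.
Proof. by rewrite -addrA (_ : 1 + 2 = 0) ?addr0//; apply: val_inj. Qed.
Lemma ord3_21 j : j + 2 + 1 = j.
Proof. by rewrite -addrA (_ : 2 + 1 = 0) ?addr0//; apply: val_inj. Qed.
Lemma ord3_22 j : j + 2 + 2 = j + 1.
Proof. by rewrite -addrA (_ : 2 + 2 = 1)//; apply: val_inj. Qed.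
Definition ord3E := (ord3_11, ord3_12, ord3_21, ord3_22).

Lemma ord3P i j : [\/ i = j, i = j + 1 | i = j + 2].
Proof.
by case: i j => [[|[|[|i]]] hi] // [[|[|[|j]]] hj] //;
  (try by constructor 1; apply: val_inj); (try by constructor 2; apply: val_inj);
  constructor 3; apply: val_inj.
Qed.

Lemma ord3_neq1 j : j + 1 != j.
Proof. by case: j => [[|[|[|j]]] hj]. Qed.
Lemma ord3_neq2 j : j + 2 != j.
Proof. by case: j => [[|[|[|j]]] hj]. Qed.
Lemma ord3_neq12 j : j + 1 != j + 2.
Proof. by case: j => [[|[|[|j]]] hj]. Qed.

Lemma ord3_all (P : 'I_3 -> Prop) j : P j -> P (j + 1) -> P (j + 2) -> forall i, P i.
Proof. by move=> ? ? ? i; case: (ord3P i j) => ->. Qed.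

Lemma ord3_sum (V : nmodType) (F : 'I_3 -> V) j : \sum_i F i = F j + F (j + 1) + F (j + 2).
Proof.
rewrite (bigD1 j)//= (bigD1 (j + 1))/=; last exact: ord3_neq1.
rewrite (bigD1 (j + 2))/=; last by rewrite ord3_neq2 eq_sym ord3_neq12.
rewrite big1 => [|i]; first by rewrite addr0 addrA.
by case: (ord3P i j) => ->; rewrite eqxx ?andbF.
Qed.
End TriangleIndex.

Section Triangle.
Context {R : realType}.
Variable p : 'I_3 -> plane R.
Hypothesis ndg : nondegenerate_triangle p.
Implicit Types (x y : plane R) (j : 'I_3).

Definition cross x y : R := x.1 * y.2 - x.2 * y.1.

Definition tri_det : R := cross (p 2 - p 1) (p 3 - p 1).

Lemma tri_det_neq0 : tri_det != 0.
Proof. exact: ndg. Qed.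

Lemma tri_detE j : cross (p (j + 1) - p j) (p (j + 2) - p j) = tri_det.
Proof.
have -> : tri_det = cross (p (1 + 1) - p 1) (p (1 + 2) - p 1).
  by rewrite /tri_det; congr (cross (p _ - _) (p _ - _)); apply: val_inj.
move: j; apply: (@ord3_all _ 1) => //; rewrite !ord3E /cross /=; ring.
Qed.

(** Ratio of signed areas: the triangle with [x] in place of [p j], over the whole triangle. With
    this explicit quotient, affinity and the vertex values are polynomial identities. *)
Definition bary j x : R := cross (p (j + 1) - x) (p (j + 2) - x) / tri_det.

Lemma bary_sum x : \sum_j bary j x = 1.
Proof.
rewrite (ord3_sum _ 1) /bary !ord3E -!mulrDl -[RHS](divff tri_det_neq0).
by congr (_ / _); rewrite -(tri_detE 1) /cross/=; ring.
Qed.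

Lemma bary_vertex j : bary j (p j) = 1.
Proof. by rewrite /bary tri_detE divff// tri_det_neq0. Qed.

Lemma bary_vertex1 j : bary j (p (j + 1)) = 0.
Proof. by rewrite /bary subrr /cross /= !mul0r subrr mul0r. Qed.

Lemma bary_vertex2 j : bary j (p (j + 2)) = 0.
Proof. by rewrite /bary subrr /cross /= !mulr0 subrr mul0r. Qed.

Lemma bary_vertexE i j : bary j (p i) = (i == j)%:R.
Proof.
case: (ord3P i j) => ->; first by rewrite eqxx bary_vertex.
  by rewrite (negbTE (ord3_neq1 j)) bary_vertex1.
by rewrite (negbTE (ord3_neq2 j)) bary_vertex2.
Qed.

Lemma sum_bary x : \sum_j bary j x *: p j = x.
Proof.
rewrite (ord3_sum _ 1) /bary !ord3E.
set D := tri_det; have D0 : D != 0 := tri_det_neq0.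
have {2}-> : x = (D / D) *: x by rewrite divff// scale1r.
rewrite /D -(tri_detE 1) in D0 *; move: (p 1) (p (1 + 1)) (p (1 + 2)) D0 => [a1 a2] [b1 b2] [c1 c2].
case: x => [x1 x2]; rewrite /cross /= => D0.
by congr pair; rewrite /= /GRing.scale /=; field.
Qed.

Lemma bary_affine j : bary j = affine_form
  (((p (j + 1)).2 - (p (j + 2)).2) / tri_det) (((p (j + 2)).1 - (p (j + 1)).1) / tri_det)
  (cross (p (j + 1)) (p (j + 2)) / tri_det).
Proof.
by apply/funext => x; rewrite /bary /affine_form /cross /=; field; exact: tri_det_neq0.
Qed.

Lemma bary_continuous j : continuous (bary j).
Proof. by rewrite bary_affine; exact: affine_form_continuous. Qed.

Lemma affine_form_cvx (a b c s t : R) x y : s + t = 1 ->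
  affine_form a b c (s *: x + t *: y) = s * affine_form a b c x + t * affine_form a b c y.
Proof.
move=> st; rewrite /affine_form /= /GRing.scale /=.
rewrite -{1}[c]mul1r -st; ring.
Qed.

Lemma bary_cvx j (s t : R) x y : s + t = 1 ->
  bary j (s *: x + t *: y) = s * bary j x + t * bary j y.
Proof. by move=> st; rewrite bary_affine affine_form_cvx. Qed.

Lemma affine_form_sum (a b c : R) (w : 'I_3 -> R) (q : 'I_3 -> plane R) : \sum_j w j = 1 ->
  affine_form a b c (\sum_j w j *: q j) = \sum_j w j * affine_form a b c (q j).
Proof.
rewrite !(ord3_sum _ 0) => w1; rewrite /affine_form /= /GRing.scale /=.
rewrite -[in LHS](mul1r c) -w1; ring.
Qed.

Lemma bary_of_sum (w : 'I_3 -> R) j : \sum_j w j = 1 -> bary j (\sum_i w i *: p i) = w j.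
Proof.
move=> w1; rewrite bary_affine affine_form_sum// -bary_affine (bigD1 j)//= bary_vertex mulr1.
by rewrite big1 ?addr0// => i /negbTE ij; rewrite bary_vertexE ij mulr0.
Qed.

Lemma open_triangleE : open_triangle p = [set x | forall j, 0 < bary j x].
Proof.
apply/seteqP; split=> [_ [w [w0 w1] <-] j|x /= x0]; first by rewrite bary_of_sum.
by exists (bary^~ x); [split=> //; exact: bary_sum|exact: sum_bary].
Qed.

Lemma open_triangle_open : open (open_triangle p).
Proof.
have oj j : open [set x | 0 < bary j x].
  have -> : [set x | 0 < bary j x] = bary j @^-1` [set y | 0 < y] by [].
  by apply: open_comp; [move=> x _; exact: bary_continuous|exact: open_gt].
have := openI (oj 0) (openI (oj (0 + 1)) (oj (0 + 2))); congr open.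
rewrite open_triangleE; apply/seteqP; split=> [x [? [? ?]]|x xj]; first exact: (@ord3_all _ 0).
by split; [exact: xj|split; exact: xj].
Qed.

Lemma closure_open_triangle : closure (open_triangle p) = [set x | forall j, 0 <= bary j x].
Proof.
apply/seteqP; split=> [x cx j|x /= xj].
  have cl : closed [set x | 0 <= bary j x].
    have -> : [set x | 0 <= bary j x] = bary j @^-1` [set y | 0 <= y] by [].
    by apply: preimage_closed; [move=> ? _; exact: bary_continuous|exact: closed_ge].
  suff : [set x | 0 <= bary j x] x by [].
  rewrite (closure_id [set x | 0 <= bary j x]).1//.
  by apply: closure_subset cx => y; rewrite open_triangleE => /(_ j)/ltW.
(* The centroid: moving slightly towards it makes all barycentric coordinates positive. *)
pose g : plane R := \sum_j 3^-1 *: p j.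
have bg j : bary j g = 3^-1.
  by rewrite (bary_of_sum (w := fun=> 3^-1))// sumr_const card_ord -[_ *+ 3]mulr_natr mulVf.
pose h (t : R) := (1 - t) *: x + t *: g.
have ch : h t @[t --> 0^'+] --> x.
  have : h t @[t --> 0] --> h 0.
    apply: cvgD; apply: cvgZr_tmp => //.
    by apply: cvgB; [exact: cvg_cst|exact: cvg_id].
  rewrite {2}/h subr0 scale1r scale0r addr0 => H.
  by apply: cvg_trans H; apply: cvg_app; exact: cvg_at_right_filter.
move=> V /ch; rewrite -/(nbhs _) /= => hV.
near (0 : R)^'+ => t.
exists (h t); split; last by near: t.
rewrite open_triangleE => j /=; rewrite bary_cvx ?subrK// bg.
apply: ltr_wpDl; last by rewrite mulr_gt0.
apply: mulr_ge0; last exact: xj.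
by rewrite subr_ge0; near: t; exact: nbhs_right_le.
Unshelve. all: by end_near. Qed.

Lemma open_triangle_bounded : exists M : R, forall x, closure (open_triangle p) x -> `|x| <= M.
Proof.
exists (\sum_j `|p j|) => x; rewrite closure_open_triangle /= => xj.
rewrite -[x in leLHS]sum_bary (le_trans (ler_norm_sum _ _ _))// ler_sum// => j _.
rewrite normrZ ger0_norm// ler_piMl// -(bary_sum x) (bigD1 j)//= lerDl sumr_ge0//.
Qed.

Let t_ j := p (j + 2) - p (j + 1).

Lemma side_vector_neq0 j : dot (t_ j) (t_ j) != 0.
Proof.
apply/eqP => /dot_eq0 t0; have := tri_det_neq0; rewrite -(tri_detE (j + 1)) !ord3E -/(t_ j) t0.
by rewrite /cross /= !mul0r subrr eqxx.
Qed.

(** Position of the orthogonal projection of [x] on the line of side [j], equal to 0 at [p (j + 1)]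
    and to 1 at [p (j + 2)]. Together with [bary j] it gives orthogonal coordinates adapted to the
    side; the second axis is [normal j], the altitude vector from its foot to [p j]. *)
Definition tang j x : R := dot (x - p (j + 1)) (t_ j) / dot (t_ j) (t_ j).

Definition normal j : plane R := p j - p (j + 1) - tang j (p j) *: t_ j.

Lemma tang_affine j : tang j = affine_form ((t_ j).1 / dot (t_ j) (t_ j)) ((t_ j).2 / dot (t_ j) (t_ j))
   (- dot (p (j + 1)) (t_ j) / dot (t_ j) (t_ j)).
Proof.
apply/funext => x; rewrite /tang /affine_form; have := side_vector_neq0 j.
by rewrite {1 3 4 5 6 7}/dot => t0; rewrite /dot /=; field.
Qed.

Lemma tang_vertex1 j : tang j (p (j + 1)) = 0.
Proof. by rewrite /tang subrr /dot /= !mul0r addr0 mul0r. Qed.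

Lemma tang_vertex2 j : tang j (p (j + 2)) = 1.
Proof. by rewrite /tang divff// side_vector_neq0. Qed.

(** [tang j] is affine, so it is the barycentric mean of its vertex values, which are 0 and 1 at the
    ends of the side. *)
Lemma bary2_tang j x : bary (j + 2) x = tang j x - tang j (p j) * bary j x.
Proof.
have : tang j x = bary j x * tang j (p j) + bary (j + 1) x * tang j (p (j + 1)) +
    bary (j + 2) x * tang j (p (j + 2)).
  rewrite -{1}[x]sum_bary tang_affine affine_form_sum ?bary_sum// -tang_affine.
  by rewrite (ord3_sum _ j).
by rewrite tang_vertex1 tang_vertex2 => ->; ring.
Qed.

Lemma bary1_tang j x : bary (j + 1) x = (1 - tang j x) - (1 - tang j (p j)) * bary j x.
Proof. have := bary_sum x; rewrite (ord3_sum _ j) bary2_tang; move: (bary _ _) (bary _ _) => v u.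
move=> /(congr1 (fun z => z - u - tang j x + tang j (p j) * u)) h.
by transitivity (1 - u - tang j x + tang j (p j) * u); [rewrite -h|]; ring. Qed.

Lemma normal_tang j : dot (normal j) (t_ j) = 0.
Proof.
rewrite /normal /tang; have := side_vector_neq0 j; rewrite /dot /= /GRing.scale /= => t0.
by field.
Qed.

Lemma plane_coords j x : x = p (j + 1) + tang j x *: t_ j + bary j x *: normal j.
Proof.
rewrite -[LHS]sum_bary (ord3_sum _ j) bary1_tang bary2_tang /normal /t_.
move: (tang _ _) (tang _ _) (bary _ _) => a b c.
move: (p j) (p (j + 1)) (p (j + 2)) => [u1 u2] [v1 v2] [w1 w2].
by congr pair; rewrite /= /GRing.scale /=; ring.
Qed.

Lemma rhoE j x : rho p j x = x - (2 * bary j x) *: normal j.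
Proof.
rewrite /rho /line_reflection -/(t_ j) -/(tang j x).
rewrite [X in _ - X = _](plane_coords j) [X in _ = X - _](plane_coords j).
move: (tang _ _) (bary _ _) (t_ _) (normal _) (p _) => a b [u1 u2] [v1 v2] [w1 w2].
by congr pair; rewrite /= /GRing.scale /=; ring.
Qed.

Lemma tangD j x v (t : R) : tang j (x + t *: v) = tang j x + t * (dot v (t_ j) / dot (t_ j) (t_ j)).
Proof.
rewrite tang_affine affine_form_line; congr (_ + t * _).
by rewrite {3}/dot; field; exact: side_vector_neq0.
Qed.

Lemma tang_rho j x : tang j (rho p j x) = tang j x.
Proof. by rewrite rhoE -scaleNr tangD normal_tang mul0r mulr0 addr0. Qed.

Lemma bary_normal j x (t : R) : bary j (x + t *: normal j) = bary j x + t.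
Proof.
have H : bary j (p (j + 1) + 1 *: normal j) = 1.
  rewrite /normal scale1r.
  have -> : p (j + 1) + (p j - p (j + 1) - tang j (p j) *: t_ j) =
     p j + (- tang j (p j)) *: t_ j by rewrite addrA addrCA subrr addr0 scaleNr.
  rewrite bary_affine affine_form_line -bary_affine bary_vertex.
  rewrite (_ : _ * (t_ j).1 + _ = 0) ?mulr0 ?addr0// /t_ /=.
  by field; exact: tri_det_neq0.
move: H; rewrite bary_affine !affine_form_line -bary_affine bary_vertex1 mul1r add0r => ->.
by rewrite mulr1.
Qed.

Lemma bary_rho j x : bary j (rho p j x) = - bary j x.
Proof. by rewrite rhoE -scaleNr bary_normal; ring. Qed.

Lemma rhoK j : involutive (rho p j).
Proof.
move=> x; rewrite (rhoE j (rho p j x)) bary_rho rhoE mulrN scaleNr opprK subrK//.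
Qed.

Lemma rho_fix j x : bary j x = 0 -> rho p j x = x.
Proof. by move=> b0; rewrite rhoE b0 mulr0 scale0r subr0. Qed.

(** In the coordinates [tang j] and [bary j] the reflection only changes the sign of the second one,
    and the two axes are orthogonal. *)
Lemma rho_isometry j : isometry (rho p j).
Proof.
apply/isometryP => x y; rewrite !rhoE.
have := normal_tang j.
have -> : x - y = (tang j x - tang j y) *: t_ j + (bary j x - bary j y) *: normal j.
  rewrite {1}[x](plane_coords j) {1}[y](plane_coords j).
  move: (tang _ _) (tang _ _) (bary _ _) (bary _ _) (t_ _) (normal _) (p _) => a a' b b' [u1 u2] [v1 v2] [w1 w2].
  by congr pair; rewrite /= /GRing.scale /=; ring.
have -> : x - (2 * bary j x) *: normal j - (y - (2 * bary j y) *: normal j) =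
    (tang j x - tang j y) *: t_ j - (bary j x - bary j y) *: normal j.
  rewrite {1}[x](plane_coords j) {1}[y](plane_coords j).
  move: (tang _ _) (tang _ _) (bary _ _) (bary _ _) (t_ _) (normal _) (p _) => a a' b b' [u1 u2] [v1 v2] [w1 w2].
  by congr pair; rewrite /= /GRing.scale /=; ring.
move: (tang j x - tang j y) (bary j x - bary j y) (t_ j) (normal j) => a b [u1 u2] [v1 v2].
rewrite /dot /= /GRing.scale /= => h.
apply/eqP; rewrite -subr_eq0; apply/eqP.
transitivity (- (4 * a * b) * (v1 * u1 + v2 * u2)); first by ring.
by rewrite h mulr0.
Qed.

Lemma sideP j x : side p j x <-> bary j x = 0 /\ forall i, 0 <= bary i x.
Proof.
split=> [[t]|[xj xi]].
  rewrite /= in_itv/= => /andP[t0 t1] <-.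
  have b i : bary i ((1 - t) *: p (j + 1) + t *: p (j + 2)) =
    (1 - t) * (j + 1 == i)%:R + t * (j + 2 == i)%:R.
    by rewrite bary_cvx ?subrK// !bary_vertexE.
  split=> [|i]; first by rewrite b (negbTE (ord3_neq1 j)) (negbTE (ord3_neq2 j)) !mulr0 addr0.
  by rewrite b addr_ge0// mulr_ge0// subr_ge0.
have := bary_sum x; rewrite (ord3_sum _ j) xj add0r => x1.
exists (bary (j + 2) x); rewrite /= ?in_itv/= ?xi/=.
  by rewrite -x1 lerDr.
by rewrite -{1}x1 addrK -[RHS]sum_bary (ord3_sum _ j) xj scale0r add0r.
Qed.

Lemma open_sideP j x : open_side p j x <->
  [/\ bary j x = 0, 0 < bary (j + 1) x & 0 < bary (j + 2) x].
Proof.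
split=> [[t]|[xj xj1 xj2]].
  rewrite /= in_itv/= => /andP[t0 t1] <-.
  rewrite !bary_cvx ?subrK// !bary_vertexE !eqxx (negbTE (ord3_neq1 j)) (negbTE (ord3_neq2 j)).
  rewrite (negbTE (ord3_neq12 j)) [_ == j + 1]eq_sym (negbTE (ord3_neq12 j)).
  by rewrite !mulr0 !mulr1 ?addr0 ?add0r subr_gt0.
have := bary_sum x; rewrite (ord3_sum _ j) xj add0r => x1.
exists (bary (j + 2) x); rewrite /= ?in_itv/= ?xj2/=.
  by rewrite -x1 ltrDr.
by rewrite -{1}x1 addrK -[RHS]sum_bary (ord3_sum _ j) xj scale0r add0r.
Qed.

(** A non-vertical line meets each vertical line in one point, and Tonelli applies; a vertical line
    is the product of a point and [R], of measure [0 * +oo = 0]. *)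
Lemma affine_form_null (a b c : R) : (a != 0) || (b != 0) ->
  @lebesgue2 R [set x | affine_form a b c x = 0] = 0%E.
Proof.
have [->|b0 _] := eqVneq b 0.
  rewrite orbF => a0.
  have -> : [set x : plane R | affine_form a 0 c x = 0] = [set - c / a] `*` setT.
    apply/seteqP; split=> -[x y] /=; rewrite /affine_form /= mul0r addr0.
      move=> /eqP; rewrite addr_eq0 => /eqP h; split=> //.
      by rewrite -h mulrAC divff// mul1r.
    by move=> [-> _]; rewrite mulrCA divff// mulr1 addNr.
  transitivity (@lebesgue_measure R [set (- c / a)%R] * @lebesgue_measure R setT)%E; last first.
    by rewrite lebesgue_measure_set1 mul0e.
  by apply: product_measure1E => //; exact: measurable_set1.
rewrite /lebesgue2 /= /product_measure1; apply: integral0_eq => x _ /=.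
apply/eqP; rewrite eq_le measure_ge0 andbT -[leRHS](lebesgue_measure_set1 (- (a * x + c) / b)).
apply: le_measure; rewrite ?inE//.
  apply: measurable_xsection.
  rewrite -[X in measurable X]setTI.
  have : measurable_fun [set: mplane R] (affine_form a b c : _ -> measurableTypeR R).
    apply: measurable_funD => //; apply: measurable_funD; apply: measurable_funM => //.
  by move=> /(_ measurableT [set 0]); apply; exact: measurable_set1.
move=> y /xsectionP /=; rewrite /affine_form /= => h; apply/(mulIf b0).
by rewrite divfK//; apply/eqP; rewrite -subr_eq0 -h; apply/eqP; ring.
Qed.

Lemma bary_null j : @lebesgue2 R [set x | bary j x = 0] = 0%E.
Proof.
rewrite bary_affine; apply: affine_form_null.
rewrite -negb_and; apply: contra_neqN tri_det_neq0 => /andP[].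
rewrite -[in X in _ -> _ -> X](tri_detE (j + 1)) !ord3E.
rewrite !mulf_eq0 !invr_eq0 !(negbTE tri_det_neq0) !orbF !subr_eq0 => /eqP h1 /eqP h2.
by rewrite /cross /= h1 h2 !subrr !mul0r subrr.
Qed.

(** Along side [j] the other two barycentric coordinates are [1 - tang j] and [tang j] up to
    multiples of [bary j], with coefficients that depend on the triangle only. [C] dominates all of
    these, so a flat strip with margin [d] at both ends of the side lies in the triangle. *)
Lemma strip_sub_triangle : exists2 C : R, 0 < C &
  (forall j, `|tang j (p j)| <= C /\ `|1 - tang j (p j)| <= C) /\
  forall j x (d : R), 0 < bary j x -> C * bary j x < d -> d <= tang j x -> d <= 1 - tang j x ->
  open_triangle p x.
Proof.
pose C := \sum_j (1 + `|tang j (p j)| + `|1 - tang j (p j)|).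
have Cj j : 1 + `|tang j (p j)| + `|1 - tang j (p j)| <= C.
  rewrite /C (bigD1 j)//= lerDl sumr_ge0// => i _; rewrite !addr_ge0//.
exists C; first by rewrite (lt_le_trans _ (Cj 0))// -addrA ltr_pwDl// addr_ge0.
split=> [j|j x d xj xC d1 d2].
  by split; rewrite (le_trans _ (Cj j))// ?lerDr ?addr_ge0// -addrA addrCA lerDl addr_ge0.
rewrite open_triangleE; apply: (@ord3_all _ j) => //.
  rewrite bary1_tang subr_gt0 (lt_le_trans _ d2)// (le_lt_trans _ xC)// ler_wpM2r ?(ltW xj)//.
  rewrite (le_trans (ler_norm _))// (le_trans _ (Cj j))// lerDr addr_ge0//.
rewrite bary2_tang subr_gt0 (lt_le_trans _ d1)// (le_lt_trans _ xC)// ler_wpM2r ?(ltW xj)//.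
by rewrite (le_trans (ler_norm _))// (le_trans _ (Cj j))// -addrA addrCA lerDl addr_ge0.
Qed.

End Triangle.

(** * Gluing patterns and tilings *)

(* The tile glued to tile k along its side j, or k itself if that side is free. *)
Definition neighbour (E : pattern) (j : 'I_3) (k : 'I_7) : 'I_7 :=
  head k [seq if e.1.1 == k then e.1.2 else e.1.1 |
          e <- E & (e.2 == j) && ((e.1.1 == k) || (e.1.2 == k))].

Definition tiles : seq 'I_7 := [:: 1; 2; 3; 4; 5; 6; 7].
Definition labels : seq 'I_3 := [:: 1; 2; 3].

Lemma mem_tiles k : k \in tiles.
Proof. by case: k => [[|[|[|[|[|[|[|k]]]]]]] hk]. Qed.

Lemma mem_labels j : j \in labels.
Proof. by case: j => [[|[|[|j]]] hj]. Qed.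

(* What is needed from the patterns E1 and E2, in decidable form. *)
Definition good_pattern (E : pattern) : bool :=
  [&& all (fun j => all (fun k => neighbour E j (neighbour E j k) == k) tiles) labels,
      all (fun e => (neighbour E e.2 e.1.1 == e.1.2) && (e.1.1 != e.1.2)) E,
      all (fun j => all (fun k => (neighbour E j k == k) || ((k, neighbour E j k, j) \in E)
         || ((neighbour E j k, k, j) \in E)) tiles) labels,
      all (fun m => all (fun k =>
        let s1 := neighbour E (m + 1) in let s2 := neighbour E (m + 2) in
        has (fun l => (s1 l == l) || (s2 l == l)) [:: k; s1 k; s2 k; s1 (s2 k); s2 (s1 k)])
        tiles) labels
    & all (fun k => (k == 1) || has (fun j => (neighbour E j k == 1) ||
        has (fun i => neighbour E i (neighbour E j k) == 1) labels) labels) tiles].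

Lemma good_E1 : good_pattern E1. Proof. by vm_compute. Qed.
Lemma good_E2 : good_pattern E2. Proof. by vm_compute. Qed.

Section Pattern.
Variable E : pattern.
Hypothesis gE : good_pattern E.
Local Notation s := (neighbour E).

Lemma neighbourK j : involutive (s j).
Proof.
move=> k; case/and5P: gE => /allP /(_ j (mem_labels j)) /allP /(_ k (mem_tiles k)) /eqP h _ _ _ _.
exact: h.
Qed.

Lemma neighbour_in k l j : (k, l, j) \in E -> s j k = l /\ k != l.
Proof. by case/and5P: gE => _ /allP h _ _ _ /h /andP[/eqP]. Qed.

Lemma neighbour_glued j k : s j k != k -> (k, s j k, j) \in E \/ (s j k, k, j) \in E.
Proof.
move=> jk; case/and5P: gE => _ _ /allP /(_ j (mem_labels j)) /allP /(_ k (mem_tiles k)) + _ _.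
by rewrite (negbTE jk) /= => /orP.
Qed.

Lemma unsharedE k j : unshared E k j = (s j k == k).
Proof.
apply/idP/eqP => [/forallP h|jk].
  apply/eqP/negPn/negP => /neighbour_glued [] hE; have /andP[] := h (s j k).
    by rewrite hE.
  by move=> _; rewrite hE.
apply/forallP => l; apply/andP; split; apply/negP => /neighbour_in[].
  by rewrite jk => -> /eqP.
by move=> lk; move: jk; rewrite -{1}lk neighbourK => ->; rewrite eqxx.
Qed.

End Pattern.

Section Tiling.
Context {R : realType}.
Variable p : 'I_3 -> plane R.
Hypothesis ndg : nondegenerate_triangle p.
Variables (E : pattern) (tau : 'I_7 -> plane R -> plane R).
Hypothesis gE : good_pattern E.
Hypothesis utau : unfolding p E tau.
Local Notation s := (neighbour E).
Local Notation T := (open_triangle p).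
Local Notation Omega := (glued p tau).
Implicit Types (k l : 'I_7) (j : 'I_3).

Lemma tau_neighbour j k : s j k != k -> tau (s j k) = tau k \o rho p j.
Proof.
case: utau => _ h jk; case: (neighbour_glued gE jk) => /h // ->.
by apply/funext => x /=; rewrite rhoK.
Qed.

(** Every tile is at most two gluings away from tile 1, where [tau] is the identity; this is the
    last clause of [good_pattern]. *)
Lemma tau_isometry k : isometry (tau k).
Proof.
have step j l : isometry (tau (s j l)) -> isometry (tau l).
  have [->//|jl hl] := eqVneq (s j l) l.
  have -> : tau l = tau (s j l) \o rho p j.
    by rewrite (tau_neighbour jl); apply/funext => x /=; rewrite rhoK.
  by apply: isometry_comp => //; exact: rho_isometry.
have t1 : isometry (tau 1) by case: utau => ->.
case/and5P: gE => _ _ _ _ /allP /(_ k (mem_tiles k)) /orP[/eqP->//|/hasP[j _]].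
by move=> /orP[/eqP h|/hasP[i _ /eqP h]]; apply: (step j); rewrite ?h//; apply: (step i); rewrite h.
Qed.

Lemma tau_fix j k x : bary p j x = 0 -> tau (s j k) x = tau k x.
Proof.
move=> xj; have [->//|jk] := eqVneq (s j k) k.
by rewrite tau_neighbour//= rho_fix.
Qed.

(* Going around a vertex through glued sides ends at a free side. *)
Lemma vertex_on_free_side m k : exists k' j,
  [/\ j != m, s j k' = k' & tau k' (p m) = tau k (p m)].
Proof.
have f1 l : tau (s (m + 1) l) (p m) = tau l (p m).
  by apply: tau_fix; rewrite bary_vertexE// eq_sym (negbTE (ord3_neq1 m)).
have f2 l : tau (s (m + 2) l) (p m) = tau l (p m).
  by apply: tau_fix; rewrite bary_vertexE// eq_sym (negbTE (ord3_neq2 m)).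
case/and5P: gE => _ _ _ /allP /(_ m (mem_labels m)) /allP /(_ k (mem_tiles k)) + _.
move=> /hasP[l lk h].
have lE : tau l (p m) = tau k (p m).
  by move: lk; rewrite !inE => /or4P[/eqP->|/eqP->|/eqP->|/orP[]/eqP->]; rewrite ?f1 ?f2 ?f1.
case/orP: h => /eqP h; [exists l, (m + 1)|exists l, (m + 2)]; split=> //.
  exact: ord3_neq1.
exact: ord3_neq2.
Qed.

Lemma tile_open k : open (tile p tau k).
Proof. by apply: isometry_open; [exact: tau_isometry|exact: open_triangle_open]. Qed.

Lemma closure_tile k : closure (tile p tau k) = tau k @` closure T.
Proof. by rewrite isometry_closure//; exact: tau_isometry. Qed.

Lemma tile_sub k : tile p tau k `<=` Omega.
Proof.
rewrite /= -open_subsetE; last exact: tile_open.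
by move=> y ky; exists k => //; exact: subset_closure.
Qed.

Lemma glued_sub x : (Omega : set _) x -> exists k y, closure T y /\ tau k y = x.
Proof.
move=> /interior_subset [k _]; rewrite closure_tile => -[y Ty <-].
by exists k, y.
Qed.

Lemma bary_ge0 j x : closure T x -> 0 <= bary p j x.
Proof. by rewrite closure_open_triangle//; exact. Qed.

Lemma tile_measurable k : measurable (tile p tau k : set (mplane R)).
Proof. by apply: open_measurable2; exact: tile_open. Qed.

Lemma triangle_measurable : measurable (T : set (mplane R)).
Proof. exact: open_measurable2 (open_triangle_open ndg). Qed.

Lemma glued_measurable : measurable (Omega : set (mplane R)).
Proof. exact: open_measurable2 (domain_open Omega). Qed.

(** A point of the polygon outside all open tiles has a vanishing barycentric coordinate in some
    closed tile, so it lies on one of finitely many lines. *)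
Lemma glued_diff_negligible :
  (@lebesgue2 R).-negligible (Omega `\` \bigcup_k tile p tau k).
Proof.
pose N k j : set (mplane R) := tau k @` [set x | bary p j x = 0].
have NE k j : exists2 g, isometry g & N k j = g @^-1` [set x | bary p j x = 0].
  by have [g ig [_ _ gE']] := isometry_image [set x | bary p j x = 0] (tau_isometry k); exists g.
have mB j : measurable ([set x | bary p j x = 0] : set (mplane R)).
  rewrite -[X in measurable X]setTI bary_affine//.
  have mb : measurable_fun [set: mplane R] (affine_form (((p (j + 1)).2 - (p (j + 2)).2) / tri_det p)
    (((p (j + 2)).1 - (p (j + 1)).1) / tri_det p)
    (cross (p (j + 1)) (p (j + 2)) / tri_det p) : _ -> measurableTypeR R).
    by apply: measurable_funD => //; apply: measurable_funD; apply: measurable_funM.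
  by apply: (mb measurableT [set 0]); exact: measurable_set1.
have N0 k j : (@lebesgue2 R).-negligible (N k j).
  have [g ig ->] := NE k j; exists (g @^-1` [set x | bary p j x = 0]); split=> //.
    by rewrite -[X in measurable X]setTI; apply: isometry_measurable.
  by rewrite (isometry_measure_preserving ig).2// bary_null.
(* [inord] turns the finite union into one over the natural numbers; the repeated members do no
   harm. *)
apply: (@negligibleS _ _ _ (@lebesgue2 R) (\bigcup_n \bigcup_m N (inord n) (inord m))).
  move=> x [/glued_sub[k [y [Ty <-]]] nT].
  have [/existsP[j /eqP yj]|ny] := boolP [exists j, bary p j y == 0].
    by exists k => //; exists j => //; exists y; rewrite ?inord_val.
  exfalso; apply: nT; exists k => //; exists y => //; rewrite open_triangleE// => j.
  by rewrite lt_def bary_ge0// andbT; apply: contra ny => yj; apply/existsP; exists j.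
by apply: negligible_bigcup => n; apply: negligible_bigcup => m.
Qed.

Lemma integral_tiles (F : mplane R -> R) : trivIset setT (tile p tau) -> measurable_fun setT F ->
  (\int[@lebesgue2 R]_(x in Omega) (F x)%:E =
   \sum_k \int[@lebesgue2 R]_(x in T) (F (tau k x))%:E)%E.
Proof.
move=> tT mF; pose U : set (mplane R) := \big[setU/set0]_(k <- enum 'I_7) tile p tau k.
have UE : U = \bigcup_k tile p tau k.
  rewrite /U -bigcup_seq; apply/seteqP.
  by split=> [x [k _ kx]|x [k _ kx]]; exists k => //=; rewrite mem_enum.
have mU : measurable U by apply: bigsetU_measurable => k _; exact: tile_measurable.
have UO : U `<=` Omega by rewrite UE => x [k _]; exact: tile_sub.
have mO := glued_measurable.
have mD : measurable (Omega `\` U : set (mplane R)) by exact: measurableD.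
rewrite -{1}(setDUK UO) integral_setU//; last 2 first.
- by apply/measurable_EFinP; exact: measurable_funTS.
- by apply/disj_set2P; apply/seteqP; split=> x // -[Ux [_ nU]].
rewrite [X in (_ + X)%E](_ : _ = 0)%E ?adde0; last first.
  apply: null_set_integral => //.
    by apply/measurable_EFinP; exact: measurable_funTS.
  by apply/negligibleP => //; rewrite UE; exact: glued_diff_negligible.
rewrite integral_bigsetU_EFin ?enum_uniq//.
- rewrite big_enum /=; apply: eq_bigr => k _.
  have -> : (T : set (mplane R)) = tau k @^-1` tile p tau k.
    apply/seteqP; split=> [x Tx|x [y Ty /(isometry_inj (tau_isometry k)) <-]//].
    by exists x.
  rewrite (integral_isometry (F := EFin \o F) (tau_isometry k))//.
    exact/measurable_EFinP.
  exact: tile_measurable.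
- by move=> k; exact: tile_measurable.
- exact: sub_trivIset tT.
- by apply/measurable_EFinP; exact: measurable_funTS.
Qed.

End Tiling.

(** * Integration by parts on a triangle *)

Section PlaneFunctions.
Context {R : realType}.
Implicit Types (f g : plane R -> R) (A : set (plane R)).
Local Notation mu2 := (@lebesgue2 R).

Lemma continuous_measurable2 f : continuous f -> measurable_fun [set: mplane R] (f : mplane R -> R).
Proof.
move=> cf; apply: (measurability _ (RGenOInfty.measurableE R)) => //.
move=> _ [_ [x ->] <-]; rewrite setTI.
apply: open_measurable2; apply: open_comp => [y _|]; first exact: cf.
exact: interval_open.
Qed.

Lemma compact_box (M : R) : compact [set x : plane R | `|x| <= M].
Proof.
have -> : [set x : plane R | `|x| <= M] = `[- M, M]%classic `*` `[- M, M]%classic.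
  apply/seteqP; split=> -[x y] /=; rewrite norm_planeE /= ge_max !in_itv /= -!ler_norml.
    by move=> /andP.
  by move=> [-> ->].
by apply: compact_setX; exact: segment_compact.
Qed.

Lemma closed_bounded_compact A (M : R) : closed A -> (forall x, A x -> `|x| <= M) -> compact A.
Proof. by move=> cA AM; exact: (subclosed_compact cA (@compact_box M)). Qed.

Lemma continuous_bounded f (M : R) : continuous f -> exists2 C : R, 0 <= C & forall x, `|x| <= M -> `|f x| <= C.
Proof.
move=> cf; have [M0|M0] := ltP M 0.
  by exists 0 => // x xM; have := le_lt_trans (le_trans (normr_ge0 x) xM) M0; rewrite ltxx.
have [] := @compact_EVT_max _ R (fun x : plane R => `|f x|) [set x : plane R | `|x| <= M].
- by exists 0; rewrite /= normr0.
- exact: compact_box.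
- apply: continuous_subspaceT => x.
  by apply: continuous_comp; [exact: cf|exact: norm_continuous].
move=> c cM h; exists `|f c| => // x xM; apply: h.
by rewrite inE.
Qed.

(** Measurability is asked on the whole plane, not just on [A], so that compositions with isometries
    stay measurable without any tracking of domains. *)
Definition L1on A f := measurable_fun [set: mplane R] (f : mplane R -> R) /\
  mu2.-integrable A (EFin \o f).

Lemma L1onD A f g : measurable (A : set (mplane R)) -> L1on A f -> L1on A g -> L1on A (fun x => f x + g x).
Proof.
move=> mA [mf f1] [mg g1]; split; first exact: measurable_funD.
by have := integrableD mA f1 g1; congr integrable.
Qed.

Lemma L1onZ A f (a : R) : measurable (A : set (mplane R)) -> L1on A f -> L1on A (fun x => a * f x).
Proof.
move=> mA [mf f1]; split; first exact: measurable_funM.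
by have := integrableZl mA a f1; congr integrable.
Qed.

Lemma L1on0 A : L1on A (fun=> 0).
Proof. by split=> //; exact: integrable0. Qed.

Lemma L1on_sum A (I : finType) (F : I -> plane R -> R) : measurable (A : set (mplane R)) ->
  (forall i, L1on A (F i)) -> L1on A (fun x => \sum_i F i x).
Proof.
move=> mA FA; have H (r : seq I) : L1on A (fun x => \sum_(i <- r) F i x).
  elim: r => [|i r ih].
    by under eq_fun do rewrite big_nil; exact: L1on0.
  by under eq_fun do rewrite big_cons; exact: L1onD.
exact: H.
Qed.

Lemma L1on_bounded A f g (C : R) : measurable (A : set (mplane R)) -> L1on A f ->
  measurable_fun [set: mplane R] (g : mplane R -> R) ->
  (forall x, A x -> `|g x| <= C) -> L1on A (fun x => f x * g x).
Proof.
move=> mA [mf f1] mg gC; split; first exact: measurable_funM.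
have fC : mu2.-integrable A (fun x => (C%:E * (`|f x|)%:E)%E).
  by apply: integrableZl => //; exact: integrable_norm.
apply: (le_integrable mA _ _ fC).
  by apply/measurable_EFinP/measurable_funTS; exact: measurable_funM.
move=> x Ax; rewrite -EFinM /= lee_fin normrM.
rewrite [leRHS]ger0_norm ?mulr_ge0//.
  by rewrite mulrC ler_wpM2r// gC.
exact: le_trans (gC _ Ax).
Qed.

Lemma L1on_continuous A f g (M : R) : measurable (A : set (mplane R)) -> (forall x, A x -> `|x| <= M) ->
  L1on A f -> continuous g -> L1on A (fun x => f x * g x).
Proof.
move=> mA AM fA cg; have [C C0 gC] := continuous_bounded M cg.
apply: (L1on_bounded (C := C)) => //; first exact: continuous_measurable2.
by move=> x /AM; exact: gC.
Qed.

Lemma test_functionI (Omega : domain R) f A : smooth f -> compact A -> A `<=` Omega ->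
  (forall x, f x != 0 -> A x) -> test_function Omega f.
Proof.
move=> sf cA AO fA.
have clA : closed A by apply: compact_closed => //; exact: norm_hausdorff.
have sA : closure [set x | f x != 0] `<=` A.
  by rewrite [X in _ `<=` X](closure_id A).1//; apply: closure_subset => x; exact: fA.
split=> //; last exact: subset_trans AO.
exact: (subclosed_compact (@closed_closure _ _) cA).
Qed.

Lemma Rintegral_dominated A (F : nat -> plane R -> R) f g : measurable (A : set (mplane R)) ->
  (forall n, measurable_fun [set: mplane R] (F n : mplane R -> R)) ->
  measurable_fun [set: mplane R] (f : mplane R -> R) -> L1on A g ->
  (forall x, A x -> F n x @[n --> \oo] --> f x) ->
  (forall n x, A x -> `|F n x| <= g x) ->
  (forall n, \int[mu2]_(x in A) F n x = 0) -> \int[mu2]_(x in A) f x = 0.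
Proof.
move=> mA mF mf [mg g1] Ff Fg F0.
have [] := @dominated_convergence _ _ _ mu2 A mA (fun n => EFin \o F n) (EFin \o f) (EFin \o g).
- by move=> n; apply/measurable_EFinP; exact: measurable_funTS.
- by apply/measurable_EFinP; exact: measurable_funTS.
- by apply: aeW => x Ax; apply: cvg_EFin; [exact: nearW|exact: Ff].
- exact: g1.
- by apply: aeW => x n Ax /=; rewrite lee_fin; exact: Fg.
move=> fI _ cv; rewrite /Rintegral.
suff -> : (\int[mu2]_(x in A) (f x)%:E = 0)%E by [].
(* [fine] also sends infinite values to 0; domination by [g] gives the integrability that turns [F0]
   into a statement on the extended integral. *)
have E n : (\int[mu2]_(x in A) (F n x)%:E = 0)%E.
  have Fi : mu2.-integrable A (EFin \o F n).
    apply: (le_integrable mA _ _ g1) => [|x Ax /=].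
      by apply/measurable_EFinP; exact: measurable_funTS.
    rewrite lee_fin (ger0_norm (le_trans _ (Fg n x Ax)))//; exact: Fg.
  have := congr1 EFin (F0 n); rewrite /Rintegral fineK//.
  exact: integrable_fin_num.
move: cv; rewrite (_ : (fun n => _) = cst 0%E); last by apply/funext.
by move=> cv; apply: (cvg_unique _ cv (@cvg_cst _ _ _ _ _)).
Qed.

End PlaneFunctions.

Section StepDerivative.
Context {R : realType}.

(** The derivative of [smooth_step], written as a partial derivative of a function on the plane: its
    continuity then follows from smoothness there. *)
Definition step_slope (t : R) : R := partial 0 (smooth_step \o affine_form 1 0 0) (t, 0).

Lemma is_derive_smooth_step (t : R) : is_derive t 1 smooth_step (step_slope t).
Proof.
have d : derivable (smooth_step : R -> R) t 1.
  have df n : derivable (flat_exp n : R -> R) t 1 by apply: ex_derive; exact: is_derive_flat_exp.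
  have dg : derivable (fun t : R => flat_exp 0 (1 - t)) t 1.
    apply/derivable1_diffP; apply: differentiable_comp.
      by apply: differentiableB => //; exact/derivable1_diffP.
    by apply/derivable1_diffP; apply: ex_derive; exact: is_derive_flat_exp.
  have d0 : (flat_exp 0 + (fun t : R => flat_exp 0 (1 - t))) t != 0.
    by rewrite gt_eqF// smooth_step_den_gt0.
  have dd := derivableM (df 0%N) (derivableV d0 (derivableD (df 0%N) dg)).
  exact: dd.
have [_ e] := @is_derive_comp_affine R smooth_step ('D_1 smooth_step t) 1 0 0 (t, 0) (unit_vector 0)
  ltac:(by rewrite /affine_form /= mul1r mul0r !addr0; exact: derivableP).
apply: (DeriveDef d).
by rewrite /step_slope /partial e /= !mulr1 mulr0 addr0 mulr1.
Qed.

Lemma derive_step_affine (a b c : R) (x w : plane R) :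
  'D_w (smooth_step \o affine_form a b c) x = step_slope (affine_form a b c x) * (a * w.1 + b * w.2).
Proof. by have [_ ->] := is_derive_comp_affine w (is_derive_smooth_step (affine_form a b c x)). Qed.

(** By continuity on [[-1, 1]]; elsewhere [smooth_step] is locally constant. *)
Lemma step_slope_bounded : exists2 M : R, 0 <= M & forall t, `|step_slope t| <= M.
Proof.
have cs : continuous (partial 0 (smooth_step \o affine_form 1 0 0) : plane R -> R).
  by apply: smooth_continuous; apply: smooth_partial; exact: smooth_step_affine.
have [M M0 hM] := continuous_bounded 1 cs.
exists M => // t; have [t1|t1] := leP `|t| 1.
  by apply: hM; rewrite norm_planeE /= normr0 ge_max t1 ler01.
have [_ <-] := is_derive_smooth_step t.
have [t0|t0] := leP t 0.
  rewrite (@near_eq_derive _ _ _ smooth_step (cst (0 : R))) ?derive_cst ?normr0//.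
  near=> y; apply: smooth_step0; apply: ltW; near: y; apply: lt_nbhsl.
  by move: t1; rewrite ler0_norm// => t1; rewrite -oppr_gt0 (lt_trans _ t1).
rewrite (@near_eq_derive _ _ _ smooth_step (cst (1 : R))) ?derive_cst ?normr0//.
near=> y; apply: smooth_step1; apply: ltW; near: y; apply: lt_nbhsr.
by move: t1; rewrite gtr0_norm.
Unshelve. all: by end_near. Qed.

Lemma step_slope0 (t : R) : 1 < t -> step_slope t = 0.
Proof.
move=> t1; have [_ <-] := is_derive_smooth_step t.
rewrite (@near_eq_derive _ _ _ smooth_step (cst (1 : R))) ?derive_cst//.
by near=> y; apply: smooth_step1; apply: ltW; near: y; apply: lt_nbhsr.
Unshelve. all: by end_near. Qed.

End StepDerivative.

(** * Boundary fluxes of weakly differentiable functions on a triangle *)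

Section Flux.
Context {R : realType}.
Variable p : 'I_3 -> plane R.
Hypothesis ndg : nondegenerate_triangle p.
Local Notation mu2 := (@lebesgue2 R).
Local Notation T := (open_triangle p).
Implicit Types (u psi : plane R -> R) (G : plane R -> plane R) (w : plane R).

Let mT : measurable (T : set (mplane R)).
Proof. by apply: open_measurable2; exact: open_triangle_open. Qed.

Definition L1field G := L1on T (fun x => (G x).1) /\ L1on T (fun x => (G x).2).

(** If [G] is the gradient of [u], Green's formula makes this the boundary integral of
    [u psi (w . n)]: a way to test the trace of [u] without defining it. *)
Definition flux u G w psi : R :=
  \int[mu2]_(x in T) (u x * 'D_w psi x + dot w (G x) * psi x).

(* The strip along side j, in the coordinates (bary j, tang j); it is
   invariant under rho j. *)
Definition strip (j : 'I_3) (e d : R) : set (plane R) :=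
  [set x | `|bary p j x| <= e /\ d <= tang p j x <= 1 - d].

Definition triangle_test psi := exists A, [/\ smooth psi, compact A, A `<=` T & forall x, psi x != 0 -> A x].

(** The positive half of the strip lies in [T] and [d > 0] keeps away from the end points, so within
    the closed triangle [psi] can live on the boundary only inside side [j]. The strip is symmetric,
    hence composition with [rho p j] preserves the class. *)
Definition side_test (j : 'I_3) psi := exists e d, [/\ smooth psi, 0 < d,
  (forall x, strip j e d x -> 0 < bary p j x -> T x) & forall x, psi x != 0 -> strip j e d x].

Lemma derive_smooth_continuous psi w : smooth psi -> continuous (fun x => 'D_w psi x).
Proof.
move=> spsi.
have -> : (fun x => 'D_w psi x) = (fun x => w.1 * partial 0 psi x + w.2 * partial 1 psi x).
  by apply/funext => x; apply: derive_partial; exact: smooth_differentiable.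
have c i : continuous (partial i psi) by apply: smooth_continuous; exact: smooth_partial.
by move=> x; apply: cvgD; apply: cvgMr; exact: c.
Qed.

Lemma L1on_triangle u psi : L1on T u -> continuous psi -> L1on T (fun x => u x * psi x).
Proof.
have [M hM] := open_triangle_bounded ndg; apply: L1on_continuous => // x Tx.
by apply: hM; exact: subset_closure.
Qed.

Lemma L1on_dot G w : L1field G -> L1on T (fun x => dot w (G x)).
Proof. by move=> [G1 G2]; rewrite /dot; apply: L1onD => //; apply: L1onZ. Qed.

Lemma L1on_flux u G w psi : L1on T u -> L1field G -> smooth psi ->
  L1on T (fun x => u x * 'D_w psi x + dot w (G x) * psi x).
Proof.
move=> hu hG sp; apply: L1onD => //.
  by apply: L1on_triangle => //; exact: derive_smooth_continuous.
by apply: L1on_triangle; [exact: L1on_dot|exact: smooth_continuous].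
Qed.

Lemma fluxD u G w psi1 psi2 : L1on T u -> L1field G -> smooth psi1 -> smooth psi2 ->
  flux u G w (psi1 + psi2) = flux u G w psi1 + flux u G w psi2.
Proof.
move=> hu hG s1 s2; rewrite /flux -RintegralD//.
- apply: eq_Rintegral => x _; rewrite deriveD; last 2 first.
  + by apply: diff_derivable; exact: smooth_differentiable.
  + by apply: diff_derivable; exact: smooth_differentiable.
  by rewrite !fctE; ring.
- by have [] := L1on_flux w hu hG s1.
- by have [] := L1on_flux w hu hG s2.
Qed.

Lemma fluxN u G w psi : L1on T u -> L1field G -> smooth psi ->
  flux u G w (- psi) = - flux u G w psi.
Proof.
move=> hu hG sp; apply/eqP; rewrite -addr_eq0 -(fluxD w hu hG (smoothN sp) sp).
apply/eqP; rewrite addNr /flux -[RHS](mul0r (fine (mu2 T))) -(Rintegral_cst _ mT).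
by apply: eq_Rintegral => x _; rewrite derive_cst !mulr0 addr0.
Qed.

Lemma fluxB u G w psi1 psi2 : L1on T u -> L1field G -> smooth psi1 -> smooth psi2 ->
  flux u G w (psi1 - psi2) = flux u G w psi1 - flux u G w psi2.
Proof.
by move=> hu hG s1 s2; rewrite (fluxD w hu hG s1 (smoothN s2)) (fluxN w hu hG s2).
Qed.

Lemma flux_dir u G (a b : R) w1 w2 psi : L1on T u -> L1field G -> smooth psi ->
  flux u G (a *: w1 + b *: w2) psi = a * flux u G w1 psi + b * flux u G w2 psi.
Proof.
move=> hu hG sp; have [m1 i1] := L1on_flux w1 hu hG sp; have [m2 i2] := L1on_flux w2 hu hG sp.
have [_ j1] := L1onZ a mT (L1on_flux w1 hu hG sp); have [_ j2] := L1onZ b mT (L1on_flux w2 hu hG sp).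
rewrite /flux -!RintegralZl// -RintegralD//.
apply: eq_Rintegral => x _; have d := smooth_differentiable x sp.
rewrite !(derive_partial _ d) /dot /= /GRing.scale /=; ring.
Qed.

Lemma flux_local u G w psi1 psi2 : (forall x, T x -> psi1 x = psi2 x) ->
  flux u G w psi1 = flux u G w psi2.
Proof.
move=> E; apply: eq_Rintegral => x; rewrite inE => Tx.
rewrite E// (near_eq_derive (g := psi2))//.
have : nbhs x T by apply: open_nbhs_nbhs; split=> //; exact: open_triangle_open.
by apply: filterS => y; exact: E.
Qed.

Lemma flux0 u G w psi : (forall x, T x -> psi x = 0) -> flux u G w psi = 0.
Proof.
move=> h; rewrite (@flux_local _ _ _ _ (cst 0))// /flux -[RHS](mul0r (fine (mu2 T))) -(Rintegral_cst _ mT).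
by apply: eq_Rintegral => x _; rewrite derive_cst !mulr0 addr0.
Qed.

Lemma flux_sum (I : finType) (c : I -> R) (U : I -> plane R -> R) (V : I -> plane R -> plane R) w psi :
  (forall k, L1on T (U k)) -> (forall k, L1field (V k)) -> smooth psi ->
  flux (fun x => \sum_k c k * U k x) (fun x => \sum_k c k *: V k x) w psi = \sum_k c k * flux (U k) (V k) w psi.
Proof.
move=> hU hV sp.
have H (r : seq I) : L1on T (fun x => \sum_(k <- r) c k * U k x) /\ L1field (fun x => \sum_(k <- r) c k *: V k x).
  elim: r => [|i r [ih1 [ih2 ih3]]].
    under eq_fun do rewrite big_nil; split; first exact: L1on0.
    by split; under eq_fun do rewrite big_nil; exact: L1on0.
  split; first by under eq_fun do rewrite big_cons; apply: L1onD => //; exact: L1onZ.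
  have [V1 V2] := hV i.
  by split; under eq_fun do rewrite big_cons; apply: L1onD => //; exact: L1onZ.
suff S (r : seq I) : flux (fun x => \sum_(k <- r) c k * U k x) (fun x => \sum_(k <- r) c k *: V k x) w psi =
  \sum_(k <- r) c k * flux (U k) (V k) w psi by exact: S.
elim: r => [|i r ih].
  rewrite big_nil -[RHS](mul0r (fine (mu2 T))) -(Rintegral_cst _ mT).
  by apply: eq_Rintegral => x _; rewrite !big_nil /dot /= !mulr0 addr0 !mul0r addr0.
have [hr1 hr2] := H r.
rewrite big_cons -ih /flux -RintegralZl//; last by have [] := L1on_flux w (hU i) (hV i) sp.
rewrite -RintegralD//.
- by apply: eq_Rintegral => x _; rewrite !big_cons /dot /= /GRing.scale /=; ring.
- by have [] := L1onZ (c i) mT (L1on_flux w (hU i) (hV i) sp).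
- by have [] := L1on_flux w hr1 hr2 sp.
Qed.

Lemma bary_normalN j x (t : R) : bary p j (x - t *: normal p j) = bary p j x - t.
Proof. by rewrite -scaleNr bary_normal. Qed.

Lemma strip_compact j e d : 0 < d -> compact (strip j e d).
Proof.
move=> d0; apply: (@closed_bounded_compact _ _ (`|p (j + 1)| + `|p (j + 2) - p (j + 1)| + `|e| * `|normal p j|)).
  have -> : strip j e d = (fun x => `|bary p j x|) @^-1` [set y | y <= e] `&`
     (tang p j @^-1` [set y | d <= y] `&` tang p j @^-1` [set y | y <= 1 - d]).
    by apply/seteqP; split=> x /= [? /andP[]].
  have ct : continuous (tang p j) by rewrite tang_affine//; exact: affine_form_continuous.
  apply: closedI; last apply: closedI.
  - apply: preimage_closed; last exact: closed_le.
    by move=> x _; apply: continuous_comp; [exact: bary_continuous|exact: norm_continuous].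
  - by apply: preimage_closed; [move=> x _; exact: ct|exact: closed_ge].
  - by apply: preimage_closed; [move=> x _; exact: ct|exact: closed_le].
move=> x [be /andP[d1 d2]]; rewrite [x in leLHS](plane_coords ndg j).
have t0 : 0 <= tang p j x by rewrite (le_trans (ltW d0)).
have t1 : tang p j x <= 1 by rewrite (le_trans d2)// gerBl ltW.
rewrite (le_trans (ler_normD _ _))// lerD//; last first.
  by rewrite normrZ ler_wpM2r// (le_trans be)// ler_norm.
by rewrite (le_trans (ler_normD _ _))// lerD// normrZ ler_piMl// ger0_norm.
Qed.

Lemma closed_bary_ge j (c : R) : closed [set x | c <= bary p j x].
Proof.
rewrite (_ : [set x | _] = bary p j @^-1` [set y | c <= y])//.
by apply: preimage_closed; [move=> x _; exact: bary_continuous|exact: closed_ge].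
Qed.

Lemma strip_rho j e d x : strip j e d x -> strip j e d (rho p j x).
Proof. by rewrite /strip /= bary_rho// tang_rho// normrN. Qed.

Lemma side_test_rho j psi : side_test j psi -> side_test j (psi \o rho p j).
Proof.
move=> [e [d [sp d0 sT sd]]]; exists e, d; split; [|exact: d0|exact: sT|].
  by apply: (smooth_isometry sp); exact: rho_isometry.
by move=> x /= /sd /strip_rho; rewrite rhoK.
Qed.

Lemma strip_bary0 j e d x : 0 < d -> strip j e d x -> bary p j x = 0 -> open_side p j x.
Proof.
move=> d0 [_ /andP[d1 d2]] b0; apply/open_sideP => //; split=> //.
  by rewrite bary1_tang// b0 mulr0 subr0 subr_gt0 (le_lt_trans d2)// gtrBl.
by rewrite bary2_tang// b0 mulr0 subr0 (lt_le_trans d0).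
Qed.

Definition bary_slope j w : R :=
  ((p (j + 1)).2 - (p (j + 2)).2) / tri_det p * w.1 + ((p (j + 2)).1 - (p (j + 1)).1) / tri_det p * w.2.

Lemma bary_line j x w (t : R) : bary p j (x + t *: w) = bary p j x + t * bary_slope j w.
Proof. by rewrite bary_affine// affine_form_line. Qed.

(* The cut-off vanishes for bary j <= 1/n and is 1 for bary j >= 2/n. *)
Definition side_cutoff j (n : nat) x : R := smooth_step (n.+1%:R * bary p j x - 1).

Lemma side_cutoffE j n : side_cutoff j n = smooth_step \o affine_form
  (n.+1%:R * (((p (j + 1)).2 - (p (j + 2)).2) / tri_det p))
  (n.+1%:R * (((p (j + 2)).1 - (p (j + 1)).1) / tri_det p))
  (n.+1%:R * (cross (p (j + 1)) (p (j + 2)) / tri_det p) - 1).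
Proof.
apply/funext => x; rewrite /side_cutoff /= bary_affine// /affine_form.
by congr smooth_step; ring.
Qed.

Lemma smooth_side_cutoff j n : smooth (side_cutoff j n).
Proof. by rewrite side_cutoffE; exact: smooth_step_affine. Qed.

Lemma derive_side_cutoff j n x w :
  'D_w (side_cutoff j n) x = step_slope (n.+1%:R * bary p j x - 1) * (n.+1%:R * bary_slope j w).
Proof.
rewrite side_cutoffE derive_step_affine /bary_slope.
have -> : affine_form (n.+1%:R * (((p (j + 1)).2 - (p (j + 2)).2) / tri_det p))
  (n.+1%:R * (((p (j + 2)).1 - (p (j + 1)).1) / tri_det p))
  (n.+1%:R * (cross (p (j + 1)) (p (j + 2)) / tri_det p) - 1) x = n.+1%:R * bary p j x - 1.
  by rewrite bary_affine// /affine_form; ring.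
by move: (step_slope _) => S; ring.
Qed.

Section Reflection.
Variables (u : plane R -> R) (G : plane R -> plane R).
Hypothesis hu : L1on T u.
Hypothesis hG : L1field G.
Hypothesis weak : forall psi w, triangle_test psi -> flux u G w psi = 0.

(** Multiplying [psi] by [side_cutoff j n] gives a test function inside [T], whose flux is 0, and
    [n] tends to infinity by dominated convergence. The only term at risk is [psi] times the
    derivative of the cut-off, of order [n] where [bary j] is of order [1 / n]: it disappears for
    tangential [w], and it stays bounded if [psi] vanishes on the side, being then of order
    [bary j]. *)
Lemma flux_side0 j w psi : side_test j psi ->
  bary_slope j w = 0 \/ (forall x, bary p j x = 0 -> psi x = 0) ->
  flux u G w psi = 0.
Proof.
move=> [e [d [sp d0 sT sd]]] H.
have [M hM] := open_triangle_bounded ndg.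
have TM x : T x -> `|x| <= M by move=> Tx; apply: hM; exact: subset_closure.
have [Ms Ms0 hMs] := @step_slope_bounded R.
pose nu := normal p j; pose kap := bary_slope j w.
have [C1 C10 hC1] := continuous_bounded M (@derive_smooth_continuous psi w sp).
(* The mean value point used below is [x] moved along [nu] by at most [|bary p j x| + |s| <= 2]. *)
have [C2 C20 hC2] := continuous_bounded (M + 2 * `|nu|) (@derive_smooth_continuous psi nu sp).
have [C3 C30 hC3] := continuous_bounded M (smooth_continuous sp).
pose F n x := u x * 'D_w (side_cutoff j n * psi) x + dot w (G x) * (side_cutoff j n * psi) x.
have sF n : smooth (side_cutoff j n * psi) by apply: smoothM; [exact: smooth_side_cutoff|exact: sp].
have DE n x : 'D_w (side_cutoff j n * psi) x = side_cutoff j n x * 'D_w psi x + psi x * 'D_w (side_cutoff j n) x.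
  rewrite deriveM//; apply: diff_derivable; apply: smooth_differentiable.
    exact: smooth_side_cutoff.
  exact: sp.
have cut1 n x : `|side_cutoff j n x| <= 1 by rewrite ger0_norm ?smooth_step_ge0// smooth_step_le1.
have key n x : T x -> `|psi x * 'D_w (side_cutoff j n) x| <= C2 * (Ms * (2 * `|kap|)).
  move=> Tx; rewrite derive_side_cutoff -/kap.
  (* Either the slope of the step is 0, or [n.+1 * bary p j x <= 2], which compensates the factor
     [n.+1] of the derivative. *)
  have [s0|s1] := ltP 1 (n.+1%:R * bary p j x - 1).
    by rewrite step_slope0// mul0r mulr0 normr0 !mulr_ge0.
  have bx : 0 < bary p j x by move: Tx; rewrite open_triangleE// => /(_ j).
  have [k0|psi0] := H; first by rewrite /kap k0 !mulr0 normr0 !mulr_ge0.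
  have psix : `|psi x| <= C2 * bary p j x.
    have [s sb E] := @mean_value_line _ psi (x - bary p j x *: nu) nu (bary p j x)
      (fun y => diff_derivable (smooth_differentiable y sp)).
    have b0 : bary p j (x - bary p j x *: nu) = 0 by rewrite bary_normalN subrr.
    rewrite subrK (psi0 _ b0) subr0 in E.
    rewrite E normrM (gtr0_norm bx) ler_wpM2r ?(ltW bx)//; apply: hC2.
    have b1 : bary p j x <= 1.
      rewrite -(bary_sum ndg x) (bigD1 j)//= lerDl sumr_ge0// => i _.
      by move: Tx; rewrite open_triangleE// => /(_ i)/ltW.
    rewrite (le_trans (ler_normD _ _))//.
    rewrite (le_trans (lerD (ler_normB _ _) (lexx _)))// -addrA lerD// ?TM//.
    rewrite (normrZ (bary p j x)) (normrZ s) -mulrDl ler_wpM2r//.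
    have n1 : `|bary p j x| <= 1 by rewrite gtr0_norm.
    by move: n1 (le_trans sb n1); lra.
  rewrite normrM (le_trans (ler_wpM2r _ psix))// -mulrA ler_wpM2l//.
  have hs := hMs (n.+1%:R * bary p j x - 1); have N0 := ler0n R n.+1.
  move: s1 bx hs N0 {psix Tx}; move: (step_slope _) => S.
  move: (bary p j x) n.+1%:R => B N s1 /ltW B0 hs N0.
  have NB : N * B <= 2 by move: s1; rewrite lerBlDr.
  rewrite (normrM S) (normrM N) (ger0_norm N0).
  rewrite (_ : B * _ = `|S| * ((N * B) * `|kap|)); last by ring.
  rewrite ler_pM//; first by rewrite mulr_ge0// mulr_ge0.
  by rewrite ler_wpM2r.
have fF n x : T x -> `|F n x| <= `|u x| * (C1 + C2 * (Ms * (2 * `|kap|))) + `|dot w (G x)| * C3.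
  move=> Tx; rewrite /F DE (le_trans (ler_normD _ _))// lerD//.
    rewrite normrM ler_wpM2l// (le_trans (ler_normD _ _))// lerD//; last exact: key.
    by rewrite normrM -[C1]mul1r ler_pM// hC1// TM.
  by rewrite normrM ler_wpM2l// normrM -[C3]mul1r ler_pM// hC3// TM.
have L1n f : L1on T f -> L1on T (fun x => `|f x|).
  move=> [mf f1]; split; first exact: measurableT_comp.
  exact: integrable_norm.
apply: (@Rintegral_dominated _ T F _ (fun x => `|u x| * (C1 + C2 * (Ms * (2 * `|kap|))) + `|dot w (G x)| * C3)) => //.
- by move=> n; have [] := L1on_flux w hu hG (sF n).
- by have [] := L1on_flux w hu hG sp.
- apply: L1onD => //.
    by under eq_fun do rewrite mulrC; apply: L1onZ => //; exact: L1n.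
  by under eq_fun do rewrite mulrC; apply: L1onZ => //; apply: L1n; exact: L1on_dot.
(* Pointwise convergence is eventual equality: since [bary p j x > 0], for large [n] the cut-off has
   value 1 and derivative 0 at [x]. *)
- move=> x Tx; apply: cvg_near_cst.
  have bx : 0 < bary p j x by move: Tx; rewrite open_triangleE// => /(_ j).
  have b2 : 0 < (1 + 1) / bary p j x by rewrite divr_gt0.
  have b3 : 0 < ((1 + 1) / bary p j x)^-1 by rewrite invr_gt0.
  have := near_infty_natSinv_lt (PosNum b3); rewrite /= => nb.
  near=> n.
  have s1 : 1 < n.+1%:R * bary p j x - 1.
    rewrite ltrBrDr -ltr_pdivrMr// -ltf_pV2 ?posrE//.
    by near: n.
  have c1 : side_cutoff j n x = 1 by rewrite /side_cutoff smooth_step1// ltW.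
  rewrite /F DE derive_side_cutoff step_slope0//.
  rewrite (_ : (side_cutoff j n * psi) x = side_cutoff j n x * psi x)// c1.
  by rewrite mul0r mulr0 addr0 !mul1r.
- move=> n; apply: weak.
  exists (strip j e d `&` [set x | n.+1%:R^-1 <= bary p j x]); split; first exact: sF.
  + apply: (subclosed_compact _ (@strip_compact j e d d0)); last by move=> x [].
    apply: closedI; first by apply: compact_closed; [exact: norm_hausdorff|exact: (@strip_compact j e d d0)].
    exact: closed_bary_ge.
  + by move=> x [sx /= bx]; apply: (sT _ sx); apply: lt_le_trans bx; rewrite invr_gt0.
  + move=> x; rewrite fctE mulf_eq0 negb_or => /andP[h /sd sx]; split=> //=.
    have : 0 < side_cutoff j n x by rewrite lt_def h smooth_step_ge0.
    by rewrite /side_cutoff smooth_step_gt0 subr_gt0 => /ltW; rewrite -ler_pdivrMl// mulr1.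
Unshelve. all: by end_near. Qed.

(* The even reflection across a side of a weakly differentiable function is
   weakly differentiable: split the direction into its tangential part, along
   which the cut-off is constant, and its normal part, for which the odd part
   of psi vanishes on the side. *)
Lemma flux_reflection j w psi : side_test j psi ->
  flux u G (linear_part (rho p j) w) (psi \o rho p j) = - flux u G w psi.
Proof.
move=> tpsi; have tpsi' := side_test_rho tpsi.
have sp : smooth psi by case: tpsi => [e [d []]].
have sp' : smooth (psi \o rho p j) by case: tpsi' => [e [d []]].
pose b := bary_slope j w; pose t := w - b *: normal p j.
have sn : bary_slope j (normal p j) = 1.
  have := bary_normal ndg j 0 1; rewrite bary_line mul1r.
  by move/(congr1 (fun z => z - bary p j 0)); rewrite !(addrC (bary p j 0)) !addrK.
have st : bary_slope j t = 0.
  have : bary_slope j t = bary_slope j w - b * bary_slope j (normal p j).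
    by rewrite /bary_slope /t /= /GRing.scale /=; ring.
  by rewrite sn mulr1 subrr.
have wE : w = 1 *: t + b *: normal p j by rewrite scale1r subrK.
have rE x : linear_part (rho p j) x = x - (2 * bary_slope j x) *: normal p j.
  rewrite /linear_part !rhoE// -[x in bary p j x]add0r -[x in 0 + x]scale1r bary_line mul1r.
  rewrite sub0r opprK mulrDr scalerDl opprD !addrA.
  by rewrite addrAC subrK.
have rwE : linear_part (rho p j) w = 1 *: t + (- b) *: normal p j.
  rewrite rE -/b /t scale1r mulrC mulr_natr mulr2n scalerDl scaleNr opprD addrA.
  by [].
rewrite rwE [in RHS]wE (flux_dir _ _ _ _ hu hG sp) (flux_dir _ _ _ _ hu hG sp') !mul1r.
rewrite (flux_side0 (w := t) tpsi (or_introl st)) (flux_side0 (w := t) tpsi' (or_introl st)) !add0r.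
rewrite mulNr; congr (- (b * _)).
apply/eqP; rewrite -subr_eq0 -(fluxB _ hu hG sp' sp); apply/eqP.
have tB : side_test j (psi \o rho p j - psi).
  have [e [d [_ d0 sT sd]]] := tpsi; exists e, d; split; [exact: smoothB|exact: d0|exact: sT|].
  move=> x; rewrite !fctE /=; have [px|/sd//] := eqVneq (psi x) 0.
  by rewrite px subr0 => /sd/strip_rho; rewrite rhoK.
apply: (flux_side0 tB); right=> x bx.
by rewrite !fctE /= rho_fix// subrr.
Qed.

End Reflection.

End Flux.

(** * Weak gradients on glued tiles *)

Lemma sum_pair (V : nmodType) (I : finType) (F : I -> V) k l : l != k ->
  (forall i, i != k -> i != l -> F i = 0) -> \sum_i F i = F k + F l.
Proof.
move=> lk F0; rewrite (bigD1 k)//= (bigD1 l)//= big1 ?addr0// => i /andP[].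
exact: F0.
Qed.

Lemma finite_positive_bound (R : realType) (I : finType) (P : I -> R -> Prop) :
  (forall i e e', P i e -> e' <= e -> P i e') -> (forall i, exists2 e, 0 < e & P i e) ->
  exists2 e, 0 < e & forall i, P i e.
Proof.
move=> mono h; have /choice[f hf] : forall i, exists e, 0 < e /\ P i e.
  by move=> i; have [e e0 Pe] := h i; exists e.
(* The inverse of 1 plus the sum of the [1 / f i] lies below every [f i]; unlike a minimum it makes
   sense for an empty [I]. *)
have S0 : 0 < 1 + \sum_i (f i)^-1.
  by rewrite ltr_pwDl// sumr_ge0// => i _; rewrite invr_ge0 ltW//; case: (hf i).
exists (1 + \sum_i (f i)^-1)^-1; first by rewrite invr_gt0.
move=> i; have [fi Pi] := hf i; apply: mono Pi _.
rewrite -[leRHS]invrK lef_pV2 ?posrE ?invr_gt0// (bigD1 i)//= addrCA lerDl addr_ge0// sumr_ge0// => k _.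
by rewrite invr_ge0 ltW//; case: (hf k).
Qed.

Section InverseIsometry.
Context {R : realType}.
Implicit Types (f : plane R -> plane R).

Definition iso_inv f : plane R -> plane R :=
  if pselect (isometry f) is left h then projT1 (cid (isometry_inverse h)) else f.

Lemma iso_invP f : isometry f -> [/\ isometry (iso_inv f), cancel f (iso_inv f) & cancel (iso_inv f) f].
Proof.
by rewrite /iso_inv; case: pselect => // h _; case: cid.
Qed.

Lemma iso_inv_isometry f : isometry f -> isometry (iso_inv f).
Proof. by move=> /iso_invP[]. Qed.

Lemma linear_part_id (x : plane R) : linear_part id x = x.
Proof. by rewrite /linear_part subr0. Qed.

Lemma linear_part_cancel f g x : isometry f -> isometry g -> cancel f g ->
  linear_part g (linear_part f x) = x.
Proof.
move=> hf hg fg; rewrite -linear_part_comp// -[RHS]linear_part_id.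
by congr (linear_part _ x); apply/funext => y; exact: fg.
Qed.

Lemma linear_partK f x : isometry f -> linear_part (iso_inv f) (linear_part f x) = x.
Proof. by move=> hf; have [ig fg gf] := iso_invP hf; exact: linear_part_cancel. Qed.

Lemma linear_partKV f x : isometry f -> linear_part f (linear_part (iso_inv f) x) = x.
Proof. by move=> hf; have [ig fg gf] := iso_invP hf; exact: linear_part_cancel. Qed.

End InverseIsometry.

Section SobolevTiles.
Context {R : realType}.
Variable p : 'I_3 -> plane R.
Hypothesis ndg : nondegenerate_triangle p.
Variables (E : pattern) (tau : 'I_7 -> plane R -> plane R).
Hypothesis gE : good_pattern E.
Hypothesis utau : unfolding p E tau.
Hypothesis adm : admissible p tau E.
Local Notation s := (neighbour E).
Local Notation T := (open_triangle p).
Local Notation Omega := (glued p tau).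
Local Notation mu2 := (@lebesgue2 R).
Implicit Types (k l : 'I_7) (j : 'I_3) (u phi psi : plane R -> R) (g : plane R -> plane R) (w : plane R).

Let ti := tau_isometry ndg gE utau.
Let mT := triangle_measurable ndg.
Let mO := glued_measurable p tau.

Lemma tiles_disjoint k l x y : T x -> T y -> tau k x = tau l y -> k = l.
Proof.
case: adm => dis _ _ Tx Ty xy; have [//|kl] := eqVneq k l.
have := dis k l I I; apply; exists (tau k x); split; first by exists x.
by exists y.
Qed.

Lemma tile_closure_disjoint k l x y : closure T x -> T y -> tau k x = tau l y -> k = l.
Proof.
move=> cx Ty xy; have : closure (tile p tau k) (tau k x).
  by rewrite (closure_tile ndg gE utau); exists x.
have oy : nbhs (tau k x) (tile p tau l).
  apply: open_nbhs_nbhs; split; first exact: (tile_open ndg gE utau).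
  by rewrite xy; exists y.
move=> /(_ _ oy) [_ [[x' Tx' <-] [y' Ty' E']]].
exact/esym/(tiles_disjoint Ty' Tx').
Qed.

(** Free sides are edges of the boundary curve, and an open set contains no point of its
    boundary. *)
Lemma free_side_not_glued k j x : s j k = k -> side p j x -> ~ (Omega : set _) (tau k x).
Proof.
case: adm => _ _ [v [_ bd ed]] jk sx.
have : boundary (Omega : set (plane R)) (tau k x).
  rewrite bd.
  have : [set edge v i | i in setT] (tau k @` side p j).
    rewrite ed; exists (k, j) => //=.
    by rewrite (unsharedE gE) jk eqxx.
  by move=> [i _ ei]; exists i => //; rewrite ei; exists x.
move=> [_ nI] Ox; apply: nI.
by rewrite /interior; apply: open_nbhs_nbhs; split=> //; exact: domain_open.
Qed.

(** A boundary point of a tile inside the polygon lies in the relative interior of a glued side: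
    free sides are excluded, and so are vertices, since each of them also sits on a free side by
    [vertex_on_free_side]. *)
Lemma glued_bary0 k j x : closure T x -> (Omega : set _) (tau k x) -> bary p j x = 0 ->
  s j k != k /\ open_side p j x.
Proof.
move=> cx Ox bx; have ge0 i := bary_ge0 ndg i cx.
split; first by apply/negP => /eqP h; apply: (free_side_not_glued h _ Ox); apply/sideP.
apply/open_sideP => //; split=> //.
  rewrite lt_def ge0 andbT; apply/eqP => b1.
  have xE : x = p (j + 2).
    have := bary_sum ndg x; rewrite (ord3_sum _ j) bx b1 !add0r => b2.
    by rewrite -[LHS](sum_bary ndg) (ord3_sum _ j) bx b1 b2 !scale0r !add0r scale1r.
  have [k' [i [ij si kE]]] := vertex_on_free_side ndg gE utau (j + 2) k.
  apply: (free_side_not_glued (k := k') (j := i) (x := p (j + 2)) si); last by rewrite kE -xE.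
  by apply/sideP => //; split=> [|l]; rewrite bary_vertexE// eq_sym (negbTE ij).
rewrite lt_def ge0 andbT; apply/eqP => b1.
have xE : x = p (j + 1).
  have := bary_sum ndg x; rewrite (ord3_sum _ j) bx b1 add0r addr0 => b2.
  by rewrite -[LHS](sum_bary ndg) (ord3_sum _ j) bx b1 b2 !scale0r add0r addr0 scale1r.
have [k' [i [ij si kE]]] := vertex_on_free_side ndg gE utau (j + 1) k.
apply: (free_side_not_glued (k := k') (j := i) (x := p (j + 1)) si); last by rewrite kE -xE.
by apply/sideP => //; split=> [|l]; rewrite bary_vertexE// eq_sym (negbTE ij).
Qed.

Lemma open_side_closure j x : open_side p j x -> closure T x.
Proof.
move=> /(open_sideP ndg)[b0 b1 b2]; rewrite closure_open_triangle//=.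
by apply: (@ord3_all _ j); rewrite ?b0// ltW.
Qed.

Lemma shared_side_glued k j x : s j k != k -> open_side p j x -> (Omega : set _) (tau k x).
Proof.
case: adm => _ sh _ jk ox; have [h|h] := neighbour_glued gE jk.
  by apply: (sh _ _ _ h); exists x.
by rewrite -(tau_fix ndg gE utau (j := j)); [apply: (sh _ _ _ h); exists x|case/(open_sideP ndg): ox].
Qed.

(** The gradient of [u \o tau k] when [g] is that of [u]: the inverse of the orthogonal linear part
    of [tau k] is its transpose. *)
Definition tile_field k g : plane R -> plane R := fun x => linear_part (iso_inv (tau k)) (g (tau k x)).

Lemma tile_preimage k : (T : set (plane R)) = tau k @^-1` tile p tau k.
Proof.
apply/seteqP; split=> [x Tx|x [y Ty /(isometry_inj (ti k)) <-]//].
by exists x.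
Qed.

Lemma L1on_tile k u : L1on Omega u -> L1on T (u \o tau k).
Proof.
move=> [mu u1]; split; first by apply: measurableT_comp => //; exact: isometry_measurable.
rewrite (tile_preimage k).
apply: (integrable_isometry (F := EFin \o u) (ti k) _ _).1.
- exact/measurable_EFinP.
- exact: (tile_measurable ndg gE utau).
- apply: integrableS u1; [exact: mO|exact: (tile_measurable ndg gE utau)|].
  exact: (tile_sub ndg gE utau).
Qed.

Lemma L1field_tile k g : L1on Omega (fun x => (g x).1) -> L1on Omega (fun x => (g x).2) ->
  L1field p (tile_field k g).
Proof.
move=> /(L1on_tile k) g1 /(L1on_tile k) g2.
have [a [c [d [_ _ lE]]]] := isometryE (iso_inv_isometry (ti k)).
have E1 x : linear_part (iso_inv (tau k)) x = (a * x.1 - c * (d * x.2), c * x.1 + a * (d * x.2)).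
  by rewrite /linear_part lE addrK.
split.
  apply: (@eq_ind _ (fun x => a * (g (tau k x)).1 + (- (c * d)) * (g (tau k x)).2) (L1on T)).
    by apply: L1onD => //; apply: L1onZ.
  by apply/funext => x; rewrite /tile_field E1 /=; ring.
apply: (@eq_ind _ (fun x => c * (g (tau k x)).1 + (a * d) * (g (tau k x)).2) (L1on T)).
  by apply: L1onD => //; apply: L1onZ.
by apply/funext => x; rewrite /tile_field E1 /=; ring.
Qed.

Definition wgrad (D : domain R) u g := forall phi, test_function D phi -> forall w,
  \int[mu2]_(x in D) (u x * 'D_w phi x + dot w (g x) * phi x) = 0.

Lemma integral_flux u g phi w : L1on Omega u -> L1on Omega (fun x => (g x).1) ->
  L1on Omega (fun x => (g x).2) -> smooth phi ->
  \int[mu2]_(x in Omega) (u x * 'D_w phi x + dot w (g x) * phi x) =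
  \sum_k flux p (u \o tau k) (tile_field k g) (linear_part (iso_inv (tau k)) w) (phi \o tau k).
Proof.
move=> hu hg1 hg2 sp; case: adm => dis _ _.
have mF : measurable_fun [set: mplane R] (fun x : mplane R => u x * 'D_w phi x + dot w (g x) * phi x).
  apply: measurable_funD.
    apply: measurable_funM; first by case: hu.
    by apply: continuous_measurable2; exact: (@derive_smooth_continuous _ phi w sp).
  apply: measurable_funM; last by apply: continuous_measurable2; exact: smooth_continuous.
  rewrite /dot; apply: measurable_funD; apply: measurable_funM => //; by case: hg1; case: hg2.
have pull k x : (u \o tau k) x * 'D_(linear_part (iso_inv (tau k)) w) (phi \o tau k) x +
    dot (linear_part (iso_inv (tau k)) w) (tile_field k g x) * (phi \o tau k) x =
    u (tau k x) * 'D_w phi (tau k x) + dot w (g (tau k x)) * phi (tau k x).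
  by rewrite derive_isometry// linear_partKV// /tile_field linear_part_dot//; exact: iso_inv_isometry.
rewrite /Rintegral (integral_tiles ndg gE utau dis mF) -sum_fine; last first.
  move=> k _; apply: integrable_fin_num => //.
  have [_] := L1on_flux ndg (linear_part (iso_inv (tau k)) w) (L1on_tile k hu) (L1field_tile k hg1 hg2) (smooth_isometry sp (ti k)).
  by apply: eq_integrable => // x _ /=; congr EFin; exact: pull.
apply: eq_bigr => k _; rewrite /flux /Rintegral; congr fine; apply: eq_integral => x _; congr EFin.
by rewrite pull.
Qed.

(** Membership in [H^1] of the polygon, read on 7-tuples: weak differentiability inside each tile,
    and equality of traces, in the form of fluxes, for the two tiles at a glued side. Both tiles are
    compared on the same copy of [T], and nothing is asked on free sides. *)
Definition weak_tiles (U : 'I_7 -> plane R -> R) (V : 'I_7 -> plane R -> plane R) :=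
  (forall k psi w, triangle_test p psi -> flux p (U k) (V k) w psi = 0) /\
  (forall k j psi w, s j k != k -> side_test p j psi ->
     flux p (U k) (V k) w psi = flux p (U (s j k)) (V (s j k)) w psi).

Lemma rho_strip_tile k j (e d : R) y : 0 < d -> s j k != k ->
  (forall x, strip p j e d x -> 0 < bary p j x -> T x) -> strip p j e d y ->
  [\/ T y, open_side p j y | T (rho p j y)].
Proof.
move=> d0 jk sT sy; have [b0|b0|b0] := ltgtP (bary p j y) 0.
- by constructor 3; apply: sT; [exact: strip_rho|rewrite bary_rho// oppr_gt0].
- by constructor 1; exact: sT.
- by constructor 2; exact: strip_bary0 sy b0.
Qed.

(** A test function [psi] near side [j] is carried to the polygon by [tau k]; it lives only on tile
    [k] and on the neighbour, where it is seen as [psi \o rho p j]. The two fluxes add up to 0, and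
    [flux_reflection] replaces the second one by minus the flux of [psi] itself. *)
Lemma wgrad_tiles u g : L1on Omega u -> L1on Omega (fun x => (g x).1) -> L1on Omega (fun x => (g x).2) ->
  wgrad Omega u g -> weak_tiles (fun k => u \o tau k) (fun k => tile_field k g).
Proof.
move=> hu hg1 hg2 wg.
have tauK k x : iso_inv (tau k) (tau k x) = x by have [_ h _] := iso_invP (ti k); exact: h.
have tauKV k x : tau k (iso_inv (tau k) x) = x by have [_ _ h] := iso_invP (ti k); exact: h.
have ca k : continuous (tau k) by exact: isometry_continuous.
have part1 k psi w : triangle_test p psi -> flux p (u \o tau k) (tile_field k g) w psi = 0.
  move=> [A [sp cA AT pA]].
  have sphi : smooth (psi \o iso_inv (tau k)) by exact: (smooth_isometry sp (iso_inv_isometry (ti k))).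
  have tphi : test_function Omega (psi \o iso_inv (tau k)).
    apply: (test_functionI (A := tau k @` A)) => //.
    - by apply: continuous_compact => //; apply: continuous_subspaceT; exact: ca.
    - by move=> _ [x /AT Tx <-]; apply: (tile_sub ndg gE utau (k := k)); exists x.
    - by move=> x /= /pA Ax; exists (iso_inv (tau k) x).
  have := wg _ tphi (linear_part (tau k) w); rewrite (integral_flux _ hu hg1 hg2 sphi) (bigD1 k)//=.
  rewrite linear_partK// big1 ?addr0 => [<-|l lk].
    by congr flux; apply/funext => x /=; rewrite tauK.
  apply: flux0 => // x Tx /=; apply/eqP/negPn/negP => /pA/AT Ty.
  by move: lk; rewrite (tiles_disjoint Tx Ty (esym (tauKV k (tau l x)))) eqxx.
split=> [k psi w|k j psi w jk tpsi]; first exact: part1.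
have [e [d [sp d0 sT sd]]] := tpsi.
have tl x : tau (s j k) x = tau k (rho p j x) by rewrite (tau_neighbour ndg gE utau jk).
have sphi : smooth (psi \o iso_inv (tau k)) by exact: (smooth_isometry sp (iso_inv_isometry (ti k))).
have tphi : test_function Omega (psi \o iso_inv (tau k)).
  apply: (test_functionI (A := tau k @` strip p j e d)) => //.
  - apply: continuous_compact; first by apply: continuous_subspaceT; exact: ca.
    exact: (@strip_compact _ p ndg j e d d0).
  - move=> _ [y sy <-]; have [Ty|oy|Ty] := rho_strip_tile d0 jk sT sy.
    + by apply: (tile_sub ndg gE utau (k := k)); exists y.
    + exact: (shared_side_glued jk oy).
    + by rewrite -[y](rhoK ndg j) -tl; apply: (tile_sub ndg gE utau (k := s j k)); exists (rho p j y).
  - by move=> x /= /sd Ax; exists (iso_inv (tau k) x).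
have := wg _ tphi (linear_part (tau k) w); rewrite (integral_flux _ hu hg1 hg2 sphi) (sum_pair jk); last first.
  move=> l lk ljk.
  apply: flux0 => // x Tx /=; apply/eqP/negPn/negP => /sd sy.
  have [Ty|oy|Ty] := rho_strip_tile d0 jk sT sy.
  - by move: lk; rewrite (tiles_disjoint Tx Ty (esym (tauKV k (tau l x)))) eqxx.
  - move: lk; rewrite (tile_closure_disjoint (k := k) (l := l) (y := x) _ Tx (tauKV k (tau l x))) ?eqxx//.
    exact: (open_side_closure oy).
  - move: ljk; rewrite (tiles_disjoint (k := l) (l := s j k) Tx Ty) ?eqxx//.
    by rewrite tl rhoK// tauKV.
rewrite linear_partK; last exact: ti.
have -> : linear_part (iso_inv (tau (s j k))) (linear_part (tau k) w) = linear_part (rho p j) w.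
  have rr := rho_isometry ndg j.
  have -> : linear_part (tau k) w = linear_part (tau (s j k)) (linear_part (rho p j) w).
    rewrite -linear_part_comp//; congr (linear_part _ w); apply/funext => x /=.
    by rewrite tl rhoK.
  by rewrite linear_partK.
have -> : (psi \o iso_inv (tau k)) \o tau k = psi by apply/funext => x /=; rewrite tauK.
have -> : (psi \o iso_inv (tau k)) \o tau (s j k) = psi \o rho p j.
  by apply/funext => x /=; rewrite tl tauK.
rewrite (flux_reflection ndg (L1on_tile _ hu) (L1field_tile _ hg1 hg2)) => [/eqP|psi' w'|//].
  by rewrite subr_eq0 => /eqP.
exact: part1.
Qed.

Lemma smooth_step_bary j (a b : R) : smooth (fun x => smooth_step (a * bary p j x + b)).
Proof.
apply: (@eq_ind _ _ (@smooth R) (smooth_step_affine (a * (((p (j + 1)).2 - (p (j + 2)).2) / tri_det p))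
   (a * (((p (j + 2)).1 - (p (j + 1)).1) / tri_det p))
   (a * (cross (p (j + 1)) (p (j + 2)) / tri_det p) + b))).
apply/funext => x /=; congr smooth_step.
by rewrite bary_affine// /affine_form; ring.
Qed.

Lemma smooth_step_tang j (a b : R) : smooth (fun x => smooth_step (a * tang p j x + b)).
Proof.
have [a1 [a2 [a3 tE]]] : exists a1 a2 a3, tang p j = affine_form a1 a2 a3.
  by rewrite tang_affine//; do 3 eexists.
apply: (@eq_ind _ _ (@smooth R) (smooth_step_affine (a * a1) (a * a2) (a * a3 + b))).
by apply/funext => x /=; rewrite tE /affine_form; congr smooth_step; ring.
Qed.

Lemma support_bound k phi (f : plane R -> R) : test_function Omega phi -> continuous f ->
  (forall x, closure T x -> (Omega : set _) (tau k x) -> 0 < f x) ->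
  exists2 e, 0 < e & forall x, closure T x -> phi (tau k x) != 0 -> e <= f x.
Proof.
move=> [_ cK KO] cf f0; set K := closure _ in cK KO.
pose A := closure T `&` tau k @^-1` K.
have cA : compact A.
  have [M hM] := open_triangle_bounded ndg.
  apply: (@closed_bounded_compact _ _ M); last by move=> x [/hM].
  apply: closedI; first exact: closed_closure.
  apply: preimage_closed; last exact: closed_closure.
  by move=> x _; exact: isometry_continuous.
have inA x : closure T x -> phi (tau k x) != 0 -> A x.
  by move=> cx px; split=> //; apply: subset_closure.
have [A0|/set0P A0] := eqVneq A set0.
  by exists 1 => // x cx /(inA _ cx); rewrite A0.
have [c cAc h] := compact_EVT_min A0 cA (continuous_subspaceT cf).
exists (f c); first by move: cAc; rewrite inE => -[cc Kc]; apply: f0 => //; exact: KO.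
by move=> x cx px; apply: h; rewrite inE; exact: inA.
Qed.

Lemma support_away_vertices phi : test_function Omega phi -> exists2 e, 0 < e &
  forall k x, closure T x -> phi (tau k x) != 0 ->
  forall i i', i != i' -> bary p i x < e -> e <= bary p i' x.
Proof.
move=> tphi; have [] := @finite_positive_bound R ('I_7 * ('I_3 * 'I_3))%type
  (fun t e => forall x, closure T x -> phi (tau t.1 x) != 0 -> t.2.1 != t.2.2 -> bary p t.2.1 x < e -> e <= bary p t.2.2 x).
- move=> [k [i i']] e e' /= h ee x cx px ii b1.
  by rewrite (le_trans ee)// h// (lt_le_trans b1).
- move=> [k [i i']] /=; have [->|ii] := eqVneq i i'; first by exists 1.
  have pos x : closure T x -> (Omega : set _) (tau k x) -> 0 < bary p i x + bary p i' x.
    move=> cx Ox; rewrite lt_def addr_ge0 ?(bary_ge0 ndg)// andbT; apply/negP.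
    rewrite paddr_eq0 ?(bary_ge0 ndg)// => /andP[/eqP b1 /eqP b2].
    have [_ /(open_sideP ndg)[_ h1 h2]] := glued_bary0 cx Ox b1.
    move: ii b2; case: (ord3P i' i) => ->; rewrite ?eqxx// => _ b2.
      by move: h1; rewrite b2 ltxx.
    by move: h2; rewrite b2 ltxx.
  have cb : continuous (fun x => bary p i x + bary p i' x).
    by move=> x; apply: cvgD; exact: bary_continuous.
  have [e e0 he] := support_bound tphi cb pos.
  (* The two barycentric coordinates have sum at least [e], so they are not both below [e / 2]. *)
  exists (e / 2); first by rewrite divr_gt0.
  by move=> x cx px _ b1; have := he x cx px; lra.
by move=> e e0 h; exists e => // k x cx px i i' ii; exact: (h (k, (i, i'))).
Qed.

Lemma support_away_free_sides phi : test_function Omega phi -> exists2 e, 0 < e &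
  forall k j, s j k = k -> forall x, closure T x -> phi (tau k x) != 0 -> e <= bary p j x.
Proof.
move=> tphi; have [] := @finite_positive_bound R ('I_7 * 'I_3)%type
  (fun t e => s t.2 t.1 = t.1 -> forall x, closure T x -> phi (tau t.1 x) != 0 -> e <= bary p t.2 x).
- by move=> [k j] e e' /= h ee jk x cx px; rewrite (le_trans ee)// h.
- move=> [k j] /=; have [jk|jk] := eqVneq (s j k) k; last by exists 1 => // /eqP; rewrite (negbTE jk).
  have pos x : closure T x -> (Omega : set _) (tau k x) -> 0 < bary p j x.
    move=> cx Ox; rewrite lt_def (bary_ge0 ndg)// andbT; apply/negP => /eqP b0.
    by have [+ _] := glued_bary0 cx Ox b0; rewrite jk eqxx.
  have [e e0 he] := support_bound tphi (@bary_continuous _ p ndg j) pos.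
  by exists e => // _.
by move=> e e0 h; exists e => // k j; exact: (h (k, j)).
Qed.

Section Partition.
Variables (e d : R).
Hypotheses (e0 : 0 < e) (d0 : 0 < d).

Let inside j x := smooth_step (e^-1 * bary p j x + -1).
Let outside j x := smooth_step (- e^-1 * bary p j x + -1).

(** Equal to 1 for [|bary p j x| <= e] and to 0 from [2 * e] on. It is even in [bary p j], hence
    invariant under [rho p j], so that the two tiles at a glued side use the same cut-off. *)
Definition near_line j x := 1 - inside j x - outside j x.
Definition side_bump j x := near_line j x *
  (smooth_step (d^-1 * tang p j x + -1) * smooth_step (- d^-1 * tang p j x + (d^-1 - 1))).
Definition inner_bump x := inside 0 x * (inside (0 + 1) x * inside (0 + 2) x).

Lemma inside0 j x : bary p j x <= e -> inside j x = 0.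
Proof. by move=> h; rewrite /inside smooth_step0// subr_le0 mulrC ler_pdivrMr ?mul1r. Qed.

Lemma inside1 j x : 2 * e <= bary p j x -> inside j x = 1.
Proof. by move=> h; rewrite /inside smooth_step1// lerBrDr mulrC ler_pdivlMr. Qed.

Lemma outside0 j x : - e <= bary p j x -> outside j x = 0.
Proof.
by move=> h; rewrite /outside smooth_step0// subr_le0 mulNr -mulrN mulrC ler_pdivrMr// mul1r lerNl.
Qed.

Lemma outside1 j x : bary p j x <= - (2 * e) -> outside j x = 1.
Proof.
by move=> h; rewrite /outside smooth_step1// lerBrDr mulNr -mulrN mulrC ler_pdivlMr// lerNr.
Qed.

Lemma smooth_side_bump j : smooth (side_bump j).
Proof.
have s1 : smooth (near_line j).
  exact: (smoothB (smoothB (smooth_cst 1) (smooth_step_bary j _ _)) (smooth_step_bary j _ _)).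
exact: (smoothM s1 (smoothM (smooth_step_tang j _ _) (smooth_step_tang j _ _))).
Qed.

Lemma smooth_inner_bump : smooth inner_bump.
Proof.
exact: (smoothM (smooth_step_bary _ _ _) (smoothM (smooth_step_bary _ _ _) (smooth_step_bary _ _ _))).
Qed.

Lemma side_bump_rho j x : side_bump j (rho p j x) = side_bump j x.
Proof.
rewrite /side_bump tang_rho// /near_line /inside /outside bary_rho//; congr (_ * _).
by rewrite !mulrN !mulNr opprK addrAC.
Qed.

Lemma side_bump_strip j x : side_bump j x != 0 -> strip p j (2 * e) d x.
Proof.
have near0 : 2 * e < `|bary p j x| -> side_bump j x = 0.
  rewrite /side_bump ltNge ler_norml negb_and -!ltNge => /orP[] hb.
    rewrite /near_line outside1 ?ltW// inside0 ?subr0 ?subrr ?mul0r// (le_trans (ltW hb))// lerNl.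
    by rewrite (le_trans (y := 0)) ?oppr_le0 ?mulr_ge0// ltW.
  rewrite /near_line inside1 ?ltW// outside0 ?subrr ?subr0 ?mul0r// (le_trans _ (ltW hb))//.
  by rewrite (le_trans (y := 0)) ?oppr_le0 ?mulr_ge0// ltW.
have lo0 : tang p j x < d -> side_bump j x = 0.
  move=> ht; rewrite /side_bump (@smooth_step0 _ (d^-1 * tang p j x + -1)) ?mul0r ?mulr0//.
  by rewrite subr_le0 mulrC ler_pdivrMr// mul1r ltW.
have hi0 : 1 - d < tang p j x -> side_bump j x = 0.
  move=> ht; rewrite /side_bump (@smooth_step0 _ (- d^-1 * tang p j x + (d^-1 - 1))) ?mulr0//.
  by rewrite addrA subr_le0 addrC mulNr -{1}[d^-1]mulr1 -mulrBr mulrC ler_pdivrMr// mul1r lerBlDr -lerBlDl ltW.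
move=> /eqP sb; split; first by rewrite leNgt; apply/negP => /near0.
apply/andP; split; rewrite leNgt; apply/negP; first by move=> /lo0.
by move=> /hi0.
Qed.

(** At most one coordinate is below [2 * e]. If it is [bary p j x], then [side_bump j] is
    [1 - inside j], the other side bumps vanish and [inner_bump] is [inside j]; if there is none,
    only [inner_bump] remains, with value 1. *)
Lemma partition_of_unity x : (forall j, 0 < bary p j x) ->
  (forall i i', i != i' -> bary p i x < 2 * e -> 2 * e <= bary p i' x) ->
  (forall j, bary p j x < 2 * e -> 2 * d <= tang p j x /\ 2 * d <= 1 - tang p j x) ->
  inner_bump x + \sum_j side_bump j x = 1.
Proof.
move=> x0 sep tg.
have out j : outside j x = 0 by apply: outside0; rewrite (le_trans _ (ltW (x0 j)))// oppr_le0 ltW.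
have nl j : near_line j x = 1 - inside j x by rewrite /near_line out subr0.
have bump0 j : 2 * e <= bary p j x -> side_bump j x = 0.
  by move=> h; rewrite /side_bump nl inside1// subrr mul0r.
have bump1 j : bary p j x < 2 * e -> side_bump j x = 1 - inside j x.
  move=> h; have [t1 t2] := tg j h; rewrite /side_bump nl !smooth_step1 ?mulr1//.
    by rewrite addrA lerBrDr addrC mulNr -{1}[d^-1]mulr1 -mulrBr mulrC ler_pdivlMr.
  by rewrite lerBrDr mulrC ler_pdivlMr.
have innerE j : inner_bump x = inside j x * (inside (j + 1) x * inside (j + 2) x).
  rewrite /inner_bump; move: j; apply: (@ord3_all _ 0) => //; rewrite !ord3E; ring.
have [/existsP[j jx]|none] := boolP [exists j, bary p j x < 2 * e].
  have j1 := sep j (j + 1) ltac:(by rewrite eq_sym ord3_neq1) jx.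
  have j2 := sep j (j + 2) ltac:(by rewrite eq_sym ord3_neq2) jx.
  rewrite (innerE j) (ord3_sum _ j) (bump0 _ j1) (bump0 _ j2) bump1//.
  by rewrite (inside1 j1) (inside1 j2) !mulr1 !addr0 addrC subrK.
have all2 j : 2 * e <= bary p j x.
  by rewrite leNgt; apply: contra none => h; apply/existsP; exists j.
by rewrite big1 ?addr0 => [|j _]; [rewrite /inner_bump !inside1// !mulr1|exact: bump0].
Qed.

End Partition.

(** [s j] permutes the tiles, so the sum equals its opposite; at a tile fixed by [s j] the
    hypothesis says that the term is 0. *)
Lemma sum_antisymmetric (f : 'I_7 -> R) j : (forall k, f (s j k) = - f k) -> \sum_k f k = 0.
Proof.
move=> h; suff : (\sum_k f k) + \sum_k f k = 0 by move: (\sum_k f k) => x; lra.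
rewrite {1}(reindex_inj (can_inj (neighbourK gE j)))/= -big_split big1//= => k _.
by rewrite h addNr.
Qed.

(** On each tile the pulled back test function is split by the partition of unity. Inner parts have
    no flux; the part at a glued side cancels against that of the neighbour, by [flux_reflection]
    and equality of traces; the part at a free side is 0 because the support stays away from it. The
    double sum thus vanishes for each side label separately. *)
Lemma tiles_wgrad u g : L1on Omega u -> L1on Omega (fun x => (g x).1) -> L1on Omega (fun x => (g x).2) ->
  weak_tiles (fun k => u \o tau k) (fun k => tile_field k g) -> wgrad Omega u g.
Proof.
move=> hu hg1 hg2 [inner0 sides] phi tphi w.
have sphi : smooth phi by case: tphi.
have [e1 e1p away1] := support_away_vertices tphi.
have [e2 e2p away2] := support_away_free_sides tphi.
have [C C0 [tC sub]] := strip_sub_triangle ndg.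
(* Where [bary p j x < 2 * e], the other two coordinates are at least [e1 >= 3 * d] and differ from
   [1 - tang p j x] and [tang p j x] by at most [2 * e * C < d]; this leaves the margin [2 * d]
   wanted by [partition_of_unity]. Moreover [2 * e < e2] keeps the bumps of free sides off the
   support. *)
pose d := Num.min e1 e2 / 3.
have d0 : 0 < d by rewrite divr_gt0// lt_min e1p.
have [d1 d2] : 3 * d <= e1 /\ 3 * d <= e2.
  by rewrite /d mulrC divfK//; split; rewrite ge_min lexx ?orbT.
pose e := d / (C + 1) / 2.
have C10 : 0 < C + 1 by rewrite addr_gt0.
have e0 : 0 < e by rewrite /e; apply: divr_gt0 => //; exact: divr_gt0.
have e2E : 2 * e * (C + 1) = d by rewrite /e; field; rewrite gt_eqF// addr_gt0.
have C2e : C * (2 * e) < d by rewrite -e2E; nra.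
have e2d : 2 * e <= d by rewrite -e2E; nra.
rewrite (integral_flux _ hu hg1 hg2 sphi).
have sphik k : smooth (phi \o tau k) by exact: (smooth_isometry sphi (ti k)).
have ssb j k : smooth (side_bump e d j * (phi \o tau k)).
  exact: (smoothM (smooth_side_bump e d j) (sphik k)).
have sib k : smooth (inner_bump e * (phi \o tau k)).
  exact: (smoothM (smooth_inner_bump e) (sphik k)).
pose wk k := linear_part (iso_inv (tau k)) w.
pose F k psi := flux p (u \o tau k) (tile_field k g) (wk k) psi.
have FD k psi1 psi2 : smooth psi1 -> smooth psi2 -> F k (psi1 + psi2) = F k psi1 + F k psi2.
  exact: (fluxD ndg (wk k) (L1on_tile k hu) (L1field_tile k hg1 hg2)).
have inner_test k : triangle_test p (inner_bump e * (phi \o tau k)).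
  have sT : [set x | forall j, e <= bary p j x] `<=` T.
    by move=> x hx; rewrite open_triangleE//= => j; exact: lt_le_trans e0 (hx j).
  exists [set x | forall j, e <= bary p j x]; split; [exact: sib| |exact: sT|].
    have [M hM] := open_triangle_bounded ndg.
    apply: (@closed_bounded_compact _ _ M); last by move=> x /sT/subset_closure/hM.
    have -> : [set x | forall j, e <= bary p j x] = \bigcap_j [set x | e <= bary p j x].
      by apply/seteqP; split=> x /= h j => [_|]; exact: h.
    by apply: closed_bigI => j _; exact: (@closed_bary_ge _ p ndg).
  move=> x; apply: contraPP => /existsNP[j /negP]; rewrite -ltNge => hj.
  apply/negP; rewrite negbK; apply/eqP; rewrite (_ : (_ * _) x = inner_bump e x * phi (tau k x))//.
  by rewrite /inner_bump; move: j hj; apply: (@ord3_all _ 0) => hj; rewrite (inside0 _ (ltW hj))// ?mul0r ?mulr0 ?mul0r.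
have bump_test k j : side_test p j (side_bump e d j * (phi \o tau k)).
  exists (2 * e), d; split; [exact: ssb|exact: d0| |].
    move=> x [bx /andP[t1 t2]] b0; apply: (sub j x d) => //.
      by rewrite (le_lt_trans _ C2e)// ler_pM2l// (le_trans (ler_norm _)).
    by rewrite lerBrDr addrC -lerBrDr.
  move=> x; rewrite (_ : (_ * _) x = side_bump e d j x * phi (tau k x))//.
  by have [->|n0 _] := eqVneq (side_bump e d j x) 0; [rewrite mul0r eqxx|exact: side_bump_strip].
have split_flux k : F k (phi \o tau k) = \sum_j F k (side_bump e d j * (phi \o tau k)).
  have -> : F k (phi \o tau k) = F k (inner_bump e * (phi \o tau k) +
      (side_bump e d 0 * (phi \o tau k) + (side_bump e d (0 + 1) * (phi \o tau k) + side_bump e d (0 + 2) * (phi \o tau k)))).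
    apply: (flux_local ndg) => x Tx.
    rewrite (_ : (_ + _) x = (inner_bump e x + (side_bump e d 0 x + (side_bump e d (0 + 1) x + side_bump e d (0 + 2) x))) * phi (tau k x)); last first.
      by rewrite !mulrDl.
    have [p0|pn0] := eqVneq (phi (tau k x)) 0; first by rewrite /= p0 mulr0.
    have cx := subset_closure Tx.
    have x0 j : 0 < bary p j x by move: Tx; rewrite open_triangleE//; exact.
    have := @partition_of_unity e d e0 d0 x x0; rewrite (ord3_sum _ 0) -!addrA => pu.
    rewrite pu ?mul1r//; clear pu.
    - move=> i i' ii hi; apply: (@le_trans _ _ e1); first lra.
      by apply: (away1 k x cx pn0 i i' ii); lra.
    - move=> j hj.
      have h1 : e1 <= bary p (j + 1) x by apply: (away1 k x cx pn0 j) => //; [rewrite eq_sym ord3_neq1|lra].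
      have h2 : e1 <= bary p (j + 2) x by apply: (away1 k x cx pn0 j) => //; [rewrite eq_sym ord3_neq2|lra].
      move: h1 h2; rewrite bary1_tang// bary2_tang//.
      have [/ler_normlP[t1 t2] /ler_normlP[t3 t4]] := tC j.
      have bp := x0 j.
      move=> h1 h2; split.
        have : - (C * (2 * e)) <= bary p j x * tang p j (p j) by nra.
        by lra.
      have : - (C * (2 * e)) <= bary p j x * (1 - tang p j (p j)) by nra.
      by lra.
  rewrite (FD k _ _ (sib k) (smoothD (ssb _ k) (smoothD (ssb _ k) (ssb _ k)))).
  rewrite {1}/F (inner0 k _ (wk k) (inner_test k)) add0r.
  rewrite (FD k _ _ (ssb _ k) (smoothD (ssb _ k) (ssb _ k))) (FD k _ _ (ssb _ k) (ssb _ k)).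
  by rewrite (ord3_sum _ 0) addrA.
transitivity (\sum_k \sum_j F k (side_bump e d j * (phi \o tau k))).
  by apply: eq_bigr => k _; exact: split_flux.
rewrite exchange_big big1//= => j _; apply: (@sum_antisymmetric _ j) => k.
have [jk|jk] := eqVneq (s j k) k.
  rewrite jk; suff -> : F k (side_bump e d j * (phi \o tau k)) = 0 by rewrite oppr0.
  apply: (flux0 ndg) => x Tx; rewrite (_ : (_ * _) x = side_bump e d j x * phi (tau k x))//.
  have [p0|pn0] := eqVneq (phi (tau k x)) 0; first by rewrite p0 mulr0.
  have h : e2 <= bary p j x := away2 k j jk x (subset_closure Tx) pn0.
  have [->|/(side_bump_strip e0 d0)[h' _]] := eqVneq (side_bump e d j x) 0; first by rewrite mul0r.
  have h2 : bary p j x <= 2 * e := le_trans (ler_norm _) h'.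
  by exfalso; lra.
pose psi := side_bump e d j * (phi \o tau k).
have psiE : side_bump e d j * (phi \o tau (s j k)) = psi \o rho p j.
  rewrite (tau_neighbour ndg gE utau jk); apply/funext => x.
  rewrite (_ : (_ * _) x = side_bump e d j x * phi (tau k (rho p j x)))//.
  rewrite (_ : (psi \o _) x = side_bump e d j (rho p j x) * phi (tau k (rho p j x)))//.
  by rewrite side_bump_rho.
have wE : wk (s j k) = linear_part (rho p j) (wk k).
  have rr := rho_isometry ndg j.
  have wE : w = linear_part (tau (s j k)) (linear_part (rho p j) (wk k)).
    rewrite -linear_part_comp//.
    rewrite (_ : tau (s j k) \o rho p j = tau k) ?linear_partKV//.
    by apply/funext => x /=; rewrite (tau_neighbour ndg gE utau jk)/= rhoK.
  by rewrite {1}/wk [in LHS]wE linear_partK.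
rewrite psiE {1}/F wE.
rewrite (flux_reflection ndg (L1on_tile _ hu) (L1field_tile _ hg1 hg2)); [|by move=> ? ?; exact: inner0|exact: bump_test].
by rewrite -(sides k j psi (wk k) jk (bump_test k j)).
Qed.

End SobolevTiles.

(** * Square integrable classes *)

Section SquareIntegrable.
Context {R : realType}.
Variable D : domain R.
Local Notation C := R[i].
Local Notation muD := (lebesgue_on D).
Local Notation L2r := (Lfun muD 2%:E).
Implicit Types (f g h : plane R -> R) (u v w : L2 D).

Lemma Lfun2P f : f \in L2r <->
  measurable_fun [set: mplane R] (f : mplane R -> R) /\
  muD.-integrable setT (fun x : mplane R => (f x ^+ 2)%:E).
Proof.
split=> [hf|[mf sf]].
  split; last exact: Lfun2_integrable_sqr.
  by move/sub_Lfun_mfun: hf; rewrite inE.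
rewrite inE; apply/andP; split; first by rewrite inE; exact: mf.
rewrite inE /finite_norm unlock /= poweR_lty//.
move/integrableP: sf => [_]; apply: le_lt_trans.
rewrite le_eqVlt; apply/orP; left; apply/eqP; apply: eq_integral => x _ /=.
by rewrite powR_mulrn// real_normK ?num_real// ger0_norm ?sqr_ge0.
Qed.

Lemma Lfun2_measurable f : f \in L2r -> measurable_fun [set: mplane R] (f : mplane R -> R).
Proof. by move/Lfun2P => []. Qed.

Lemma Lfun2_mul f g : f \in L2r -> g \in L2r ->
  muD.-integrable setT (fun x : mplane R => (f x * g x)%:E).
Proof. move=> hf hg; have := Lfun2_mul_Lfun1 hf hg; move/Lfun1_integrable => h; exact: h. Qed.

Definition rpair f g := \int[muD]_x (f x * g x).

Lemma rpairC f g : rpair f g = rpair g f.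
Proof. by apply: eq_Rintegral => x _; rewrite mulrC. Qed.

Lemma rpairDl f g h : f \in L2r -> g \in L2r -> h \in L2r ->
  rpair (fun x => f x + g x) h = rpair f h + rpair g h.
Proof.
move=> hf hg hh; rewrite /rpair -RintegralD//; [|exact: Lfun2_mul|exact: Lfun2_mul].
by apply: eq_Rintegral => x _; rewrite mulrDl.
Qed.

Lemma rpairZl (a : R) f h : f \in L2r -> h \in L2r -> rpair (fun x => a * f x) h = a * rpair f h.
Proof.
move=> hf hh; rewrite /rpair -RintegralZl//; last exact: Lfun2_mul.
by apply: eq_Rintegral => x _; rewrite mulrA.
Qed.

Lemma ae_integral f g : measurable_fun [set: mplane R] (f : mplane R -> R) ->
  measurable_fun [set: mplane R] (g : mplane R -> R) ->
  {ae muD, forall x, f x = g x} -> \int[muD]_x f x = \int[muD]_x g x.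
Proof.
move=> mf mg fg; rewrite /Rintegral; congr fine; apply: ae_eq_integral => //.
- exact/measurable_EFinP.
- exact/measurable_EFinP.
- have FL := ae_filter_ringOfSetsType muD.
  by apply: filterS fg => x fgx _; congr EFin.
Qed.

Lemma rpair_ae f f' g : f \in L2r -> f' \in L2r -> g \in L2r ->
  {ae muD, forall x, f x = f' x} -> rpair f g = rpair f' g.
Proof.
move=> hf hf' hg ff; apply: ae_integral.
- by apply: measurable_funM; exact: Lfun2_measurable.
- by apply: measurable_funM; exact: Lfun2_measurable.
- have FL := ae_filter_ringOfSetsType muD.
  by apply: filterS ff => x ->.
Qed.

Lemma rpair_ge0 f : 0 <= rpair f f.
Proof. by apply: Rintegral_ge0 => x _; rewrite -expr2 sqr_ge0. Qed.

Lemma rpair_eq0 f : f \in L2r -> rpair f f = 0 -> {ae muD, forall x, f x = 0}.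
Proof.
move=> hf h0; have mf := Lfun2_measurable hf.
have iff := Lfun2_mul hf hf.
have : (\int[muD]_x `|(f x * f x)%:E| = 0)%E.
  rewrite -[RHS]/(0%:E) -h0 /rpair /Rintegral fineK; last exact: integrable_fin_num.
  by apply: eq_integral => x _ /=; rewrite ger0_norm// -expr2 sqr_ge0.
move/(ae_eq_integral_abs _ measurableT) => h.
have {h} := h ltac:(by apply/measurable_EFinP; exact: measurable_funM).
have FL := ae_filter_ringOfSetsType muD.
by apply: filterS => x /(_ I)/= [/eqP]; rewrite mulf_eq0 orbb => /eqP.
Qed.

Lemma sqintP (f : plane R -> C) : f \in sqint_pred D <->
  (@complex.Re R \o f) \in L2r /\ (@complex.Im R \o f) \in L2r.
Proof. by split=> [/andP[]|[h1 h2]]; [|apply/andP]. Qed.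

Lemma L2_Re u : (fun x => complex.Re (u x)) \in L2r.
Proof. by have /sqintP[] := valP (repr u). Qed.

Lemma L2_Im u : (fun x => complex.Im (u x)) \in L2r.
Proof. by have /sqintP[] := valP (repr u). Qed.

Definition toL2 (f : plane R -> C) : L2 D :=
  if pselect (f \in sqint_pred D) is left h then \pi_(L2 D)%qT (Sqint h) else 0.

(** [repr] picks some representative of the class, known only up to null sets: every pointwise
    identity for elements of [L2] is an almost everywhere statement. *)
Lemma L2_pi (f : sqint D) : {ae muD, forall x, L2_fun (\pi_(L2 D)%qT f) x = f x}.
Proof.
have : repr (\pi_(L2 D)%qT f) - f \in @null_pred R D by rewrite Quotient.idealrBE reprK.
move/asboolP; have FL := ae_filter_ringOfSetsType muD.
apply: filterS => x /= h; apply/eqP; rewrite -subr_eq0; apply/eqP; exact: h.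
Qed.

Lemma toL2E (f : plane R -> C) : f \in sqint_pred D -> {ae muD, forall x, toL2 f x = f x}.
Proof. by rewrite /toL2; case: pselect => // h _; exact: L2_pi. Qed.

Lemma L2P u v : u = v <-> {ae muD, forall x, u x = v x}.
Proof.
have FL := ae_filter_ringOfSetsType muD.
split=> [->|uv]; first exact: aeW.
rewrite -[u]reprK -[v]reprK; apply/eqP; rewrite -Quotient.idealrBE; apply/asboolP.
by apply: filterS uv => x uvx; apply/eqP; rewrite subr_eq0; apply/eqP; exact: uvx.
Qed.

Lemma L2_addE u v : {ae muD, forall x, L2_fun (u + v) x = u x + v x}.
Proof.
have -> : u + v = \pi_(L2 D)%qT (repr u + repr v).
  by rewrite -{1}[u]reprK -{1}[v]reprK -[LHS]pi_addr.
exact: (L2_pi (repr u + repr v)).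
Qed.

Lemma L2_scaleE (a : C) u : {ae muD, forall x, L2_fun (a *: u) x = a * u x}.
Proof. exact: (L2_pi (a *: repr u)). Qed.

Lemma Re_mulc (a b : C) : complex.Re (a * b) = complex.Re a * complex.Re b - complex.Im a * complex.Im b.
Proof. by case: a; case: b. Qed.

Lemma Im_mulc (a b : C) : complex.Im (a * b) = complex.Re a * complex.Im b + complex.Im a * complex.Re b.
Proof. by case: a; case: b. Qed.

Lemma ReDc (a b : C) : complex.Re (a + b) = complex.Re a + complex.Re b.
Proof. by case: a; case: b. Qed.

Lemma ImDc (a b : C) : complex.Im (a + b) = complex.Im a + complex.Im b.
Proof. by case: a; case: b. Qed.

Lemma Re_conjc (a : C) : complex.Re (a^*) = complex.Re a.
Proof. by case: a. Qed.

Lemma Im_conjc (a : C) : complex.Im (a^*) = - complex.Im a.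
Proof. by case: a. Qed.

Lemma complexP (a b : C) : complex.Re a = complex.Re b -> complex.Im a = complex.Im b -> a = b.
Proof. by case: a b => [a1 a2] [b1 b2] /= -> ->. Qed.

Lemma Re_inner u v : complex.Re (inner u v) =
  rpair (fun x => complex.Re (u x)) (fun x => complex.Re (v x)) +
  rpair (fun x => complex.Im (u x)) (fun x => complex.Im (v x)).
Proof.
rewrite /inner /cintegral [LHS]/= /rpair -RintegralD//;
  [|exact: (Lfun2_mul (L2_Re u) (L2_Re v))|exact: (Lfun2_mul (L2_Im u) (L2_Im v))].
by apply: eq_Rintegral => x _; rewrite Re_mulc Re_conjc Im_conjc mulrN opprK.
Qed.

Lemma Im_inner u v : complex.Im (inner u v) =
  rpair (fun x => complex.Im (u x)) (fun x => complex.Re (v x)) -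
  rpair (fun x => complex.Re (u x)) (fun x => complex.Im (v x)).
Proof.
rewrite /inner /cintegral [LHS]/= /rpair -RintegralB//;
  [|exact: (Lfun2_mul (L2_Im u) (L2_Re v))|exact: (Lfun2_mul (L2_Re u) (L2_Im v))].
by apply: eq_Rintegral => x _; rewrite Im_mulc Re_conjc Im_conjc mulrN addrC.
Qed.

Lemma Lfun2D f g : f \in L2r -> g \in L2r -> (fun x => f x + g x) \in L2r.
Proof. by move=> hf hg; have [_ LD] := @Lfun_submod_closed _ _ R muD 2%:E (lee1n 2);
  have := LD 1 f g hf hg; rewrite scale1r. Qed.

Lemma Lfun2Z a f : f \in L2r -> (fun x => a * f x) \in L2r.
Proof.
by move=> hf; have [L0 LD] := @Lfun_submod_closed _ _ R muD 2%:E (lee1n 2);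
  have := LD a f 0 hf L0; rewrite addr0.
Qed.

Lemma ReD_ae u v : {ae muD, forall x, complex.Re (L2_fun (u + v) x) = complex.Re (u x) + complex.Re (v x)}.
Proof.
by have FL := ae_filter_ringOfSetsType muD; apply: filterS (L2_addE u v) => x ->; exact: ReDc.
Qed.

Lemma ImD_ae u v : {ae muD, forall x, complex.Im (L2_fun (u + v) x) = complex.Im (u x) + complex.Im (v x)}.
Proof.
by have FL := ae_filter_ringOfSetsType muD; apply: filterS (L2_addE u v) => x ->; exact: ImDc.
Qed.

Lemma ReZ_ae (a : C) u : {ae muD, forall x, complex.Re (L2_fun (a *: u) x) =
  complex.Re a * complex.Re (u x) + (- complex.Im a) * complex.Im (u x)}.
Proof.
by have FL := ae_filter_ringOfSetsType muD; apply: filterS (L2_scaleE a u) => x ->; rewrite Re_mulc mulNr.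
Qed.

Lemma ImZ_ae (a : C) u : {ae muD, forall x, complex.Im (L2_fun (a *: u) x) =
  complex.Re a * complex.Im (u x) + complex.Im a * complex.Re (u x)}.
Proof.
by have FL := ae_filter_ringOfSetsType muD; apply: filterS (L2_scaleE a u) => x ->; rewrite Im_mulc.
Qed.

Lemma rpair_ReD u v h : h \in L2r -> rpair (fun x => complex.Re (L2_fun (u + v) x)) h =
  rpair (fun x => complex.Re (u x)) h + rpair (fun x => complex.Re (v x)) h.
Proof.
move=> hh; rewrite -(rpairDl (L2_Re u) (L2_Re v) hh).
exact: (rpair_ae (L2_Re _) (Lfun2D (L2_Re _) (L2_Re _)) hh (ReD_ae u v)).
Qed.

Lemma rpair_ImD u v h : h \in L2r -> rpair (fun x => complex.Im (L2_fun (u + v) x)) h =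
  rpair (fun x => complex.Im (u x)) h + rpair (fun x => complex.Im (v x)) h.
Proof.
move=> hh; rewrite -(rpairDl (L2_Im u) (L2_Im v) hh).
exact: (rpair_ae (L2_Im _) (Lfun2D (L2_Im _) (L2_Im _)) hh (ImD_ae u v)).
Qed.

Lemma rpair_ReZ a u h : h \in L2r -> rpair (fun x => complex.Re (L2_fun (a *: u) x)) h =
  complex.Re a * rpair (fun x => complex.Re (u x)) h - complex.Im a * rpair (fun x => complex.Im (u x)) h.
Proof.
move=> hh; rewrite -mulNr -(rpairZl _ (L2_Re u) hh) -(rpairZl _ (L2_Im u) hh).
rewrite -(rpairDl (Lfun2Z _ (L2_Re u)) (Lfun2Z _ (L2_Im u)) hh).
exact: (rpair_ae (L2_Re _) (Lfun2D (Lfun2Z _ (L2_Re _)) (Lfun2Z _ (L2_Im _))) hh (ReZ_ae a u)).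
Qed.

Lemma rpair_ImZ a u h : h \in L2r -> rpair (fun x => complex.Im (L2_fun (a *: u) x)) h =
  complex.Re a * rpair (fun x => complex.Im (u x)) h + complex.Im a * rpair (fun x => complex.Re (u x)) h.
Proof.
move=> hh; rewrite -(rpairZl _ (L2_Re u) hh) -(rpairZl _ (L2_Im u) hh).
rewrite -(rpairDl (Lfun2Z _ (L2_Im u)) (Lfun2Z _ (L2_Re u)) hh).
exact: (rpair_ae (L2_Im _) (Lfun2D (Lfun2Z _ (L2_Im _)) (Lfun2Z _ (L2_Re _))) hh (ImZ_ae a u)).
Qed.

Lemma innerDl u v w : inner (u + v) w = inner u w + inner v w.
Proof.
apply: complexP; rewrite ?ReDc ?ImDc ?Re_inner ?Im_inner !(rpair_ReD _ _ (L2_Re w), rpair_ReD _ _ (L2_Im w),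
  rpair_ImD _ _ (L2_Re w), rpair_ImD _ _ (L2_Im w)); ring.
Qed.

Lemma innerZl a u w : inner (a *: u) w = a * inner u w.
Proof.
apply: complexP; rewrite ?Re_mulc ?Im_mulc ?Re_inner ?Im_inner !(rpair_ReZ _ _ (L2_Re w), rpair_ReZ _ _ (L2_Im w),
  rpair_ImZ _ _ (L2_Re w), rpair_ImZ _ _ (L2_Im w)); ring.
Qed.

Lemma inner_conj u v : inner v u = (inner u v)^*.
Proof.
apply: complexP; rewrite ?Re_conjc ?Im_conjc ?Re_inner ?Im_inner.
  by rewrite rpairC [X in _ + X]rpairC.
by rewrite opprB rpairC [X in _ - X]rpairC.
Qed.

Lemma inner_real u : complex.Im (inner u u) = 0.
Proof. by rewrite Im_inner rpairC subrr. Qed.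

Lemma inner_ge0 u : 0 <= complex.Re (inner u u).
Proof. by rewrite Re_inner addr_ge0// rpair_ge0. Qed.

Lemma inner_eq0 u : complex.Re (inner u u) = 0 -> u = 0.
Proof.
rewrite Re_inner => /eqP; rewrite paddr_eq0 ?rpair_ge0// => /andP[/eqP h1 /eqP h2].
have FL := ae_filter_ringOfSetsType muD.
apply/L2P; have := L2_scaleE 0 u; rewrite scale0r.
apply: filterS3 (rpair_eq0 (L2_Re u) h1) (rpair_eq0 (L2_Im u) h2) => x e1 e2 ->.
by rewrite mul0r; apply: complexP.
Qed.

End SquareIntegrable.

Section InnerProduct.
Context {R : realType} {D : domain R}.
Local Notation C := R[i].
Implicit Types (u v w : L2 D).

Lemma innerDr u v w : inner w (u + v) = inner w u + inner w v.
Proof. by rewrite inner_conj innerDl rmorphD /= -!inner_conj. Qed.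

Lemma innerZr (a : C) u w : inner w (a *: u) = a^* * inner w u.
Proof. by rewrite inner_conj innerZl rmorphM /= -inner_conj. Qed.

Lemma inner0l w : inner 0 w = 0.
Proof. by rewrite -(scale0r (0 : L2 D)) innerZl mul0r. Qed.

Lemma inner0r w : inner w 0 = 0.
Proof. by rewrite inner_conj inner0l; apply: complexP => /=; rewrite ?oppr0. Qed.

Lemma innerNl u w : inner (- u) w = - inner u w.
Proof. by rewrite -scaleN1r innerZl mulN1r. Qed.

Lemma innerNr u w : inner w (- u) = - inner w u.
Proof. by rewrite inner_conj innerNl rmorphN /= -inner_conj. Qed.

Lemma inner_suml (I : Type) (r : seq I) (F : I -> L2 D) w :
  inner (\sum_(i <- r) F i) w = \sum_(i <- r) inner (F i) w.
Proof. by elim/big_ind2: _ => [|? ? ? ? <- <-|//]; [exact: inner0l|rewrite innerDl]. Qed.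

(** A real scalar product with the same norm, which suffices for Cauchy-Schwarz, the triangle
    inequality and dissipativity. *)
Definition rinner u v : R := complex.Re (inner u v).

Lemma rinnerC u v : rinner u v = rinner v u.
Proof. by rewrite /rinner (inner_conj v u) Re_conjc. Qed.

Lemma rinnerDl u v w : rinner (u + v) w = rinner u w + rinner v w.
Proof. by rewrite /rinner innerDl ReDc. Qed.

Lemma rinnerDr u v w : rinner w (u + v) = rinner w u + rinner w v.
Proof. by rewrite !(rinnerC w) rinnerDl. Qed.

Lemma rinnerNl u w : rinner (- u) w = - rinner u w.
Proof. by rewrite /rinner innerNl; case: inner. Qed.

Lemma rinnerNr u w : rinner w (- u) = - rinner w u.
Proof. by rewrite !(rinnerC w) rinnerNl. Qed.

Lemma rinnerZl (a : R) u w : rinner (a%:C *: u) w = a * rinner u w.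
Proof. by rewrite /rinner innerZl Re_mulc /= mul0r subr0. Qed.

Lemma rinnerZr (a : R) u w : rinner w (a%:C *: u) = a * rinner w u.
Proof. by rewrite !(rinnerC w) rinnerZl. Qed.

Lemma rinner_ge0 u : 0 <= rinner u u. Proof. exact: inner_ge0. Qed.

Lemma L2norm_ge0 u : 0 <= L2norm u. Proof. exact: sqrtr_ge0. Qed.

Lemma L2norm_sqr u : L2norm u ^+ 2 = rinner u u.
Proof. by rewrite sqr_sqrtr// inner_ge0. Qed.

Lemma L2norm_eq0 u : L2norm u = 0 -> u = 0.
Proof. by move=> h; apply: inner_eq0; rewrite -/(rinner u u) -L2norm_sqr h expr0n. Qed.

Lemma L2norm0 : L2norm (0 : L2 D) = 0.
Proof. by rewrite /L2norm inner0l sqrtr0. Qed.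

Lemma rinner_le u v : `|rinner u v| <= L2norm u * L2norm v.
Proof.
rewrite -(@ler_pXn2r _ 2)// ?nnegrE ?mulr_ge0 ?L2norm_ge0//.
rewrite real_normK ?num_real// exprMn !L2norm_sqr.
have [v0|vn0] := eqVneq (rinner v v) 0.
  by rewrite (inner_eq0 v0) /rinner !inner0r /= expr0n/= mulr0.
have v0 : 0 < rinner v v by rewrite lt_def vn0 rinner_ge0.
(* The component of [u] orthogonal to [v], scaled by [rinner v v] to avoid a division. *)
have := rinner_ge0 ((rinner v v)%:C *: u - (rinner u v)%:C *: v).
rewrite !(rinnerDl, rinnerDr, rinnerNl, rinnerNr, rinnerZl, rinnerZr) (rinnerC v u).
rewrite (_ : _ + _ = rinner v v * (rinner u u * rinner v v - rinner u v ^+ 2)); last by ring.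
by rewrite pmulr_rge0// subr_ge0.
Qed.

Lemma L2normD u v : L2norm (u + v) <= L2norm u + L2norm v.
Proof.
rewrite -(@ler_pXn2r _ 2)// ?nnegrE ?addr_ge0 ?L2norm_ge0//.
rewrite sqrrD !L2norm_sqr rinnerDl !rinnerDr (rinnerC v u).
have := rinner_le u v; rewrite ler_norml => /andP[_ h].
by rewrite mulr2n; lra.
Qed.

Lemma normcE (a : C) : complex.Re a ^+ 2 + complex.Im a ^+ 2 = complex.Re (a * a^*).
Proof. by case: a => a b /=; rewrite mulrN opprK !expr2. Qed.

Lemma L2normZ (a : C) u : L2norm (a *: u) = Num.sqrt (complex.Re a ^+ 2 + complex.Im a ^+ 2) * L2norm u.
Proof.
rewrite /L2norm innerZl innerZr mulrA -sqrtrM; last by rewrite addr_ge0 ?sqr_ge0.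
congr Num.sqrt; rewrite normcE [in LHS]Re_mulc inner_real mulr0 subr0//.
Qed.

Lemma L2normZr (a : R) u : L2norm (a%:C *: u) = `|a| * L2norm u.
Proof. by rewrite L2normZ /= expr0n addr0 sqrtr_sqr. Qed.

Lemma L2normN u : L2norm (- u) = L2norm u.
Proof. by rewrite /L2norm innerNl innerNr opprK. Qed.

Lemma L2norm_distC u v : L2norm (u - v) = L2norm (v - u).
Proof. by rewrite -L2normN opprB. Qed.

Lemma L2norm_sum (I : Type) (r : seq I) (F : I -> L2 D) :
  L2norm (\sum_(i <- r) F i) <= \sum_(i <- r) L2norm (F i).
Proof.
elim/big_ind2: _ => [|x a y b h1 h2|//]; first by rewrite L2norm0.
by rewrite (le_trans (L2normD _ _))// lerD.
Qed.

End InnerProduct.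

(** * Restriction to the tiles *)

Section Restriction.
Context {R : realType}.
Variable D : domain R.
Local Notation mu2 := (@lebesgue2 R).
Local Notation muD := (lebesgue_on D).

Lemma lebesgue_onE (A : set (mplane R)) : muD A = mu2 (A `&` D).
Proof. by []. Qed.

Lemma Rintegral_lebesgue_on f : measurable_fun [set: mplane R] (f : mplane R -> R) ->
  \int[muD]_x f x = \int[mu2]_(x in D) f x.
Proof. by move=> mf; rewrite /Rintegral integral_mrestr//; exact/measurable_EFinP. Qed.

Lemma L1on_lebesgue_on (f : plane R -> R) : measurable_fun [set: mplane R] (f : mplane R -> R) ->
  muD.-integrable setT (EFin \o (f : mplane R -> R)) <-> L1on D f.
Proof.
move=> mf; have mE : measurable_fun setT (EFin \o (f : mplane R -> R)) by exact/measurable_EFinP.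
split=> [/(integrable_mrestr mu2 (open_measurable2 (domain_open D)) mE) h|[_ h]]; last exact/(integrable_mrestr mu2 (open_measurable2 (domain_open D)) mE).
by split.
Qed.

Lemma Lfun2_L1on (f : plane R -> R) : f \in Lfun muD 2%:E <->
  measurable_fun [set: mplane R] (f : mplane R -> R) /\ L1on D (fun x => f x ^+ 2).
Proof.
split=> [/Lfun2P[mf sf]|[mf sf]]; [split=> //|apply/Lfun2P; split=> //].
- by apply/L1on_lebesgue_on => //; exact: measurable_funX.
- by apply/L1on_lebesgue_on => //; exact: measurable_funX.
Qed.

Lemma ae_lebesgue_on : {ae muD, forall x, (D : set _) x}.
Proof.
have mD := open_measurable2 (domain_open D).
exists (~` (D : set (mplane R))); split => //; first exact: measurableC.
by rewrite lebesgue_onE setICl measure0.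
Qed.

End Restriction.

Section Pullback.
Context {R : realType}.
Variable p : 'I_3 -> plane R.
Hypothesis ndg : nondegenerate_triangle p.

Definition triangle_domain : domain R := Domain (open_triangle_open ndg).

Variables (E : pattern) (tau : 'I_7 -> plane R -> plane R).
Hypothesis gE : good_pattern E.
Hypothesis utau : unfolding p E tau.
Hypothesis adm : admissible p tau E.
Local Notation C := R[i].
Local Notation T := (open_triangle p).
Local Notation Td := triangle_domain.
Local Notation Omega := (glued p tau).
Local Notation mu2 := (@lebesgue2 R).
Implicit Types (k l : 'I_7) (u v : L2 Omega) (U : 'I_7 -> L2 Td) (f g : plane R -> R).

Let ti := tau_isometry ndg gE utau.
Let mT := triangle_measurable ndg.
Let mO := glued_measurable p tau.
Let dis : trivIset setT (tile p tau). Proof. by case: adm. Qed.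

Lemma pull_ae k (P : plane R -> Prop) : {ae lebesgue_on Omega, forall x, P x} ->
  {ae lebesgue_on Td, forall x, P (tau k x)}.
Proof.
move=> [N [mN N0 PN]]; have [mt t2] := isometry_measure_preserving (ti k).
exists (tau k @^-1` N); split.
- by rewrite -[X in measurable X]setTI; exact: mt.
- rewrite lebesgue_onE in N0; rewrite lebesgue_onE.
  have -> : (tau k @^-1` N `&` Td) = tau k @^-1` (N `&` tile p tau k).
    by rewrite preimage_setI -(tile_preimage ndg gE utau).
  have mI : measurable (N `&` tile p tau k : set (mplane R)).
    by apply: measurableI => //; exact: (tile_measurable ndg gE utau).
  rewrite t2//; apply/eqP; rewrite -measure_le0 -N0 le_measure ?inE//.
    by apply: measurableI => //.
  by apply: setIS; exact: (tile_sub ndg gE utau).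
- by move=> x /= h; apply: PN.
Qed.

Lemma Lfun2_pull k f : f \in Lfun (lebesgue_on Omega) 2%:E -> (f \o tau k) \in Lfun (lebesgue_on Td) 2%:E.
Proof.
move=> /Lfun2_L1on[mf sf]; apply/Lfun2_L1on; split; last exact: (L1on_tile ndg gE utau k sf).
by apply: measurableT_comp => //; exact: isometry_measurable.
Qed.

Definition pull k u : L2 Td := toL2 Td (u \o tau k).

Lemma sqint_pull k u : (u \o tau k) \in sqint_pred Td.
Proof. by apply/sqintP; split; [exact: (Lfun2_pull k (L2_Re u))|exact: (Lfun2_pull k (L2_Im u))]. Qed.

Lemma pullE k u : {ae lebesgue_on Td, forall x, pull k u x = u (tau k x)}.
Proof. exact: (toL2E (sqint_pull k u)). Qed.

Lemma pullD k u v : pull k (u + v) = pull k u + pull k v.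
Proof.
have FL := ae_filter_ringOfSetsType (lebesgue_on Td).
apply/L2P.
have := pull_ae k (L2_addE u v); have := pullE k (u + v); have := L2_addE (pull k u) (pull k v).
have := pullE k u; have := pullE k v => e1 e2 e3 e4 e5.
by apply: filterS3 e1 (filterI e2 e3) (filterI e4 e5) => x h1 [h2 h3] [h4 h5]; rewrite h3 h4 h5 h1 h2.
Qed.
Lemma pullZ k (a : C) u : pull k (a *: u) = a *: pull k u.
Proof.
have FL := ae_filter_ringOfSetsType (lebesgue_on Td).
apply/L2P; apply: filterS3 (filterI (pullE k u) (pullE k (a *: u))) (L2_scaleE a (pull k u)) (pull_ae k (L2_scaleE a u)).
by move=> x [h1 h2] h3 h4; rewrite h2 h3 h4 h1.
Qed.

Lemma rpair_pull f g : f \in Lfun (lebesgue_on Omega) 2%:E -> g \in Lfun (lebesgue_on Omega) 2%:E ->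
  rpair Omega f g = \sum_k rpair Td (f \o tau k) (g \o tau k).
Proof.
move=> hf hg; have mfg : measurable_fun [set: mplane R] (fun x : mplane R => f x * g x).
  by apply: measurable_funM; [exact: (Lfun2_measurable hf)|exact: (Lfun2_measurable hg)].
have mfgk k : measurable_fun [set: mplane R] (fun x : mplane R => f (tau k x) * g (tau k x)).
  by apply: (measurableT_comp mfg); exact: isometry_measurable.
rewrite /rpair (Rintegral_lebesgue_on Omega mfg) /Rintegral (integral_tiles ndg gE utau dis mfg) -sum_fine.
  by apply: eq_bigr => k _; rewrite integral_mrestr//; apply/measurable_EFinP; exact: mfgk.
move=> k _; apply: integrable_fin_num => //.
have /(L1on_lebesgue_on Td (mfgk k))[_] := Lfun2_mul (Lfun2_pull k hf) (Lfun2_pull k hg).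
exact.
Qed.

(** [P] and [Q] stand for real and imaginary parts, so that one lemma serves all four pairings in
    [inner]. *)
Lemma rpair_pullP (P Q : C -> R) u v :
  (forall (D : domain R) (u : L2 D), (fun x => P (u x)) \in Lfun (lebesgue_on D) 2%:E) ->
  (forall (D : domain R) (u : L2 D), (fun x => Q (u x)) \in Lfun (lebesgue_on D) 2%:E) ->
  rpair Omega (fun x => P (u x)) (fun x => Q (v x)) =
  \sum_k rpair Td (fun x => P (pull k u x)) (fun x => Q (pull k v x)).
Proof.
move=> hP hQ; rewrite rpair_pull//; apply: eq_bigr => k _.
have FL := ae_filter_ringOfSetsType (lebesgue_on Td).
rewrite -(rpair_ae (f := fun x => P (pull k u x)) (f' := (fun x => P (u x)) \o tau k)).
- rewrite rpairC [RHS]rpairC; apply/esym/rpair_ae => //.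
  + exact: (Lfun2_pull k (hQ _ v)).
  + by apply: filterS (pullE k v) => x ->.
- exact: hP.
- exact: (Lfun2_pull k (hP _ u)).
- exact: (Lfun2_pull k (hQ _ v)).
- by apply: filterS (pullE k u) => x ->.
Qed.

Lemma inner_pull u v : inner u v = \sum_k inner (pull k u) (pull k v).
Proof.
have sRe (F : 'I_7 -> C) : complex.Re (\sum_k F k) = \sum_k complex.Re (F k).
  by apply: (big_morph (@complex.Re R)) => // a b; exact: ReDc.
have sIm (F : 'I_7 -> C) : complex.Im (\sum_k F k) = \sum_k complex.Im (F k).
  by apply: (big_morph (@complex.Im R)) => // a b; exact: ImDc.
apply: complexP; rewrite ?sRe ?sIm.
  have e1 := @rpair_pullP (@complex.Re R) (@complex.Re R) u v (@L2_Re R) (@L2_Re R).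
  have e2 := @rpair_pullP (@complex.Im R) (@complex.Im R) u v (@L2_Im R) (@L2_Im R).
  apply: (etrans (Re_inner u v)); apply: (etrans (congr2 +%R e1 e2)).
  rewrite (eq_bigr _ (fun k _ => Re_inner (pull k u) (pull k v))).
  by rewrite big_split.
have e1 := @rpair_pullP (@complex.Re R) (@complex.Im R) u v (@L2_Re R) (@L2_Im R).
have e2 := @rpair_pullP (@complex.Im R) (@complex.Re R) u v (@L2_Im R) (@L2_Re R).
apply: (etrans (Im_inner u v)); apply: (etrans (congr2 (fun x y => x - y) e2 e1)).
rewrite (eq_bigr _ (fun k _ => Im_inner (pull k u) (pull k v))).
by rewrite sumrB.
Qed.

Lemma pullN k u : pull k (- u) = - pull k u.
Proof. by rewrite -scaleN1r pullZ scaleN1r. Qed.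

Lemma pull_inj u v : (forall k, pull k u = pull k v) -> u = v.
Proof.
move=> h; apply/eqP; rewrite -subr_eq0; apply/eqP/inner_eq0; rewrite inner_pull big1// => k _.
by rewrite pullD pullN h subrr inner0l.
Qed.

Lemma sqint_glue_term k f : f \in Lfun (lebesgue_on Td) 2%:E ->
  (fun y => \1_(tile p tau k : set (mplane R)) y * f (iso_inv (tau k) y)) \in Lfun (lebesgue_on Omega) 2%:E.
Proof.
move=> /Lfun2_L1on[mf [_ sf]]; have [ig fg gf] := iso_invP (ti k).
have mtk := tile_measurable ndg gE utau k.
have mF : measurable_fun [set: mplane R] (fun y : mplane R => \1_(tile p tau k : set (mplane R)) y * f (iso_inv (tau k) y)).
  apply: measurable_funM; first exact: measurable_indic.
  by apply: measurableT_comp => //; exact: isometry_measurable.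
apply/Lfun2_L1on; split=> //.
have mF2 := measurable_funX 2 mF.
split=> //; apply/integrableP; split; first by apply/measurable_EFinP; exact: measurable_funTS.
under eq_integral => x _.
  rewrite (_ : `| _ |%E = ((\1_(tile p tau k : set (mplane R)) x * f (iso_inv (tau k) x)) ^+ 2)%:E)%E; last first.
    by rewrite /= ger0_norm ?sqr_ge0.
over.
rewrite (integral_tiles ndg gE utau dis mF2) (bigD1 k)//= big1 ?adde0 => [|l lk]; last first.
  apply: integral0_eq => x Tx; rewrite indicE; case: (boolP (_ \in _)); rewrite ?mul0r ?expr0n//.
  rewrite inE => -[y Ty yx]; by move: lk; rewrite (tiles_disjoint adm Ty Tx yx) eqxx.
rewrite (eq_integral (fun x : mplane R => (f x ^+ 2)%:E)) => [|x]; last first.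
  by rewrite inE => Tx; rewrite indicE mem_set ?mul1r ?fg//; exists x.
by move/integrableP: sf => [_]; under eq_integral => x _ do rewrite /= ger0_norm ?sqr_ge0//.
Qed.

(** Points on the sides of the tiles get the value 0, which is immaterial in [L2]. *)
Definition glue_fun U y : C :=
  \sum_k (\1_(tile p tau k : set (mplane R)) y)%:C * U k (iso_inv (tau k) y).

Definition glue U : L2 Omega := toL2 Omega (glue_fun U).

Lemma sqint_glue U : glue_fun U \in sqint_pred Omega.
Proof.
have sum2 (F : 'I_7 -> plane R -> R) : (forall k, F k \in Lfun (lebesgue_on Omega) 2%:E) ->
    (fun y => \sum_k F k y) \in Lfun (lebesgue_on Omega) 2%:E.
  move=> hF; suff H (r : seq 'I_7) : (fun y => \sum_(k <- r) F k y) \in Lfun (lebesgue_on Omega) 2%:E by exact: H.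
  elim: r => [|k r ih].
    under eq_fun do rewrite big_nil.
    by have [L0 _] := @Lfun_submod_closed _ _ R (lebesgue_on Omega) 2%:E (lee1n 2).
  by under eq_fun do rewrite big_cons; exact: (Lfun2D (hF k) ih).
apply/sqintP; split.
  rewrite (_ : _ \o _ = fun y => \sum_k \1_(tile p tau k : set (mplane R)) y * complex.Re (U k (iso_inv (tau k) y))).
    by apply: sum2 => k; exact: (sqint_glue_term k (L2_Re (U k))).
  apply/funext => y /=; rewrite /glue_fun (big_morph (@complex.Re R) (@ReDc R) (erefl _)).
  by apply: eq_bigr => k _; rewrite Re_mulc /= mul0r subr0.
rewrite (_ : _ \o _ = fun y => \sum_k \1_(tile p tau k : set (mplane R)) y * complex.Im (U k (iso_inv (tau k) y))).
  by apply: sum2 => k; exact: (sqint_glue_term k (L2_Im (U k))).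
apply/funext => y /=; rewrite /glue_fun (big_morph (@complex.Im R) (@ImDc R) (erefl _)).
by apply: eq_bigr => k _; rewrite Im_mulc /= mul0r addr0.
Qed.

Lemma glueK U k : pull k (glue U) = U k.
Proof.
have FL := ae_filter_ringOfSetsType (lebesgue_on Td).
apply/L2P.
apply: filterS3 (pullE k (glue U)) (pull_ae k (toL2E (sqint_glue U))) (ae_lebesgue_on Td) => x -> -> Tx.
have [ig fg gf] := iso_invP (ti k).
rewrite /glue_fun (bigD1 k)//= big1 ?addr0 => [|l lk].
  by rewrite indicE mem_set ?fg ?mul1r//; exists x.
rewrite indicE; case: (boolP (_ \in _)); rewrite ?mul0r//.
rewrite inE => -[y Ty yx]; by move: lk; rewrite (tiles_disjoint adm Ty Tx yx) eqxx.
Qed.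

End Pullback.

(** * The Neumann Laplacian in the tiles *)

Lemma ord2_sum (V : nmodType) (F : 'I_2 -> V) : \sum_i F i = F 0 + F 1.
Proof.
by rewrite !big_ord_recl big_ord0 addr0; congr (F _ + F _); exact: val_inj.
Qed.

Lemma ord2P (i : 'I_2) : i = 0 \/ i = 1.
Proof. by case: i => -[|[|//]] h; [left|right]; exact: val_inj. Qed.

Lemma conj_real (R : realType) (r : R) : (r%:C)^* = r%:C.
Proof. by apply: complexP; rewrite ?Re_conjc ?Im_conjc /= ?oppr0. Qed.

Section Frame.
Context {R : realType}.
Implicit Types (f : plane R -> plane R) (x w : plane R).

Definition coordinate (i : 'I_2) x : R := if i == 0 then x.1 else x.2.

Definition frame f (i m : 'I_2) : R := coordinate i (linear_part f (unit_vector m)).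

Lemma frame_linear f i x : isometry f ->
  coordinate i (linear_part f x) = \sum_m frame f i m * coordinate m x.
Proof.
move=> hf; rewrite ord2_sum /frame {1}(unit_vector_sum x) linear_partD// !linear_partZ//.
by rewrite /coordinate; case: (i == 0) => /=; rewrite mulrC [X in _ + X = _]mulrC.
Qed.

Lemma frame_coef f : isometry f -> exists a c d : R, [/\ a ^+ 2 + c ^+ 2 = 1, d ^+ 2 = 1,
  (frame f 0 0 = a /\ frame f 0 1 = - (c * d)) & frame f 1 0 = c /\ frame f 1 1 = a * d].
Proof.
move=> /isometryE[a [c [d [ac d1 fE]]]]; exists a, c, d.
have lE x : linear_part f x = (a * x.1 - c * (d * x.2), c * x.1 + a * (d * x.2)) by rewrite /linear_part fE addrK.
by rewrite /frame !lE /unit_vector /coordinate /=; split=> //; split; ring.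
Qed.

Lemma frame_col f m m' : isometry f -> \sum_i frame f i m * frame f i m' = (m == m')%:R.
Proof.
move=> /frame_coef[a [c [d [ac d1 [e1 e2] [e3 e4]]]]]; rewrite ord2_sum.
case: (ord2P m) => ->; case: (ord2P m') => -> /=; rewrite ?e1 ?e2 ?e3 ?e4 ?mulr1n ?mulr0n.
- by rewrite -ac; ring.
- by ring.
- by ring.
- by transitivity ((a ^+ 2 + c ^+ 2) * d ^+ 2); [ring|rewrite ac d1 mulr1].
Qed.

Lemma frame_row f i i' : isometry f -> \sum_m frame f i m * frame f i' m = (i == i')%:R.
Proof.
move=> /frame_coef[a [c [d [ac d1 [e1 e2] [e3 e4]]]]]; rewrite ord2_sum.
case: (ord2P i) => ->; case: (ord2P i') => -> /=; rewrite ?e1 ?e2 ?e3 ?e4 ?mulr1n ?mulr0n.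
- by transitivity (a ^+ 2 + c ^+ 2 * d ^+ 2); [ring|rewrite d1 mulr1].
- by transitivity (a * c * (1 - d ^+ 2)); [ring|rewrite d1 subrr mulr0].
- by transitivity (a * c * (1 - d ^+ 2)); [ring|rewrite d1 subrr mulr0].
- by transitivity (c ^+ 2 + a ^+ 2 * d ^+ 2); [ring|rewrite d1 mulr1 addrC].
Qed.

End Frame.

Section ComplexParts.
Context {R : realType}.
Local Notation C := R[i].

(** The boolean selects the real or the imaginary part, so that statements on weak derivatives are
    proved once for both. *)
Definition part (b : bool) (z : C) : R := if b then complex.Re z else complex.Im z.

Lemma partD b x y : part b (x + y) = part b x + part b y.
Proof. by case: b; [exact: ReDc|exact: ImDc]. Qed.

Lemma part_mulr b x (r : R) : part b (x * r%:C) = part b x * r.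
Proof. by rewrite /part Re_mulc Im_mulc; case: b; rewrite /= mulr0 ?subr0 ?add0r. Qed.

Lemma part_mull b x (r : R) : part b (r%:C * x) = r * part b x.
Proof. by rewrite mulrC part_mulr mulrC. Qed.

Lemma partP x y : (forall b, part b x = part b y) -> x = y.
Proof. by move=> h; apply: complexP; [exact: (h true)|exact: (h false)]. Qed.

Lemma L2_part (D : domain R) b (u : L2 D) : (fun x => part b (u x)) \in Lfun (lebesgue_on D) 2%:E.
Proof. by case: b; [exact: L2_Re|exact: L2_Im]. Qed.

Definition field_part (D : domain R) b (du : 'I_2 -> L2 D) x : plane R := (part b (du 0 x), part b (du 1 x)).

End ComplexParts.

Section WeakGradient.
Context {R : realType}.
Variable D : domain R.
Variable M : R.
Hypothesis DM : forall x, (D : set (plane R)) x -> `|x| <= M.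
Local Notation mu2 := (@lebesgue2 R).
Implicit Types (u : L2 D) (du : 'I_2 -> L2 D).

Let mD := open_measurable2 (domain_open D).

Lemma bounded_measure : (mu2 D < +oo)%E.
Proof.
pose B : set (mplane R) := (`[- M, M] : set (measurableTypeR R)) `*` (`[- M, M] : set (measurableTypeR R)).
have mI : measurable (`[- M, M] : set (measurableTypeR R)) by exact: measurable_itv.
have mB : measurable B by exact: measurableX.
apply: (@le_lt_trans _ _ (mu2 B)).
  apply: le_measure; rewrite ?inE// => x Dx; have := DM Dx.
  by rewrite norm_planeE ge_max !ler_norml => /andP[h1 h2]; split; rewrite /= in_itv/=.
have -> : mu2 B = (@lebesgue_measure R `[(- M)%R, M] * @lebesgue_measure R `[(- M)%R, M])%E by exact: product_measure1E.
have fI : (@lebesgue_measure R `[(- M)%R, M] < +oo)%E.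
  by rewrite lebesgue_measure_itv/=; case: ifP => _; rewrite -?EFinB ltry.
by rewrite lte_mul_pinfty// ge0_fin_numE.
Qed.

Lemma L1on_part b u : L1on D (fun x => part b (u x)).
Proof.
have h := L2_part b u; have mf := Lfun2_measurable h; apply/L1on_lebesgue_on => //.
apply/Lfun1_integrable; apply: Lfun_subset12 h.
by rewrite lebesgue_onE setTI ge0_fin_numE// bounded_measure.
Qed.

Lemma L1on_part_continuous b u f : continuous f -> L1on D (fun x => part b (u x) * f x).
Proof. by move=> cf; exact: (L1on_continuous mD DM (L1on_part b u) cf). Qed.

Lemma part_cintegral b (f : plane R -> R[i]) : part b (cintegral D f) = \int[lebesgue_on D]_x part b (f x).
Proof. by case: b. Qed.

Lemma part_cintegral_mul b u (f : plane R -> R) : continuous f ->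
  part b (cintegral D (fun x => u x * (f x)%:C)) = \int[mu2]_(x in D) (part b (u x) * f x).
Proof.
move=> cf; have [mf _] := L1on_part_continuous b u cf.
by rewrite part_cintegral -Rintegral_lebesgue_on//; apply: eq_Rintegral => x _; rewrite part_mulr.
Qed.

(** The definition tests complex functions in the two axis directions only. Test functions are real,
    so real and imaginary parts separate, and ['D_w phi] is a linear combination of the two partial
    derivatives. *)
Lemma weak_gradient_wgrad u du :
  weak_gradient u du <-> forall b, wgrad D (fun x => part b (u x)) (field_part b du).
Proof.
have key b phi i : smooth phi ->
  (part b (cintegral D (fun x => u x * (partial i phi x)%:C)) =
    part b (- cintegral D (fun x => du i x * (phi x)%:C))) <->
  \int[mu2]_(x in D) (part b (u x) * 'D_(unit_vector i) phi x + part b (du i x) * phi x) = 0.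
  move=> sphi; have cp := smooth_continuous sphi.
  have cd : continuous (fun x => 'D_(unit_vector i) phi x) := @derive_smooth_continuous R phi (unit_vector i) sphi.
  have [_ i1] := L1on_part_continuous b u cd; have [_ i2] := L1on_part_continuous b (du i) cp.
  rewrite RintegralD//.
  have -> : part b (- cintegral D (fun x => du i x * (phi x)%:C)) =
      - part b (cintegral D (fun x => du i x * (phi x)%:C)).
    by move: (cintegral _ _) => -[x y]; case: b {i1 i2}.
  rewrite !part_cintegral_mul//.
  by split=> [->|/eqP]; [rewrite addNr|rewrite addr_eq0 => /eqP].
have coord b i x : dot (unit_vector i) (field_part b du x) = part b (du i x).
  by rewrite /dot /field_part /unit_vector; case: (ord2P i) => -> /=; rewrite ?mul1r ?mul0r ?addr0 ?add0r.
split=> [wg b phi tphi w|wg phi tphi i].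
  have sphi : smooth phi by case: tphi.
  have cp := smooth_continuous sphi.
  have cd i : continuous (fun x => 'D_(unit_vector i) phi x) := @derive_smooth_continuous R phi (unit_vector i) sphi.
  have h i : \int[mu2]_(x in D) (part b (u x) * 'D_(unit_vector i) phi x + part b (du i x) * phi x) = 0.
    by apply/key => //; rewrite wg.
  have I i : L1on D (fun x => part b (u x) * 'D_(unit_vector i) phi x + part b (du i x) * phi x).
    by apply: L1onD => //; exact: L1on_part_continuous.
  transitivity (\int[mu2]_(x in D) (w.1 * (part b (u x) * 'D_(unit_vector 0) phi x + part b (du 0 x) * phi x) +
     w.2 * (part b (u x) * 'D_(unit_vector 1) phi x + part b (du 1 x) * phi x))).
    apply: eq_Rintegral => x _; rewrite (derive_partial w (smooth_differentiable x sphi)).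
    by rewrite /dot /field_part /=; rewrite /partial; ring.
  have [_ i0] := I 0; have [_ i1] := I 1.
  have [_ j0] := L1onZ w.1 mD (I 0); have [_ j1] := L1onZ w.2 mD (I 1).
  by rewrite RintegralD// !RintegralZl// !h !mulr0 addr0.
apply: partP => b; apply/key; first by case: tphi.
rewrite -[RHS](wg b phi tphi (unit_vector i)).
by apply: eq_Rintegral => x _; rewrite coord.
Qed.

End WeakGradient.

Section GradientPullback.
Context {R : realType}.
Variable p : 'I_3 -> plane R.
Hypothesis ndg : nondegenerate_triangle p.
Variables (E : pattern) (tau : 'I_7 -> plane R -> plane R).
Hypothesis gE : good_pattern E.
Hypothesis utau : unfolding p E tau.
Hypothesis adm : admissible p tau E.
Local Notation C := R[i].
Local Notation T := (open_triangle p).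
Local Notation Td := (triangle_domain ndg).
Local Notation Omega := (glued p tau).
Local Notation mu2 := (@lebesgue2 R).
Implicit Types (k l : 'I_7) (u v : L2 Omega) (du dv : 'I_2 -> L2 Omega) (b : bool).
Local Notation pull := (pull ndg).

Let ti := tau_isometry ndg gE utau.
Let fr k := frame (iso_inv (tau k)).
Let ii k : isometry (iso_inv (tau k)). Proof. exact: iso_inv_isometry. Qed.

Definition pull_gradient k du (i : 'I_2) : L2 Td := \sum_m (fr k i m)%:C *: pull k (du m).

Lemma glued_bounded : exists M : R, forall x, (Omega : set (plane R)) x -> `|x| <= M.
Proof.
have [M hM] := open_triangle_bounded ndg.
exists (\sum_k (`|tau k 0| + 2 * M)) => x /interior_subset[k _].
rewrite (closure_tile ndg gE utau) => -[y cy <-].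
have M0 : 0 <= M by rewrite (le_trans _ (hM y cy)).
rewrite (bigD1 k)//= -[leLHS]addr0 lerD ?sumr_ge0// => [|i _]; last by rewrite addr_ge0// mulr_ge0.
rewrite -[tau k y](subrK (tau k 0)) addrC (le_trans (ler_normD _ _))// lerD2l.
rewrite (le_trans (dist_norm _ _))// ti (le_trans (norm_dist _ _))// ler_wpM2l// subr0.
exact: hM.
Qed.

Lemma triangle_bounded : exists M : R, forall x, (Td : set (plane R)) x -> `|x| <= M.
Proof.
by have [M hM] := open_triangle_bounded ndg; exists M => x Tx; apply: hM; exact: subset_closure.
Qed.

Lemma flux_ae b (u' : plane R -> R) (G' : plane R -> plane R) (U : L2 Td) (G : 'I_2 -> L2 Td) w psi :
  L1on T u' -> L1field p G' -> smooth psi ->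
  {ae lebesgue_on Td, forall x, part b (U x) = u' x} ->
  {ae lebesgue_on Td, forall x, field_part b G x = G' x} ->
  flux p (fun x => part b (U x)) (field_part b G) w psi = flux p u' G' w psi.
Proof.
move=> hu hG sp e1 e2; have [M hM] := triangle_bounded.
have [m1 _] := L1on_flux ndg w hu hG sp.
have hG' : L1field p (field_part b G) by split; exact: (L1on_part hM).
have [m2 _] := L1on_flux ndg w (L1on_part hM b U) hG' sp.
rewrite /flux -(Rintegral_lebesgue_on Td m1) -(Rintegral_lebesgue_on Td m2).
apply: ae_integral => //.
have FL := ae_filter_ringOfSetsType (lebesgue_on Td).
by apply: filterS2 e1 e2 => x -> ->.
Qed.

Lemma pull_gradient_ae k b du :
  {ae lebesgue_on Td, forall x, field_part b (pull_gradient k du) x = tile_field tau k (field_part b du) x}.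
Proof.
have FL := ae_filter_ringOfSetsType (lebesgue_on Td).
have comp i : {ae lebesgue_on Td, forall x, part b (pull_gradient k du i x) = coordinate i (tile_field tau k (field_part b du) x)}.
  have h0 := L2_scaleE (fr k i 0)%:C (pull k (du 0)); have h1 := L2_scaleE (fr k i 1)%:C (pull k (du 1)).
  have h := L2_addE ((fr k i 0)%:C *: pull k (du 0)) ((fr k i 1)%:C *: pull k (du 1)).
  rewrite /pull_gradient ord2_sum.
  apply: filterS3 h (filterI h0 h1) (filterI (pullE ndg gE utau k (du 0)) (pullE ndg gE utau k (du 1))).
  move=> x -> [-> ->] [-> ->]; rewrite /tile_field frame_linear// ord2_sum partD !part_mull.
  by rewrite /coordinate.
apply: filterS2 (comp 0) (comp 1) => x e1 e2.
by rewrite /field_part e1 e2 /coordinate; case: tile_field.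
Qed.

Lemma weak_tiles_ext (U U' : 'I_7 -> plane R -> R) (V V' : 'I_7 -> plane R -> plane R) :
  (forall k w psi, smooth psi -> flux p (U k) (V k) w psi = flux p (U' k) (V' k) w psi) ->
  weak_tiles p E U V -> weak_tiles p E U' V'.
Proof.
move=> h [h1 h2]; split=> [k psi w t|k j psi w jk t].
  by rewrite -h ?h1//; case: t => A [].
by have sp : smooth psi by [case: t => e [d []]]; rewrite -!h// (h2 k j).
Qed.

(** The equivalence is known for functions; passing to classes costs only almost everywhere
    equalities, which no flux can see. *)
Lemma weak_gradient_tiles u du : weak_gradient u du <->
  forall b, weak_tiles p E (fun k x => part b (pull k u x)) (fun k => field_part b (pull_gradient k du)).
Proof.
have [M hM] := glued_bounded.
have hu b : L1on Omega (fun x => part b (u x)) := L1on_part hM b u.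
have hg1 b : L1on Omega (fun x => (field_part b du x).1) := L1on_part hM b (du 0).
have hg2 b : L1on Omega (fun x => (field_part b du x).2) := L1on_part hM b (du 1).
have FL := ae_filter_ringOfSetsType (lebesgue_on Td).
have eq b k w psi : smooth psi -> flux p (fun x => part b (pull k u x)) (field_part b (pull_gradient k du)) w psi =
    flux p ((fun x => part b (u x)) \o tau k) (tile_field tau k (field_part b du)) w psi.
  move=> sp; apply: flux_ae sp _ (pull_gradient_ae k b du).
  - exact: (L1on_tile ndg gE utau k (hu b)).
  - exact: (L1field_tile ndg gE utau k (hg1 b) (hg2 b)).
  - by apply: filterS (pullE ndg gE utau k u) => x ->.
rewrite (weak_gradient_wgrad hM); split=> h b.
  apply: (weak_tiles_ext (fun k w psi sp => esym (eq b k w psi sp))).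
  exact: (wgrad_tiles ndg gE utau adm (hu b) (hg1 b) (hg2 b) (h b)).
apply: (tiles_wgrad ndg gE utau adm (hu b) (hg1 b) (hg2 b)).
exact: (weak_tiles_ext (eq b) (h b)).
Qed.

(** The frames are orthogonal, so rotated gradients have the same scalar product: the Dirichlet form
    is the sum of the forms on the tiles. *)
Lemma inner_gradient du dv : \sum_i inner (du i) (dv i) =
  \sum_k \sum_i inner (pull_gradient k du i) (pull_gradient k dv i).
Proof.
apply: (etrans (eq_bigr _ (fun i _ => inner_pull ndg gE utau adm (du i) (dv i)))).
rewrite exchange_big /=; apply: eq_bigr => k _.
rewrite !ord2_sum /pull_gradient !ord2_sum !(innerDl, innerDr, innerZl, innerZr) !conj_real.
have h00 := frame_col 0 0 (ii k); have h01 := frame_col 0 1 (ii k).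
have h11 := frame_col 1 1 (ii k).
rewrite -/(fr k) !ord2_sum /= ?mulr1n ?mulr0n in h00 h01 h11.
move: (inner _ _) (inner _ _) (inner _ _) (inner _ _) => x y z t.
transitivity ((fr k 0 0 * fr k 0 0 + fr k 1 0 * fr k 1 0)%:C * t + (fr k 0 1 * fr k 0 1 + fr k 1 1 * fr k 1 1)%:C * z +
   (fr k 0 0 * fr k 0 1 + fr k 1 0 * fr k 1 1)%:C * (x + y)).
  by rewrite h00 h01 h11 !mul1r mul0r addr0.
by apply: complexP; rewrite !(ReDc, ImDc, Re_mulc, Im_mulc) /=; ring.
Qed.

(** The indices of [fr] are transposed compared with [pull_gradient], which inverts an orthogonal
    matrix. *)
Definition push_gradient (G : 'I_7 -> 'I_2 -> L2 Td) (m : 'I_2) : L2 Omega :=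
  glue tau (fun k => \sum_i (fr k i m)%:C *: G k i).

Lemma push_gradientK G k i : pull_gradient k (push_gradient G) i = G k i.
Proof.
rewrite /pull_gradient ord2_sum /push_gradient !(glueK gE utau adm) !ord2_sum !scalerDr !scalerA.
have h00 := frame_row i 0 (ii k); have h01 := frame_row i 1 (ii k).
rewrite -/(fr k) !ord2_sum in h00 h01.
rewrite addrACA -!scalerDl -!rmorphM -!rmorphD /= h00 h01.
by case: (ord2P i) => -> /=; rewrite ?scale1r ?scale0r ?addr0 ?add0r.
Qed.

End GradientPullback.

(** * Transplantation *)

Lemma L2norm_le (R : realType) (D D' : domain R) (u : L2 D) (v : L2 D') :
  rinner u u <= rinner v v -> L2norm u <= L2norm v.
Proof. by move=> h; rewrite /L2norm ler_wsqrtr. Qed.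

Section PullNorm.
Context {R : realType}.
Variable p : 'I_3 -> plane R.
Hypothesis ndg : nondegenerate_triangle p.
Variables (E : pattern) (tau : 'I_7 -> plane R -> plane R).
Hypotheses (gE : good_pattern E) (utau : unfolding p E tau) (adm : admissible p tau E).
Local Notation Omega := (glued p tau).
Implicit Types (u : L2 Omega).

Lemma rinner_pull u : rinner u u = \sum_k rinner (pull ndg k u) (pull ndg k u).
Proof.
rewrite /rinner (inner_pull ndg gE utau adm).
by rewrite (big_morph (@complex.Re R) (@ReDc R) (erefl _)).
Qed.

Lemma L2norm_pull k u : L2norm (pull ndg k u) <= L2norm u.
Proof.
apply: L2norm_le.
by rewrite (rinner_pull u) (bigD1 k)//= lerDl sumr_ge0// => l _; exact: rinner_ge0.
Qed.

Lemma L2norm_le_pull u : L2norm u <= \sum_k L2norm (pull ndg k u).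
Proof.
rewrite -(@ler_pXn2r _ 2)// ?nnegrE ?L2norm_ge0 ?sumr_ge0// => [|k _]; last exact: L2norm_ge0.
rewrite L2norm_sqr rinner_pull expr2 mulr_suml ler_sum// => k _.
rewrite -L2norm_sqr expr2 ler_wpM2l ?L2norm_ge0// (bigD1 k)//= lerDl sumr_ge0// => l _.
exact: L2norm_ge0.
Qed.

End PullNorm.

Section Transplantation.
Context {R : realType}.
Variable p : 'I_3 -> plane R.
Hypothesis ndg : nondegenerate_triangle p.
Local Notation Td := (triangle_domain ndg).
Local Notation C := R[i].
Variables (E : pattern) (tau : 'I_7 -> plane R -> plane R).
Hypotheses (gE : good_pattern E) (utau : unfolding p E tau) (adm : admissible p tau E).
Variables (E' : pattern) (tau' : 'I_7 -> plane R -> plane R).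
Hypotheses (gE' : good_pattern E') (utau' : unfolding p E' tau') (adm' : admissible p tau' E').
Local Notation Omega := (glued p tau).
Local Notation Omega' := (glued p tau').
Local Notation pull := (pull ndg).
Implicit Types (c : 'I_7 -> 'I_7 -> R).

Definition transplant c (u : L2 Omega) : L2 Omega' :=
  glue tau' (fun l => \sum_k (c l k)%:C *: pull k u).

Lemma pull_transplant c u l : pull l (transplant c u) = \sum_k (c l k)%:C *: pull k u.
Proof. exact: (glueK gE' utau' adm'). Qed.

Lemma transplant_linear c : linear (transplant c).
Proof.
move=> a u v; suff h : transplant c (a *: u + v) = a *: transplant c u + transplant c v by exact: h.
apply: (pull_inj gE' utau' adm') => l.
rewrite (pullD ndg gE' utau') (pullZ ndg gE' utau') !pull_transplant scaler_sumr -big_split/=.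
apply: eq_bigr => k _.
by rewrite (pullD ndg gE utau) (pullZ ndg gE utau) scalerDr !scalerA mulrC.
Qed.

Lemma transplant_bounded c : bounded_operator (transplant c).
Proof.
exists (\sum_l \sum_k `|c l k|) => u.
rewrite (le_trans (L2norm_le_pull ndg gE' utau' adm' _))// mulr_suml ler_sum// => l _.
rewrite pull_transplant (le_trans (L2norm_sum _ _))// mulr_suml ler_sum// => k _.
apply: (le_trans (y := `|c l k| * L2norm (pull k u))); first by rewrite (L2normZr (c l k) (pull k u)).
exact: (ler_wpM2l (normr_ge0 (c l k)) (L2norm_pull ndg gE utau adm k u)).
Qed.

(** The involutions are symmetric permutation matrices, so this says that [c] commutes with them
    from one pattern to the other, and the transpose of [c] then intertwines in the opposite
    direction. *)
Definition intertwiner c := forall j l k, c (neighbour E' j l) (neighbour E j k) = c l k.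

Lemma part_sumZ_ae b (c : 'I_7 -> R) (U : 'I_7 -> L2 Td) :
  {ae lebesgue_on Td, forall x, part b (L2_fun (\sum_k (c k)%:C *: U k) x) = \sum_k c k * part b (U k x)}.
Proof.
have FL := ae_filter_ringOfSetsType (lebesgue_on Td).
rewrite unlock; elim: (index_enum _) => [|k r ih] /=.
  have := L2_scaleE 0 (0 : L2 Td); rewrite scale0r.
  by apply: filterS => x ->; rewrite mul0r; case: b.
apply: filterS3 ih (L2_addE ((c k)%:C *: U k) (foldr (fun k y => (c k)%:C *: U k + y) 0 r)) (L2_scaleE (c k)%:C (U k)).
by move=> x e1 e2 e3; rewrite e2 partD e3 part_mull e1.
Qed.

(** To compare the traces of row [l] and of its neighbour, reindex the second sum by
    [neighbour E j]: the coefficients agree by [intertwiner], the fluxes by hypothesis, trivially so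
    for a tile [k] whose side [j] is free. Hence a side may be glued in one pattern and free in the
    other. *)
Lemma weak_tiles_transplant c b (U : 'I_7 -> L2 Td) (G : 'I_7 -> 'I_2 -> L2 Td) : intertwiner c ->
  weak_tiles p E (fun k x => part b (U k x)) (fun k => field_part b (G k)) ->
  weak_tiles p E' (fun l x => part b (L2_fun (\sum_k (c l k)%:C *: U k) x))
    (fun l => field_part b (fun i => \sum_k (c l k)%:C *: G k i)).
Proof.
have [M hM] := triangle_bounded ndg.
have FL := ae_filter_ringOfSetsType (lebesgue_on Td).
move=> cc [h1 h2].
have hU k : L1on (open_triangle p) (fun x => part b (U k x)) := L1on_part hM b (U k).
have hG k : L1field p (field_part b (G k)) by split; exact: (L1on_part hM).
have mT := triangle_measurable ndg.
have fE l w psi : smooth psi ->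
    flux p (fun x => part b (L2_fun (\sum_k (c l k)%:C *: U k) x)) (field_part b (fun i => \sum_k (c l k)%:C *: G k i)) w psi =
    \sum_k c l k * flux p (fun x => part b (U k x)) (field_part b (G k)) w psi.
  move=> sp; rewrite -(flux_sum ndg (c l) w hU hG sp).
  have comp1 (V : 'I_7 -> plane R) : (\sum_k V k).1 = \sum_k (V k).1 by exact: (big_morph fst).
  have comp2 (V : 'I_7 -> plane R) : (\sum_k V k).2 = \sum_k (V k).2 by exact: (big_morph snd).
  apply: flux_ae sp _ _.
  - by apply: L1on_sum => // k; apply: L1onZ.
  - split.
      under eq_fun do rewrite comp1 /=.
      by apply: L1on_sum => // k; apply: L1onZ => //; case: (hG k).
    under eq_fun do rewrite comp2 /=.
    by apply: L1on_sum => // k; apply: L1onZ => //; case: (hG k).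
  - exact: part_sumZ_ae.
  - apply: filterS2 (part_sumZ_ae b (c l) (fun k => G k 0)) (part_sumZ_ae b (c l) (fun k => G k 1)) => x e1 e2.
    by rewrite /field_part e1 e2; apply: injective_projections; rewrite ?comp1 ?comp2.
split=> [l psi w t|l j psi w jl t].
  rewrite fE; last by case: t => A [].
  by rewrite big1// => k _; rewrite h1// mulr0.
have sp : smooth psi by case: t => e [d []].
rewrite !fE// [RHS](reindex_inj (can_inj (neighbourK gE j)))/=; apply: eq_bigr => k _.
rewrite cc; have [->//|jk] := eqVneq (neighbour E j k) k.
by rewrite (h2 k j).
Qed.

Definition transplant_gradient c (du : 'I_2 -> L2 Omega) : 'I_2 -> L2 Omega' :=
  push_gradient tau' (fun l i => \sum_k (c l k)%:C *: pull_gradient ndg k du i).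

Lemma pull_transplant_gradient c du l i : pull_gradient ndg l (transplant_gradient c du) i =
  \sum_k (c l k)%:C *: pull_gradient ndg k du i.
Proof. exact: (push_gradientK gE' utau' adm'). Qed.

Lemma weak_gradient_transplant c u du : intertwiner c -> weak_gradient u du ->
  weak_gradient (transplant c u) (transplant_gradient c du).
Proof.
move=> cc /(weak_gradient_tiles ndg gE utau adm) h.
apply/(weak_gradient_tiles ndg gE' utau' adm') => b.
have := weak_tiles_transplant cc (h b).
under eq_fun do under eq_fun do rewrite -pull_transplant.
congr weak_tiles; apply/funext => l; congr field_part; apply/funext => i.
by rewrite pull_transplant_gradient.
Qed.

Lemma inner_transplant c u (v : L2 Omega') :
  inner (transplant c u) v = \sum_l \sum_k (c l k)%:C * inner (pull k u) (pull l v).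
Proof.
apply: (etrans (inner_pull ndg gE' utau' adm' _ _)); apply: eq_bigr => l _.
rewrite pull_transplant inner_suml; apply: eq_bigr => k _; exact: innerZl.
Qed.

Lemma inner_transplant_gradient c du (dv : 'I_2 -> L2 Omega') :
  \sum_i inner (transplant_gradient c du i) (dv i) =
  \sum_l \sum_k (c l k)%:C * \sum_i inner (pull_gradient ndg k du i) (pull_gradient ndg l dv i).
Proof.
apply: (etrans (inner_gradient ndg gE' utau' adm' _ _)); apply: eq_bigr => l _.
under eq_bigr => i _ do rewrite pull_transplant_gradient inner_suml.
rewrite exchange_big /=; apply: eq_bigr => k _.
by rewrite mulr_sumr; apply: eq_bigr => i _; exact: innerZl.
Qed.

End Transplantation.

Lemma sum_transpose (R : realType) (c : 'I_7 -> 'I_7 -> R) (F G : 'I_7 -> 'I_7 -> R[i]) :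
  (forall k l, F k l = (G l k)^*) ->
  \sum_l \sum_k (c l k)%:C * F k l = (\sum_k \sum_l (c l k)%:C * G l k)^*.
Proof.
move=> h; rewrite exchange_big rmorph_sum; apply: eq_bigr => k _; rewrite rmorph_sum.
by apply: eq_bigr => l _; rewrite rmorphM /= conj_real h.
Qed.

Section Transfer.
Context {R : realType}.
Variable p : 'I_3 -> plane R.
Hypothesis ndg : nondegenerate_triangle p.
Variables (E : pattern) (tau : 'I_7 -> plane R -> plane R).
Hypotheses (gE : good_pattern E) (utau : unfolding p E tau) (adm : admissible p tau E).
Variables (E' : pattern) (tau' : 'I_7 -> plane R -> plane R).
Hypotheses (gE' : good_pattern E') (utau' : unfolding p E' tau') (adm' : admissible p tau' E').
Local Notation Omega := (glued p tau).
Local Notation Omega' := (glued p tau').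
Implicit Types (c : 'I_7 -> 'I_7 -> R).

Lemma transplantK c c' (u : L2 Omega) :
  (forall k m, \sum_l c' k l * c l m = (k == m)%:R) ->
  transplant ndg tau c' (transplant ndg tau' c u) = u.
Proof.
move=> cc; apply: (pull_inj gE utau adm) => k.
rewrite (pull_transplant ndg gE utau adm).
under eq_bigr => l _ do rewrite (pull_transplant ndg gE' utau' adm') scaler_sumr.
transitivity (\sum_m (\sum_l c' k l * c l m)%:C *: pull ndg m u).
  rewrite exchange_big; apply: eq_bigr => m _; rewrite rmorph_sum scaler_suml.
  by apply: eq_bigr => l _; rewrite scalerA -rmorphM.
rewrite (bigD1 k)//= cc eqxx scale1r -[RHS]addr0; congr (_ + _).
by apply: big1 => m mk; rewrite cc eq_sym (negbTE mk) scale0r.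
Qed.

(** The matrix is real, so the adjoint is the transplantation by its transpose. *)
Lemma transplant_adjoint c (u : L2 Omega) (v : L2 Omega') :
  inner (transplant ndg tau' c u) v = inner u (transplant ndg tau (fun k l => c l k) v).
Proof.
apply: (etrans (inner_transplant ndg gE' utau' adm' _ _ _)); apply/esym.
apply: (etrans (inner_conj _ _)); apply: (etrans (congr1 _ (inner_transplant ndg gE utau adm _ _ _))).
by apply/esym/sum_transpose => k l; exact: inner_conj.
Qed.

Lemma transplant_gradient_adjoint c (du : 'I_2 -> L2 Omega) (dv : 'I_2 -> L2 Omega') :
  \sum_i inner (transplant_gradient ndg tau' c du i) (dv i) =
  \sum_i inner (du i) (transplant_gradient ndg tau (fun k l => c l k) dv i).
Proof.
apply: (etrans (inner_transplant_gradient ndg gE' utau' adm' _ _ _)); apply/esym.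
apply: (etrans (eq_bigr _ (fun i _ => inner_conj _ _))); rewrite -rmorph_sum /=.
apply: (etrans (congr1 _ (inner_transplant_gradient ndg gE utau adm _ _ _))).
apply/esym/sum_transpose => k l; rewrite rmorph_sum /=; apply: eq_bigr => i _; exact: inner_conj.
Qed.

(** With [B] for the transplantation and [a] for the form, [a (B u, v) = a (u, B^T v) = - (f, B^T v)
    = - (B f, v)]. The middle equality requires [B^T v] in [H^1], which the transposed intertwining
    relation provides. *)
Lemma neumann_transplant c (u f : L2 Omega) : intertwiner E E' c ->
  neumann_laplacian u f -> neumann_laplacian (transplant ndg tau' c u) (transplant ndg tau' c f).
Proof.
move=> cc [du wu h]; exists (transplant_gradient ndg tau' c du).
  exact: (weak_gradient_transplant ndg gE utau adm gE' utau' adm' cc wu).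
move=> v dv wv; have cc' : intertwiner E' E (fun k l => c l k) by move=> j k l; exact: cc.
rewrite transplant_gradient_adjoint.
rewrite (h _ _ (weak_gradient_transplant ndg gE' utau' adm' gE utau adm cc' wv)).
by rewrite !innerNl transplant_adjoint.
Qed.

End Transfer.

(** * The Fano matrix *)

(* The incidence relation of a Fano plane. *)
Definition fano_flags : seq ('I_7 * 'I_7) :=
  [:: (1, 2); (1, 3); (1, 4); (2, 1); (2, 3); (2, 7); (3, 1); (3, 4); (3, 5); (4, 1); (4, 2); (4, 6);
      (5, 4); (5, 6); (5, 7); (6, 2); (6, 5); (6, 7); (7, 3); (7, 5); (7, 6)].

Definition fano (l k : 'I_7) : bool := (l, k) \in fano_flags.

(** For each label, tiles of the first pattern are permuted as points and tiles of the second as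
    lines: the pair of involutions is an automorphism of the Fano plane. All 147 cases are
    computed. *)
Lemma fano_neighbour j l k : fano (neighbour E2 j l) (neighbour E1 j k) = fano l k.
Proof.
have : all (fun j => all (fun l => all (fun k => fano (neighbour E2 j l) (neighbour E1 j k) == fano l k) tiles) tiles) labels.
  by vm_compute.
by move=> /allP/(_ j (mem_labels j))/allP/(_ l (mem_tiles l))/allP/(_ k (mem_tiles k))/eqP.
Qed.

Lemma sum_tiles (V : nmodType) (F : 'I_7 -> V) : \sum_k F k = \sum_(k <- tiles) F k.
Proof.
rewrite -big_enum; apply/perm_big/uniq_perm; rewrite ?enum_uniq//.
by move=> k; rewrite mem_tiles mem_enum.
Qed.

(* Any two points lie on one line, every point on three, and dually. *)
Lemma fano_pairs k m :
  perm_eq [seq (fano l k, fano l m) | l <- tiles]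
    (if k == m then nseq 3 (true, true) ++ nseq 4 (false, false)
     else [:: (true, true)] ++ nseq 2 (true, false) ++ nseq 2 (false, true) ++ nseq 2 (false, false)) /\
  perm_eq [seq (fano k l, fano m l) | l <- tiles]
    (if k == m then nseq 3 (true, true) ++ nseq 4 (false, false)
     else [:: (true, true)] ++ nseq 2 (true, false) ++ nseq 2 (false, true) ++ nseq 2 (false, false)).
Proof.
have : all (fun k => all (fun m =>
  perm_eq [seq (fano l k, fano l m) | l <- tiles]
    (if k == m then nseq 3 (true, true) ++ nseq 4 (false, false)
     else [:: (true, true)] ++ nseq 2 (true, false) ++ nseq 2 (false, true) ++ nseq 2 (false, false)) &&
  perm_eq [seq (fano k l, fano m l) | l <- tiles]
    (if k == m then nseq 3 (true, true) ++ nseq 4 (false, false)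
     else [:: (true, true)] ++ nseq 2 (true, false) ++ nseq 2 (false, true) ++ nseq 2 (false, false))) tiles) tiles.
  by vm_compute.
by move=> /allP/(_ k (mem_tiles k))/allP/(_ m (mem_tiles m))/andP.
Qed.

Section FanoMatrix.
Context {R : realType}.

Definition fano_mx (l k : 'I_7) : R := (fano l k)%:R.
(** With [B] the incidence matrix and [J] the all-ones matrix, [B^T B = 2 I + J] and [J B^T = 3 J],
    so the inverse of [B] is [(B^T - J / 3) / 2], with entries [1/3] at flags and [-1/6] elsewhere.
    Being a function of [fano] alone, it intertwines because [B] does. *)
Definition fano_inv (k l : 'I_7) : R := if fano l k then 3^-1 else - 6^-1.

(** The summand depends on a pair of booleans only, so the multiset of these pairs, given by
    [fano_pairs], determines the sum. *)
Lemma fano_sum (g : 'I_7 -> bool * bool) (k m : 'I_7) (F : bool * bool -> R) :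
  perm_eq [seq g l | l <- tiles]
    (if k == m then nseq 3 (true, true) ++ nseq 4 (false, false)
     else [:: (true, true)] ++ nseq 2 (true, false) ++ nseq 2 (false, true) ++ nseq 2 (false, false)) ->
  \sum_l F (g l) = if k == m then 3 * F (true, true) + 4 * F (false, false)
    else F (true, true) + 2 * F (true, false) + 2 * F (false, true) + 2 * F (false, false).
Proof.
move=> h; rewrite sum_tiles -(big_map g xpredT) (perm_big _ h).
by case: (k == m); rewrite !big_cons !big_nil /=; ring.
Qed.

Lemma fano_invK k m : \sum_l fano_inv k l * fano_mx l m = (k == m)%:R.
Proof.
have [h _] := fano_pairs k m.
apply: (etrans (fano_sum (fun b => (if b.1 then 3^-1 else - 6^-1) * b.2%:R) h)) => /=.
by case: (k == m) => /=; field.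
Qed.

Lemma fano_mxK l m : \sum_k fano_mx l k * fano_inv k m = (l == m)%:R.
Proof.
have [_ h] := fano_pairs l m.
apply: (etrans (fano_sum (fun b => b.1%:R * (if b.2 then 3^-1 else - 6^-1)) h)) => /=.
by case: (l == m) => /=; field.
Qed.

Lemma fano_mx_intertwiner : intertwiner E1 E2 fano_mx.
Proof. by move=> j l k; rewrite /fano_mx fano_neighbour. Qed.

Lemma fano_inv_intertwiner : intertwiner E2 E1 fano_inv.
Proof. by move=> j l k; rewrite /fano_inv fano_neighbour. Qed.

End FanoMatrix.

Theorem neumann_laplacians_similar (R : realType) (p : 'I_3 -> plane R)
    (tau1 tau2 : 'I_7 -> plane R -> plane R) :
  nondegenerate_triangle p -> unfolding p E1 tau1 -> unfolding p E2 tau2 ->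
  admissible p tau1 E1 -> admissible p tau2 E2 ->
  exists (U : {linear L2 (glued p tau1) -> L2 (glued p tau2)})
         (V : {linear L2 (glued p tau2) -> L2 (glued p tau1)}),
    [/\ bounded_operator U, bounded_operator V, cancel U V, cancel V U
      & (forall u f, neumann_laplacian u f -> neumann_laplacian (U u) (U f)) /\
        (forall u f, neumann_laplacian u f -> neumann_laplacian (V u) (V f))].
Proof.
move=> ndg u1 u2 a1 a2; have g1 := good_E1; have g2 := good_E2.
pose Ul := transplant_linear ndg g1 u1 g2 u2 a2 (fano_mx (R := R)).
pose Vl := transplant_linear ndg g2 u2 g1 u1 a1 (fano_inv (R := R)).
pose U : {linear L2 (glued p tau1) -> L2 (glued p tau2)} :=
  HB.pack (transplant ndg tau2 (tau := tau1) fano_mx) (GRing.isLinear.Build _ _ _ _ _ Ul).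
pose V : {linear L2 (glued p tau2) -> L2 (glued p tau1)} :=
  HB.pack (transplant ndg tau1 (tau := tau2) fano_inv) (GRing.isLinear.Build _ _ _ _ _ Vl).
exists U, V; split.
- exact: (transplant_bounded ndg g1 u1 a1 g2 u2 a2).
- exact: (transplant_bounded ndg g2 u2 a2 g1 u1 a1).
- by move=> u; exact: (transplantK ndg g1 u1 a1 g2 u2 a2 u fano_invK).
- by move=> u; exact: (transplantK ndg g2 u2 a2 g1 u1 a1 u fano_mxK).
- split=> u f.
    exact: (neumann_transplant ndg g1 u1 a1 g2 u2 a2 fano_mx_intertwiner).
  exact: (neumann_transplant ndg g2 u2 a2 g1 u1 a1 fano_inv_intertwiner).
Qed.

(** * Isospectrality of similar operators *)

Section Isospectral.
Context {R : realType}.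
Local Notation C := R[i].

Lemma has_dimension_image (V1 V2 : lmodType C) (U : {linear V1 -> V2}) (V : V2 -> V1)
    (F1 : set V1) (F2 : set V2) d :
  cancel U V -> cancel V U -> (forall u, F1 u <-> F2 (U u)) ->
  has_dimension F1 d -> has_dimension F2 d.
Proof.
move=> UK VK FU [e [free F1E]]; exists (U \o e).
have UE (c : 'I_d -> C) : \sum_i c i *: U (e i) = U (\sum_i c i *: e i).
  by rewrite linear_sum; apply: eq_bigr => i _; rewrite linearZ.
split=> [c|].
  by rewrite UE => h; apply: free; apply: (can_inj UK); rewrite h linear0.
apply/seteqP; split=> [y|_ [c _ <-]].
  rewrite -[y]VK => /FU; rewrite F1E => -[c _ cE].
  by exists c => //; rewrite UE cE.
by rewrite /= UE; apply/FU; rewrite F1E; exists c.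
Qed.

Lemma isospectral_similar (V1 V2 : lmodType C) (U : {linear V1 -> V2}) (V : {linear V2 -> V1})
    (A1 : V1 -> V1 -> Prop) (A2 : V2 -> V2 -> Prop) :
  cancel U V -> cancel V U -> (forall u f, A1 u f -> A2 (U u) (U f)) ->
  (forall u f, A2 u f -> A1 (V u) (V f)) -> isospectral A1 A2.
Proof.
move=> UK VK h12 h21.
have dimE mu d : has_dimension (eigenspace A1 mu) d <-> has_dimension (eigenspace A2 mu) d.
  split.
    apply: (has_dimension_image UK VK) => u; rewrite /eigenspace /=; split=> [/h12|/h21].
      by rewrite linearZ.
    by rewrite linearZ /= UK.
  apply: (has_dimension_image VK UK) => u; rewrite /eigenspace /=; split=> [/h21|/h12].
    by rewrite linearZ.
  by rewrite linearZ /= VK.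
split=> // lambda; split=> -[nd h]; split=> // mu; have [s [us sk ds]] := h mu;
  by exists s; split=> //; apply/dimE.
Qed.

End Isospectral.

(** * Uniqueness of the generated semigroup *)

Section RightLimits.
Context {R : realType}.

Lemma right_limit0P (f : R -> R) : (forall t, 0 <= f t) ->
  (f t @[t --> 0^'+] --> (0 : R)) <->
  (forall e, 0 < e -> exists2 d : R, 0 < d & forall t, 0 < t -> t < d -> f t < e).
Proof.
move=> f0; split=> [/cvgr0Pnorm_lt h e e0|h].
  have [d /= d0 hd] := h e e0; exists d => // t t0 td.
  have := hd t; rewrite /ball_/= sub0r normrN (gtr0_norm t0) ger0_norm//.
  by apply.
apply/cvgr0Pnorm_lt => e e0; have [d d0 hd] := h e e0.
exists d => //= t; rewrite /ball_ /= sub0r normrN => td t0; rewrite ger0_norm//; apply: hd => //.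
by rewrite -(gtr0_norm t0).
Qed.

(** The upper right derivative is nowhere positive. Let [T] be the supremum of the [t] with
    [phi t <= phi a + e * (t - a)]: continuity puts [T] into this set, and for [T < b] the
    hypothesis at [T] would produce a later element. *)
Lemma right_derivative_nonincreasing (phi : R -> R) (a b : R) : a <= b ->
  (forall t, a <= t -> t <= b -> forall e, 0 < e -> exists2 d, 0 < d & forall r, a <= r -> r <= b ->
     `|r - t| < d -> `|phi r - phi t| < e) ->
  (forall t, a <= t -> t <= b -> forall e, 0 < e -> exists2 d, 0 < d & forall h, 0 < h -> h < d ->
     phi (t + h) <= phi t + e * h) ->
  phi b <= phi a.
Proof.
move=> ab cphi dphi; apply/ler_addgt0Pr => e0 e0_gt0.
(* The summand 1 keeps the denominator positive when [a = b]. *)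
pose e := e0 / (b - a + 1).
have ba : 0 < b - a + 1 by rewrite ltr_wpDl// subr_ge0.
have e_gt0 : 0 < e by rewrite divr_gt0.
pose P : set R := [set t | [/\ a <= t, t <= b & phi t <= phi a + e * (t - a)]].
have Pa : P a by split=> //; rewrite subrr mulr0 addr0.
have supP : has_sup P by split; [exists a|exists b => t []].
pose T := sup P.
have aT : a <= T by apply: ub_le_sup => //; case: supP.
have Tb : T <= b by apply: ge_sup; [exists a|move=> t []].
have PT : P T.
  split=> //; rewrite leNgt; apply/negP => lt_phi.
  pose g := (phi T - (phi a + e * (T - a))) / 2.
  have g0 : 0 < g by rewrite /g divr_gt0// subr_gt0.
  have [d d0 hd] := cphi T aT Tb g g0.
  have [t [at_ tb pt] Tt] := sup_adherent d0 supP.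
  have tT : t <= T by apply: ub_le_sup; [case: supP|split].
  have := hd t at_ tb; rewrite distrC ger0_norm ?subr_ge0//.
  rewrite ltrBlDl -ltrBlDr => /(_ Tt); rewrite ltr_norml => /andP[h _].
  have : phi a + e * (t - a) <= phi a + e * (T - a) by rewrite lerD2l ler_wpM2l ?lerD2r// ltW.
  by rewrite /g in h; lra.
have [Tlt|bT] := ltP T b; last first.
  have -> : b = T by apply/eqP; rewrite eq_le bT Tb.
  case: PT => _ _ /le_trans; apply; rewrite lerD2l.
  apply: (@le_trans _ _ (e * (b - a + 1))); last by rewrite /e divfK// gt_eqF.
  by rewrite ler_wpM2l ?ltW//; lra.
have [d d0 hd] := dphi T aT Tb e e_gt0.
pose h := Num.min (d / 2) (b - T).
have h0 : 0 < h by rewrite lt_min divr_gt0//= subr_gt0.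
have hd' : h < d by rewrite gt_min ltr_pdivrMr// ltr_pMr// ltr1n.
have hb : h <= b - T by rewrite ge_min lexx orbT.
have : P (T + h).
  split; [by rewrite (le_trans aT)// lerDl ltW|by rewrite -lerBrDl|].
  rewrite (le_trans (hd h h0 hd'))//; case: PT => _ _ PT.
  by rewrite -addrA (addrC h) addrA mulrDr addrA lerD2r.
move=> /(ub_le_sup (proj2 supP)); rewrite -/T gerDl leNgt h0//.
Qed.

End RightLimits.

Lemma subrACA (V : zmodType) (a b c d : V) : a - b - (c - d) = a - c - (b - d).
Proof. by rewrite !opprD !opprK addrACA. Qed.

Lemma subr_cancel2 (V : zmodType) (a b c d : V) : b = d -> a - c = a - b - (c - d).
Proof. by move=> ->; rewrite opprB addrA subrK. Qed.

Lemma linear_L2B (R : realType) (D D' : domain R) (F : {linear L2 D -> L2 D'}) (u v : L2 D) :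
  F (u - v) = F u - F v.
Proof. exact: linearB. Qed.

Lemma linear_L2Z (R : realType) (D D' : domain R) (F : {linear L2 D -> L2 D'}) (a : R[i]) (u : L2 D) :
  F (a *: u) = a *: F u.
Proof. exact: linearZ. Qed.

Section Semigroup.
Context {R : realType} {D : domain R}.
Variables (S : R -> {linear L2 D -> L2 D}) (A : L2 D -> L2 D -> Prop).
Hypothesis hS : semigroup_generated_by S A.
Implicit Types (u v f : L2 D) (t r h : R).

Lemma semigroup_bound t : 0 < t -> exists2 M : R, 0 < M & forall u, L2norm (S t u) <= M * L2norm u.
Proof.
case: hS => bd _ _ _ /bd[M hM]; exists (`|M| + 1); first by rewrite ltr_wpDl.
move=> u; rewrite (le_trans (hM u))// ler_wpM2r ?L2norm_ge0//.
by rewrite (le_trans (ler_norm _))// lerDl.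
Qed.

Lemma semigroup_strong u e : 0 < e -> exists2 d, 0 < d & forall h, 0 < h -> h < d -> L2norm (S h u - u) < e.
Proof.
case: hS => _ _ sc _; have := sc u.
move/(right_limit0P (f := fun t => L2norm (S t u - u)) (fun t => L2norm_ge0 _)); exact.
Qed.

Lemma generatorP u f : A u f <-> forall e, 0 < e -> exists2 d, 0 < d & forall h, 0 < h -> h < d ->
  L2norm ((h^-1)%:C *: (S h u - u) - f) < e.
Proof.
case: hS => _ _ _ gen; apply: (iff_trans (gen u f)).
exact: (right_limit0P (f := fun t => L2norm ((t^-1)%:C *: (S t u - u) - f)) (fun t => L2norm_ge0 _)).
Qed.

Lemma semigroupD r t u : 0 < r -> 0 < t -> S (r + t) u = S r (S t u).
Proof. by case: hS => _ h _ _ r0 t0; exact: h. Qed.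

Lemma semigroup_right_continuous u t e : 0 < t -> 0 < e ->
  exists2 d, 0 < d & forall h, 0 < h -> h < d -> L2norm (S (t + h) u - S t u) < e.
Proof.
move=> t0 e0; have [M M0 hM] := semigroup_bound t0.
have [d d0 hd] := semigroup_strong u (divr_gt0 e0 M0).
exists d => // h h0 hh; rewrite semigroupD// -linearB (le_lt_trans (hM _))//.
by rewrite mulrC -ltr_pdivlMr//; exact: hd.
Qed.

(* Right continuity makes small oscillation an open dense condition, and Baire's
   theorem then yields a point of continuity. *)
Lemma semigroup_continuity_point u t : 0 < t -> exists t0, [/\ 0 < t0, t0 < t &
  forall e, 0 < e -> exists2 d, 0 < d & forall r, 0 < r -> `|r - t0| < d -> L2norm (S r u - S t0 u) < e].
Proof.
move=> t_gt0.
(* Points near which the orbit oscillates by less than [1 / (n + 1)]. Only positive times count, so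
   the condition is vacuous at negative points, and Baire's theorem can be applied on the whole
   line. *)
pose O (n : nat) : set R := [set x | exists2 d, 0 < d & forall r r', 0 < r -> 0 < r' ->
  `|r - x| < d -> `|r' - x| < d -> L2norm (S r u - S r' u) < n.+1%:R^-1].
have [] := @Baire R R O _ `]0, t[%classic.
- move=> n; split.
    rewrite openE => x [d d0 hd]; exists (d / 2) => /=; first by rewrite divr_gt0.
    move=> y /= xy; exists (d / 2); first by rewrite divr_gt0.
    move=> r r' r0 r'0 ry r'y.
    have tri z : `|z - y| < d / 2 -> `|z - x| < d.
      move=> zy; rewrite -(subrKA y) (le_lt_trans (ler_normD _ _))// [ltRHS]splitr ltrD//.
      by rewrite distrC.
    by apply: hd => //; exact: tri.
  move=> W [x Wx] oW.
  have [d /= d0 hd] : nbhs x W by apply: open_nbhs_nbhs; split.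
  have [x0|x0] := ltP 0 x; last first.
    exists (x - d / 2); split.
      by apply: hd; rewrite /= opprB addrC subrK gtr0_norm ?divr_gt0// ltr_pdivrMr// ltr_pMr// ltr1n.
    exists (d / 2); first by rewrite divr_gt0.
    by move=> r r' r0 _ + _; rewrite ltr_norml => /andP[_ h]; exfalso; lra.
  have e0 : 0 < n.+1%:R^-1 / 2 :> R by rewrite divr_gt0// invr_gt0.
  have [d' d'0 hd'] := semigroup_right_continuous u x0 e0.
  pose m := Num.min d d'.
  have m0 : 0 < m by rewrite lt_min d0.
  have [md md'] : m <= d /\ m <= d' by rewrite /m !ge_min !lexx orbT.
  (* On []x, x + m[] the orbit is close to its value at [x], hence oscillates little; the midpoint
     of this interval lies in [W]. *)
  exists (x + m / 2); split.
    apply: hd; rewrite /= opprD addrA subrr sub0r normrN gtr0_norm ?divr_gt0//.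
    by rewrite (lt_le_trans _ md)// ltr_pdivrMr// ltr_pMr// ltr1n.
  exists (m / 2); first by rewrite divr_gt0.
  have near r : `|r - (x + m / 2)| < m / 2 -> L2norm (S r u - S x u) < n.+1%:R^-1 / 2.
    rewrite ltr_norml => /andP[h1 h2].
    have -> : r = x + (r - x) by ring.
    by apply: hd'; lra.
  move=> r r' _ _ /near h1 /near h2.
  have -> : S r u - S r' u = (S r u - S x u) + (S x u - S r' u) by rewrite addrA subrK.
  rewrite (le_lt_trans (L2normD _ _))// [ltRHS]splitr ltrD// L2norm_distC//.
- by exists (t / 2); rewrite /= in_itv/= divr_gt0//= ltr_pdivrMr// ltr_pMr// ltr1n.
- exact: itv_open.
move=> t0 [/=]; rewrite in_itv/= => /andP[t00 t0t] h; exists t0; split=> // e e0.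
have [n _ /(_ n (leqnn n)) /= hn] := near_infty_natSinv_lt (PosNum e0).
have [d d0 hd] := h n I; exists d => // r r0 rt.
apply: lt_trans hn; apply: hd => //.
by rewrite subrr normr0.
Qed.

(** Continuity at some earlier [t0] is carried to [t] by the bounded operator [S (t - t0)]. This
    includes continuity from the left, on which the supremum argument of
    [right_derivative_nonincreasing] relies. *)
Lemma semigroup_continuous u t e : 0 < t -> 0 < e ->
  exists2 d, 0 < d & forall r, 0 < r -> `|r - t| < d -> L2norm (S r u - S t u) < e.
Proof.
move=> t_gt0 e0; have [t0 [t00 t0t h]] := semigroup_continuity_point u t_gt0.
have c0 : 0 < t - t0 by rewrite subr_gt0.
have [M M0 hM] := semigroup_bound c0.
have [d d0 hd] := h _ (divr_gt0 e0 M0).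
exists (Num.min d t0); first by rewrite lt_min d0.
move=> r r0; rewrite lt_min => /andP[rd rt0].
have s0 : 0 < t0 + (r - t) by move: rt0; rewrite ltr_norml => /andP[+ _]; lra.
have -> : S r u = S (t - t0) (S (t0 + (r - t)) u) by rewrite -semigroupD//; congr (S _ u); ring.
have -> : S t u = S (t - t0) (S t0 u) by rewrite -semigroupD// subrK.
rewrite -linearB (le_lt_trans (hM _))// mulrC -ltr_pdivlMr//; apply: hd => //.
by rewrite addrAC subrr add0r.
Qed.

Lemma generator_invariant u f t : 0 < t -> A u f -> A (S t u) (S t f).
Proof.
move=> t0 /generatorP h; apply/generatorP => e e0.
have [M M0 hM] := semigroup_bound t0; have [d d0 hd] := h _ (divr_gt0 e0 M0).
exists d => // s s0 sd.
have -> : S s (S t u) = S t (S s u) by rewrite -!semigroupD// addrC.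
have -> : (s^-1)%:C *: (S t (S s u) - S t u) - S t f = S t ((s^-1)%:C *: (S s u - u) - f).
    transitivity (S t ((s^-1)%:C *: (S s u - u)) - S t f); last by apply/esym; exact: linear_L2B.
  congr (_ - _); apply/esym; apply: (etrans (linear_L2Z (S t) _ _)); congr (_ *: _).
  exact: linear_L2B.
rewrite (le_lt_trans (hM _))// mulrC -ltr_pdivlMr//; exact: hd.
Qed.

End Semigroup.

Lemma L2norm_line (R : realType) (D : domain R) (x k : L2 D) (h : R) :
  L2norm (x + h%:C *: k) ^+ 2 = L2norm x ^+ 2 + h * (2 * rinner k x + h * rinner k k).
Proof.
rewrite !L2norm_sqr !(rinnerDl, rinnerDr, rinnerZl, rinnerZr) (rinnerC x k); ring.
Qed.

Section Uniqueness.
Context {R : realType} {D : domain R}.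
Variables (S W : R -> {linear L2 D -> L2 D}) (A : L2 D -> L2 D -> Prop).
Hypotheses (hS : semigroup_generated_by S A) (hW : semigroup_generated_by W A).
Hypothesis A_sub : forall u v f g, A u f -> A v g -> A (u - v) (f - g).
Hypothesis A_dissipative : forall u f, A u f -> rinner f u <= 0.
Hypothesis A_dense : forall u (e : R), 0 < e -> exists v f, A v f /\ L2norm (u - v) < e.
Implicit Types (u v f : L2 D) (t r h e : R).

Let d u t := S t u - W t u.
Let phi u t := L2norm (d u t) ^+ 2.

Lemma semigroup_difference_continuous u t e : 0 < t -> 0 < e ->
  exists2 a, 0 < a & forall r, 0 < r -> `|r - t| < a -> `|phi u r - phi u t| < e.
Proof.
move=> t0 e0; set y := L2norm (d u t).
have y0 : 0 <= y by exact: L2norm_ge0.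
have y1 : 0 < 2 * y + 1 by rewrite ltr_wpDl// mulr_ge0.
(* For [x < y + e' <= y + 1] one has [|x ^ 2 - y ^ 2| <= |x - y| * (2 * y + 1)]. *)
pose e' := Num.min 1 (e / (2 * y + 1)).
have e'0 : 0 < e' by rewrite lt_min ltr01 divr_gt0.
have e'1 : e' <= 1 by rewrite ge_min lexx.
have e'2 : e' * (2 * y + 1) <= e by rewrite -ler_pdivlMr// ge_min lexx orbT.
have e'h : 0 < e' / 2 by rewrite divr_gt0.
have [a a0 ha] := semigroup_continuous hS u t0 e'h.
have [b b0 hb] := semigroup_continuous hW u t0 e'h.
exists (Num.min a b); first by rewrite lt_min a0.
move=> r r0; rewrite lt_min => /andP[/(ha r r0) h1 /(hb r r0) h2].
have h : L2norm (d u r - d u t) < e'.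
  have -> : d u r - d u t = (S r u - S t u) - (W r u - W t u) by rewrite /d opprB addrACA addrA [RHS]addrAC opprB addrA.
  rewrite (le_lt_trans (L2normD _ _))// [ltRHS]splitr ltrD// L2normN//.
have l1 : L2norm (d u r) <= y + L2norm (d u r - d u t).
  by rewrite -{1}(subrK (d u t) (d u r)) addrC L2normD.
have l2 : y <= L2norm (d u r) + L2norm (d u r - d u t).
  by rewrite /y -{1}(subrK (d u r) (d u t)) addrC (le_trans (L2normD _ _))// lerD2l L2norm_distC.
rewrite /phi -/y; move: (L2norm (d u r)) (L2norm (d u r - d u t)) (L2norm_ge0 (d u r)) h l1 l2 => x z x0 h l1 l2.
rewrite subr_sqr normrM (ger0_norm (addr_ge0 x0 y0)).
have hz : `|x - y| < e' by rewrite ltr_norml; apply/andP; split; lra.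
have xy : x + y < 2 * y + 1 by lra.
apply: lt_le_trans e'2; apply: (@le_lt_trans _ _ (`|x - y| * (2 * y + 1))); first by rewrite ler_wpM2l// ltW.
by rewrite ltr_pM2r.
Qed.

(** The right derivative of the squared norm is [2 Re (A d, d) <= 0] for the difference [d] of the
    two orbits, which stays in the domain by [generator_invariant]. *)
Lemma semigroup_difference_derivative u f t e : A u f -> 0 < t -> 0 < e ->
  exists2 a, 0 < a & forall h, 0 < h -> h < a -> phi u (t + h) <= phi u t + e * h.
Proof.
move=> Auf t0 e0; pose g := S t f - W t f.
have Ad : A (d u t) g.
  by apply: A_sub; [exact: (generator_invariant hS t0)|exact: (generator_invariant hW t0)].
have dis := A_dissipative Ad.
set y := L2norm (d u t); have y0 : 0 <= y by exact: L2norm_ge0.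
have y1 : 0 < 4 * (y + 1) by rewrite mulr_gt0// ltr_wpDl.
(* In [2 (k, d) + h (k, k)], with [k] the difference quotient, the error [n] of [k] contributes at
   most [2 * n * y <= e / 2], and the last term is at most [e / 2] once [h * K < e / 2]. *)
pose n := e / (4 * (y + 1)).
have n0 : 0 < n by rewrite divr_gt0.
have ny : 2 * n * y <= e / 2.
  have E : n * (4 * (y + 1)) = e by rewrite /n divfK// gt_eqF.
  by rewrite -E; nra.
have n2 : 0 < n / 2 by rewrite divr_gt0.
have /(generatorP hS) /(_ _ n2)[a a0 ha] := generator_invariant hS t0 Auf.
have /(generatorP hW) /(_ _ n2)[b b0 hb] := generator_invariant hW t0 Auf.
pose K := (L2norm g + n) ^+ 2 + 1.
have K0 : 0 < K by rewrite ltr_wpDl// sqr_ge0.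
exists (Num.min (Num.min a b) (e / 2 / K)); first by rewrite !lt_min a0 b0 !divr_gt0.
move=> h h0; rewrite !lt_min => /andP[/andP[/(ha h h0) h1 /(hb h h0) h2] hK].
pose k := (h^-1)%:C *: (d u (t + h) - d u t).
have dE : d u (t + h) = d u t + h%:C *: k.
  by rewrite /k scalerA -rmorphM divff ?gt_eqF// scale1r [RHS]addrC subrK.
have kg : L2norm (k - g) < n.
  have -> : k - g = ((h^-1)%:C *: (S h (S t u) - S t u) - S t f) - ((h^-1)%:C *: (W h (W t u) - W t u) - W t f).
    rewrite -(semigroupD hS)// -(semigroupD hW)// (addrC h) /k /g /d.
    transitivity ((h^-1)%:C *: ((S (t + h) u - S t u) - (W (t + h) u - W t u)) - (S t f - W t f)).
      by congr (_ *: _ - _); exact: subrACA.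
    transitivity (((h^-1)%:C *: (S (t + h) u - S t u) - (h^-1)%:C *: (W (t + h) u - W t u)) - (S t f - W t f)).
      by congr (_ - _); exact: scalerBr.
    exact: subrACA.
  by rewrite (le_lt_trans (L2normD _ _))// [ltRHS]splitr ltrD// L2normN.
have kb : L2norm k <= L2norm g + n.
  by rewrite -(subrK g k) addrC (le_trans (L2normD _ _))// lerD2l ltW.
have kd : rinner k (d u t) <= n * y.
  rewrite -(subrK g k) rinnerDl -[leRHS]addr0 lerD//.
  rewrite (le_trans (ler_norm _))// (le_trans (rinner_le _ _))// ler_wpM2r//; exact: ltW.
have kk : h * rinner k k <= e / 2.
  rewrite -L2norm_sqr; apply: (@le_trans _ _ (h * K)); last by rewrite ltW// -ltr_pdivlMr.
  rewrite ler_pM2l// /K ler_wpDr// ler_pXn2r// ?nnegrE ?L2norm_ge0//.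
  by rewrite addr_ge0 ?L2norm_ge0// ltW.
rewrite /phi dE L2norm_line lerD2l (mulrC e).
by rewrite ler_pM2l//; lra.
Qed.

(** The squared distance of the two orbits is nonincreasing on [[s, t]] for every small [s > 0], and
    at [s] it is as small as desired because both orbits start at [u]. *)
Lemma semigroup_unique_domain u f t : A u f -> 0 < t -> S t u = W t u.
Proof.
move=> Auf t0; apply/eqP; rewrite -subr_eq0; apply/eqP/L2norm_eq0.
apply/eqP; rewrite -(sqrf_eq0 (L2norm _)) -/(d u t) -/(phi u t) eq_le [X in _ && X]sqr_ge0 andbT.
apply/ler_addgt0Pr => e e0; rewrite add0r.
(* Two errors below [e1] give a norm below [Num.min 1 e], whose square is below [e]. *)
pose e1 := Num.min 1 e / 2.
have e10 : 0 < e1 by rewrite divr_gt0// lt_min ltr01.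
have [a a0 ha] := semigroup_strong hS u e10; have [b b0 hb] := semigroup_strong hW u e10.
pose s := Num.min (Num.min a b) t / 2.
have s0 : 0 < s by rewrite divr_gt0// !lt_min a0 b0.
have [sa sb st] : [/\ s < a, s < b & s <= t].
  have h : Num.min (Num.min a b) t <= a /\ Num.min (Num.min a b) t <= b /\ Num.min (Num.min a b) t <= t.
    by rewrite !ge_min !lexx !orbT.
  by move: s0 h; rewrite /s; move: (Num.min (Num.min a b) t) => m; split; lra.
have ds : L2norm (d u s) < Num.min 1 e.
  have -> : d u s = (S s u - u) - (W s u - u) by rewrite opprB addrA subrK.
  by rewrite (le_lt_trans (L2normD _ _))// L2normN [ltRHS]splitr ltrD//; [exact: ha|exact: hb].
have : phi u t <= phi u s.
  apply: right_derivative_nonincreasing st _ _ => r sr rt e' e'0.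
    have r0 := lt_le_trans s0 sr.
    have [c c0 hc] := semigroup_difference_continuous u r0 e'0.
    by exists c => // r' sr' _; apply: hc; exact: lt_le_trans s0 sr'.
  exact: (semigroup_difference_derivative Auf (lt_le_trans s0 sr) e'0).
move/le_trans; apply; rewrite /phi.
move: ds; rewrite lt_min => /andP[d1 d2].
have := L2norm_ge0 (d u s); move: (L2norm (d u s)) d1 d2 => x d1 d2 x0; nra.
Qed.

(** At a fixed time both operators are bounded, so agreement on the dense domain is enough. *)
Theorem semigroup_unique u t : 0 < t -> S t u = W t u.
Proof.
move=> t0; apply/eqP; rewrite -subr_eq0; apply/eqP/L2norm_eq0.
apply/eqP; rewrite eq_le L2norm_ge0 andbT; apply/ler_addgt0Pr => e e0; rewrite add0r.
have [M M0 hM] := semigroup_bound hS t0; have [N N0 hN] := semigroup_bound hW t0.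
have [v [f [Avf uv]]] := A_dense u (divr_gt0 e0 (addr_gt0 M0 N0)).
have -> : S t u - W t u = S t (u - v) - W t (u - v).
  by rewrite (linear_L2B (S t) u v) (linear_L2B (W t) u v); apply: (@subr_cancel2 (L2 D)); exact: (semigroup_unique_domain Avf t0).
rewrite (le_trans (L2normD _ _))// L2normN.
rewrite (le_trans (lerD (hM _) (hN _)))// -mulrDl mulrC -ler_pdivlMr ?addr_gt0//.
exact: ltW.
Qed.

End Uniqueness.

(** * Dissipativity of the Neumann Laplacian *)

Section RealElements.
Context {R : realType}.
Variable D : domain R.
Local Notation C := R[i].
Local Notation muD := (lebesgue_on D).
Local Notation L2r := (Lfun muD 2%:E).
Implicit Types (f g : plane R -> R) (u v : L2 D).

Lemma Lfun2_cst0 : (fun=> 0 : R) \in L2r.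
Proof. by have [L0 _] := @Lfun_submod_closed _ _ R muD 2%:E (lee1n 2). Qed.

Lemma sqint_real f : f \in L2r -> (fun x => (f x)%:C) \in sqint_pred D.
Proof. by move=> hf; apply/sqintP; split; [exact: hf|exact: Lfun2_cst0]. Qed.

Definition realL2 f : L2 D := toL2 D (fun x => (f x)%:C).

Lemma realL2E f : f \in L2r -> {ae muD, forall x, realL2 f x = (f x)%:C}.
Proof. by move=> hf; exact: (toL2E (sqint_real hf)). Qed.

Lemma realL2_ae f g : f \in L2r -> g \in L2r -> {ae muD, forall x, f x = g x} -> realL2 f = realL2 g.
Proof.
move=> hf hg fg; have FL := ae_filter_ringOfSetsType muD.
by apply/L2P; apply: filterS3 (realL2E hf) (realL2E hg) fg => x -> -> ->.
Qed.

Lemma realL2D f g : f \in L2r -> g \in L2r -> realL2 (fun x => f x + g x) = realL2 f + realL2 g.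
Proof.
move=> hf hg; have FL := ae_filter_ringOfSetsType muD; apply/L2P.
apply: filterS3 (realL2E (Lfun2D hf hg)) (L2_addE (realL2 f) (realL2 g)) (filterI (realL2E hf) (realL2E hg)).
by move=> x -> -> [-> ->]; rewrite -rmorphD.
Qed.

Lemma realL2Z (a : R) f : f \in L2r -> realL2 (fun x => a * f x) = a%:C *: realL2 f.
Proof.
move=> hf; have FL := ae_filter_ringOfSetsType muD; apply/L2P.
apply: filterS3 (realL2E (Lfun2Z a hf)) (L2_scaleE a%:C (realL2 f)) (realL2E hf).
by move=> x -> -> ->; rewrite -rmorphM.
Qed.

Lemma realL2B f g : f \in L2r -> g \in L2r -> realL2 (fun x => f x - g x) = realL2 f - realL2 g.
Proof.
move=> hf hg; rewrite -[X in _ + X]scaleN1r (_ : -1 = (-1)%:C); last by apply: complexP; rewrite /= ?oppr0.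
rewrite -(realL2Z _ hg) -(realL2D hf (Lfun2Z _ hg)).
by congr realL2; apply/funext => x; rewrite mulN1r.
Qed.

Lemma L2_split u : u = realL2 (fun x => complex.Re (u x)) + 'i%C *: realL2 (fun x => complex.Im (u x)).
Proof.
have FL := ae_filter_ringOfSetsType muD; apply/L2P.
set a := realL2 _; set b := realL2 _.
apply: filterS3 (filterI (realL2E (L2_Re u)) (realL2E (L2_Im u))) (L2_addE a ('i%C *: b)) (L2_scaleE 'i%C b).
move=> x [e1 e2] -> ->; rewrite e1 e2; case: (u x) => y z.
by apply: complexP; rewrite !(ReDc, ImDc, Re_mulc, Im_mulc) /=; ring.
Qed.

Lemma rinner_realL2 f : f \in L2r -> rinner (realL2 f) (realL2 f) = rpair D f f.
Proof.
move=> hf; have FL := ae_filter_ringOfSetsType muD.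
have h1 : {ae muD, forall x, complex.Re (realL2 f x) = f x} by apply: filterS (realL2E hf) => x ->.
have h2 : {ae muD, forall x, complex.Im (realL2 f x) = 0} by apply: filterS (realL2E hf) => x ->.
rewrite /rinner Re_inner (rpair_ae (L2_Re _) hf (L2_Re _) h1) rpairC (rpair_ae (L2_Re _) hf hf h1).
rewrite (rpair_ae (L2_Im _) Lfun2_cst0 (L2_Im _) h2) -[RHS]addr0; congr (_ + _).
rewrite /rpair -[RHS](mul0r (fine (muD setT))) -Rintegral_cst//.
by apply: eq_Rintegral => x _; rewrite mul0r.
Qed.

Lemma cintegral_inner u f : f \in L2r -> cintegral D (fun x => u x * (f x)%:C) = inner u (realL2 f).
Proof.
move=> hf; have FL := ae_filter_ringOfSetsType muD.
have h1 : {ae muD, forall x, complex.Re (realL2 f x) = f x} by apply: filterS (realL2E hf) => x ->.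
have h2 : {ae muD, forall x, complex.Im (realL2 f x) = 0} by apply: filterS (realL2E hf) => x ->.
have z g : rpair D (fun=> 0) g = 0.
  rewrite /rpair -[RHS](mul0r (fine (muD setT))) -Rintegral_cst//.
  by apply: eq_Rintegral => x _; rewrite mul0r.
have key b : part b (cintegral D (fun x => u x * (f x)%:C)) = rpair D (fun x => part b (u x)) f.
  rewrite part_cintegral; apply: eq_Rintegral => x _; exact: part_mulr.
apply: complexP; rewrite ?Re_inner ?Im_inner.
  apply: (etrans (key true)).
  rewrite rpairC -(rpair_ae (L2_Re _) hf (L2_Re u) h1) rpairC -[LHS]addr0; congr (_ + _).
  by rewrite rpairC (rpair_ae (L2_Im _) Lfun2_cst0 (L2_Im _) h2) z.
apply: (etrans (key false)).
rewrite rpairC -(rpair_ae (L2_Re _) hf (L2_Im u) h1) rpairC -[LHS]subr0; congr (_ - _).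
by rewrite rpairC (rpair_ae (L2_Im _) Lfun2_cst0 (L2_Re _) h2) z.
Qed.

End RealElements.

Section NeumannDomain.
Context {R : realType}.
Variable D : domain R.
Variable M : R.
Hypothesis DM : forall x, (D : set (plane R)) x -> `|x| <= M.
Local Notation mu2 := (@lebesgue2 R).
Local Notation L2r := (Lfun (lebesgue_on D) 2%:E).
Implicit Types (u v f g : L2 D) (du dv : 'I_2 -> L2 D) (phi psi : plane R -> R).

Let mD := open_measurable2 (domain_open D).

Lemma Lfun2_bounded (F : plane R -> R) (K : R) : measurable_fun [set: mplane R] (F : mplane R -> R) ->
  (forall x, (D : set (plane R)) x -> `|F x| <= K) -> F \in L2r.
Proof.
move=> mF FK; apply/Lfun2_L1on; split=> //.
have h1 : L1on D (fun=> 1).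
  split=> //; apply/integrableP; split; first by apply/measurable_EFinP; exact: measurable_cst.
  rewrite (eq_integral (fun x : mplane R => 1%E)) => [|x _]; last by rewrite /= normr1.
  by rewrite integral_cst// mul1e; exact: (bounded_measure DM).
have := @L1on_bounded _ D (fun=> 1) (fun x => F x ^+ 2) (K ^+ 2) mD h1 _ _.
rewrite (_ : (fun x => 1 * F x ^+ 2) = (fun x => F x ^+ 2)); last by apply/funext => x; rewrite mul1r.
apply; first exact: measurable_funX.
move=> x /FK h; rewrite normrX ler_pXn2r// ?nnegrE//.
exact: le_trans h.
Qed.

Lemma Lfun2_continuous (F : plane R -> R) : continuous F -> F \in L2r.
Proof.
move=> cF; have [K K0 hK] := continuous_bounded M cF.
by apply: (@Lfun2_bounded _ K) => [|x /DM]; [exact: continuous_measurable2|exact: hK].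
Qed.

Lemma Lfun2_smooth phi : smooth phi -> phi \in L2r.
Proof. by move=> sp; apply: Lfun2_continuous; exact: smooth_continuous. Qed.

Lemma weak_gradient_inner u du : weak_gradient u du <-> forall phi, test_function D phi -> forall i,
  inner u (realL2 D (partial i phi)) = - inner (du i) (realL2 D phi).
Proof.
split=> h phi tp i; have sp : smooth phi by case: tp.
  by have := h phi tp i; rewrite (cintegral_inner _ (Lfun2_smooth (smooth_partial i sp))) (cintegral_inner _ (Lfun2_smooth sp)).
by rewrite (cintegral_inner _ (Lfun2_smooth (smooth_partial i sp))) (cintegral_inner _ (Lfun2_smooth sp)) h.
Qed.

Lemma weak_gradientD (a : R[i]) u v du dv : weak_gradient u du -> weak_gradient v dv ->
  weak_gradient (a *: u + v) (fun i => a *: du i + dv i).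
Proof.
move=> /weak_gradient_inner hu /weak_gradient_inner hv; apply/weak_gradient_inner => phi tp i.
by rewrite !innerDl !innerZl (hu phi tp) (hv phi tp) opprD mulrN.
Qed.

Lemma neumannD (a : R[i]) u v f g : neumann_laplacian u f -> neumann_laplacian v g ->
  neumann_laplacian (a *: u + v) (a *: f + g).
Proof.
move=> [du wu hu] [dv wv hv]; exists (fun i => a *: du i + dv i); first exact: weak_gradientD.
move=> w dw ww; under eq_bigr => i _ do rewrite innerDl innerZl.
rewrite big_split /= -mulr_sumr (hu w dw ww) (hv w dw ww).
by rewrite !innerNl innerDl innerZl opprD mulrN.
Qed.

Lemma neumann_dissipative u f : neumann_laplacian u f -> rinner f u <= 0.
Proof.
move=> [du wu hu]; have := congr1 (@complex.Re R) (hu u du wu).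
rewrite innerNl (big_morph (@complex.Re R) (@ReDc R) (erefl _)) => h.
have -> : rinner f u = - \sum_i rinner (du i) (du i).
  by rewrite [X in - X]h /rinner; case: inner => x y /=; rewrite opprK.
by rewrite oppr_le0 sumr_ge0// => i _; exact: rinner_ge0.
Qed.

Lemma test_partial i phi : test_function D phi -> test_function D (partial i phi).
Proof.
move=> [sp cK KD]; have spi := smooth_partial i sp.
apply: (test_functionI spi cK KD) => x; apply: contraPP => nx; apply/negP; rewrite negbK; apply/eqP.
have : nbhs x (~` closure [set x | phi x != 0]).
  by apply: open_nbhs_nbhs; split=> //; apply: closed_openC; exact: closed_closure.
move=> nb; rewrite /partial (near_eq_derive (g := cst 0)) ?derive_cst//.
by apply: filterS nb => y ny; apply/eqP/negPn/negP => py; apply: ny; exact: subset_closure.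
Qed.

Lemma integral_translate F (v : plane R) : measurable_fun [set: mplane R] (F : mplane R -> R) ->
  \int[mu2]_x F (x + v) = \int[mu2]_x F x.
Proof.
move=> mF; have iv : isometry (fun x : plane R => x + v).
  by move=> x y; rewrite /dist opprD addrACA subrr addr0.
rewrite /Rintegral; congr fine.
have := @integral_isometry _ _ (EFin \o F) setT iv _ measurableT.
by rewrite preimage_setT; apply; exact/measurable_EFinP.
Qed.

(** By translation invariance the difference quotients have integral 0; they converge to the
    derivative and are dominated by a constant on a box. *)
Lemma integral_derive0 phi w : smooth phi -> (exists N : R, forall x, phi x != 0 -> `|x| <= N) ->
  \int[mu2]_x 'D_w phi x = 0.
Proof.
move=> sp [N hN].
have cd : continuous (fun x => 'D_w phi x) := @derive_smooth_continuous R phi w sp.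
have dphi x : derivable phi x w by apply: diff_derivable; exact: smooth_differentiable.
(* The box of radius [N1] contains the supports of all translates by [w / (n + 1)]; a mean value
   point may leave it by at most [|w|], whence the bound [K] on a larger box. *)
pose N1 := `|N| + `|w|.
have [K K0 hK] := continuous_bounded (N1 + `|w|) cd.
pose B : set (mplane R) := (`[- N1, N1] : set (measurableTypeR R)) `*` (`[- N1, N1] : set (measurableTypeR R)).
have BE x : B x <-> `|x : plane R| <= N1.
  rewrite norm_planeE ge_max !ler_norml /B /=; split=> [[]|/andP[]]; rewrite !in_itv/=.
    by move=> -> ->.
  by move=> -> ->.
have mI : measurable (`[- N1, N1] : set (measurableTypeR R)) by exact: measurable_itv.
have mB : measurable B by exact: measurableX.
have fB : (mu2 B < +oo)%E.
  have -> : mu2 B = (@lebesgue_measure R `[(- N1)%R, N1] * @lebesgue_measure R `[(- N1)%R, N1])%E by exact: product_measure1E.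
  have fI : (@lebesgue_measure R `[(- N1)%R, N1] < +oo)%E.
    by rewrite lebesgue_measure_itv/=; case: ifP => _; rewrite -?EFinB ltry.
  by rewrite lte_mul_pinfty// ge0_fin_numE.
pose F (n : nat) x := n.+1%:R * (phi (x + n.+1%:R^-1 *: w) - phi x).
have mphi := continuous_measurable2 (smooth_continuous sp).
have mshift (v : plane R) : measurable_fun [set: mplane R] (fun x : mplane R => phi (x + v)).
  apply: (measurableT_comp mphi); apply: isometry_measurable => x y.
  by rewrite /dist opprD addrACA subrr addr0.
have dom (f : plane R -> R) (a : R) : measurable_fun [set: mplane R] (f : mplane R -> R) ->
    (forall x, `|f x| <= a * \1_B x) -> L1on [set: plane R] f.
  move=> mf fK; split=> //; apply: (@le_integrable _ _ _ mu2 setT measurableT _ (fun x => (a * \1_B x)%:E)).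
  - exact/measurable_EFinP.
  - by move=> x _ /=; rewrite lee_fin (le_trans (fK x))// ler_norm.
  - rewrite (_ : (fun x => _) = (fun x => a%:E * (\1_B x)%:E)%E); last by apply/funext => x; rewrite EFinM.
    apply: integrableZl => //; apply/integrableP; split; first exact/measurable_EFinP/measurable_indic.
    rewrite (eq_integral (fun x : mplane R => (\1_B x)%:E)) => [|x _]; last by rewrite /= ger0_norm.
    by rewrite integral_indic// setIT.
have invn (n : nat) : `|n.+1%:R^-1 : R| <= 1 by rewrite ger0_norm ?invr_ge0// invf_le1 ?ler1n.
have FK n x : `|F n x| <= K * \1_B x.
  rewrite indicE; case: (boolP (x \in B)) => [|/negP]; rewrite inE BE => Bx; rewrite ?mulr1 ?mulr0.
    have [t t1 E] := mean_value_line x n.+1%:R^-1 dphi.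
    rewrite /F E mulrCA mulfV// mulr1; apply: hK.
    rewrite (le_trans (ler_normD _ _))// lerD// normrZ -[leRHS]mul1r ler_wpM2r//.
    exact: (le_trans t1).
  have phi0 y : `|N| < `|y| -> phi y = 0.
    move=> h; apply/eqP/negPn/negP => /hN h'.
    by have := lt_le_trans h (le_trans h' (ler_norm N)); rewrite ltxx.
  have hx : `|N| + `|w| < `|x| by rewrite ltNge; apply/negP.
  rewrite /F !phi0 ?subrr ?mulr0 ?normr0//; first by rewrite (le_lt_trans _ hx)// lerDl.
  have := lerB_normD x (n.+1%:R^-1 *: w).
  have : `|n.+1%:R^-1 *: w| <= `|w| by rewrite normrZ -[leRHS]mul1r ler_wpM2r.
  by lra.
have mF n : measurable_fun [set: mplane R] (F n : mplane R -> R).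
  by apply: measurable_funM => //; apply: measurable_funB.
apply: (@Rintegral_dominated R setT F _ (fun x => K * \1_B x) measurableT mF _ (dom _ K _ _)).
- exact: continuous_measurable2.
- by apply: measurable_funM => //; exact: measurable_indic.
- by move=> x; rewrite ger0_norm// mulr_ge0// indicE.
- move=> x _.
  have hc : n.+1%:R^-1 @[n --> \oo] --> (0 : R)^'.
    move=> P [e /= e0 hP].
    have := near_infty_natSinv_lt (PosNum e0); apply: filterS => n /= hn; apply: hP => /=.
      by rewrite sub0r normrN gtr0_norm ?invr_gt0.
    by rewrite gt_eqF// invr_gt0.
  have := cvg_comp _ _ hc (dphi x); apply: cvg_trans.
  suff -> : (fun n => F n x) = (fun h => h^-1 *: ((phi \o shift x) (h *: w) - phi x)) \o (fun n : nat => n.+1%:R^-1) by [].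
  by apply/funext => n; rewrite /F /= invrK (addrC x).
- by move=> n x _; exact: FK.
have L (v : plane R) : mu2.-integrable setT (EFin \o (fun x => phi (x + v))).
  have mv : measurable_fun setT (EFin \o (phi : mplane R -> R)) by exact/measurable_EFinP.
  have iv : isometry (fun x : plane R => x + v).
    by move=> x y; rewrite /dist opprD addrACA subrr addr0.
  have := integrable_isometry (D := setT) iv mv measurableT.
  rewrite preimage_setT => -[h _]; apply: h.
  have [K2 K20 hK2] := continuous_bounded N1 (smooth_continuous sp).
  have [] // := dom phi K2 mphi _ => x.
  rewrite indicE; case: (boolP (x \in B)) => [|/negP]; rewrite inE BE => Bx; rewrite ?mulr1 ?mulr0; first exact: hK2.
  suff -> : phi x = 0 by rewrite normr0.
  apply/eqP/negPn/negP => /hN h; apply: Bx; rewrite (le_trans h)// (le_trans (ler_norm _))// lerDl//.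
have L0 : mu2.-integrable setT (EFin \o phi).
  by have := L 0; rewrite (_ : (fun x => phi (x + 0)) = phi)//; apply/funext => x; rewrite addr0.
move=> n; rewrite /F RintegralZl//; last first.
  by have := integrableB measurableT (L (n.+1%:R^-1 *: w)) L0; congr integrable.
by rewrite RintegralB// integral_translate// subrr mulr0.
Qed.

Lemma integral_by_parts phi psi w : test_function D phi -> test_function D psi ->
  \int[mu2]_(x in D) (phi x * 'D_w psi x + 'D_w phi x * psi x) = 0.
Proof.
move=> [sp cK KD] [sq _ _]; have spq := smoothM sp sq.
have suppD x : phi x != 0 -> (D : set (plane R)) x by move=> px; apply: KD; exact: subset_closure.
have out x : ~ (D : set (plane R)) x -> 'D_w (phi * psi) x = 0.
  move=> nx; have nb : nbhs x (~` closure [set x | phi x != 0]).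
    apply: open_nbhs_nbhs; split; first by apply: closed_openC; exact: closed_closure.
    by move=> /KD.
  rewrite (near_eq_derive (g := cst 0)) ?derive_cst//.
  apply: filterS nb => y ny; rewrite (_ : (phi * psi) y = phi y * psi y)//.
  by apply/eqP; rewrite mulf_eq0; apply/orP; left; apply/negPn/negP => py; apply: ny; exact: subset_closure.
have E : \int[mu2]_x 'D_w (phi * psi) x = 0.
  apply: integral_derive0 => //; exists M => x px; apply/DM/suppD.
  by apply: contra px => /eqP p0; rewrite (_ : (phi * psi) x = phi x * psi x)// p0 mul0r.
rewrite -E /Rintegral; congr fine.
rewrite [LHS]integral_mkcond; apply: eq_integral => x _; rewrite /patch; case: (boolP (x \in _)).
  rewrite inE => Dx; congr EFin; rewrite deriveM; first by congr (_ + _); exact: mulrC.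
    by apply: diff_derivable; exact: smooth_differentiable.
  by apply: diff_derivable; exact: smooth_differentiable.
by move=> /negP; rewrite inE => /out ->.
Qed.

Definition laplacian phi x := partial 0 (partial 0 phi) x + partial 1 (partial 1 phi) x.

(** Green's formula without boundary terms: [partial i phi] is again a test function, so the weak
    gradient of [v] tested against it gives the form identity. *)
Lemma test_neumann phi : test_function D phi ->
  neumann_laplacian (realL2 D phi) (realL2 D (laplacian phi)).
Proof.
move=> tp; have sp : smooth phi by case: tp.
have l2 i : partial i phi \in L2r by apply: Lfun2_smooth; exact: smooth_partial.
have l22 i : partial i (partial i phi) \in L2r by apply: Lfun2_smooth; do 2 apply: smooth_partial.
exists (fun i => realL2 D (partial i phi)).
  move=> psi tq i; have sq : smooth psi by case: tq.
  have tt := integral_by_parts (unit_vector i) tp tq.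
  have FL := ae_filter_ringOfSetsType (lebesgue_on D).
  have key b (g h : plane R -> R) : g \in L2r -> h \in L2r -> part b (cintegral D (fun x => realL2 D g x * (h x)%:C)) =
      part b (\int[mu2]_(x in D) (g x * h x))%:C.
    move=> hg hh; rewrite part_cintegral.
    have mgh : measurable_fun [set: mplane R] (fun x : mplane R => g x * h x).
      by apply: measurable_funM; [exact: (Lfun2_measurable hg)|exact: (Lfun2_measurable hh)].
    transitivity (rpair D (fun x => part b (realL2 D g x)) h).
      by apply: eq_Rintegral => x _; exact: part_mulr.
    case: b => /=.
      by rewrite -(Rintegral_lebesgue_on D mgh); apply: rpair_ae => //; [exact: L2_Re|apply: filterS (realL2E hg) => x ->].
    transitivity (rpair D (fun=> 0) h).
      by apply: rpair_ae => //; [exact: L2_Im|exact: Lfun2_cst0|apply: filterS (realL2E hg) => x ->].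
    rewrite /rpair -[RHS](mul0r (fine (lebesgue_on D setT))) -Rintegral_cst//.
    by apply: eq_Rintegral => x _; rewrite mul0r.
  have lq := Lfun2_smooth sq; have lp := Lfun2_smooth sp; have ldq := Lfun2_smooth (smooth_partial i sq).
  have i1 := Lfun2_mul lp ldq; have i2 := Lfun2_mul (l2 i) lq.
  have m1 : measurable_fun [set: mplane R] (fun x : mplane R => phi x * partial i psi x).
    by apply: measurable_funM; [exact: (Lfun2_measurable lp)|exact: (Lfun2_measurable ldq)].
  have m2 : measurable_fun [set: mplane R] (fun x : mplane R => partial i phi x * psi x).
    by apply: measurable_funM; [exact: (Lfun2_measurable (l2 i))|exact: (Lfun2_measurable lq)].
  have [_ j1] := (L1on_lebesgue_on D m1).1 i1; have [_ j2] := (L1on_lebesgue_on D m2).1 i2.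
  move: tt; rewrite RintegralD// => /eqP; rewrite addr_eq0 => /eqP tt.
  apply: partP => b; rewrite (key b _ _ lp ldq).
  have -> : forall z : R[i], part b (- z) = - part b z by case: b => -[].
  rewrite (key b _ _ (l2 i) lq) tt.
  by case: b {key} => //=; rewrite oppr0.
move=> v dv /weak_gradient_inner wv.
rewrite ord2_sum (realL2D (l22 0) (l22 1)) innerNl innerDl.
have E i : inner (realL2 D (partial i phi)) (dv i) = - inner (realL2 D (partial i (partial i phi))) v.
  rewrite inner_conj [in RHS]inner_conj (wv _ (test_partial i tp) i).
  by rewrite rmorphN opprK.
apply: (etrans (congr2 +%R (E 0) (E 1))); exact/esym/opprD.
Qed.

End NeumannDomain.

(** * Density of the Neumann domain *)

Section OpenGenerate.
Context {R : realType}.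

(** The product sigma-algebra is generated by the two coordinates, which are continuous and thus
    measurable for the sigma-algebra of the open sets. *)
Lemma measurable_open_generated (A : set (mplane R)) : measurable A ->
  <<s [set O : set (plane R) | open O] >> (A : set (plane R)).
Proof.
pose G := [set O : set (plane R) | open O].
have mG (O : set (plane R)) : open O -> G.-sigma.-measurable O by move=> oO; exact: sub_sigma_algebra.
have mproj (f : plane R -> R) : continuous f ->
    measurable_fun [set: g_sigma_algebraType G] (f : g_sigma_algebraType G -> measurableTypeR R).
  move=> cf; apply: (measurability _ (RGenOInfty.measurableE R)) => _ [_ [x ->] <-].
  rewrite setTI; apply: mG; apply: open_comp; last exact: interval_open.
  by move=> y _; exact: cf.
have mid : measurable_fun [set: g_sigma_algebraType G] (id : g_sigma_algebraType G -> mplane R).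
  apply/measurable_fun_pairP; split; apply: mproj => x; [exact: cvg_fst|exact: cvg_snd].
by move=> /(mid measurableT); rewrite setTI.
Qed.

End OpenGenerate.

Section Density.
Context {R : realType}.
Variable D : domain R.
Variable M : R.
Hypothesis DM : forall x, (D : set (plane R)) x -> `|x| <= M.
Local Notation mu2 := (@lebesgue2 R).
Local Notation L2r := (Lfun (lebesgue_on D) 2%:E).
Implicit Types (u v f : L2 D) (F G : plane R -> R).

Let mD := open_measurable2 (domain_open D).

Definition neumann_closure u := forall e : R, 0 < e -> exists v f, neumann_laplacian v f /\ L2norm (u - v) < e.

Lemma neumann_closure_domain v f : neumann_laplacian v f -> neumann_closure v.
Proof. by move=> h e e0; exists v, f; split=> //; rewrite subrr L2norm0. Qed.

Lemma neumann_closureD (a : R[i]) u v : neumann_closure u -> neumann_closure v -> neumann_closure (a *: u + v).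
Proof.
move=> hu hv e e0; set b := Num.sqrt (complex.Re a ^+ 2 + complex.Im a ^+ 2) + 1.
have b0 : 0 < b by rewrite ltr_wpDl// sqrtr_ge0.
have e2 : 0 < e / 2 by rewrite divr_gt0.
have [u' [f [uf h1]]] := hu _ (divr_gt0 e2 b0); have [v' [g [vg h2]]] := hv _ e2.
exists (a *: u' + v'), (a *: f + g); split; first exact: (neumannD DM).
have -> : a *: u + v - (a *: u' + v') = a *: (u - u') + (v - v').
  by rewrite scalerBr opprD addrACA.
rewrite (le_lt_trans (L2normD _ _))// [ltRHS]splitr ltrD//.
rewrite L2normZ; apply: (@le_lt_trans _ _ (b * L2norm (u - u'))).
  by rewrite ler_wpM2r ?L2norm_ge0// lerDl.
by rewrite mulrC -ltr_pdivlMr.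
Qed.

Lemma neumann_closure_closed u : (forall e : R, 0 < e -> exists v, neumann_closure v /\ L2norm (u - v) < e) ->
  neumann_closure u.
Proof.
move=> h e e0; have e2 : 0 < e / 2 by rewrite divr_gt0.
have [v [hv uv]] := h _ e2; have [w [f [hw vw]]] := hv _ e2.
exists w, f; split=> //; have -> : u - w = (u - v) + (v - w) by rewrite addrA subrK.
by rewrite (le_lt_trans (L2normD _ _))// [ltRHS]splitr ltrD.
Qed.

(** Such functions form a space stable under dominated limits. It contains the test functions, hence
    indicators of open sets, then of measurable sets, then simple functions, and finally all of
    [L2r]. *)
Definition approximable F := F \in L2r /\ neumann_closure (realL2 D F).

Lemma approximable_test F : test_function D F -> approximable F.
Proof.
move=> tF; split; first by case: tF => sF _ _; exact: (Lfun2_smooth DM).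
exact: (neumann_closure_domain (test_neumann DM tF)).
Qed.

Lemma approximableD (a : R) F G : approximable F -> approximable G -> approximable (fun x => a * F x + G x).
Proof.
move=> [F2 hF] [G2 hG]; split; first exact: Lfun2D (Lfun2Z _ F2) G2.
rewrite (realL2D (Lfun2Z a F2) G2) (realL2Z a F2).
exact: neumann_closureD.
Qed.

Lemma approximable_ae F G : G \in L2r -> {ae lebesgue_on D, forall x, F x = G x} -> approximable F -> approximable G.
Proof. by move=> hG FG [hF h]; split; [exact: hG|rewrite -(realL2_ae hF hG FG); exact: h]. Qed.

Lemma approximable_limit (F : nat -> plane R -> R) G (g : plane R -> R) : (forall n, approximable (F n)) ->
  G \in L2r -> g \in L2r -> (forall n x, (D : set (plane R)) x -> `|G x - F n x| <= g x) ->
  (forall x, (D : set (plane R)) x -> F n x @[n --> \oo] --> G x) -> approximable G.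
Proof.
move=> aF hG hg bd cv; split=> //; apply: neumann_closure_closed => e e0.
have F2 n : F n \in L2r by case: (aF n).
have mF n := Lfun2_measurable (F2 n); have mG := Lfun2_measurable hG.
have mH n : measurable_fun [set: mplane R] (fun x : mplane R => (G x - F n x) ^+ 2).
  by apply: measurable_funX; apply: measurable_funB.
have [_ [_ ig]] := (Lfun2_L1on D g).1 hg.
have [] := @dominated_convergence _ _ _ mu2 D mD (fun n x => ((G x - F n x) ^+ 2)%:E) (fun=> 0%E) (fun x => (g x ^+ 2)%:E).
- by move=> n; apply/measurable_EFinP; apply: measurable_funTS.
- exact: measurable_cst.
- apply: aeW => x Dx; rewrite -[X in _ --> X]/(0%:E); apply: cvg_EFin; first exact: nearW.
  have h : (fun n => G x - F n x) @ \oo --> (0 : R).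
    by rewrite -(subrr (G x)); apply: cvgB; [exact: cvg_cst|exact: cv].
  rewrite (_ : fine \o _ = (fun n => (G x - F n x) * (G x - F n x))); last first.
    by apply/funext => n; rewrite /= expr2.
  have hh : (fun n => (G x - F n x) * (G x - F n x)) @ \oo --> (0 * 0 : R) by exact: (cvgM h h).
  by rewrite mulr0 in hh.
- exact: ig.
- apply: aeW => x n Dx /=; rewrite lee_fin ger0_norm ?sqr_ge0// -real_normK ?num_real//.
  by rewrite ler_pXn2r// ?nnegrE ?(le_trans _ (bd n x Dx))//; exact: bd.
move=> _ _; rewrite integral0 => /fine_cvgP[_] /cvgrPdist_lt /(_ _ (exprn_gt0 2 e0))[n _ /(_ n (leqnn n))] hn.
exists (realL2 D (F n)); split; first by case: (aF n).
rewrite -(realL2B hG (F2 n)).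
have lB : (fun x => G x - F n x) \in L2r.
  have := Lfun2D hG (Lfun2Z (-1) (F2 n)); rewrite (_ : (fun x => _) = (fun x => G x - F n x))//.
  by apply/funext => x; rewrite mulN1r.
rewrite -(@ltr_pXn2r _ 2)// ?nnegrE ?L2norm_ge0 ?(ltW e0)// L2norm_sqr (rinner_realL2 lB).
move: hn => /=; rewrite sub0r normrN; apply: le_lt_trans.
apply: (le_trans _ (ler_norm _)); rewrite /rpair.
rewrite Rintegral_lebesgue_on; last by apply: measurable_funM; apply: measurable_funB.
by rewrite le_eqVlt; apply/orP; left; apply/eqP; rewrite /Rintegral.
Qed.

Section OpenIndicator.
Variable O : set (plane R).
Hypotheses (oO : open O) (OD : O `<=` D).

Let center (q : rat * rat * nat) : plane R := (ratr q.1.1, ratr q.1.2).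
Let scale (q : rat * rat * nat) : R := q.2.+1%:R.
Let square q := [set x : plane R | `|x - center q| <= (scale q)^-1].
Let ramp (a b c : R) := @smooth_step R \o affine_form a b c.
(** A product of four steps, positive exactly on the open square with centre [center q] and
    half-width [1 / scale q]. *)
Let bump0 q : plane R -> R :=
  ramp (scale q) 0 (1 - scale q * (center q).1) * ramp (- scale q) 0 (1 + scale q * (center q).1) *
  (ramp 0 (scale q) (1 - scale q * (center q).2) * ramp 0 (- scale q) (1 + scale q * (center q).2)).
Let bump q : plane R -> R := if `[< square q `<=` O >] then bump0 q else cst 0.
Let bumps (i : nat) : plane R -> R := if unpickle i is Some q then bump q else cst 0.
(** [1 - prd n n] is smooth and lives on finitely many squares inside [O]. At a point of [O] some
    bump is positive, and the growing power sends [prd n n] to 0; outside [O] all factors are 1. So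
    the indicator of [O] is a bounded pointwise limit of test functions. *)
Let prd (N n : nat) : plane R -> R := fun x => \prod_(i < n) (1 - bumps i x) ^+ N.

Let scale_gt0 q : 0 < scale q. Proof. by rewrite /scale ltr0n. Qed.

Let smooth_bumps i : smooth (bumps i).
Proof.
rewrite /bumps; case: unpickle => [q|]; last exact: smooth_cst.
rewrite /bump; case: asboolP => _; last exact: smooth_cst.
exact: (smoothM (smoothM (smooth_step_affine _ _ _) (smooth_step_affine _ _ _))
  (smoothM (smooth_step_affine _ _ _) (smooth_step_affine _ _ _))).
Qed.

Let bump0E q x : bump0 q x =
  smooth_step (1 + scale q * (x.1 - (center q).1)) * smooth_step (1 - scale q * (x.1 - (center q).1)) *
  (smooth_step (1 + scale q * (x.2 - (center q).2)) * smooth_step (1 - scale q * (x.2 - (center q).2))).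
Proof.
rewrite /bump0 !fctE /ramp /affine_form /=; congr (smooth_step _ * smooth_step _ * (smooth_step _ * smooth_step _)); ring.
Qed.

Let steps_ge0 (a b : R) : 0 <= smooth_step a * smooth_step b.
Proof. exact: (mulr_ge0 (smooth_step_ge0 a) (smooth_step_ge0 b)). Qed.

Let steps_le1 (a b : R) : smooth_step a * smooth_step b <= 1.
Proof.
exact: (mulr_ile1 (smooth_step_ge0 a) (smooth_step_ge0 b) (smooth_step_le1 a) (smooth_step_le1 b)).
Qed.

Let bump0_gt0 q x : (0 < bump0 q x) = (`|x - center q| < (scale q)^-1).
Proof.
have s0 := scale_gt0 q.
have pm (t : R) : (0 < smooth_step (1 + scale q * t) * smooth_step (1 - scale q * t)) = (`|t| < (scale q)^-1).
  have [h|h] := ltP 0 (1 + scale q * t).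
    rewrite pmulr_rgt0 ?smooth_step_gt0// subr_gt0 ltr_norml.
    have -> : (t < (scale q)^-1) = (scale q * t < 1) by rewrite -ltr_pdivlMl// mulr1.
    have -> : - (scale q)^-1 < t by rewrite -(ltr_pM2l s0) mulrN divff ?gt_eqF//; lra.
    by [].
  rewrite (smooth_step0 h) mul0r ltxx ltr_norml.
  have -> : - (scale q)^-1 < t = false; last by [].
  by apply/negbTE; rewrite -leNgt -(ler_pM2l s0) mulrN divff ?gt_eqF//; lra.
rewrite bump0E norm_planeE gt_max -!pm /=.
move: (steps_ge0 (1 + scale q * (x.1 - (center q).1)) (1 - scale q * (x.1 - (center q).1))).
move: (steps_ge0 (1 + scale q * (x.2 - (center q).2)) (1 - scale q * (x.2 - (center q).2))).
move: (smooth_step _ * smooth_step _) => b b0; move: (smooth_step _ * smooth_step _) => a a0.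
rewrite !lt_def mulr_ge0// a0 b0 !andbT.
by rewrite mulf_eq0 negb_or.
Qed.

Let bump0_ge0 q x : 0 <= bump0 q x.
Proof. by rewrite bump0E; exact: (mulr_ge0 (steps_ge0 _ _) (steps_ge0 _ _)). Qed.

Let bump0_le1 q x : bump0 q x <= 1.
Proof. by rewrite bump0E; exact: (mulr_ile1 (steps_ge0 _ _) (steps_ge0 _ _) (steps_le1 _ _) (steps_le1 _ _)). Qed.

Let bumps_ge0 i x : 0 <= bumps i x.
Proof. by rewrite /bumps; case: unpickle => // q; rewrite /bump; case: asboolP. Qed.

Let bumps_le1 i x : bumps i x <= 1.
Proof. by rewrite /bumps; case: unpickle => [q|]; [rewrite /bump; case: asboolP => _; [exact: bump0_le1|]|]. Qed.

Let bumps_compact i : exists A, [/\ compact A, A `<=` O & forall x, bumps i x != 0 -> A x].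
Proof.
have triv : exists A, [/\ compact A, A `<=` O & forall x : plane R, (cst 0 : plane R -> R) x != 0 -> A x].
  by exists set0; split; [exact: compact0|by []|move=> x; rewrite /cst eqxx].
rewrite /bumps; case: unpickle => [q|] //; rewrite /bump; case: asboolP => // qO.
exists (square q); split=> //.
  apply: (@closed_bounded_compact _ _ ((scale q)^-1 + `|center q|)).
    rewrite (_ : square q = (fun x => `|x - center q|) @^-1` [set y | y <= (scale q)^-1])//.
    apply: preimage_closed; last exact: closed_le.
    by move=> x _; apply: cvg_norm; apply: cvgB; [exact: cvg_id|exact: cvg_cst].
  by move=> x sx; rewrite -(subrK (center q) x) (le_trans (ler_normD _ _))// lerD2r.
move=> x b0; apply/ltW; rewrite -bump0_gt0 lt_def b0/=; exact: bump0_ge0.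
Qed.

Let prd_compact N n : exists A, [/\ compact A, A `<=` O & forall x, prd N n x != 1 -> A x].
Proof.
elim: n => [|n [A [cA AO hA]]].
  by exists set0; split; [exact: compact0|by []|move=> x; rewrite /prd big_ord0 eqxx].
have [B [cB BO hB]] := bumps_compact n.
exists (A `|` B); split; [exact: compactU|by move=> x [/AO|/BO]|].
move=> x; rewrite /prd big_ord_recr /=.
have [p1|/hA Ax _] := eqVneq (prd N n x) 1; last by left.
rewrite [X in X * _]p1 mul1r; have [->|/hB] := eqVneq (bumps n x) 0; last by right.
by rewrite subr0 expr1n eqxx.
Qed.

Let smooth_prd N n : smooth (prd N n).
Proof.
have sE k i : smooth (fun x => (1 - bumps i x) ^+ k).
  elim: k => [|k ih]; first exact: (smooth_cst 1).
  rewrite (_ : (fun x => _) = (cst 1 - bumps i) * (fun x => (1 - bumps i x) ^+ k)).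
    exact: (smoothM (smoothB (smooth_cst 1) (smooth_bumps i)) ih).
  by apply/funext => x; rewrite exprS.
elim: n => [|n ih].
  rewrite (_ : prd N 0 = cst 1); first exact: smooth_cst.
  by apply/funext => x; rewrite /prd big_ord0.
rewrite (_ : prd N n.+1 = prd N n * (fun x => (1 - bumps n x) ^+ N)); first exact: (smoothM ih (sE N n)).
by apply/funext => x; rewrite /prd big_ord_recr.
Qed.

Let bumps_cover x : O x -> exists2 i, 0 < bumps i x & True.
Proof.
move=> Ox; have /nbhs_ballP[e /= e0 xeO] : nbhs x O by exact: open_nbhs_nbhs.
have e20 : 0 < e / 2 by rewrite divr_gt0.
have [n _ /(_ n (leqnn n)) /= ne] := near_infty_natSinv_lt (PosNum e20).
have n0 : 0 < n.+1%:R^-1 :> R by rewrite invr_gt0.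
have ratP (y : R) : exists q : rat, `|y - ratr q| < n.+1%:R^-1.
  have [q] := @rat_in_itvoo R (y - n.+1%:R^-1) (y + n.+1%:R^-1) ltac:(by rewrite ltrD2l gtrN).
  by rewrite inE /= => /andP[h1 h2]; exists q; rewrite ltr_distlC; apply/andP; split; [exact: h1|exact: h2].
have [q1 h1] := ratP x.1; have [q2 h2] := ratP x.2.
pose q := (q1, q2, n); exists (pickle q) => //.
have xq : `|x - center q| < (scale q)^-1 by rewrite norm_planeE gt_max h1 h2.
rewrite /bumps pickleK /bump asboolT ?bump0_gt0// => y yq; apply: xeO.
rewrite -ball_normE /ball_/=; rewrite -(subrKA (center q)) (le_lt_trans (ler_normD _ _))//.
rewrite (distrC (center q)) [ltRHS]splitr ltrD// ?(lt_trans xq ne)//.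
exact: le_lt_trans yq ne.
Qed.

Lemma approximable_open_sub : approximable (\1_O : plane R -> R).
Proof.
have mO : measurable (O : set (mplane R)) by exact: open_measurable2.
have p01 N n x : 0 <= prd N n x <= 1.
  rewrite /prd; elim: n => [|n /andP[ih1 ih2]]; first by rewrite big_ord0 ler01 lexx.
  rewrite big_ord_recr /=; have b1 := bumps_le1 n x; have b0 := bumps_ge0 n x.
  by rewrite mulr_ge0 ?exprn_ge0 ?subr_ge0//= mulr_ile1 ?exprn_ge0 ?exprn_ile1 ?subr_ge0// lerBlDr lerDl.
pose F n x := 1 - prd n n x.
have tF n : test_function D (F n).
  have [A [cA AO hA]] := prd_compact n n.
  apply: (test_functionI (A := A)) => //; [exact: (smoothB (smooth_cst 1) (smooth_prd n n))|by move=> x /AO/OD|].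
  by move=> x; rewrite /F subr_eq0 eq_sym => /hA.
have i01 x : 0 <= (\1_O x : R) <= 1 by rewrite indicE; case: (_ \in _); rewrite ?ler01 ?lexx.
apply: (@approximable_limit F _ (fun=> 1)).
- by move=> n; exact: approximable_test.
- apply: (Lfun2_bounded DM (K := 1)); first exact: measurable_indic.
  by move=> x _; have /andP[h1 h2] := i01 x; rewrite ger0_norm.
- by apply: (Lfun2_bounded DM (K := 1)) => [|x _]; rewrite ?normr1//.
- move=> n x _; have /andP[h1 h2] := i01 x; have /andP[h3 h4] := p01 n n x.
  by rewrite /F ler_norml; apply/andP; split; lra.
move=> x Dx; rewrite indicE; case: (boolP (x \in O)) => [|/negP]; rewrite inE => Ox /=.
  have [i b0 _] := bumps_cover Ox.
  suff h : prd n n x @[n --> \oo] --> (0 : R).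
    by rewrite /F -[X in _ --> X]subr0; apply: cvgB; [exact: cvg_cst|exact: h].
  have b1 := bumps_le1 i x.
  have hg : (1 - bumps i x) ^+ n @[n --> \oo] --> (0 : R).
    by apply: cvg_expr; rewrite ger0_norm ?subr_ge0// ltrBlDr ltrDl.
  apply: (squeeze_cvgr _ (cvg_cst 0) hg); exists i.+1 => // n /= ni.
  have /andP[-> _] := p01 n n x; rewrite /prd (bigD1 (Ordinal ni))//= ler_piMr ?exprn_ge0 ?subr_ge0//.
  apply: prodr_ile1 => j _; have := bumps_le1 j x; have := bumps_ge0 j x => c0 c1.
  by rewrite exprn_ge0 ?subr_ge0//= exprn_ile1 ?subr_ge0// lerBlDr lerDl.
rewrite (_ : (fun n => F n x) = cst 0); first exact: cvg_cst.
apply/funext => n; rewrite /F; have [A [cA AO hA]] := prd_compact n n.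
have [->|/hA/AO//] := eqVneq (prd n n x) 1; by rewrite subrr.
Qed.

End OpenIndicator.

Lemma Lfun2_indic (A : set (mplane R)) : measurable A -> (\1_A : plane R -> R) \in L2r.
Proof.
move=> mA; apply: (Lfun2_bounded DM (K := 1)); first exact: measurable_indic.
by move=> x _; rewrite indicE; case: (_ \in _); rewrite ?normr1 ?normr0.
Qed.

Lemma Lfun2_one : (fun=> 1 : R) \in L2r.
Proof. by apply: (Lfun2_bounded DM (K := 1)) => [|x _]; rewrite ?normr1. Qed.

Lemma approximable_open (O : set (plane R)) : open O -> approximable (\1_O : plane R -> R).
Proof.
move=> oO; have oI : open (O `&` D) by apply: openI => //; exact: domain_open.
have FL := ae_filter_ringOfSetsType (lebesgue_on D).
apply: (@approximable_ae (\1_(O `&` D))).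
- by apply: Lfun2_indic; exact: open_measurable2.
- by apply: filterS (ae_lebesgue_on D) => x Dx; rewrite !indicE in_setI (mem_set Dx) andbT.
- by apply: approximable_open_sub => // x [].
Qed.

(** Sets with approximable indicator form a lambda-system: proper differences by linearity,
    increasing unions by dominated convergence with the bound 1 on the bounded set [D]. It contains
    the open sets, which are stable under intersection and generate. *)
Lemma approximable_measurable (A : set (mplane R)) : measurable A -> approximable (\1_A : plane R -> R).
Proof.
move=> mA; have := measurable_open_generated mA.
pose H := [set B : set (plane R) | measurable (B : set (mplane R)) /\ approximable (\1_B : plane R -> R)].
suff h : <<s [set O : set (plane R) | open O] >> `<=` H by move=> /h[].
apply: lambda_system_subset => //.
- by move=> B1 B2 /= o1 o2; exact: openI.
- split; [by move=> B _ x _| | |].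
  + by split; [exact: measurableT|exact: approximable_open openT].
  + move=> B1 B2 B21 [m1 a1] [m2 a2]; split; first exact: measurableD.
    have E : (\1_(B1 `\` B2) : plane R -> R) = (fun x => -1 * \1_B2 x + \1_B1 x).
      apply/funext => x; rewrite !indicE in_setD.
      have [x2|x2] := boolP (x \in B2); last by rewrite andbT mulr0 add0r.
      have x1 : x \in B1 by rewrite inE; apply: B21; rewrite inE in x2.
      by rewrite x1 /= mulN1r addNr.
    by rewrite E; exact: approximableD.
  + move=> B ndB HB; have mU : measurable (\bigcup_n B n : set (mplane R)).
      by apply: bigcup_measurable => n _; case: (HB n).
    split=> //; apply: (@approximable_limit (fun n => \1_(B n)) _ (fun=> 1)).
    * by move=> n; case: (HB n).
    * exact: Lfun2_indic.
    * exact: Lfun2_one.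
    * move=> n x _; rewrite !indicE.
      by case: (_ \in _); case: (_ \in _); rewrite ?subrr ?normr0 ?subr0 ?sub0r ?normrN ?normr1.
    * move=> x _; rewrite indicE; case: (boolP (x \in _)) => [|/negP]; rewrite inE.
        move=> [n _ Bn]; apply: cvg_near_cst; exists n => // m /= nm.
        rewrite indicE mem_set//; apply: subsetPset Bn.
        exact: (ndB _ _ nm).
      move=> nB; apply: cvg_near_cst; apply: nearW => m; rewrite indicE memNset// => Bm.
      by apply: nB; exists m.
- by move=> B /=; split; [exact: open_measurable2|exact: approximable_open].
Qed.

Lemma approximable_sum n (a : 'I_n -> R) (F : 'I_n -> plane R -> R) :
  (forall i, approximable (F i)) -> approximable (fun x => \sum_i a i * F i x).
Proof.
move=> aF; suff H (r : seq 'I_n) : approximable (fun x => \sum_(i <- r) a i * F i x) by exact: H.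
elim: r => [|i r ih].
  have := approximable_open open0; rewrite (_ : \1_set0 = (fun=> 0 : R)); last by apply/funext => x; rewrite indic0.
  by under [X in _ -> approximable X]eq_fun do rewrite big_nil.
by under eq_fun do rewrite big_cons; exact: (approximableD (a i) (aF i) ih).
Qed.

Import HBNNSimple.

Lemma approximable_nonneg F : F \in L2r -> (forall x, 0 <= F x) -> approximable F.
Proof.
move=> F2 F0; have mF := Lfun2_measurable F2.
have mE : measurable_fun setT (EFin \o (F : mplane R -> R)) by exact/measurable_EFinP.
pose s := nnsfun_approx measurableT mE.
have E0 (x : mplane R) : [set: mplane R] x -> (0 <= (EFin \o F) x)%E by move=> _; rewrite lee_fin F0.
have cv x : s n x @[n --> \oo] --> F x.
  by have /fine_cvgP[_ h] := cvg_nnsfun_approx measurableT mE E0 (x := x) I; exact: h.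
have le n x : s n x <= F x.
  have nd : nondecreasing_seq (fun n => s n x).
    by move=> a b ab; have /lefP := nd_nnsfun_approx measurableT mE ab; exact.
  by have := nondecreasing_cvgn_le nd (cvgP _ (cv x)) n; rewrite (cvg_lim _ (cv x)).
apply: (@approximable_limit (fun n => s n : plane R -> R) _ F) => //.
- move=> n; have -> : (s n : plane R -> R) = _ := funext (fimfunEord (s n)).
  by apply: approximable_sum => i; apply: approximable_measurable.
- move=> n x _; rewrite ger0_norm ?subr_ge0// lerBlDr lerDl.
  exact: fun_ge0.
Qed.

Lemma approximable_all F : F \in L2r -> approximable F.
Proof.
move=> F2; have mF := Lfun2_measurable F2.
have n2 : (fun x => `|F x|) \in L2r.
  apply/Lfun2_L1on; split; first exact: measurableT_comp.
  have [_ h] := (Lfun2_L1on D F).1 F2.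
  by under eq_fun do rewrite real_normK ?num_real//.
have p2 : (fun x => 2^-1 * (`|F x| + F x)) \in L2r by exact: Lfun2Z (Lfun2D n2 F2).
have m2 : (fun x => 2^-1 * (`|F x| + -1 * F x)) \in L2r by exact: Lfun2Z (Lfun2D n2 (Lfun2Z _ F2)).
have ap := approximable_nonneg p2; have am := approximable_nonneg m2.
have -> : F = (fun x => -1 * (2^-1 * (`|F x| + -1 * F x)) + 2^-1 * (`|F x| + F x)).
  by apply/funext => x; field.
apply: approximableD.
  by apply: am => x; rewrite mulr_ge0// mulN1r subr_ge0 ler_norm.
by apply: ap => x; apply: mulr_ge0 => //; have := ler_norm (- F x); rewrite normrN; lra.
Qed.

Theorem neumann_domain_dense u (e : R) : 0 < e -> exists v f, neumann_laplacian v f /\ L2norm (u - v) < e.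
Proof.
move: e; rewrite (L2_split u) addrC; apply: neumann_closureD.
  by case: (approximable_all (L2_Im u)).
by case: (approximable_all (L2_Re u)).
Qed.

End Density.

(** * Similarity of the Neumann semigroups *)

Section Conjugation.
Context {R : realType}.
Variables (D1 D2 : domain R).
Variables (U : {linear L2 D1 -> L2 D2}) (V : {linear L2 D2 -> L2 D1}).
Hypotheses (bU : bounded_operator U) (bV : bounded_operator V) (UK : cancel U V) (VK : cancel V U).
Variable S : R -> {linear L2 D2 -> L2 D2}.

Lemma conjugate_semigroup_linear t : linear (fun u => V (S t (U u))).
Proof. by move=> a u v; rewrite !linearP. Qed.

Definition conjugate_semigroup t : {linear L2 D1 -> L2 D1} :=
  HB.pack (fun u => V (S t (U u))) (GRing.isLinear.Build _ _ _ _ _ (conjugate_semigroup_linear t)).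

Lemma bounded_operatorP (D D' : domain R) (F : L2 D -> L2 D') : bounded_operator F ->
  exists2 m : R, 0 < m & forall u, L2norm (F u) <= m * L2norm u.
Proof.
move=> [m hm]; exists (`|m| + 1); first by rewrite ltr_wpDl.
move=> u; apply: (le_trans (hm u)); apply: ler_wpM2r; first exact: L2norm_ge0.
by rewrite (le_trans (ler_norm _))// lerDl.
Qed.

Lemma bounded_cvg0 (D D' : domain R) (F : L2 D -> L2 D') (G : R -> L2 D) : bounded_operator F ->
  L2norm (G t) @[t --> 0^'+] --> (0 : R) -> L2norm (F (G t)) @[t --> 0^'+] --> (0 : R).
Proof.
move=> /bounded_operatorP[m m0 hm] hG.
apply/(right_limit0P (f := fun t => L2norm (F (G t))) (fun t => L2norm_ge0 _)) => e e0.
have := (right_limit0P (f := fun t => L2norm (G t)) (fun t => L2norm_ge0 _)).1 hG _ (divr_gt0 e0 m0).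
move=> [d d0 hd]; exists d => // t t0 td; apply: (le_lt_trans (hm _)).
by rewrite mulrC -ltr_pdivlMr//; exact: hd.
Qed.

Lemma conjugate_semigroup_generated (A1 : L2 D1 -> L2 D1 -> Prop) (A2 : L2 D2 -> L2 D2 -> Prop) :
  (forall u f, A1 u f -> A2 (U u) (U f)) -> (forall u f, A2 u f -> A1 (V u) (V f)) ->
  semigroup_generated_by S A2 -> semigroup_generated_by conjugate_semigroup A1.
Proof.
move=> h12 h21 [bd sg sc gen]; split.
- move=> t t0; have [m m0 hm] := bounded_operatorP (bd t t0).
  have [mu mu0 hmu] := bounded_operatorP bU; have [mv mv0 hmv] := bounded_operatorP bV.
  exists (mv * (m * mu)) => u; apply: (le_trans (hmv _)); rewrite -mulrA; apply: (ler_wpM2l (ltW mv0)).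
  by apply: (le_trans (hm _)); rewrite -mulrA; apply: (ler_wpM2l (ltW m0)); exact: hmu.
- by move=> s t s0 t0 u; rewrite /= VK sg.
- move=> u; have := bounded_cvg0 bV (sc (U u)).
  by under eq_fun do rewrite linear_L2B UK.
- have E t u f : (t^-1)%:C *: (V (S t (U u)) - u) - f = V ((t^-1)%:C *: (S t (U u) - U u) - U f).
    transitivity (V ((t^-1)%:C *: (S t (U u) - U u)) - V (U f)); last by apply/esym; exact: linear_L2B.
    rewrite UK; congr (_ - f); apply/esym; apply: (etrans (linear_L2Z V _ _)); congr (_ *: _).
    by apply: (etrans (linear_L2B V _ _)); rewrite UK.
  move=> u f; split=> [/h12/gen h|h].
    by have := bounded_cvg0 bV h; under eq_fun do rewrite -E.
  rewrite -[u]UK -[f]UK; apply/h21/gen.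
  have := bounded_cvg0 bU h.
  by under eq_fun do rewrite /= E VK.
Qed.

End Conjugation.

(** The conjugate of [S2] by [U] has the same generator as [S1], and uniqueness identifies the
    two. *)
Theorem neumann_semigroups_similar (R : realType) (p : 'I_3 -> plane R)
    (tau1 tau2 : 'I_7 -> plane R -> plane R)
    (S1 : R -> {linear L2 (glued p tau1) -> L2 (glued p tau1)})
    (S2 : R -> {linear L2 (glued p tau2) -> L2 (glued p tau2)}) :
  nondegenerate_triangle p -> unfolding p E1 tau1 -> unfolding p E2 tau2 ->
  admissible p tau1 E1 -> admissible p tau2 E2 ->
  semigroup_generated_by S1 (@neumann_laplacian R (glued p tau1)) ->
  semigroup_generated_by S2 (@neumann_laplacian R (glued p tau2)) ->
  similar_semigroups S1 S2.
Proof.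
move=> ndg u1 u2 a1 a2 g1 g2.
have [U [V [bU bV UK VK [h12 h21]]]] := neumann_laplacians_similar ndg u1 u2 a1 a2.
have [M hM] := glued_bounded ndg good_E1 u1.
exists U, V; split=> // t t0 u.
have gW := conjugate_semigroup_generated bU bV UK VK h12 h21 g2.
apply: (semigroup_unique g1 gW) t0.
- move=> v w f g hv hw; have := neumannD hM (-1) hw hv.
  by rewrite !scaleN1r ![- _ + _]addrC.
- by move=> v f; exact: neumann_dissipative.
- by move=> v e e0; exact: (neumann_domain_dense hM).
Qed.

(** * Areas of small discs *)

Section Area.
Context {R : realType}.
Local Notation mu2 := (@lebesgue2 R).
Implicit Types (A B O : set (plane R)) (x y : plane R) (r : R).

Definition disc x r : set (plane R) := [set y | dist y x < r].

Lemma dist_continuous x : continuous (fun y : plane R => dist y x).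
Proof.
move=> y; apply: (@continuous_comp _ _ _ (fun y => dot (y - x) (y - x)) Num.sqrt); last exact: sqrt_continuous.
have -> : (fun y => dot (y - x) (y - x)) = (fun y => affine_form 1 0 (- x.1) y * affine_form 1 0 (- x.1) y +
    affine_form 0 1 (- x.2) y * affine_form 0 1 (- x.2) y).
  by apply/funext => z; rewrite /dot /affine_form /=; ring.
by apply: cvgD; apply: cvgM; exact: affine_form_continuous.
Qed.

Lemma disc_open x r : open (disc x r).
Proof.
rewrite (_ : disc x r = (fun y => dist y x) @^-1` [set t | t < r])//.
by apply: open_comp; [move=> y _; exact: dist_continuous|exact: open_lt].
Qed.

Lemma disc_measurable x r : measurable (disc x r : set (mplane R)).
Proof. by apply: open_measurable2; exact: disc_open. Qed.

Lemma disc_finite A x r : measurable (A : set (mplane R)) -> (mu2 (A `&` disc x r) < +oo)%E.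
Proof.
move=> mA; apply: (@le_lt_trans _ _ (mu2 (disc x r))).
  by apply: le_measure; rewrite ?inE; [apply: measurableI => //; exact: disc_measurable|exact: disc_measurable|exact: subIsetr].
have h := @bounded_measure R (Domain (@disc_open x r)) (`|x| + r) _; apply: h => y /= yr.
by rewrite -(subrK x y) addrC (le_trans (ler_normD _ _))// lerD2l (le_trans (dist_norm _ _))// ltW.
Qed.

Definition area A x r : R := fine (mu2 (A `&` disc x r)).

Lemma areaE A x r : measurable (A : set (mplane R)) -> (area A x r)%:E = mu2 (A `&` disc x r).
Proof. by move=> mA; rewrite fineK// ge0_fin_numE// disc_finite. Qed.

Lemma area_ge0 A x r : 0 <= area A x r.
Proof. exact: fine_ge0. Qed.

Lemma area_isometry f A x r : isometry f -> measurable (A : set (mplane R)) ->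
  area (f @^-1` A) x r = area A (f x) r.
Proof.
move=> hf mA.
have E : f @^-1` A `&` disc x r = f @^-1` (A `&` disc (f x) r).
  by apply/seteqP; split=> y [h1 h2]; split=> //=; move: h2; rewrite /disc /= hf.
have [_ h] := isometry_measure_preserving hf.
have mI : measurable (A `&` disc (f x) r : set (mplane R)) by apply: measurableI => //; exact: disc_measurable.
by rewrite /area E (h _ mI).
Qed.

Lemma area_local A B x r : (forall y, dist y x < r -> A y <-> B y) -> area A x r = area B x r.
Proof. by move=> h; rewrite /area; congr (fine (mu2 _)); apply/seteqP; split=> y [h1 h2]; split=> //; apply/h. Qed.

Lemma area_le A B x r : measurable (A : set (mplane R)) -> measurable (B : set (mplane R)) -> A `<=` B ->
  area A x r <= area B x r.
Proof.
move=> mA mB AB; rewrite -lee_fin !areaE//.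
have mD := disc_measurable x r.
by apply: le_measure; rewrite ?inE; [exact: measurableI|exact: measurableI|exact: setSI].
Qed.

Lemma open_measure_gt0 O : open O -> O !=set0 -> (0 < mu2 O)%E.
Proof.
move=> oO [x Ox]; have /nbhs_ballP[e /= e0 xeO] : nbhs x O by exact: open_nbhs_nbhs.
pose I (c : R) : set (measurableTypeR R) := `]c - e, c + e[%classic.
have mI c : measurable (I c) by exact: measurable_itv.
have I0 c : (0 < @lebesgue_measure R (I c))%E.
  by rewrite lebesgue_measure_itv/= lte_fin ltrD2l gtrN// -EFinB lte_fin; lra.
apply: (@lt_le_trans _ _ (mu2 (I x.1 `*` I x.2))).
  have -> : mu2 (I x.1 `*` I x.2) = (@lebesgue_measure R (I x.1) * @lebesgue_measure R (I x.2))%E by exact: product_measure1E.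
  by rewrite mule_gt0.
apply: le_measure; rewrite ?inE; [exact: measurableX|exact: open_measurable2|].
move=> y [/= h1 h2]; move: h1 h2; rewrite /I /= !in_itv/= => h1 h2; apply: xeO.
by split; rewrite /ball /= ltr_distlC.
Qed.

Lemma area_lt A B O x r : measurable (A : set (mplane R)) -> measurable (B : set (mplane R)) -> A `<=` B ->
  open O -> O `<=` B `\` A -> (O `&` disc x r) !=set0 -> area A x r < area B x r.
Proof.
move=> mA mB AB oO OBA O0; have mD := disc_measurable x r.
have mO : measurable (O : set (mplane R)) by exact: open_measurable2.
rewrite -lte_fin !areaE//.
have fin A' : measurable (A' : set (mplane R)) -> mu2 (A' `&` disc x r) \is a fin_num.
  by move=> mA'; rewrite ge0_fin_numE// disc_finite.
apply: (@lt_le_trans _ _ (mu2 (A `&` disc x r) + mu2 (O `&` disc x r))%E).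
  by rewrite lteDl ?fin//; apply: open_measure_gt0 => //; apply: openI => //; exact: disc_open.
rewrite -measureU; [|exact: measurableI|exact: measurableI|].
  apply: le_measure; rewrite ?inE; [by apply: measurableU; exact: measurableI|exact: measurableI|].
  by move=> y [[/AB]|[/OBA[]]].
by apply/seteqP; split=> // y [[Ay _] [/OBA[_]]].
Qed.

(** The sector at 0 between the positive first axis and the ray through [(k, 1)]: [k] is the
    cotangent of its opening angle. [half] is the case of a straight angle. *)
Definition wedge (k : R) : set (plane R) := [set x | 0 < x.2 /\ k * x.2 < x.1].
Definition half : set (plane R) := [set x | 0 < x.2].

Lemma affine_open (a b c : R) : open [set x : plane R | 0 < affine_form a b c x].
Proof.
rewrite (_ : [set x | _] = affine_form a b c @^-1` [set t | 0 < t])//.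
by apply: open_comp; [move=> x _; exact: affine_form_continuous|exact: open_gt].
Qed.

Lemma half_open : open half.
Proof.
rewrite (_ : half = [set x | 0 < affine_form 0 1 0 x]); first exact: affine_open.
by apply/seteqP; split=> x; rewrite /half /affine_form /= mul0r add0r mul1r addr0.
Qed.

Lemma wedge_open k : open (wedge k).
Proof.
rewrite (_ : wedge k = half `&` [set x | 0 < affine_form 1 (- k) 0 x]).
  by apply: openI; [exact: half_open|exact: affine_open].
by apply/seteqP; split=> x [h1 h2]; split=> //; move: h2; rewrite /affine_form /=; lra.
Qed.

Lemma slope_point (m r : R) : 0 < r -> exists2 d, 0 < d & disc 0 r (d * m, d).
Proof.
move=> r0; have m0 : 0 < 4 * (`|m| + 1) by rewrite mulr_gt0// ltr_wpDl.
exists (r / (4 * (`|m| + 1))); first by rewrite divr_gt0.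
set d := r / _; have d0 : 0 < d by rewrite divr_gt0.
have dE : d * (4 * (`|m| + 1)) = r by rewrite /d divfK// gt_eqF.
have n0 : 0 <= `|m| by [].
rewrite /disc /=; apply: (le_lt_trans (norm_dist _ _)); rewrite subr0 norm_planeE /= normrM (gtr0_norm d0).
have : Num.max (d * `|m|) d <= d * (`|m| + 1) by rewrite ge_max; apply/andP; split; nra.
by nra.
Qed.

(** Angles decrease as cotangents increase; the gap between the two sectors contains a ray of
    intermediate cotangent, hence a nonempty open set in every disc. *)
Lemma wedge_decreasing k k' r : 0 < r -> k < k' -> area (wedge k') 0 r < area (wedge k) 0 r.
Proof.
move=> r0 kk; apply: (@area_lt _ _ (half `&` ([set x | 0 < affine_form 1 (- k) 0 x] `&` [set x | 0 < affine_form (-1) k' 0 x]))).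
- by apply: open_measurable2; exact: wedge_open.
- by apply: open_measurable2; exact: wedge_open.
- by move=> x [x2 h]; split=> //; rewrite (le_lt_trans _ h)// ler_wpM2r ?ltW.
- by apply: openI; [exact: half_open|apply: openI; exact: affine_open].
- move=> x [x2 []]; rewrite /affine_form /= => h1 h2; split; first by split=> //; lra.
  by move=> [_]; lra.
have [d d0 hd] := slope_point ((k + k') / 2) r0.
exists (d * ((k + k') / 2), d); split=> //; rewrite /half /affine_form /=; split=> //; split=> /=; nra.
Qed.

Lemma wedge_gt0 k r : 0 < r -> 0 < area (wedge k) 0 r.
Proof.
move=> r0; apply: le_lt_trans (wedge_decreasing r0 (_ : k < k + 1)); first exact: area_ge0.
by rewrite ltrDl.
Qed.

Lemma wedge_half k r : 0 < r -> area (wedge k) 0 r < area half 0 r.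
Proof.
move=> r0; apply: (@area_lt _ _ (half `&` [set x | 0 < affine_form (-1) k 0 x])).
- by apply: open_measurable2; exact: wedge_open.
- by apply: open_measurable2; exact: half_open.
- by move=> x [].
- by apply: openI; [exact: half_open|exact: affine_open].
- move=> x [x2]; rewrite /affine_form /= => h; split=> // -[_]; lra.
have [d d0 hd] := slope_point (k - 1) r0.
by exists (d * (k - 1), d); split=> //; rewrite /half /affine_form /=; split=> //=; nra.
Qed.

Lemma isometry_shift (v : plane R) : isometry (fun x => x + v).
Proof. by move=> x y; rewrite /dist opprD addrACA subrr addr0. Qed.

Lemma half_shift (a r : R) : area half (a, 0) r = area half 0 r.
Proof.
have mh : measurable (half : set (mplane R)) by apply: open_measurable2; exact: half_open.
rewrite -[(a, 0)]add0r -(area_isometry 0 r (isometry_shift (a, 0)) mh).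
by apply: area_local => y _; rewrite /half /= addr0.
Qed.

Lemma half_le_all x r : area half 0 r <= area setT x r.
Proof.
rewrite -[x]add0r -(area_isometry 0 r (isometry_shift x) measurableT) preimage_setT.
by apply: area_le => //; apply: open_measurable2; exact: half_open.
Qed.

End Area.

(** * The triangle in small discs around its points *)

Section LocalShape.
Context {R : realType}.
Variable p : 'I_3 -> plane R.
Hypothesis ndg : nondegenerate_triangle p.
Local Notation T := (open_triangle p).
Implicit Types (i j : 'I_3) (x y : plane R).

Let mT := triangle_measurable ndg.

Definition side_length j : R := Num.sqrt (dot (p (j + 2) - p (j + 1)) (p (j + 2) - p (j + 1))).
Definition height j : R := Num.sqrt (dot (normal p j) (normal p j)).

(** Orthonormal coordinates with origin [p (j + 1)] and first axis along side [j]: [tang] and [bary]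
    rescaled to lengths. *)
Definition side_frame j x : plane R := (tang p j x * side_length j, bary p j x * height j).

Lemma dot_gt0 x : x != 0 -> 0 < dot x x.
Proof. by move=> x0; rewrite lt_def dot_ge0 andbT; apply: contra x0 => /eqP/dot_eq0 ->. Qed.

Lemma side_length_gt0 j : 0 < side_length j.
Proof. by rewrite sqrtr_gt0 lt_def dot_ge0 (side_vector_neq0 ndg). Qed.

Lemma normal_neq0 j : normal p j != 0.
Proof.
apply/eqP => n0; have := bary_normal ndg j (p (j + 1)) 1.
by rewrite n0 scaler0 addr0 => /eqP; rewrite -subr_eq0 opprD addrA subrr sub0r oppr_eq0 oner_eq0.
Qed.

Lemma height_gt0 j : 0 < height j.
Proof. by rewrite sqrtr_gt0 dot_gt0// normal_neq0. Qed.

Lemma side_frame_isometry j : isometry (side_frame j).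
Proof.
move=> x y; rewrite /dist; congr Num.sqrt.
have nt := normal_tang ndg j.
have L2 : side_length j ^+ 2 = dot (p (j + 2) - p (j + 1)) (p (j + 2) - p (j + 1)) by rewrite sqr_sqrtr// dot_ge0.
have H2 : height j ^+ 2 = dot (normal p j) (normal p j) by rewrite sqr_sqrtr// dot_ge0.
rewrite [in RHS](plane_coords ndg j x) [in RHS](plane_coords ndg j y) /side_frame.
move: (p (j + 2) - p (j + 1)) (normal p j) nt L2 H2 => t n nt L2 H2.
move: (p (j + 1)) (tang p j x) (tang p j y) (bary p j x) (bary p j y) => o a a' b b'.
transitivity ((a - a') ^+ 2 * side_length j ^+ 2 + (b - b') ^+ 2 * height j ^+ 2).
  by rewrite /dot /=; ring.
rewrite L2 H2; transitivity ((a - a') ^+ 2 * dot t t + (b - b') ^+ 2 * dot n n + 2 * (a - a') * (b - b') * dot n t).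
  by rewrite nt mulr0 addr0.
clear nt L2 H2; move: o t n => [q1 q2] [t1 t2] [n1 n2].
by rewrite /dot /= /GRing.scale /=; ring.
Qed.

(** Cotangent of the angle at [p i], read in the frame of side [i + 2], which starts at [p i]: the
    apex is [p (i + 2)], and the quotient is its abscissa over its height. *)
Definition cotangent i : R := tang p (i + 2) (p (i + 2)) * side_length (i + 2) / height (i + 2).

Lemma near_positive j y : 0 < bary p j y -> \forall r \near 0^'+, forall x, dist x y < r -> 0 < bary p j x.
Proof.
move=> by0; have : nbhs y [set x | 0 < bary p j x].
  have := @bary_continuous _ p ndg j y; move/cvgrPdist_lt => /(_ _ by0).
  by apply: filterS => x; rewrite ltr_norml => /andP[_]; rewrite ltrBlDr ltrDl.
move=> /nbhs_ballP[e /= e0 h]; apply: filterS (nbhs_right_lt e0) => r re x xr; apply: h.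
by rewrite -ball_normE /ball_/= distrC (le_lt_trans (dist_norm _ _))// (lt_trans xr).
Qed.

(** Near [p i] the coordinate [bary p i] is positive anyway, and the other two conditions describe
    the wedge. *)
Lemma area_vertex i : \forall r \near 0^'+, area T (p i) r = area (wedge (cotangent i)) 0 r.
Proof.
have [j ji] : exists j, j + 1 = i by exists (i + 2); rewrite ord3E.
have jE : i + 2 = j by rewrite -ji ord3E.
have b1 : 0 < bary p (j + 1) (p i) by rewrite bary_vertexE// ji eqxx.
have := near_positive b1; apply: filterS => r hr.
have L0 := side_length_gt0 j; have h0 := height_gt0 j.
have f0 : side_frame j (p i) = 0.
  by rewrite /side_frame -ji tang_vertex1// bary_vertexE// (negbTE (ord3_neq1 j)) !mul0r.
have mw : measurable (wedge (cotangent i) : set (mplane R)) by apply: open_measurable2; exact: wedge_open.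
rewrite -f0 -(area_isometry _ _ (side_frame_isometry j) mw).
apply: area_local => x xr; rewrite open_triangleE//= /wedge /side_frame /=.
have wE : (cotangent i * (bary p j x * height j) < tang p j x * side_length j) = (0 < bary p (j + 2) x).
  rewrite bary2_tang// /cotangent jE subr_gt0.
  have -> : tang p j (p j) * side_length j / height j * (bary p j x * height j) = (tang p j (p j) * bary p j x) * side_length j.
    by field; rewrite gt_eqF.
  by rewrite ltr_pM2r.
rewrite wE pmulr_lgt0//; split=> [h|[h1 h2]]; first by split; exact: h.
by apply: (@ord3_all _ j) => //; exact: hr.
Qed.

Lemma area_side j y : open_side p j y -> \forall r \near 0^'+, area T y r = area half 0 r.
Proof.
move=> /(open_sideP ndg)[b0 b1 b2]; have := near_positive b1; apply: filterS2 (near_positive b2) => r hr2 hr1.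
have h0 := height_gt0 j.
have mh : measurable (half : set (mplane R)) by apply: open_measurable2; exact: half_open.
rewrite -(half_shift (tang p j y * side_length j)).
have -> : (tang p j y * side_length j, 0) = side_frame j y by rewrite /side_frame b0 mul0r.
rewrite -(area_isometry _ _ (side_frame_isometry j) mh).
apply: area_local => x xr; rewrite open_triangleE//= /half /side_frame /= pmulr_lgt0//.
split=> [h|h]; first exact: h.
by apply: (@ord3_all _ j) => //; [exact: hr1|exact: hr2].
Qed.

Lemma area_inside y : T y -> \forall r \near 0^'+, area half 0 r <= area T y r.
Proof.
move=> Ty; have b0 j : 0 < bary p j y by move: Ty; rewrite open_triangleE//; exact.
have h := near_positive (b0 0); have h1 := near_positive (b0 (0 + 1)); have h2 := near_positive (b0 (0 + 2)).
apply: filterS3 h h1 h2 => r h h1 h2.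
have E : area T y r = area setT y r; last by rewrite /= E; exact: half_le_all.
apply: area_local => x xr; split=> // _.
by rewrite open_triangleE//=; apply: (@ord3_all _ 0); [exact: h|exact: h1|exact: h2].
Qed.

Lemma near_outside y : ~ closure T y -> \forall r \near 0^'+, forall x, dist x y < r -> ~ closure T x.
Proof.
move=> ny; have : nbhs y (~` closure T).
  by apply: open_nbhs_nbhs; split=> //; apply: closed_openC; exact: closed_closure.
move=> /nbhs_ballP[e /= e0 h]; apply: filterS (nbhs_right_lt e0) => r re x xr; apply: h.
by rewrite -ball_normE /ball_/= distrC (le_lt_trans (dist_norm _ _))// (lt_trans xr).
Qed.

Lemma area_outside y : ~ closure T y -> \forall r \near 0^'+, area T y r = 0.
Proof.
move=> /near_outside; apply: filterS => r h.
have -> : area T y r = area set0 y r; last by rewrite /area set0I measure0.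
by apply: area_local => x /h nx; split=> // Tx; apply: nx; exact: subset_closure.
Qed.

Lemma cotangentE i : cotangent i = dot (p (i + 2) - p i) (p (i + 1) - p i) / `|tri_det p|.
Proof.
have [j ji] : exists j, j + 1 = i by exists (i + 2); rewrite ord3E.
have jE : i + 2 = j by rewrite -ji ord3E.
have j2 : i + 1 = j + 2 by rewrite -ji ord3E.
have L0 := side_length_gt0 j; have h0 := height_gt0 j.
have L2 : side_length j ^+ 2 = dot (p (j + 2) - p (j + 1)) (p (j + 2) - p (j + 1)) by rewrite sqr_sqrtr// dot_ge0.
have H2 : height j ^+ 2 = dot (normal p j) (normal p j) by rewrite sqr_sqrtr// dot_ge0.
have t0 := side_vector_neq0 ndg j.
(* Base times height is twice the area, by Lagrange's identity. *)
have Lh : side_length j * height j = `|tri_det p|.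
  apply/eqP; rewrite -(@eqrXn2 _ 2)// ?mulr_ge0 ?ltW// exprMn L2 H2 real_normK ?num_real//.
  rewrite -(tri_detE p j) /normal /tang; apply/eqP.
  move: t0; rewrite /cross.
  have -> : p (j + 1) - p j = - (p j - p (j + 1)) by rewrite opprB.
  have -> : p (j + 2) - p j = (p (j + 2) - p (j + 1)) - (p j - p (j + 1)).
    by move: (p (j + 2)) (p (j + 1)) (p j) => a b c; rewrite opprB addrA subrK.
  move: (p (j + 2) - p (j + 1)) (p j - p (j + 1)) => [t1 t2] [u1 u2].
  by rewrite /dot /= /GRing.scale /= => t0; field.
rewrite /cotangent jE j2 -ji -Lh /tang -L2.
by field; rewrite !gt_eqF.
Qed.

(** All cotangents have the denominator [|tri_det p|], so equal ones mean equal scalar products at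
    two vertices, and then the sides opposite to these vertices have the same length. *)
Lemma cotangent_inj : scalene_triangle p -> injective cotangent.
Proof.
move=> sc; have d0 : `|tri_det p| != 0 by rewrite normr_eq0 tri_det_neq0.
have next i : cotangent i = cotangent (i + 1) -> False.
  rewrite !cotangentE => /(congr1 (fun x : R => x * `|tri_det p|)); rewrite !divfK// !ord3E => h.
  suff : i = i + 1 by move/eqP; rewrite eq_sym (negbTE (ord3_neq1 i)).
  apply: sc => /=; rewrite /dist !ord3E; congr Num.sqrt; move: h.
  move: (p i) (p (i + 1)) (p (i + 2)) => [a1 a2] [b1 b2] [c1 c2]; rewrite /dot /=.
  by move=> h; lra.
move=> i i' e; case: (ord3P i i') => // h; first by case: (next i'); rewrite -h.
by case: (next i); rewrite e h ord3E.
Qed.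

End LocalShape.

(** * Corners of the polygons *)

(** The tiles around vertex [j] of tile [k]: sides [j + 1] and [j + 2] end there and are crossed
    alternately, starting with either; a free side stops the walk, as the involution then fixes the
    tile. Three crossings suffice for both patterns. *)
Definition fan (E : pattern) (j : 'I_3) (k : 'I_7) : seq 'I_7 :=
  let s1 := neighbour E (j + 1) in let s2 := neighbour E (j + 2) in
  undup [:: k; s1 k; s2 k; s1 (s2 k); s2 (s1 k); s1 (s2 (s1 k)); s2 (s1 (s2 k))].

Definition free_sides (E : pattern) : seq ('I_7 * 'I_3) :=
  [seq q <- [seq (k, j) | k <- tiles, j <- labels] | neighbour E q.2 q.1 == q.1].

Definition fan_ends (E : pattern) (j : 'I_3) (k : 'I_7) : seq ('I_7 * 'I_3) :=
  [seq q <- free_sides E | (q.1 \in fan E j k) && (q.2 != j)].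

(** Nine free sides, as many as the polygon has edges; two free sides that end each fan; and no two
    fans of the same label overlap without belonging to the same vertex. *)
Definition good_fans (E : pattern) : bool :=
  [&& size (free_sides E) == 9,
      all (fun j => all (fun k => size (fan_ends E j k) == 2) tiles) labels
    & all (fun j => all (fun k => all (fun l => has (mem (fan E j k)) (fan E j l) ==> (l \in fan E j k)) tiles) tiles) labels].

Lemma good_fans_E1 : good_fans E1. Proof. by vm_compute. Qed.
Lemma good_fans_E2 : good_fans E2. Proof. by vm_compute. Qed.

Lemma near_finite (R : realType) (I : finType) (P : I -> R -> Prop) :
  (forall i, \forall r \near 0^'+, P i r) -> \forall r \near 0^'+, forall i, P i r.
Proof.
move=> h; suff H (s : seq I) : \forall r \near 0^'+, forall i, i \in s -> P i r.
  by apply: filterS (H (enum I)) => r hr i; apply: hr; rewrite mem_enum.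
elim: s => [|i s ih]; first by apply: nearW.
apply: filterS2 (h i) ih => r hi hs l; rewrite inE => /predU1P[->//|]; exact: hs.
Qed.

(** An end point of a segment is an extreme point: it is interior to no nondegenerate subsegment. *)
Lemma segment_end (R : realType) (a b c d x : plane R) : segment c d a -> segment c d b ->
  x = c \/ x = d -> open_segment a b x -> a = b.
Proof.
move=> [s /= s01 <-] [t /= t01 <-] xcd [u /= u01 xE].
move: s01 t01 u01; rewrite !in_itv/= => /andP[s0 s1] /andP[t0 t1] /andP[u0 u1].
have [dc|dc] := eqVneq d c; first by rewrite dc -!scalerDl !subrK.
have E (m : R) : (1 - m) *: c + m *: d = c + m *: (d - c).
  by rewrite scalerBl scale1r scalerBr -addrA [- _ + _]addrC.
have {}xE : x = c + ((1 - u) * s + u * t) *: (d - c).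
  rewrite -xE !E; move: (d - c) => w; rewrite !scalerDr addrACA -scalerDl subrK scale1r.
  by rewrite !scalerA -scalerDl.
have dc0 : d - c != 0 by rewrite subr_eq0.
have inj (m n : R) : m *: (d - c) = n *: (d - c) -> m = n.
  by move/eqP; rewrite -subr_eq0 -scalerBl scaler_eq0 (negbTE dc0) orbF subr_eq0 => /eqP.
case: xcd => xcd.
  have /inj h : ((1 - u) * s + u * t) *: (d - c) = 0 *: (d - c).
    by rewrite scale0r; apply: (addrI c); rewrite -xE addr0.
  have s00 : s = 0 by nra.
  have t00 : t = 0 by nra.
  by rewrite s00 t00.
have /inj h : ((1 - u) * s + u * t) *: (d - c) = 1 *: (d - c).
  by rewrite scale1r; apply: (addrI c); rewrite -xE addrC subrK.
have s00 : s = 1 by nra.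
have t00 : t = 1 by nra.
by rewrite s00 t00.
Qed.

Lemma ordS_neq (i : 'I_9) : ordS i != i /\ ordS (ordS i) != i.
Proof. by case: i => [[|[|[|[|[|[|[|[|[|i]]]]]]]]] hi]. Qed.

Section Corners.
Context {R : realType}.
Variable p : 'I_3 -> plane R.
Hypothesis ndg : nondegenerate_triangle p.
Variables (E : pattern) (tau : 'I_7 -> plane R -> plane R).
Hypotheses (gE : good_pattern E) (gF : good_fans E).
Hypotheses (utau : unfolding p E tau) (adm : admissible p tau E).
Local Notation s := (neighbour E).
Local Notation T := (open_triangle p).
Local Notation Omega := (glued p tau).
Implicit Types (k l : 'I_7) (j i m : 'I_3) (x y z : plane R).

Let ti := tau_isometry ndg gE utau.
Let mT := triangle_measurable ndg.

Definition free_side (q : 'I_7 * 'I_3) : set (plane R) := tau q.1 @` side p q.2.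

Lemma mem_free_sides q : (q \in free_sides E) = (s q.2 q.1 == q.1).
Proof.
case: q => k j; rewrite mem_filter (allpairs_f (fun k j => (k, j)) (mem_tiles k) (mem_labels j)).
by rewrite andbT.
Qed.

Lemma free_sides_uniq : uniq (free_sides E).
Proof. by apply: filter_uniq; vm_compute. Qed.

Lemma fan_tau j k l : l \in fan E j k -> tau l (p j) = tau k (p j).
Proof.
have f1 k' : tau (s (j + 1) k') (p j) = tau k' (p j).
  by apply: (tau_fix ndg gE utau); rewrite bary_vertexE// eq_sym (negbTE (ord3_neq1 j)).
have f2 k' : tau (s (j + 2) k') (p j) = tau k' (p j).
  by apply: (tau_fix ndg gE utau); rewrite bary_vertexE// eq_sym (negbTE (ord3_neq2 j)).
by rewrite mem_undup !inE => /or4P[||| /or4P[]] /eqP ->; rewrite ?f1 ?f2 ?f1 ?f2.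
Qed.

Lemma fan_join j k l (l' : 'I_7) : l' \in fan E j l -> l' \in fan E j k -> l \in fan E j k.
Proof.
case/and3P: gF => _ _ /allP /(_ j (mem_labels j)) /allP /(_ k (mem_tiles k)) /allP /(_ l (mem_tiles l)).
by move=> /implyP h ml mk; apply: h; apply/hasP; exists l'.
Qed.

Lemma fan_endsP j k : exists q1 q2, [/\ q1 != q2, q1 \in free_sides E, q2 \in free_sides E &
  forall q, q \in [:: q1; q2] -> [/\ q.1 \in fan E j k, q.2 != j & free_side q (tau k (p j))]].
Proof.
case/and3P: gF => _ /allP /(_ j (mem_labels j)) /allP /(_ k (mem_tiles k)) /eqP sz _.
have uq : uniq (fan_ends E j k) by apply: filter_uniq; exact: free_sides_uniq.
have hq q : q \in fan_ends E j k -> [/\ q.1 \in fan E j k, q.2 != j & free_side q (tau k (p j))].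
  rewrite mem_filter => /andP[/andP[h1 h2] _]; split=> //.
  exists (p j); last exact: fan_tau.
  by apply/sideP => //; split=> [|i]; rewrite bary_vertexE// eq_sym (negbTE h2).
have hf q : q \in fan_ends E j k -> q \in free_sides E by rewrite mem_filter => /andP[].
case: (fan_ends E j k) sz uq hq hf => [|q1 [|q2 []]]//= _ /andP[]; rewrite inE => n12 _ hq hf.
by exists q1, q2; split=> //; [apply: hf; rewrite inE eqxx|apply: hf; rewrite !inE eqxx orbT].
Qed.

(** [admissible] equates two sets of sets only. The nine edges are pairwise distinct and there are
    nine free sides, so counting turns the equality into a bijection. *)
Lemma boundary_edges : exists v : 'I_9 -> plane R, simple_polygon v /\
  exists g : 'I_9 -> 'I_7 * 'I_3, [/\ injective g, forall i : 'I_9, edge v i = free_side (g i) &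
    forall q, q \in free_sides E -> exists i : 'I_9, g i = q].
Proof.
case: adm => _ _ [v [sv _ ed]]; exists v; split=> //.
have /choice[g hg] : forall i : 'I_9, exists q, q \in free_sides E /\ edge v i = free_side q.
  move=> i; have : [set tau kj.1 @` side p kj.2 | kj in [set kj | unshared E kj.1 kj.2]] (edge v i).
    by rewrite -ed; exists i.
  move=> [q /= uq qe]; exists q; split; last by rewrite -qe.
  by rewrite mem_free_sides -(unsharedE gE).
(* Equal edges would share both end points, but two different edges of a simple polygon with more
   than two vertices share at most one. *)
have einj : injective (edge v).
  case: sv => vi sp i i' ee; apply/eqP/negPn/negP => ii.
  have in0 (i0 : 'I_9) : edge v i0 (v i0).
    by exists 0; rewrite /= ?in_itv/= ?lexx ?ler01// subr0 scale1r scale0r addr0.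
  have in1 (i0 : 'I_9) : edge v i0 (v (ordS i0)).
    by exists 1; rewrite /= ?in_itv/= ?lexx ?ler01// subrr scale1r scale0r add0r.
  have [n1 n2] := ordS_neq i'.
  have [n1' n2'] := ordS_neq i.
  have [[e1 e2]|[e1 e2]] := sp i i' (v i) ii (in0 i) ltac:(by rewrite -ee; exact: in0).
    by move: ii; rewrite (vi _ _ e2) eqxx.
  have [[e3 e4]|[e3 e4]] := sp i i' (v (ordS i)) ii (in1 i) ltac:(by rewrite -ee; exact: in1).
    by move: n2'; rewrite -e3 -e1 eqxx.
  by move: n1'; rewrite (vi _ _ e4) eqxx.
have ginj : injective g.
  by move=> i i' gg; apply: einj; rewrite (hg i).2 (hg i').2 gg.
exists g; split=> // [i|q qf]; first exact: (hg i).2.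
have sub : {subset codom g <= free_sides E}.
  by move=> _ /codomP[i ->]; exact: (hg i).1.
have ug : uniq (codom g) by exact/injectiveP.
have sz : (size (free_sides E) <= size (codom g))%N.
  by rewrite size_codom card_ord; case/and3P: gF => /eqP ->.
have [_ eqm] := uniq_min_size ug sub sz.
by move: qf; rewrite -eqm => /codomP[i ->]; exists i.
Qed.

(** A common point of two edges is the starting vertex of one of them. For three edges through [x]
    this is always the same vertex, yet its index would have to occur in each of the three pairs of
    indices. *)
Lemma at_most_two x q1 q2 q3 : q1 \in free_sides E -> q2 \in free_sides E -> q3 \in free_sides E ->
  q1 != q2 -> free_side q1 x -> free_side q2 x -> free_side q3 x -> q3 \in [:: q1; q2].
Proof.
have [v [[vi sp] [g [gi ge gs]]]] := boundary_edges.
move=> /gs[i1 <-] /gs[i2 <-] /gs[i3 <-]; rewrite -!ge !inE !(inj_eq gi) => n12 h1 h2 h3.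
apply/negPn/negP; rewrite negb_or => /andP[n31 n32].
have vert (i i' : 'I_9) : i != i' -> edge v i x -> edge v i' x -> exists2 m : 'I_9, x = v m & (m == i) || (m == i').
  move=> ii hi hi'; have [[_ ->]|[_ ->]] := sp i i' x ii hi hi'.
    by exists i' => //; rewrite eqxx orbT.
  by exists i => //; rewrite eqxx.
have [m1 e1 M1] := vert _ _ n12 h1 h2; have [m2 e2 M2] := vert _ _ n31 h3 h1.
have [m3 e3 M3] := vert _ _ n32 h3 h2.
have E12 : m1 = m2 by apply: vi; rewrite -e1 -e2.
have E13 : m1 = m3 by apply: vi; rewrite -e1 -e3.
move: M1 M2 M3; rewrite -E12 -E13; case/orP => /eqP ->.
  by rewrite (negbTE n12) (eq_sym i1 i3) (negbTE n31).
by rewrite (eq_sym i2 i1) (negbTE n12) (eq_sym i2 i3) (negbTE n32).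
Qed.

(** Meeting another free side would make the point an end of its edge, which [segment_end] forbids
    for a point in the interior of the side. *)
Lemma open_side_unique q q' y : q \in free_sides E -> q' \in free_sides E -> q != q' ->
  open_side p q.2 y -> ~ free_side q' (tau q.1 y).
Proof.
have [v [[vi sp] [g [gi ge gs]]]] := boundary_edges.
move=> /gs[i gq] /gs[i' <-]; rewrite -gq (inj_eq gi) -ge => ii oy ey'.
have ey : edge v i (tau (g i).1 y).
  by rewrite ge; exists y => //; case: oy => t /= /andP[t0 t1] <-; exists t => //; rewrite /= in_itv/= !ltW.
have vend : tau (g i).1 y = v i \/ tau (g i).1 y = v (ordS i).
  by have [[-> ->]|[_ ->]] := sp i i' _ ii ey ey'; [right|left].
set k := (g i).1 in oy ey vend *; set j := (g i).2 in oy.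
have pe t : 0 <= t <= 1 -> edge v i (tau k ((1 - t) *: p (j + 1) + t *: p (j + 2))).
  by move=> t01; rewrite ge; exists ((1 - t) *: p (j + 1) + t *: p (j + 2)) => //; exists t.
have tab : tau k (p (j + 1)) = tau k (p (j + 2)).
  apply: (@segment_end _ _ _ (v i) (v (ordS i)) (tau k y)) => //.
  - by have := pe 0; rewrite lexx ler01 subr0 scale1r scale0r addr0; apply.
  - by have := pe 1; rewrite lexx ler01 subrr scale1r scale0r add0r; apply.
  case: oy => t t01 <-; exists t => //; rewrite (isometry_cvx _ _ (ti k))//.
  by rewrite subrK.
have /eqP := isometry_inj (ti k) tab.
by rewrite -subr_eq0 => /eqP h; have := side_vector_neq0 ndg j; rewrite -opprB h oppr0 /dot/= !mulr0 addr0 eqxx.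
Qed.

Lemma closure_side j y : closure T y -> bary p j y = 0 ->
  [\/ open_side p j y, y = p (j + 1) | y = p (j + 2)].
Proof.
rewrite closure_open_triangle// => h z.
have := bary_sum ndg y; have := sum_bary ndg y; rewrite !(ord3_sum _ j) z scale0r !add0r => yE b1.
have [z1|n1] := eqVneq (bary p (j + 1) y) 0.
  by constructor 3; move: yE b1; rewrite z1 scale0r !add0r => + b; rewrite b scale1r.
have [z2|n2] := eqVneq (bary p (j + 2) y) 0.
  by constructor 2; move: yE b1; rewrite z2 scale0r !addr0 => + b; rewrite b scale1r.
by constructor 1; apply/open_sideP => //; split=> //; rewrite lt_neqAle h andbT eq_sym.
Qed.

Lemma closure_cases y : closure T y -> [\/ T y, exists j, open_side p j y | exists j, y = p j].
Proof.
move=> cy; have := cy; rewrite closure_open_triangle// => h.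
have [[j z0]|nz] := pselect (exists j, bary p j y = 0).
  case: (closure_side cy z0) => ?; first by constructor 2; exists j.
    by constructor 3; exists (j + 1).
  by constructor 3; exists (j + 2).
constructor 1; rewrite open_triangleE//= => j; rewrite lt_neqAle h andbT eq_sym.
by apply/eqP => z; apply: nz; exists j.
Qed.

Lemma vertex_closure j : closure T (p j).
Proof. by rewrite closure_open_triangle//= => i; rewrite bary_vertexE. Qed.

Lemma vertex_inj : injective p.
Proof.
move=> i j e; have /eqP := bary_vertex ndg j; rewrite -e bary_vertexE//.
by case: (i =P j) => //= _; rewrite eq_sym oner_eq0.
Qed.

Lemma open_side_free l i z q1 q2 : q1 != q2 -> q1 \in free_sides E -> q2 \in free_sides E ->
  free_side q1 (tau l z) -> free_side q2 (tau l z) -> ~ open_side p i z.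
Proof.
move=> n12 f1 f2 h1 h2 oz; have [sl|sl] := eqVneq (s i l) l; last first.
  have [w hw e] := h1; have := shared_side_glued ndg gE utau adm sl oz; rewrite -e.
  by apply: (free_side_not_glued gE adm _ hw); apply/eqP; rewrite -mem_free_sides.
have fl : (l, i) \in free_sides E by rewrite mem_free_sides; apply/eqP.
have [e|n] := eqVneq (l, i) q1; last exact: (open_side_unique fl f1 n oz).
by apply: (open_side_unique fl f2 _ oz) => //; rewrite e.
Qed.

(** The fan of [k] puts two free sides through the vertex. This rules out interior points of sides
    by [open_side_free]; and a second fan at the same point ends on free sides that [at_most_two]
    identifies with those of the first, so the fans overlap and [fan_join] applies. *)
Lemma tiles_at_vertex j k l y : closure T y -> tau l y = tau k (p j) -> l \in fan E j k /\ y = p j.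
Proof.
move=> cy e; have [q1 [q2 [n12 f1 f2 hq]]] := fan_endsP j k.
have [|g1 j1 s1] := hq q1; first by rewrite inE eqxx.
have [|g2 j2 s2] := hq q2; first by rewrite !inE eqxx orbT.
case: (closure_cases cy) => [Ty|[i oy]|[m ym]].
- have kl := tile_closure_disjoint ndg gE utau adm (@vertex_closure j) Ty (esym e).
  move: e; rewrite kl => /(isometry_inj (ti l)) ye.
  by move: Ty; rewrite ye open_triangleE// => /(_ (j + 1)); rewrite bary_vertexE // eq_sym (negbTE (ord3_neq1 j)) ltxx.
- by exfalso; move: s1 s2; rewrite -e => s1 s2; exact: (open_side_free n12 f1 f2 s1 s2 oy).
have [q3 [q4 [_ f3 _ hq3]]] := fan_endsP m l.
have [|g3 m3 s3] := hq3 q3; first by rewrite inE eqxx.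
rewrite -ym e in s3.
have [g3' _ _] := hq q3 (at_most_two f1 f2 f3 n12 s1 s2 s3).
have mj : m = j.
  apply: vertex_inj; apply: (isometry_inj (ti q3.1)).
  by rewrite (fan_tau g3) (fan_tau g3') -e ym.
by rewrite ym mj; split=> //; rewrite mj in g3; exact: fan_join g3 g3'.
Qed.

Lemma tiles_at_side j k l y z : s j k = k -> open_side p j y -> closure T z ->
  tau l z = tau k y -> l = k.
Proof.
move=> sk oy cz e.
have fk : (k, j) \in free_sides E by rewrite mem_free_sides; apply/eqP.
have sx : free_side (k, j) (tau k y).
  by exists y => //; case: oy => t /= /andP[t0 t1] <-; exists t => //; rewrite /= in_itv/= !ltW.
case: (closure_cases cz) => [Tz|[i oz]|[m zm]].
- by apply/esym; apply: (tile_closure_disjoint ndg gE utau adm (open_side_closure ndg oy) Tz).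
- have [sl|sl] := eqVneq (s i l) l; last first.
    have := shared_side_glued ndg gE utau adm sl oz; rewrite e => gk.
    have [w hw we] := sx; rewrite /= in hw we.
    by case: (free_side_not_glued gE adm sk hw); rewrite we.
  have fl : (l, i) \in free_sides E by rewrite mem_free_sides; apply/eqP.
  have [[]//|n] := eqVneq (l, i) (k, j).
  by case: (open_side_unique fl fk n oz); rewrite /= e.
have [q1 [q2 [n12 f1 f2 hq]]] := fan_endsP m l.
have [|_ _ s1] := hq q1; first by rewrite inE eqxx.
have [|_ _ s2] := hq q2; first by rewrite !inE eqxx orbT.
rewrite -zm e in s1 s2.
have [e1|n1] := eqVneq (k, j) q1; last by case: (open_side_unique fk f1 n1 oy).
by case: (@open_side_unique (k, j) q2 y) => //; rewrite e1.
Qed.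

Lemma area_glued x r : area Omega x r = \sum_l area T (iso_inv (tau l) x) r.
Proof.
have mO := glued_measurable p tau; have mD := @disc_measurable R x r.
have tT : trivIset setT (tile p tau) by case: adm.
suff : (area Omega x r)%:E = (\sum_l area T (iso_inv (tau l) x) r)%:E by case.
rewrite -sumEFin; apply: (etrans (areaE x r mO)).
transitivity (\int[@lebesgue2 R]_(y in Omega) (\1_(disc x r) y)%:E)%E.
  by rewrite (integral_indic _ mO mD) setIC.
rewrite (integral_tiles ndg gE utau tT)//; apply: eq_bigr => l _.
have [il fK Kf] := iso_invP (ti l).
apply/esym; apply: (etrans (areaE (iso_inv (tau l) x) r mT)); rewrite setIC.
rewrite -(integral_indic _ mT (@disc_measurable R (iso_inv (tau l) x) r)).
apply: eq_integral => y _; congr (_%:E); rewrite !indicE.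
have dE : disc (iso_inv (tau l) x) r y = disc x r (tau l y) by rewrite /disc /= -(ti l) Kf.
by congr ((nat_of_bool _)%:R); apply/idP/idP; rewrite !in_setE dE.
Qed.

Lemma sum_mem_uniq (I : finType) (q : seq I) (S : R) : uniq q ->
  \sum_i (i \in q)%:R * S = (size q)%:R * S.
Proof.
move=> uq; rewrite -mulr_suml; congr (_ * _).
rewrite -natr_sum -(card_uniqP uq) -sum1_card [in RHS]big_mkcond; congr (_%:R).
Qed.

Lemma area_glued_vertex j k : \forall r \near 0^'+,
  area Omega (tau k (p j)) r = (size (fan E j k))%:R * area (wedge (cotangent p j)) 0 r.
Proof.
suff h l : \forall r \near 0^'+, area T (iso_inv (tau l) (tau k (p j))) r =
    (l \in fan E j k)%:R * area (wedge (cotangent p j)) 0 r.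
  apply: filterS (near_finite h) => r hr; rewrite area_glued (eq_bigr _ (fun l _ => hr l)).
  by apply: sum_mem_uniq; exact: undup_uniq.
have [_ fK Kf] := iso_invP (ti l).
case: (boolP (l \in fan E j k)) => lf.
  apply: filterS (area_vertex ndg j) => r <-; rewrite mul1r.
  by rewrite -(fan_tau lf) fK.
have no : ~ closure T (iso_inv (tau l) (tau k (p j))).
  by move=> cl; move/negP: lf; apply; have [] := tiles_at_vertex cl (Kf _).
by apply: filterS (area_outside no) => r ->; rewrite mul0r.
Qed.

Lemma area_glued_side j k y : s j k = k -> open_side p j y ->
  \forall r \near 0^'+, area Omega (tau k y) r = area (@half R) 0 r.
Proof.
move=> sk oy; suff h l : \forall r \near 0^'+, area T (iso_inv (tau l) (tau k y)) r =
    (l \in [:: k])%:R * area (@half R) 0 r.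
  apply: filterS (near_finite h) => r hr; rewrite area_glued (eq_bigr _ (fun l _ => hr l)).
  by rewrite sum_mem_uniq//= mul1r.
have [_ fK Kf] := iso_invP (ti l).
rewrite inE; have [->|lk] := eqVneq l k.
  have [_ fK' _] := iso_invP (ti k).
  by apply: filterS (area_side ndg oy) => r <-; rewrite mul1r fK'.
have no : ~ closure T (iso_inv (tau l) (tau k y)).
  by move=> cl; move/eqP: lk; apply; exact: tiles_at_side sk oy cl (Kf _).
by apply: filterS (area_outside no) => r ->; rewrite mul0r.
Qed.

Lemma area_tile_le x l r : area T (iso_inv (tau l) x) r <= area Omega x r.
Proof.
rewrite area_glued (bigD1 l)//= lerDl; apply: sumr_ge0 => k _; exact: area_ge0.
Qed.

(** Serves to recognise vertices: a positive area below that of a half-disc occurs only at images of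
    vertices of [T]. *)
Lemma area_glued_cases x : [\/ \forall r \near 0^'+, area Omega x r = 0,
  \forall r \near 0^'+, area (@half R) 0 r <= area Omega x r | exists k j, x = tau k (p j)].
Proof.
have [[l cl]|no] := pselect (exists l, closure T (iso_inv (tau l) x)); last first.
  constructor 1; have h l : \forall r \near 0^'+, area T (iso_inv (tau l) x) r = 0.
    by apply: area_outside => cl; apply: no; exists l.
  apply: filterS (near_finite h) => r hr.
  by rewrite area_glued big1.
have [_ fK Kf] := iso_invP (ti l).
case: (closure_cases cl) => [Ty|[j oy]|[j yp]].
- constructor 2; apply: filterS (area_inside ndg Ty) => r h; exact: le_trans h (area_tile_le _ _ _).
- constructor 2; apply: filterS (area_side ndg oy) => r h; rewrite -h; exact: area_tile_le.
- by constructor 3; exists l, j; rewrite -yp Kf.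
Qed.

Lemma fan1_neighbour j k : size (fan E j k) = 1%N ->
  [/\ s (j + 1) k = k, s (j + 2) k = k & forall l, l \in fan E j k -> l = k].
Proof.
move=> sz; have mk : k \in fan E j k by rewrite mem_undup inE eqxx.
have one l : l \in fan E j k -> l = k.
  by case: (fan E j k) sz mk => [|a []]//= _; rewrite !inE => /eqP -> /eqP.
by split=> //; apply: one; rewrite mem_undup !inE eqxx !orbT.
Qed.

Lemma corner_tile j k : size (fan E j k) = 1%N ->
  \forall r \near 0^'+, forall y, dist y (p j) < r -> (Omega : set _) (tau k y) <-> T y.
Proof.
move=> /fan1_neighbour[s1 s2 one].
have h l : \forall r \near 0^'+, forall y, dist y (p j) < r ->
    closure T (iso_inv (tau l) (tau k y)) -> l = k.
  have [il fK Kf] := iso_invP (ti l).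
  have [lk|/eqP lk] := eqVneq l k; first exact: nearW.
  have no : ~ closure T (iso_inv (tau l) (tau k (p j))).
    by move=> cl; apply: lk; apply: one; have [] := tiles_at_vertex cl (Kf _).
  by apply: filterS (near_outside no) => r hr y yr cy; case: (hr (iso_inv (tau l) (tau k y))); rewrite // il ti.
have b0 : 0 < bary p j (p j) by rewrite bary_vertexE// eqxx.
apply: filterS2 (near_finite h) (near_positive ndg b0) => r hr br y yr; split=> [Oy|Ty]; last first.
  by apply: (tile_sub ndg gE utau); exists y.
have [l [z [cz zE]]] := glued_sub ndg gE utau Oy.
have [_ fK _] := iso_invP (ti l).
have lk : l = k by apply: (hr l y yr); rewrite -zE fK.
have zy : z = y by apply: (isometry_inj (ti k)); rewrite -lk in zE *.
rewrite zy in cz; rewrite open_triangleE//=; apply: (@ord3_all _ j); first exact: br.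
  rewrite lt_neqAle (bary_ge0 ndg _ cz) andbT eq_sym; apply/eqP => z0.
  by have [] := glued_bary0 ndg gE utau adm cz Oy z0; rewrite s1 eqxx.
rewrite lt_neqAle (bary_ge0 ndg _ cz) andbT eq_sym; apply/eqP => z0.
by have [] := glued_bary0 ndg gE utau adm cz Oy z0; rewrite s2 eqxx.
Qed.

End Corners.

(** * The polygons are not congruent *)

(** Single-tile corners at vertex [a], unique in the second pattern, whose tiles have fans of
    different sizes at their other two vertices. Such corners are found for every [a], as the label
    of the sharpest angle depends on the triangle. *)
Definition corner_data (a : 'I_3) (k1 k2 : 'I_7) : bool :=
  [&& size (fan E1 a k1) == 1%N, size (fan E2 a k2) == 1%N,
      all (fun k => (size (fan E2 a k) == 1%N) ==> (k == k2)) tiles,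
      size (fan E1 (a + 1) k1) != size (fan E2 (a + 1) k2)
    & size (fan E1 (a + 2) k1) != size (fan E2 (a + 2) k2)].

Lemma corner_dataP a : exists k1 k2, corner_data a k1 k2.
Proof.
have /allP /(_ a (mem_labels a)) /hasP[k1 _ /hasP[k2 _ h]] :
  all (fun a => has (fun k1 => has (corner_data a k1) tiles) tiles) labels by vm_compute.
by exists k1, k2.
Qed.

Local Opaque fan.

(** * Isometries that preserve a corner of the triangle *)

Section Corner.
Context {R : realType}.
Variable p : 'I_3 -> plane R.
Hypothesis ndg : nondegenerate_triangle p.
Implicit Types (j i m : 'I_3) (x y z : plane R).
Local Notation T := (open_triangle p).

Definition corner_map a (g : plane R -> plane R) := [/\ isometry g, g (p a) = p a &
  \forall r \near 0^'+, forall y, dist y (p a) < r -> T y <-> T (g y)].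

Lemma dist_scale (c : R) x y : 0 <= c -> dist (x + c *: y) x = c * dist y 0.
Proof.
move=> c0; rewrite /dist subr0 [_ + _ - _]addrAC subrr add0r -[in RHS](ger0_norm c0) -sqrtr_sqr.
rewrite -sqrtrM ?sqr_ge0//; congr Num.sqrt; case: y => y1 y2; rewrite /dot /= /GRing.scale /=; ring.
Qed.

(** The conditions are homogeneous around [p a]: shrinking [x] towards [p a] by a factor [c]
    multiplies both coordinates by [c] and leads into the disc where [T] is known to be preserved. A
    local property thus extends to the whole cone. *)
Lemma corner_map_conv a g x : corner_map a g ->
  (0 < bary p (a + 1) x /\ 0 < bary p (a + 2) x) <->
  (0 < bary p (a + 1) (g x) /\ 0 < bary p (a + 2) (g x)).
Proof.
move=> [ig ga hg].
have b0 : 0 < bary p a (p a) by rewrite bary_vertexE// eqxx.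
have /filter_ex : \forall r \near (0:R)^'+, 0 < r /\ forall y, dist y (p a) < r ->
    [/\ T y <-> T (g y), 0 < bary p a y & 0 < bary p a (g y)].
  near=> r; split; first by near: r; exact: nbhs_right_gt.
  move=> y yr; split; first by apply: (near hg r).
    by move: y yr; near: r; exact: near_positive.
  have gy : dist (g y) (p a) < r by rewrite -[X in dist _ X]ga ig.
  by move: (g y) gy; near: r; exact: near_positive.
move=> [r [r0 hr]].
have [c [c0 c1 cr]] : exists c : R, [/\ 0 < c, c <= 1 & c * dist x (p a) < r].
  have d0 : 0 < dist x (p a) + 1 by rewrite ltr_pwDr// sqrtr_ge0.
  exists (Num.min 1 (r / (dist x (p a) + 1))); split.
  - by rewrite lt_min ltr01 divr_gt0.
  - by rewrite ge_min lexx.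
  rewrite (@le_lt_trans _ _ (r / (dist x (p a) + 1) * dist x (p a)))//.
    by rewrite ler_wpM2r ?sqrtr_ge0// ge_min lexx orbT.
  by rewrite mulrAC ltr_pdivrMr// ltr_pM2l// ltrDl.
pose y := (1 - c) *: p a + c *: x.
have yr : dist y (p a) < r.
  have -> : y = p a + c *: (x - p a) by rewrite /y scalerBl scale1r scalerBr -addrA [- _ + _]addrC.
  by rewrite dist_scale ?ltW// /dist subr0.
have [Tg ba bga] := hr y yr.
have by_ i : i != a -> bary p i y = c * bary p i x.
  by move=> ia; rewrite /y bary_cvx ?subrK// bary_vertexE// eq_sym (negbTE ia) mulr0 add0r.
have bgy i : i != a -> bary p i (g y) = c * bary p i (g x).
  move=> ia; rewrite /y (isometry_cvx _ _ ig) ?subrK// ga.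
  by rewrite bary_cvx ?subrK// bary_vertexE// eq_sym (negbTE ia) mulr0 add0r.
have TE z : 0 < bary p a z -> T z <-> 0 < bary p (a + 1) z /\ 0 < bary p (a + 2) z.
  move=> bz; rewrite open_triangleE//=; split=> [h|[h1 h2]]; first by split; exact: h.
  exact: (@ord3_all _ a).
move: Tg; rewrite (TE _ ba) (TE _ bga) !by_ ?bgy ?ord3_neq1 ?ord3_neq2//.
by rewrite !(pmulr_rgt0 _ c0).
Unshelve. all: by end_near.
Qed.

Lemma corner_expand a x : x = p a + bary p (a + 1) x *: (p (a + 1) - p a) + bary p (a + 2) x *: (p (a + 2) - p a).
Proof.
have := bary_sum ndg x; rewrite -[X in _ -> X = _](sum_bary ndg x) !(ord3_sum _ a).
move: (bary p a x) (bary p (a + 1) x) (bary p (a + 2) x) (p a) (p (a + 1)) (p (a + 2)).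
move=> u v w [a1 a2] [b1 b2] [c1 c2] e.
have -> : u = 1 - v - w by rewrite -e; ring.
by congr (_, _); rewrite /= /GRing.scale /=; ring.
Qed.

Lemma point_with_bary a (u v : R) : exists x, bary p (a + 1) x = u /\ bary p (a + 2) x = v.
Proof.
pose w (j : 'I_3) := if j == a then 1 - u - v else if j == a + 1 then u else v.
have w1 : \sum_j w j = 1.
  rewrite (ord3_sum _ a) /w eqxx (negbTE (ord3_neq1 a)) (negbTE (ord3_neq2 a)) eqxx.
  by rewrite [a + 2 == _]eq_sym (negbTE (ord3_neq12 a)); ring.
exists (\sum_j w j *: p j); rewrite !(bary_of_sum ndg _ w1) /w.
rewrite (negbTE (ord3_neq1 a)) (negbTE (ord3_neq2 a)) eqxx.
by rewrite [a + 2 == _]eq_sym (negbTE (ord3_neq12 a)).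
Qed.

Section Images.
Variables (a : 'I_3) (g : plane R -> plane R).
Hypothesis hg : corner_map a g.
Let M i j := bary p i (g (p j)).

Lemma bary_corner_map x i : i != a ->
  bary p i (g x) = bary p (a + 1) x * M i (a + 1) + bary p (a + 2) x * M i (a + 2).
Proof.
move=> ia; have [ig ga _] := hg.
rewrite -{1}(sum_bary ndg x) (isometry_sum _ ig) ?bary_sum// bary_affine//.
rewrite affine_form_sum ?bary_sum// -bary_affine// (ord3_sum _ a) ga bary_vertexE//.
by rewrite eq_sym (negbTE ia) mulr0 add0r.
Qed.

(** [M] is the matrix of [g] in the basis of the two sides issuing from [p a]; it preserves the open
    quadrant in both directions. *)
Lemma corner_cone (u v : R) : (0 < u /\ 0 < v) <->
  (0 < u * M (a + 1) (a + 1) + v * M (a + 1) (a + 2) /\ 0 < u * M (a + 2) (a + 1) + v * M (a + 2) (a + 2)).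
Proof.
have [x [<- <-]] := point_with_bary a u v.
by rewrite -!bary_corner_map ?ord3_neq1 ?ord3_neq2//; exact: corner_map_conv.
Qed.

Lemma dist_side i : i != a -> 0 < dist (p i) (p a).
Proof.
move=> ia; rewrite /dist sqrtr_gt0 dot_gt0// subr_eq0.
by apply/negP => /eqP h; have := bary_vertexE ndg i i; rewrite {1}h bary_vertexE// eqxx eq_sym (negbTE ia) => /eqP; rewrite eq_sym oner_eq0.
Qed.

(** A linear map that preserves the open quadrant in both directions permutes its two boundary rays,
    and lengths fix the scales. If the rays are exchanged, [c] is the quotient of the lengths of the
    two sides. *)
Lemma corner_map_images : g (p (a + 1)) = p (a + 1) \/ exists2 c : R, 0 < c &
  g (p (a + 1)) = p a + c *: (p (a + 2) - p a) /\ g (p (a + 2)) = p a + c^-1 *: (p (a + 1) - p a).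
Proof.
have [ig ga _] := hg.
have ge0 (b c : R) : (forall t, 0 < t -> 0 < b + t * c) -> 0 <= b.
  move=> h; rewrite leNgt; apply/negP => b0.
  have [c0|c0] := leP c 0; first by have := h 1 ltr01; lra.
  have c1 : c != 0 by rewrite gt_eqF.
  have : 0 < - b / c by rewrite divr_gt0// oppr_gt0.
  by move=> /h; rewrite divrK ?unitfE// subrr ltxx.
have := corner_expand a (g (p (a + 1))); have := corner_expand a (g (p (a + 2))).
rewrite -!/(M _ _).
have D1 := dist_side (ord3_neq1 a); have D2 := dist_side (ord3_neq2 a).
move: (M (a + 1) (a + 1)) (M (a + 1) (a + 2)) (M (a + 2) (a + 1)) (M (a + 2) (a + 2)) corner_cone => m11 m12 m21 m22 cone e2 e1.
have [p1 p2] := (cone 1 1).1 (conj ltr01 ltr01); rewrite !mul1r in p1 p2.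
have m11_ge0 : 0 <= m11 by apply: (ge0 _ m12) => t t0; have [] := (cone 1 t).1 (conj ltr01 t0); rewrite mul1r.
have m21_ge0 : 0 <= m21 by apply: (ge0 _ m22) => t t0; have [_] := (cone 1 t).1 (conj ltr01 t0); rewrite mul1r.
have m12_ge0 : 0 <= m12 by apply: (ge0 _ m11) => t t0; have [] := (cone t 1).1 (conj t0 ltr01); rewrite mul1r addrC.
have m22_ge0 : 0 <= m22 by apply: (ge0 _ m21) => t t0; have [_] := (cone t 1).1 (conj t0 ltr01); rewrite mul1r addrC.
(* A column with two positive entries would send a boundary ray into the open quadrant. *)
have n1 : ~ (0 < m11 /\ 0 < m21).
  by move=> h; have := (cone 1 0).2; rewrite !mul1r !mul0r !addr0 ltxx => /(_ h)[].
have n2 : ~ (0 < m12 /\ 0 < m22).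
  by move=> h; have := (cone 0 1).2; rewrite !mul1r !mul0r !add0r ltxx => /(_ h)[].
have dscale (c : R) i : 0 <= c -> dist (p a + c *: (p i - p a)) (p a) = c * dist (p i) (p a).
  by move=> c0; rewrite dist_scale// /dist subr0.
have d1 : dist (g (p (a + 1))) (p a) = dist (p (a + 1)) (p a) by rewrite -[X in dist _ X]ga ig.
have d2 : dist (g (p (a + 2))) (p a) = dist (p (a + 2)) (p a) by rewrite -[X in dist _ X]ga ig.
have [m0|m0] := eqVneq m21 0.
  left; move: d1; rewrite e1 m0 scale0r addr0 dscale// => d1.
  have -> : m11 = 1 by apply: (mulIf (negbT (gt_eqF D1))); rewrite d1 mul1r.
  by rewrite scale1r addrC subrK.
have {m21_ge0}m21_gt0 : 0 < m21 by rewrite lt_def m0.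
have m11_0 : m11 = 0 by apply/eqP; apply/negPn/negP => h; apply: n1; split; rewrite // lt_def h.
have m12_gt0 : 0 < m12 by move: p1; rewrite m11_0 add0r.
have m22_0 : m22 = 0 by apply/eqP; apply/negPn/negP => h; apply: n2; split; rewrite // lt_def h.
rewrite m11_0 scale0r addr0 in e1; rewrite m22_0 scale0r addr0 in e2.
move: d1 d2; rewrite e1 e2 !dscale ?ltW// => d1 d2.
right; exists m21 => //; split=> //.
congr (_ + _ *: _); apply/(mulfI m0); rewrite mulfV//.
by apply: (mulIf (negbT (gt_eqF D1))); rewrite mul1r -mulrA d2 d1.
Qed.

End Images.
End Corner.

Section NotCongruent.
Context {R : realType}.
Variable p : 'I_3 -> plane R.
Hypotheses (ndg : nondegenerate_triangle p) (sca : scalene_triangle p).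
Variables tau1 tau2 : 'I_7 -> plane R -> plane R.
Hypotheses (u1 : unfolding p E1 tau1) (u2 : unfolding p E2 tau2).
Hypotheses (a1 : admissible p tau1 E1) (a2 : admissible p tau2 E2).
Local Notation T := (open_triangle p).
Local Notation Omega1 := (glued p tau1).
Local Notation Omega2 := (glued p tau2).
Implicit Types (j i m : 'I_3) (k l : 'I_7) (x y z : plane R).

Let S j r := area (wedge (cotangent p j)) 0 r.

Lemma natr_mul_inj (n1 n2 : nat) (t : R) : 0 < t -> n1%:R * t = n2%:R * t -> n1 = n2.
Proof. by move=> t0 /(mulIf (negbT (gt_eqF t0))) /eqP; rewrite eqr_nat => /eqP. Qed.

(** The largest cotangent belongs to the smallest angle; scalenity makes the maximum strict. *)
Lemma sharpest_angle : exists a, forall j, j != a -> cotangent p j < cotangent p a.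
Proof.
pose a := [arg max_(i > 0) cotangent p i]%O; exists a => j ja.
have : cotangent p j <= cotangent p a by rewrite /a; case: Order.TotalTheory.arg_maxP => // i _; exact.
rewrite le_eqVlt => /orP[/eqP e|//].
by move: ja; rewrite (cotangent_inj ndg sca e) eqxx.
Qed.

Lemma fan_size_gt0 E j k : (0 < size (fan E j k))%N.
Proof.
have : k \in fan E j k by rewrite mem_undup inE eqxx.
by case: (fan E j k).
Qed.

Variable f : plane R -> plane R.
Hypotheses (fi : isometry f) (f12 : f @` Omega1 = Omega2).

Lemma congruence_mem x : (Omega2 : set _) (f x) <-> (Omega1 : set _) x.
Proof.
rewrite -f12; split=> [[y Oy /(isometry_inj fi) <-]//|Ox]; first by exists x.
Qed.

Lemma congruence_area x r : area Omega2 (f x) r = area Omega1 x r.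
Proof.
rewrite -(area_isometry x r fi (glued_measurable p tau2)).
by apply: area_local => y _; exact: congruence_mem.
Qed.

Lemma near_pos (P : R -> Prop) : (\forall r \near 0^'+, P r) -> exists2 r, 0 < r & P r.
Proof.
move=> hP; have /filter_ex[r []] : \forall r \near (0:R)^'+, 0 < r /\ P r.
  by apply: filterS2 (nbhs_right_gt 0) hP.
by exists r.
Qed.

(** Around the image of the corner the area is that of one sharpest wedge, positive and below a
    half-disc, so this image is a vertex, with label [j] and some fan size [n >= 1]. Then [n] wedges
    at [j] have the area of one at [a], and minimality of the latter forces [j = a] and [n = 1]. *)
Lemma corner_transport a k1 : (forall j, j != a -> cotangent p j < cotangent p a) ->
  size (fan E1 a k1) = 1%N -> exists k2, size (fan E2 a k2) = 1%N /\ f (tau1 k1 (p a)) = tau2 k2 (p a).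
Proof.
move=> amax s1; set x := tau1 k1 (p a).
have Ax : \forall r \near 0^'+, area Omega2 (f x) r = S a r.
  have := area_glued_vertex ndg good_E1 good_fans_E1 u1 a1 a k1.
  by apply: filterS => r; rewrite congruence_area s1 mul1r.
have [z|h|[k [j fx]]] := area_glued_cases ndg good_E2 u2 a2 (f x).
- have [r r0 [Ar zr]] := near_pos (filterI Ax z).
  by have := wedge_gt0 (cotangent p a) r0; rewrite -/(S a r) -Ar zr ltxx.
- have [r r0 [Ar hr]] := near_pos (filterI Ax h).
  by have := wedge_half (cotangent p a) r0; rewrite -/(S a r) -Ar ltNge hr.
have := area_glued_vertex ndg good_E2 good_fans_E2 u2 a2 j k; rewrite -fx => h.
have [r r0 [Ar hr]] := near_pos (filterI Ax h).
rewrite Ar -/(S j r) in hr.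
have n1 := fan_size_gt0 E2 j k; have Sj := wedge_gt0 (cotangent p j) r0; rewrite -/(S j r) in Sj.
have Sle : S j r <= S a r.
  by rewrite hr; apply: (ler_peMl (ltW Sj)); rewrite ler1n.
have ja : j = a.
  apply/eqP/negPn/negP => /amax /(wedge_decreasing r0).
  by rewrite -/(S _ _) -/(S _ _) ltNge Sle.
exists k; split; last by rewrite fx ja.
rewrite ja in hr Sj *; apply/esym/(natr_mul_inj Sj); rewrite mul1r; exact: hr.
Qed.

Section Transported.
Variables (k1 k2 : 'I_7) (g : plane R -> plane R).
Hypothesis gE : forall y, tau2 k2 (g y) = f (tau1 k1 y).

Lemma transported_area y r : area Omega2 (tau2 k2 (g y)) r = area Omega1 (tau1 k1 y) r.
Proof. by rewrite gE congruence_area. Qed.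

Lemma fixed_vertex_fan j : g (p j) = p j -> size (fan E1 j k1) = size (fan E2 j k2).
Proof.
move=> gj; have h1 := area_glued_vertex ndg good_E1 good_fans_E1 u1 a1 j k1.
have h2 := area_glued_vertex ndg good_E2 good_fans_E2 u2 a2 j k2.
have [r r0 [A1 A2]] := near_pos (filterI h1 h2).
by apply: (natr_mul_inj (wedge_gt0 (cotangent p j) r0)); rewrite -A1 -A2 -{2}gj transported_area.
Qed.

(** [g] sends the vertex to an interior point of a free side of the second polygon, and such a point
    of the first polygon to the vertex. Both fans therefore cover as much as a half-disc with wedges
    of the same area. *)
Lemma swapped_vertex_fan j y : neighbour E1 j k1 = k1 -> neighbour E2 j k2 = k2 -> open_side p j y ->
  g (p j) = y -> g y = p j -> size (fan E1 j k1) = size (fan E2 j k2).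
Proof.
move=> n1 n2 oy gj gy; have h1 := area_glued_vertex ndg good_E1 good_fans_E1 u1 a1 j k1.
have h2 := area_glued_vertex ndg good_E2 good_fans_E2 u2 a2 j k2.
have h3 := area_glued_side ndg good_E1 good_fans_E1 u1 a1 n1 oy.
have h4 := area_glued_side ndg good_E2 good_fans_E2 u2 a2 n2 oy.
have [r r0 [[A1 A2] [A3 A4]]] := near_pos (filterI (filterI h1 h2) (filterI h3 h4)).
apply: (natr_mul_inj (wedge_gt0 (cotangent p j) r0)).
have B1 := transported_area (p j) r; have B2 := transported_area y r; rewrite gj in B1; rewrite gy in B2.
apply: (etrans (esym A1)); apply: (etrans (esym B1)); apply: (etrans A4).
by apply: (etrans (esym A3)); apply: (etrans (esym B2)).
Qed.

Lemma transported_corner a : isometry g -> g (p a) = p a -> size (fan E1 a k1) = 1%N ->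
  size (fan E2 a k2) = 1%N -> corner_map p a g.
Proof.
move=> ig ga s1 s2; split=> //.
have h1 := corner_tile ndg good_E1 good_fans_E1 u1 a1 s1.
have h2 := corner_tile ndg good_E2 good_fans_E2 u2 a2 s2.
apply: filterS2 h1 h2 => r h1 h2 y yr; rewrite -h1// -h2; last by rewrite -[X in dist _ X]ga ig.
by rewrite gE congruence_mem.
Qed.

(** Both sides at [p a] are free because the corner consists of one tile. If [g] exchanges them, the
    end of the shorter side lands inside the longer one, and that point is sent back to this end, so
    [swapped_vertex_fan] applies; equal lengths contradict scalenity. *)
Lemma corner_fans a : isometry g -> g (p a) = p a -> size (fan E1 a k1) = 1%N ->
  size (fan E2 a k2) = 1%N -> size (fan E1 (a + 1) k1) = size (fan E2 (a + 1) k2) \/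
  size (fan E1 (a + 2) k1) = size (fan E2 (a + 2) k2).
Proof.
move=> ig ga s1 s2.
have [n11 n12 _] := fan1_neighbour s1; have [n21 n22 _] := fan1_neighbour s2.
have [gj|[c c0 [g1 g2]]] := corner_map_images ndg (transported_corner ig ga s1 s2).
  by left; exact: fixed_vertex_fan.
have gs (t d : R) i i' : g (p i) = p a + d *: (p i' - p a) -> t * d = 1 -> g (p a + t *: (p i - p a)) = p i'.
  move=> gi td; have -> : p a + t *: (p i - p a) = (1 - t) *: p a + t *: p i.
    by rewrite scalerBl scale1r scalerBr -addrA [- _ + _]addrC.
  rewrite (isometry_cvx _ _ ig) ?subrK// ga gi scalerDr scalerA td scale1r.
  by rewrite addrA -scalerDl subrK scale1r addrC subrK.
have e i (t : R) : p a + t *: (p i - p a) = (1 - t) *: p a + t *: p i.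
  by rewrite scalerBl scale1r scalerBr -addrA [- _ + _]addrC.
have [c1|c1|c1] := ltgtP c 1.
- left; apply: (swapped_vertex_fan n11 n21 _ g1); last by apply: gs g2 _; rewrite mulfV// gt_eqF.
  rewrite /open_side !ord3E e; exists (1 - c); first by rewrite /= in_itv/=; apply/andP; split; lra.
  by rewrite subKr addrC.
- right; apply: (swapped_vertex_fan n12 n22 _ g2); last by apply: gs g1 _; rewrite mulVf// gt_eqF.
  rewrite /open_side !ord3E e; exists c^-1 => //=; rewrite in_itv/= invr_gt0 c0/=.
  by rewrite invf_lt1.
exfalso; have : dist (g (p (a + 1))) (g (p a)) = dist (p (a + 1)) (p a) by exact: ig.
rewrite g1 ga c1 scale1r addrC subrK => d.
have := @sca (a + 1) (a + 2); rewrite /= !ord3E => h.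
have /h : dist (p (a + 2)) (p a) = dist (p a) (p (a + 1)) by rewrite d /dist; congr Num.sqrt; rewrite /dot /=; ring.
by move=> /eqP; rewrite (negbTE (ord3_neq12 a)).
Qed.

End Transported.

Lemma no_congruence : False.
Proof.
have [a amax] := sharpest_angle.
have [k1 [k2 /and5P[/eqP s1 /eqP s2 /allP one /eqP n1 /eqP n2]]] := corner_dataP a.
have [k [sk fk]] := corner_transport amax s1.
have {}sk : k = k2 by apply/eqP; apply: (implyP (one k (mem_tiles k))); rewrite sk.
rewrite sk in fk.
have [i2 fK Kf] := iso_invP (tau_isometry ndg good_E2 u2 k2).
(* The congruence read in the coordinates of the two corner tiles; it fixes [p a]. *)
pose g y := iso_inv (tau2 k2) (f (tau1 k1 y)).
have gE y : tau2 k2 (g y) = f (tau1 k1 y) by rewrite Kf.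
have ig : isometry g by move=> x y; rewrite /g i2 fi (tau_isometry ndg good_E1 u1 k1).
have ga : g (p a) = p a by rewrite /g fk fK.
by have [/n1|/n2] := corner_fans gE ig ga s1 s2.
Qed.

End NotCongruent.

Theorem theorem3p4 (R : realType) (p : 'I_3 -> (R * R)%type)
    (tau1 tau2 : 'I_7 -> (R * R)%type -> (R * R)%type)
    (p_nondegenerate : nondegenerate_triangle p) (p_scalene : scalene_triangle p)
    (tau1_unfolding : unfolding p E1 tau1)
    (tau2_unfolding : unfolding p E2 tau2)
    (tau1_admissible : admissible p tau1 E1)
    (tau2_admissible : admissible p tau2 E2) :
  let Omega1 := glued p tau1 in
  let Omega2 := glued p tau2 in
  [/\ forall (S1 : R -> {linear L2 Omega1 -> L2 Omega1})
             (S2 : R -> {linear L2 Omega2 -> L2 Omega2}),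
        semigroup_generated_by S1 (@neumann_laplacian R Omega1) ->
        semigroup_generated_by S2 (@neumann_laplacian R Omega2) ->
        similar_semigroups S1 S2,
      isospectral (@neumann_laplacian R Omega1) (@neumann_laplacian R Omega2)
    & ~ congruent Omega1 Omega2].
Proof.
move=> Omega1 Omega2; split.
- by move=> S1 S2; apply: neumann_semigroups_similar.
- have [U [V [_ _ UK VK [h12 h21]]]] := neumann_laplacians_similar p_nondegenerate
    tau1_unfolding tau2_unfolding tau1_admissible tau2_admissible.
  exact: isospectral_similar UK VK h12 h21.
- move=> [f fi f12].
  exact: (no_congruence p_nondegenerate p_scalene tau1_unfolding tau2_unfolding
    tau1_admissible tau2_admissible fi f12).
Qed.
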